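(* Consider the polynomial Liénard system $$\dot x=y,\qquad \dot y=-g(x)-f(x)y,\qquad g(x)=\sum_{i=r}^{m}a_ix^i,\quad f(x)=\sum_{i=s}^{n}b_ix^i,$$ where $m,n,r,s\in\mathbb{N}$, the coefficients are real and $a_ra_mb_sb_n\neq 0$. Put $F(x)=\int_0^x f(\xi)\,d\xi$ and $G(x)=\int_0^x g(\xi)\,d\xi$. The system has a nilpotent type global center at the origin if and only if all of the following conditions hold: (i) $xg(x)>0$ for all $x\neq 0$; (ii* ) either $r$ is odd, $2<r<2s+1$ and $a_r>0$; or $r=2s+1\ge 3$ and $b_s^2-2(r+1)a_r<0$; (iii) either $m$ is odd, $m>2n+1$ and $a_m>0$; or $m=2n+1$ and $4(n+1)a_mb_n^{-2}>1$; (iv) for all $x_1<0<x_2$, if $G(x_1)=G(x_2)$ then $F(x_1)=F(x_2)$. Moreover, in this case the phase portrait in the Poincaré disc is the following: the origin is the only finite equilibrium, all other finite orbits are periodic orbits surrounding the origin, there are exactly two equilibria at infinity, namely the two endpoints of the $y$-axis, and a neighbourhood of each of these in the disc consists of one hyperbolic sector.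
   Context: Here $\mathbb{N}$ includes $0$ and the dot denotes the derivative with respect to the independent variable $t$. An equilibrium $p$ of a planar differential system is a center if it has a neighbourhood $U$ such that $U\setminus\{p\}$ is filled with periodic (closed) orbits. The period annulus of a center $p$ is the maximal connected set of periodic orbits surrounding $p$ and having $p$ in its boundary. A center $p$ is a global center if its period annulus is $\mathbb{R}^2\setminus\{p\}$. A (global) center is of nilpotent type if both eigenvalues of the Jacobian matrix of the system at it are zero but this matrix is not identically zero. The Poincaré disc is the Poincaré compactification of the plane, with points at infinity forming the boundary circle. *)

(* Defs.v *)
From HB Require Import structures.
From mathcomp Require Import all_boot all_order all_algebra.
From mathcomp Require Import all_classical all_reals all_analysis.
From mathcomp Require Import ring.
From mathcomp Require Import complex.

Set Implicit Arguments.
Unset Strict Implicit.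
Unset Printing Implicit Defensive.

Import Order.TTheory GRing.Theory Num.Theory.
Import numFieldNormedType.Exports.

Local Open Scope classical_set_scope.
Local Open Scope ring_scope.

Section Vectors.
Variable R : realType.

Definition row2 (a b : R) : 'rV[R]_2 := \row_i [:: a; b]`_i.

Definition row3 (a b c : R) : 'rV[R]_3 := \row_i [:: a; b; c]`_i.

Definition xcoord n (p : 'rV[R]_n.+1) : R := p 0 ord0.
Definition ycoord n (p : 'rV[R]_n.+2) : R := p 0 (inord 1).
Definition zcoord n (p : 'rV[R]_n.+3) : R := p 0 (inord 2).

Lemma xcoord2 (a b : R) : xcoord (row2 a b) = a.
Proof. by rewrite /xcoord mxE. Qed.

Lemma ycoord2 (a b : R) : ycoord (row2 a b) = b.
Proof. by rewrite /ycoord mxE inordK. Qed.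

Lemma xcoord3 (a b c : R) : xcoord (row3 a b c) = a.
Proof. by rewrite /xcoord mxE. Qed.

Lemma ycoord3 (a b c : R) : ycoord (row3 a b c) = b.
Proof. by rewrite /ycoord mxE inordK. Qed.

Lemma zcoord3 (a b c : R) : zcoord (row3 a b c) = c.
Proof. by rewrite /zcoord mxE inordK. Qed.

End Vectors.

Section Flows.
Variables (R : realType) (V : normedModType R).
Implicit Types (X : V -> V) (gamma : R -> V) (p q : V) (O A W : set V).

(* One-sided differentiability at the endpoints follows from continuity when X
   is continuous. *)
Definition solution_on X (T : R) gamma :=
  {within `[0, T], continuous gamma} /\
  (forall t : R, t \in `]0, T[ -> is_derive t (1 : R) gamma (X (gamma t))).

(* A trajectory leads from p to q in nonnegative time without leaving W. *)
Definition reaches X W p q := exists (T : R) gamma,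
  [/\ 0 <= T, solution_on X T gamma, gamma 0 = p, gamma T = q &
      gamma @` `[0, T] `<=` W].

Definition orbit X p : set V :=
  [set q | reaches X setT p q \/ reaches X setT q p].

Definition equilibrium X p := X p = 0.

Definition periodic_orbit X O := exists (T : R) gamma,
  [/\ 0 < T, (forall t : R, is_derive t (1 : R) gamma (X (gamma t))),
      (forall t, gamma (t + T) = gamma t),
      (exists t, gamma t <> gamma 0) &
      O = range gamma].

(* p lies in a bounded component of the complement of O; for a closed planar
   orbit O this means that p lies in the interior of the Jordan curve O. *)
Definition surrounds O p :=
  ~ O p /\ bounded_set (connected_component (~` O) p).

Definition center X p :=
  equilibrium X p /\
  exists2 U, nbhs p U &
    forall q, U q -> q <> p ->
      exists O, [/\ periodic_orbit X O, O q & O `<=` U `\ p].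

Definition annulus_of_periodic_orbits X p A :=
  [/\ (forall q, A q ->
         exists O, [/\ periodic_orbit X O, surrounds O p, O q & O `<=` A]),
      connected A &
      (closure A `\` A°) p].

Definition period_annulus X p A :=
  annulus_of_periodic_orbits X p A /\
  (forall B, annulus_of_periodic_orbits X p B -> A `<=` B -> B = A).

Definition global_center X p := center X p /\ period_annulus X p (~` [set p]).

End Flows.

(* The restrictions of X to D near p and of Y to E near q are topologically
   equivalent: some homeomorphism h (with inverse k) from a neighbourhood W of
   p in D onto a neighbourhood N of q in E maps arcs of trajectories onto arcs
   of trajectories, preserving their orientation. *)
Definition locally_topologically_equivalent (R : realType)
    (V V' : normedModType R)
    (X : V -> V) (D : set V) (p : V) (Y : V' -> V') (E : set V') (q : V') :=
  exists (W : set V) (N : set V') (h : V -> V') (k : V' -> V),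
  [/\ [/\ W `<=` D, within D (nbhs p) W, N `<=` E & within E (nbhs q) N],
      [/\ h @` W `<=` N, k @` N `<=` W,
          (forall w, W w -> k (h w) = w) & (forall v, N v -> h (k v) = v)],
      {within W, continuous h} /\ {within N, continuous k},
      h p = q &
      forall w w', W w -> W w' ->
        (reaches X W w w' <-> reaches Y N (h w) (h w'))].

Section HyperbolicSector.
Variable R : realType.

Definition linear_saddle (p : 'rV[R]_2) : 'rV[R]_2 :=
  row2 (xcoord p) (- ycoord p).

Definition closed_quadrant : set 'rV[R]_2 :=
  [set p | 0 <= xcoord p /\ 0 <= ycoord p].

(* Small neighbourhoods of p in D consist of one hyperbolic sector.  The
   orientation of the model is irrelevant, since exchanging the coordinates of
   the quadrant reverses it. *)
Definition one_hyperbolic_sector (V : normedModType R) (X : V -> V) (D : set V)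
    (p : V) :=
  locally_topologically_equivalent X D p linear_saddle closed_quadrant 0.

End HyperbolicSector.

Section PlanarPolynomialSystems.
Variable R : realType.

(* The polynomials P, Q of the system x' = P(x, y), y' = Q(x, y).  As in
   polyXY, the outer variable 'X is x and the inner variable 'Y is y, so that
   P`_i`_j is the coefficient of x^i y^j in P. *)
Definition planar_system := ({poly {poly R}} * {poly {poly R}})%type.
Implicit Types (S : planar_system) (u : {poly {poly R}}).

Definition vector_field S (p : 'rV[R]_2) : 'rV[R]_2 :=
  row2 S.1.[xcoord p, ycoord p] S.2.[xcoord p, ycoord p].

(* The library's Jacobian matrix acts on row vectors, hence is the transpose
   of the usual one; neither clause is affected.  Eigenvalues are complex. *)
Definition nilpotent_linear_part (X : 'rV[R]_2 -> 'rV[R]_2) (p : 'rV[R]_2) :=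
  'J X p <> 0 /\
  (forall l : R[i],
     eigenvalue (map_mx (real_complex R) ('J X p)) l -> l = 0).

Definition nilpotent_global_center S (p : 'rV[R]_2) :=
  global_center (vector_field S) p /\ nilpotent_linear_part (vector_field S) p.

Definition total_degree u : nat :=
  \max_(i < size u) \max_(j < size (u`_i)%R | ((u`_i)%R`_j)%R != 0%R) (i + j).

Definition system_degree S : nat := maxn (total_degree S.1) (total_degree S.2).

(* z^d u(x/z, y/z), for d at least the total degree of u. *)
Definition homogenization (d : nat) u (x y z : R) : R :=
  \sum_(i < size u) \sum_(j < size u`_i)
    u`_i`_j * x ^+ i * y ^+ j * z ^+ (d - (i + j)).

(* The closed upper hemisphere of the unit sphere; the vertical projection
   (x, y, z) |-> (x, y) is a homeomorphism onto the closed unit disc. *)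
Definition poincare_disc : set 'rV[R]_3 :=
  [set q | xcoord q ^+ 2 + ycoord q ^+ 2 + zcoord q ^+ 2 = 1 /\ 0 <= zcoord q].

Definition at_infinity : set 'rV[R]_3 :=
  [set q | poincare_disc q /\ zcoord q = 0].

Definition central_projection (p : 'rV[R]_2) : 'rV[R]_3 :=
  (Num.sqrt (xcoord p ^+ 2 + ycoord p ^+ 2 + 1))^-1 *:
    row3 (xcoord p) (ycoord p) 1.

(* The image of the vector field of S under the central projection, multiplied
   by z^(d-1) with d > 0 the degree of S, is the tangential component of
   (z^d P(x/z, y/z), z^d Q(x/z, y/z), 0) on the sphere; see
   [poincare_field_central_projection].  In this form it is polynomial and
   extends to the circle at infinity z = 0. *)
Definition poincare_field S (q : 'rV[R]_3) : 'rV[R]_3 :=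
  let d := system_degree S in
  let P := homogenization d S.1 (xcoord q) (ycoord q) (zcoord q) in
  let Q := homogenization d S.2 (xcoord q) (ycoord q) (zcoord q) in
  row3 P Q 0 - (xcoord q * P + ycoord q * Q) *: q.

Lemma homogenizationE d (u : {poly {poly R}}) (x y z : R) :
  z != 0 -> (total_degree u <= d)%N ->
  homogenization d u (z * x) (z * y) z = z ^+ d * u.[x%:P].[y].
Proof.
move=> z0 ud; rewrite /homogenization (horner_coef u) horner_sum mulr_sumr.
apply: eq_bigr => i _; rewrite -polyC_exp hornerM hornerC (horner_coef u`_i).
rewrite mulr_suml mulr_sumr; apply: eq_bigr => j _.
have [->|uij] := eqVneq (u`_i`_j) 0; first by rewrite !mul0r mulr0.
have ijd : (i + j <= d)%N.
  apply: leq_trans ud.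
  rewrite /total_degree; apply: (bigop.bigmax_sup i) => //=.
  exact: (bigop.bigmax_sup j).
rewrite -[in RHS](subnK ijd) !exprD !exprMn; ring.
Qed.

Lemma is_derive_rVP n (gamma : R -> 'rV[R]_n) (t : R) (v : 'rV[R]_n) :
  is_derive t (1 : R) gamma v <->
  forall i, is_derive t (1:R) (fun s => gamma s 0 i : R) (v 0 i).
Proof.
split=> [[dg <-] i|H].
  have /derivable_mxP d1 := dg; rewrite derive_mx// mxE; exact: DeriveDef.
have dg : derivable gamma t 1.
  by apply/derivable_mxP => i j; rewrite ord1; have [] := H j.
apply: DeriveDef => //; apply/rowP => i.
by rewrite derive_mx// mxE; have [_ <-] := H i.
Qed.

Lemma poincare_field_central_projection (S : planar_system)
    (gamma : R -> 'rV[R]_2) (t : R) : (0 < system_degree S)%N ->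
  is_derive t (1 : R) gamma (vector_field S (gamma t)) ->
  let q := central_projection (gamma t) in
  is_derive t (1 : R) (fun s => central_projection (gamma s))
    (zcoord q ^- (system_degree S).-1 *: poincare_field S q).
Proof.
move=> d0 /is_derive_rVP dg q.
pose x s := xcoord (gamma s); pose y s := ycoord (gamma s).
set P := S.1.[xcoord (gamma t), ycoord (gamma t)].
set Q := S.2.[xcoord (gamma t), ycoord (gamma t)].
have dx : is_derive t (1 : R) x P.
  by have := dg ord0; rewrite [X in is_derive _ _ _ X]xcoord2.
have dy : is_derive t (1 : R) y Q.
  by have := dg (inord 1); rewrite [X in is_derive _ _ _ X]ycoord2.
pose D s := x s ^+ 2 + y s ^+ 2 + 1; pose w s := (Num.sqrt (D s))^-1.
have D0 s : 0 < D s by rewrite ltr_wpDl// addr_ge0// sqr_ge0.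
have w0 s : w s != 0 by rewrite invr_eq0 gt_eqF// sqrtr_gt0.
have dD : is_derive t (1 : R) D (2 * (x t * P + y t * Q)).
  have -> : D = x ^+ 2 + y ^+ 2 + cst 1 by apply/funext.
  by apply: is_derive_eq; rewrite /GRing.scale/= !expr1; ring.
have dsq : is_derive t (1 : R) (Num.sqrt \o D)
  ((2 * Num.sqrt (D t))^-1 * (2 * (x t * P + y t * Q))).
  apply: is_derive1_comp; exact: is_derive1_sqrt.
have dw : is_derive t (1 : R) w (- w t ^+ 3 * (x t * P + y t * Q)).
  have -> : w = (fun s => ((Num.sqrt \o D) s)^-1) by [].
  have := w0 t; rewrite invr_eq0 => wn.
  apply: DeriveDef; first exact: derivableV.
  rewrite deriveV// derive_val /GRing.scale/= /w; field; exact: wn.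
have qE : q = row3 (w t * x t) (w t * y t) (w t).
  apply/rowP => i; rewrite !mxE.
  by case: i => [[|[|[|//]]] ?] /=; rewrite ?mulr1.
have zq : zcoord q = w t by rewrite qE zcoord3.
have dq : row3 (w t ^+ (system_degree S) * P) (w t ^+ (system_degree S) * Q) 0
   - (w t ^+ (system_degree S) * w t * (x t * P + y t * Q)) *: q
   = poincare_field S q.
  rewrite /poincare_field qE xcoord3 ycoord3 zcoord3.
  rewrite !homogenizationE ?leq_maxl ?leq_maxr//.
  rewrite -/P -/Q -/(x t) -/(y t).
  set e := w t ^+ system_degree S.
  have -> : w t * x t * (e * P) + w t * y t * (e * Q) =
    e * w t * (x t * P + y t * Q) by ring.
  by [].
rewrite -dq zq; apply/is_derive_rVP => i.
have wk : w t ^+ system_degree S = w t * w t ^+ (system_degree S).-1.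
  by rewrite -exprS prednK.
rewrite wk qE !mxE.
clear dq zq wk dg; clearbody P Q.
have wx : w t ^+ (system_degree S).-1 != 0 by rewrite expf_neq0.
case: i => [[|[|[|//]]] ?] /=.
- rewrite [X in is_derive _ _ X _](_ : _ = w * x); last first.
    by apply/funext => s; rewrite /= /central_projection !mxE.
  apply: is_derive_eq; rewrite /GRing.scale/=.
  by move: (w t ^+ _) wx => e e0; move: (w t) (x t) (y t) => u v v'; field.
- rewrite [X in is_derive _ _ X _](_ : _ = w * y); last first.
    by apply/funext => s; rewrite /= /central_projection !mxE.
  apply: is_derive_eq; rewrite /GRing.scale/=.
  by move: (w t ^+ _) wx => e e0; move: (w t) (x t) (y t) => u v v'; field.
- rewrite [X in is_derive _ _ X _](_ : _ = w); last first.
    by apply/funext => s; rewrite /= /central_projection !mxE /= mulr1.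
  apply: is_derive_eq.
  by move: (w t ^+ _) wx => e e0; move: (w t) (x t) (y t) => u v v'; field.
Qed.

(* The limits of central_projection (row2 0 y) as y tends to +oo and -oo. *)
Definition y_axis_top : 'rV[R]_3 := row3 0 1 0.
Definition y_axis_bottom : 'rV[R]_3 := row3 0 (- 1) 0.

Definition phase_portrait_one_hyperbolic_sector_at_ends_of_y_axis S :=
  let X := vector_field S in
  let Y := poincare_field S in
  [/\ (forall p, equilibrium X p <-> p = 0),
      (forall p, p <> 0 ->
         periodic_orbit X (orbit X p) /\ surrounds (orbit X p) 0),
      (forall q, at_infinity q ->
         (equilibrium Y q <-> q = y_axis_top \/ q = y_axis_bottom)),
      one_hyperbolic_sector Y poincare_disc y_axis_top &
      one_hyperbolic_sector Y poincare_disc y_axis_bottom].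

Definition lienard_system (g f : {poly R}) : planar_system :=
  ('Y, - g^:P - f^:P * 'Y).

Lemma vector_field_lienard (g f : {poly R}) (p : 'rV[R]_2) :
  vector_field (lienard_system g f) p =
  row2 (ycoord p) (- g.[xcoord p] - f.[xcoord p] * ycoord p).
Proof.
rewrite /vector_field /=.
by rewrite !(hornerD, hornerN, hornerM, hornerC, hornerX, horner_map).
Qed.

(* \sum_(lo <= i <= hi) c_i x^i *)
Definition poly_between (lo hi : nat) (c : nat -> R) : {poly R} :=
  \sum_(lo <= i < hi.+1) c i *: 'X^i.

(* The oriented integral of h from 0 to x. *)
Definition integral_from0 (h : R -> R) (x : R) : R :=
  if 0 <= x then \int[lebesgue_measure]_(t in `[0, x]) h t
  else - \int[lebesgue_measure]_(t in `[x, 0]) h t.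

End PlanarPolynomialSystems.

(* Main.v *)
Require Import Defs.
From HB Require Import structures.
From mathcomp Require Import all_boot all_order all_algebra.
From mathcomp Require Import all_classical all_reals all_analysis.
From mathcomp Require Import ring lra zify complex.

(* In the plane (x, u) with u = y + F(x) the system is x' = u - F(x),
   u' = - g(x).  Conditions (ii) and (iii) bound F^2 by 8 k^2 G with k < 1 near 0
   and near infinity, so that there a modification of log (2 G + u^2) by a multiple
   of u / sqrt (2 G + u^2) is monotone: no orbit of the half-plane x > 0 escapes,
   and each is an arc from (0, a) to (0, b) with b < 0 < a.  The left half-plane
   is the same after reflection.  In the coordinates (G, u) an arc solves
   dG/du = F - u, so (iv) makes the right and left arcs from (0, a) end at the
   same point and all orbits close up.  Conversely, when (ii) or (iii) fails, the
   region above a curve y = k x^(s+1) - C x^(s+2) near 0, or y = k x^(n+1) + C x^n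
   near infinity, traps orbits up to symmetry; and if F(x1) - F(x2) were not
   identically zero on the curve G(x1) = G(x2), it would have a constant sign
   near 0 (pseudo-gcd of the two polynomials), and comparing the two differential
   equations would separate the endpoints of the arcs.

   At the top of the Poincare disc, the height h of the crossing of a closed
   orbit with the positive u-axis is a first integral and x/y + A x/h increases
   along orbits for A large; these two functions correspond to x y and x - y on
   the saddle, and give the conjugacy of the sector with the quadrant.  The
   bottom follows by the rotation (x, y) |-> (-x, -y). *)

Set Implicit Arguments.
Unset Strict Implicit.
Unset Printing Implicit Defensive.

Import Order.TTheory GRing.Theory Num.Theory.
Import numFieldNormedType.Exports.

Local Open Scope classical_set_scope.
Local Open Scope ring_scope.

(** * Real calculus *)

(** The thresholds in (ii) and (iii) come from one discriminant. For k > 0, |u F| <= k (2 G + u^2)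
    holds for all u exactly when F^2 <= 8 k^2 G; if r = 2 s + 1, the leading terms b x^(s+1) / (s+1)
    of F and a x^(r+1) / (r+1) of G turn the limit case k = 1 into b^2 < 4 (s+1) a = 2 (r+1) a. On
    the other side, phi = k x^(s+1) bounds a trap if a < k (b - (s+1) k), whose right side is
    largest, b^2 / (4 (s+1)), at k = b / (2 (s+1)). The lower order term of the curve makes the trap
    strict when the discriminant vanishes, so the two cases are complementary. The field is
    polynomial and not Lipschitz, so existence is proved for the field with x clamped to [-B, B]; a
    bound on 2 G + u^2, valid while x >= 0, then shows that the clamp is inactive. At middle sizes
    of 2 G + u^2 nothing is assumed about F. There the exit from x > 0 comes from a different
    function, u - eta x u, which decreases at a definite rate on bounded parts of the half-plane
    away from the origin. *)

Definition isd (R : realType) (f : R -> R) (t d : R) := is_derive t (1 : R) f d.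

Section Calculus.
Variable R : realType.
Implicit Types (f g : R -> R) (a b s t : R).

Lemma isd_eq f t (d d' : R) : isd f t d -> d = d' -> isd f t d'.
Proof. by move=> ? <-. Qed.

Lemma isd_cst (c : R) t : isd (fun=> c) t (0 : R).
Proof. exact: is_derive_cst. Qed.

Lemma isd_id t : isd (fun s : R => s) t (1 : R).
Proof. exact: is_derive_id. Qed.

Lemma isdD f g t (df dg : R) : isd f t df -> isd g t dg ->
  isd (fun s => f s + g s) t (df + dg).
Proof. exact: is_deriveD. Qed.

Lemma isdN f t (df : R) : isd f t df -> isd (fun s => - f s) t (- df).
Proof. exact: is_deriveN. Qed.

Lemma isdB f g t (df dg : R) : isd f t df -> isd g t dg ->
  isd (fun s => f s - g s) t (df - dg).
Proof. exact: is_deriveB. Qed.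

Lemma isdM f g t (df dg : R) : isd f t df -> isd g t dg ->
  isd (fun s => f s * g s) t (df * g t + f t * dg).
Proof.
move=> hf hg; have h := is_deriveM hf hg; apply: (isd_eq h).
by rewrite /GRing.scale/= addrC mulrC.
Qed.

Lemma isdX f n t (df : R) : isd f t df ->
  isd (fun s => f s ^+ n) t (n%:R * f t ^+ n.-1 * df).
Proof. by move=> hf; have := is_deriveX n hf; rewrite exprfctE. Qed.

Lemma isdV f t (df : R) : f t != 0 -> isd f t df ->
  isd (fun s => (f s)^-1) t (- (f t) ^- 2 * df).
Proof. exact: is_deriveV. Qed.

Lemma isd_comp f g t (df dg : R) : isd f (g t) df -> isd g t dg ->
  isd (fun s => f (g s)) t (df * dg).
Proof.
move=> hf hg; exact: (is_derive1_comp hf hg).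
Qed.

Lemma isd_horner (p : {poly R}) f t (df : R) : isd f t df ->
  isd (fun s => p.[f s]) t (p^`().[f t] * df).
Proof. by move=> hf; apply: (@isd_comp (horner p)) => //; exact: is_derive_poly. Qed.

Lemma isd_expR f t (df : R) : isd f t df ->
  isd (fun s => expR (f s)) t (expR (f t) * df).
Proof. by move=> hf; apply: (@isd_comp expR) => //; exact: is_derive_expR. Qed.

Lemma isd_ln f t (df : R) : 0 < f t -> isd f t df ->
  isd (fun s => ln (f s)) t ((f t)^-1 * df).
Proof.
by move=> f0 hf; apply: (@isd_comp (@ln R)) => //; exact: is_derive1_ln.
Qed.

Lemma isd_sqrt f t (df : R) : 0 < f t -> isd f t df ->
  isd (fun s => Num.sqrt (f s)) t ((2 * Num.sqrt (f t))^-1 * df).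
Proof.
by move=> f0 hf; apply: (@isd_comp (@Num.sqrt R)) => //; exact: is_derive1_sqrt.
Qed.

Lemma isd_cont f t (d : R) : isd f t d -> {for t, continuous f}.
Proof. by move=> [hd _]; apply/differentiable_continuous/derivable1_diffP. Qed.

Lemma isd_uniq f t (d d' : R) : isd f t d -> isd f t d' -> d = d'.
Proof. by move=> [_ <-] [_ <-]. Qed.

Lemma isd_ext f g t (d : R) : (\near t, f t = g t) -> isd f t d -> isd g t d.
Proof. exact: near_eq_is_derive. Qed.

Lemma cont_within f (A : set R) : continuous f -> {within A, continuous f}.
Proof. exact: continuous_subspaceT. Qed.

Lemma continuous_clamp a b : continuous (fun t : R => Num.max a (Num.min t b)).
Proof.
move=> t; apply: (@continuous_max R R (fun=> a) (fun t => Num.min t b)).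
  exact: cst_continuous.
apply: (@continuous_min R R id (fun=> b)); [exact: cvg_id|exact: cst_continuous].
Qed.

Lemma within_clamp (T : topologicalType) (f : R -> T) a b : a <= b ->
  {within `[a, b], continuous f} ->
  continuous (fun t => f (Num.max a (Num.min t b))).
Proof.
move=> ab /subspace_continuousP cf t.
have cI (s : R) : `[a, b]%classic (Num.max a (Num.min s b)).
  by rewrite /= in_itv /= le_max lexx /= ge_max ab /= ge_min lexx orbT.
apply: (@cvg_comp _ _ _ (fun s => Num.max a (Num.min s b)) f); last exact: (cf _ (cI t)).
move=> P hP.
have H : nbhs t (fun s => `[a, b]%classic (Num.max a (Num.min s b)) ->
    P (Num.max a (Num.min s b))) := @continuous_clamp a b t _ hP.
by apply: (@filterS _ (nbhs t) _ _ _ _ H) => s; apply; exact: cI.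
Qed.

Lemma clamp_in (t a b : R) : a <= t <= b -> Num.max a (Num.min t b) = t.
Proof. by move=> /andP[at_ tb]; rewrite min_l// max_r. Qed.

Lemma near_oo a b t (P : R -> Prop) : a < t < b ->
  (forall s, a < s < b -> P s) -> \near t, P t.
Proof.
move=> tab H; have : t \in `]a, b[%R by rewrite in_itv.
move=> /near_in_itvoo; apply: filterS => s; rewrite in_itv; exact: H.
Qed.

Lemma IVT_eq f a b v : continuous f -> a <= b -> f a <= v <= f b \/ f b <= v <= f a ->
  exists2 c, a <= c <= b & f c = v.
Proof.
move=> cf ab h.
have [|c] := @IVT R f a b v ab (cont_within cf).
  case: h => /andP[h1 h2].
    by rewrite ge_min h1 /= le_max h2 orbT.
  by rewrite ge_min h1 orbT /= le_max h2.
by rewrite in_itv /= => ? ?; exists c.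
Qed.

Lemma isd_nondecr f (df : R -> R) a b : a <= b -> continuous f ->
  (forall t, a < t < b -> isd f t (df t)) ->
  (forall t, a < t < b -> 0 <= df t) -> f a <= f b.
Proof.
rewrite le_eqVlt => /predU1P[->//|ab] cf hd h0.
have hd' t : t \in `]a, b[%R -> is_derive t 1 f (df t) by rewrite in_itv; exact: hd.
have [c] := MVT ab hd' (cont_within cf).
rewrite in_itv => /h0 c0 e.
by rewrite -subr_ge0 e mulr_ge0// subr_ge0 ltW.
Qed.

Lemma isd_incr f (df : R -> R) a b : a < b -> continuous f ->
  (forall t, a < t < b -> isd f t (df t)) ->
  (forall t, a < t < b -> 0 < df t) -> f a < f b.
Proof.
move=> ab cf hd h0.
have hd' t : t \in `]a, b[%R -> is_derive t 1 f (df t) by rewrite in_itv; exact: hd.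
have [c] := MVT ab hd' (cont_within cf).
rewrite in_itv => /h0 c0 e.
by rewrite -subr_gt0 e mulr_gt0// subr_gt0.
Qed.

Lemma isd_nonincr f (df : R -> R) a b : a <= b -> continuous f ->
  (forall t, a < t < b -> isd f t (df t)) ->
  (forall t, a < t < b -> df t <= 0) -> f b <= f a.
Proof.
move=> ab cf hd h0; rewrite -lerN2.
apply: (@isd_nondecr (fun t => - f t) (fun t => - df t)) => //.
- by move=> t; apply: continuousN; exact: cf.
- by move=> t /hd; exact: isdN.
- by move=> t /h0; rewrite oppr_ge0.
Qed.

Lemma isd_decr f (df : R -> R) a b : a < b -> continuous f ->
  (forall t, a < t < b -> isd f t (df t)) ->
  (forall t, a < t < b -> df t < 0) -> f b < f a.
Proof.
move=> ab cf hd h0; rewrite -ltrN2.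
apply: (@isd_incr (fun t => - f t) (fun t => - df t)) => //.
- by move=> t; apply: continuousN; exact: cf.
- by move=> t /hd; exact: isdN.
- by move=> t /h0; rewrite oppr_gt0.
Qed.

(** [s] is the least point of [a, b] where f <= 0, which exists by compactness. Together with
    [isd_left_le0] and [isd_right_ge0] below, this is how an orbit is kept in a region: at the first
    exit the derivative of the exhausted quantity would have a sign that the field forbids. *)
Lemma first_zero f a b : continuous f -> a <= b -> 0 < f a -> f b <= 0 ->
  exists s, [/\ a < s <= b, f s = 0 & forall t, a <= t < s -> 0 < f t].
Proof.
move=> cf ab fa fb.
pose A := `[a, b]%classic `&` f @^-1` [set x | x <= 0].
have cA : compact A.
  apply: (@compact_closedI R); first exact: segment_compact.
  by apply: (@closed_comp _ _ f) => //; exact: closed_le.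
have A0 : A !=set0 by exists b; split => //=; rewrite in_itv /= ab lexx.
have [s sA smin] := compact_EVT_min A0 cA (cont_within (fun x => @cvg_id _ _)).
move: sA; rewrite inE => -[/=]; rewrite in_itv /= => /andP[as_ sb] fs.
have pos t : a <= t < s -> 0 < f t.
  move=> /andP[at_ ts]; rewrite ltNge; apply/negP => ft.
  have : s <= t by apply: smin; rewrite inE; split => //=; rewrite in_itv /= at_ (le_trans (ltW ts)).
  by rewrite leNgt ts.
have as' : a < s by rewrite lt_neqAle as_ andbT; apply: contraTneq fa => ->; rewrite -leNgt.
exists s; split => //; first by rewrite as'.
apply/eqP; rewrite eq_le fs leNgt; apply/negP => fs0.
have [|c /andP[ac cs] fc] := @IVT_eq f a s (f s / 2) cf as_; first by right; apply/andP; split; lra.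
have : 0 < f c.
  apply: pos; rewrite ac /= lt_neqAle cs andbT; apply/eqP => e.
  by move: fc; rewrite e; lra.
by rewrite fc; lra.
Qed.

Lemma continuous_rev f (c : R) : continuous f -> continuous (fun t => f (c - t)).
Proof.
move=> cf t; apply: (@continuous_comp _ _ _ (fun t => c - t) f) => //; last exact: cf.
by apply: continuousB; [exact: cst_continuous|exact: cvg_id].
Qed.

Lemma last_zero f a b : continuous f -> a <= b -> f a <= 0 -> 0 < f b ->
  exists s, [/\ a <= s < b, f s = 0 & forall t, s < t <= b -> 0 < f t].
Proof.
move=> cf ab fa fb.
have [|||s [/andP[s1 s2] fs h]] := @first_zero (fun t => f (a + b - t)) a b _ ab.
- exact: continuous_rev.
- by rewrite (_ : a + b - a = b) //; lra.
- by rewrite (_ : a + b - b = a) //; lra.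
exists (a + b - s); split => //; first by apply/andP; split; lra.
move=> t /andP[t1 t2]; have := h (a + b - t).
by rewrite (_ : a + b - (a + b - t) = t); [apply; apply/andP; split; lra|lra].
Qed.

Lemma isd_gt0_near f t (d : R) : isd f t d -> 0 < d ->
  exists2 e, 0 < e & (forall s, t < s < t + e -> f t < f s) /\
                     (forall s, t - e < s < t -> f s < f t).
Proof.
move=> [hd dE] d0.
have : (fun h : R => h^-1 *: ((f \o shift t) (h *: (1 : R)) - f t)) @ 0^' --> d.
  by rewrite -dE; exact: hd.
move=> /(@cvgr_gt _ _ _ _) /(_ 0 d0).
move=> /nbhs_ballP[e /= e0 he].
have key h : h != 0 -> `|h| < e -> 0 < h^-1 * (f (h + t) - f t).
  move=> h0 he'; have := he h; rewrite /ball /= sub0r normrN => /(_ he' h0).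
  by rewrite /= /GRing.scale /= mulr1.
exists e => //; split => s /andP[s1 s2].
  have := key (s - t); rewrite subrK subr_eq0 gt_eqF // ger0_norm ?subr_ge0 ?ltW//.
  have -> : (s - t < e) by lra.
  by move=> /(_ isT isT); rewrite pmulr_rgt0 ?subr_gt0// invr_gt0 subr_gt0.
have := key (s - t); rewrite subrK subr_eq0 lt_eqF // ltr0_norm ?subr_lt0 //.
have -> : (- (s - t) < e) by lra.
by move=> /(_ isT isT); rewrite nmulr_rgt0 ?subr_lt0// invr_lt0 subr_lt0.
Qed.

Lemma isd_lt0_near f t (d : R) : isd f t d -> d < 0 ->
  exists2 e, 0 < e & (forall s, t < s < t + e -> f s < f t) /\
                     (forall s, t - e < s < t -> f t < f s).
Proof.
move=> /isdN hd d0; have [|e e0 [h1 h2]] := isd_gt0_near hd; first by rewrite oppr_gt0.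
by exists e => //; split => s /[dup] ? ; [move/h1|move/h2]; rewrite ltrN2.
Qed.

Lemma isd_left_le0 f a t (d : R) : a < t -> isd f t d ->
  (forall s, a <= s < t -> f t <= f s) -> d <= 0.
Proof.
move=> at_ hd h; rewrite leNgt; apply/negP => d0.
have [e e0 [_ h2]] := isd_gt0_near hd d0.
pose s := Num.max a (t - e / 2).
have s1 : a <= s < t by rewrite le_max lexx gt_max at_ /=; lra.
have s2 : t - e < s < t.
  by move: s1 => /andP[_ ->]; rewrite lt_max andbT; apply/orP; right; lra.
by have := h _ s1; rewrite leNgt h2.
Qed.

Lemma isd_right_ge0 f b t (d : R) : t < b -> isd f t d ->
  (forall s, t < s <= b -> f t <= f s) -> 0 <= d.
Proof.
move=> at_ hd h; rewrite leNgt; apply/negP => d0.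
have [e e0 [h1 _]] := isd_lt0_near hd d0.
pose s := Num.min b (t + e / 2).
have s1 : t < s <= b by rewrite ge_min lexx lt_min at_ /= andbT; lra.
have s2 : t < s < t + e.
  by move: s1 => /andP[-> _]; rewrite gt_min; apply/orP; right; lra.
by have := h _ s1; rewrite leNgt h1.
Qed.

(* Only the values of f slightly above 0 matter. *)
Lemma barrier f (df : R -> R) (eta : R) a b : continuous f -> a <= b -> 0 < eta ->
  f a <= 0 ->
  (forall t, a < t < b -> 0 < f t < eta -> isd f t (df t)) ->
  (forall t, a < t < b -> 0 < f t < eta -> df t <= 0) -> f b <= 0.
Proof.
move=> cf ab e0 fa hd h0; rewrite leNgt; apply/negP => fb.
pose m := Num.min (f b) (eta / 2).
have m0 : 0 < m by rewrite lt_min fb /=; lra.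
have mE : m < eta by rewrite gt_min; apply/orP; right; lra.
have [|||s2 [/andP[as2 s2b] fs2 h2]] := @first_zero (fun t => m - f t) a b _ ab.
- by move=> t; apply: (@continuousB _ _ _ (fun=> m) f); [exact: cst_continuous|exact: cf].
- by move: fa m0; lra.
- by rewrite subr_le0 ge_min lexx.
have fs2m : f s2 = m by move: fs2; lra.
(* Between its last zero s1 and s2 the function climbs to the level m < eta without leaving (0,
   eta), although its derivative is nonpositive there. *)
have [|s1 [/andP[as1 s12] fs1 h1]] := @last_zero f a s2 cf (ltW as2) fa; first by rewrite fs2m.
have ins t : s1 < t < s2 -> a < t < b.
  by move=> /andP[t1 t2]; rewrite (le_lt_trans as1 t1) (lt_le_trans t2 s2b).
have inf t : s1 < t < s2 -> 0 < f t < eta.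
  move=> /andP[t1 t2]; rewrite h1 ?t1 ?ltW//=.
  have := h2 t; rewrite (ltW (le_lt_trans as1 t1)) t2 => /(_ isT); lra.
have : f s2 <= f s1.
  apply: (@isd_nonincr f df) => //; first exact: ltW.
    by move=> t ht; apply: hd; [exact: ins|exact: inf].
  by move=> t ht; apply: h0; [exact: ins|exact: inf].
by rewrite fs2m fs1 leNgt m0.
Qed.

(** The inverse is made total by clamping its argument to [f b, f a]; it is then continuous on the
    whole line and composes without side conditions. *)
Lemma decr_inverse f (df : R -> R) a b : a < b -> continuous f ->
  (forall t, a < t < b -> isd f t (df t)) ->
  (forall t, a < t < b -> df t < 0) ->
  exists g, [/\ continuous g, forall t, a <= t <= b -> g (f t) = t,
    forall y, f b <= y <= f a -> a <= g y <= b /\ f (g y) = y &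
    forall t, a < t < b -> isd g (f t) (df t)^-1].
Proof.
move=> ab cf hd h0.
have mono s t : a <= s <= b -> a <= t <= b -> s < t -> f t < f s.
  move=> /andP[as_ sb] /andP[at_ tb] st; apply: (@isd_decr f df) => // r /andP[r1 r2].
    by apply: hd; rewrite (le_lt_trans as_ r1) (lt_le_trans r2 tb).
  by apply: h0; rewrite (le_lt_trans as_ r1) (lt_le_trans r2 tb).
have fba : f b <= f a by apply/ltW/mono => //; rewrite lexx ltW.
have ex y : exists t, f b <= y <= f a -> a <= t <= b /\ f t = y.
  have [yI|] := boolP (f b <= y <= f a); last by exists 0.
  by have [|t ? ?] := IVT_eq cf (ltW ab) (_ : _ \/ f b <= y <= f a); [right|exists t].
pose g0 y := xget 0 [set t | f b <= y <= f a -> a <= t <= b /\ f t = y].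
have g0P y : f b <= y <= f a -> a <= g0 y <= b /\ f (g0 y) = y.
  by rewrite /g0; case: xgetP => [t _ /= //|+ ?]; have [t ht] := ex y; move=> /(_ t) [].
have g0K t : a <= t <= b -> g0 (f t) = t.
  move=> tI; have [|gI fg] := g0P (f t).
    move: (tI) => /andP[]; rewrite !le_eqVlt => /predU1P[<-|at_] /predU1P[->|tb]; rewrite ?lexx ?fba ?eqxx ?orbT//=.
    - by rewrite !(mono _ _ _ _ tb) ?orbT // ?lexx ltW.
    - by rewrite (mono _ _ _ _ ab) ?orbT // ?lexx ltW.
    - by rewrite !(mono _ _ _ _ at_) ?(mono _ _ _ _ tb) ?orbT // ?lexx ltW.
  case: (ltgtP (g0 (f t)) t) => // h.
    by have := mono _ _ gI tI h; rewrite fg ltxx.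
  by have := mono _ _ tI gI h; rewrite fg ltxx.
have g0c : {within `[f b, f a], continuous g0}.
  apply: (@segment_can_ge_continuous R a b f g0); first exact: ltW.
    exact: cont_within.
  by move=> t; rewrite in_itv; exact: g0K.
pose g y := g0 (Num.max (f b) (Num.min y (f a))).
have gE y : f b <= y <= f a -> g y = g0 y by move=> yI; rewrite /g clamp_in.
have fI t : a <= t <= b -> f b <= f t <= f a.
  move=> /andP[]; rewrite le_eqVlt => /predU1P[<-|at_]; first by rewrite fba lexx.
  rewrite le_eqVlt => /predU1P[->|tb]; first by rewrite fba lexx.
  by rewrite !ltW // mono // ?lexx ?(ltW ab) ?(ltW at_) ?(ltW tb).
have gK t : a <= t <= b -> g (f t) = t by move=> tI; rewrite gE ?g0K//; exact: fI.
exists g; split => //.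
- exact: within_clamp.
- by move=> y yI; rewrite gE//; exact: g0P.
- move=> t tI; apply: (@is_derive_inverse R f g).
  + by apply: (near_oo tI) => s /andP[s1 s2]; apply: gK; rewrite !ltW.
  + near=> s; exact: (cf s).
  + exact: hd.
  + by rewrite lt_eqF// h0.
Unshelve. all: by end_near. Qed.

Lemma incr_inverse f (df : R -> R) a b : a < b -> continuous f ->
  (forall t, a < t < b -> isd f t (df t)) ->
  (forall t, a < t < b -> 0 < df t) ->
  exists g, [/\ continuous g, forall t, a <= t <= b -> g (f t) = t,
    forall y, f a <= y <= f b -> a <= g y <= b /\ f (g y) = y &
    forall t, a < t < b -> isd g (f t) (df t)^-1].
Proof.
move=> ab cf hd h0.
have [||t /h0|g [gc gK fgK gd]] := @decr_inverse (fun t => - f t) (fun t => - df t) a b ab.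
- by move=> t; apply: continuousN; exact: cf.
- by move=> t /hd; exact: isdN.
- by rewrite oppr_lt0.
exists (fun y => g (- y)); split.
- move=> y; apply: (@continuous_comp _ _ _ (fun y => - y) g); last exact: gc.
  by apply: continuousN; exact: cvg_id.
- by move=> t tI; rewrite gK.
- by move=> y yI; have [|? ?] := fgK (- y); [rewrite !lerN2 andbC|split => //; lra].
- move=> t tI; apply: (isd_eq (isd_comp (gd _ tI) (isdN (isd_id _)))) => /=.
  by rewrite mulrN1 invrN opprK.
Qed.

End Calculus.

Ltac der := eapply isd_eq; [repeat first [eassumption | apply: isd_cst | apply: isd_id
  | eapply isdX | eapply isd_horner | eapply isd_expR
  | eapply isdD | eapply isdB | eapply isdN | eapply isdM ] | cbv beta ].

(** * Existence and uniqueness of solutions *)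

Section Primitive.
Variable R : realType.
Implicit Types (f : R -> R) (a b s t : R).
Notation mu := (@lebesgue_measure R).

Lemma integrable_continuous f a b : continuous f ->
  mu.-integrable `[a, b] (EFin \o f).
Proof.
move=> cf; apply: continuous_compact_integrable; first exact: segment_compact.
exact: continuous_subspaceT.
Qed.

Lemma isd_Rintegral f a t : continuous f -> a < t ->
  isd (fun x => \int[mu]_(s in `[a, x]) f s)%R t (f t).
Proof.
move=> cf at_.
have [|h1 h2] := @continuous_FTC1_closed R f a t (t + 1) _ (integrable_continuous _ _ cf) at_ (cf t).
  by rewrite ltrDl.
by apply: (DeriveDef h1); rewrite -derive1E.
Qed.

Lemma Rintegral_split f a b c : continuous f -> a <= b <= c ->
  (\int[mu]_(s in `[a, c]) f s = \int[mu]_(s in `[a, b]) f s + \int[mu]_(s in `[b, c]) f s)%R.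
Proof.
move=> cf /andP[ab bc].
have := @Rintegral_itvB R f (BLeft a) (BRight c) b (integrable_continuous _ _ cf).
rewrite !bnd_simp => /(_ ab bc) h.
rewrite -(@Rintegral_itv_obnd_cbnd _ b (BRight c) f).
  by rewrite -h addrC subrK.
apply: (integrableS _ _ _ (integrable_continuous b c cf)) => //.
by apply: subset_itvr; rewrite bnd_simp.
Qed.

Lemma isd_integral_from0 f t : continuous f -> isd (integral_from0 f) t (f t).
Proof.
move=> cf; pose N : R := `|t| + 1.
have tN : - N < t by rewrite /N; have := ler_norm (- t); rewrite normrN; lra.
have N0 : 0 < N by rewrite /N; have := normr_ge0 t; lra.
have h := isd_Rintegral cf tN.
have {}h := isdB h (isd_cst (\int[mu]_(s in `[- N, 0]) f s)%R t).
rewrite subr0 in h.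
apply: isd_ext h.
have : t \in `](- N), +oo[%R by rewrite in_itv /= tN.
move=> /near_in_itvoy; apply: filterS => s; rewrite in_itv /= andbT => Ns.
rewrite /integral_from0; case: ifPn => [s0|].
  by rewrite (@Rintegral_split f (- N) 0 s) ?s0 ?andbT ?oppr_le0 ?ltW //; ring.
rewrite -ltNge => s0.
by rewrite (@Rintegral_split f (- N) s 0) ?(ltW Ns) ?(ltW s0) //; ring.
Qed.

Lemma integral_from0_0 f : integral_from0 f 0 = 0.
Proof. by rewrite /integral_from0 lexx set_itv1 Rintegral_set1. Qed.

Lemma isd_cst_eq f a b : (forall t, isd f t 0) -> f a = f b.
Proof.
move=> h; wlog ab : a b / a <= b => [H|].
  by case: (leP a b) => [/H//|/ltW/H].
have cf : continuous f by move=> t; exact: (isd_cont (h t)).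
apply/eqP; rewrite eq_le.
rewrite (isd_nondecr ab cf (fun t _ => h t)) //=.
by rewrite (isd_nonincr ab cf (fun t _ => h t)).
Qed.

Lemma integral_from0E f (H : R -> R) : continuous f -> H 0 = 0 ->
  (forall t, isd H t (f t)) -> integral_from0 f = H.
Proof.
move=> cf H0 hH; apply/funext => x.
apply/eqP; rewrite -subr_eq0; apply/eqP.
rewrite (@isd_cst_eq (fun s => integral_from0 f s - H s) x 0).
  by rewrite integral_from0_0 H0 subr0.
by move=> t; apply: (isd_eq (isdB (isd_integral_from0 t cf) (hH t))); rewrite subrr.
Qed.

End Primitive.

(** * Global solutions of Lipschitz systems by Picard iteration *)

Section Picard.
Variable R : realType.
Variables (F g : R -> R) (L : R).
Hypothesis L0 : 0 <= L.
Hypothesis lipF : forall x y, `|F x - F y| <= L * `|x - y|.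
Hypothesis lipg : forall x y, `|g x - g y| <= L * `|x - y|.

Lemma lip_cont (h : R -> R) (K : R) : (forall x y, `|h x - h y| <= K * `|x - y|) ->
  continuous h.
Proof.
move=> hK x; apply/cvgrPdist_lt => e e0.
have K1 : 0 < `|K| + 1 by rewrite ltr_wpDl.
near=> y.
apply: le_lt_trans (hK _ _) _.
apply: (@le_lt_trans _ _ ((`|K| + 1) * `|x - y|)).
  by rewrite ler_wpM2r// (le_trans (ler_norm _))// lerDl.
rewrite -ltr_pdivlMl//; near: y.
by apply: cvgr_dist_lt; rewrite ?mulr_gt0 ?invr_gt0.
Unshelve. all: by end_near. Qed.

(** In the supremum norm weighted by 1 / w the Picard map is a contraction with factor 1/2 on the
    whole line, because K is twice L + 1. Global solutions are obtained at once, with no extension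
    of local ones. *)
Let K := 2 * (L + 1).
Let w (t : R) := expR (K * t) + expR (- (K * t)).

Let K0 : 0 < K. Proof. by rewrite /K; move: L0; lra. Qed.
Let w0 t : 0 < w t. Proof. by rewrite addr_gt0 ?expR_gt0. Qed.

(** C K w is the derivative of e = C (exp (K t) - exp (- K t)), which vanishes at 0 and satisfies
    |e| <= C w; the hypothesis makes e + h and e - h nondecreasing. *)
Lemma weight_bound (h dh : R -> R) (C : R) : h 0 = 0 ->
  (forall t, isd h t (dh t)) -> (forall t, `|dh t| <= C * K * w t) ->
  forall t, `|h t| <= C * w t.
Proof.
move=> h0 hd hb t.
pose e (s : R) := C * (expR (K * s) - expR (- (K * s))).
have he s : isd e s (C * K * w s).
  rewrite /e; der; last by rewrite /w; ring.
have e0 : e 0 = 0 by rewrite /e mulr0 oppr0 subrr mulr0.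
have C0 : 0 <= C.
  have := le_trans (normr_ge0 _) (hb 0); rewrite pmulr_lge0//.
  by rewrite pmulr_lge0.
have cc (p dp : R -> R) : (forall s, isd p s (dp s)) -> continuous p.
  by move=> hp s; exact: (isd_cont (hp s)).
have hp s : isd (fun s => e s + h s) s (C * K * w s + dh s) by exact: isdD.
have hm s : isd (fun s => e s - h s) s (C * K * w s - dh s) by exact: isdB.
have dp s : 0 <= C * K * w s + dh s by have := hb s; rewrite ler_norml => /andP[? _]; lra.
have dm s : 0 <= C * K * w s - dh s by have := hb s; rewrite ler_norml => /andP[_ ?]; lra.
have ew : `|e t| <= C * w t.
  rewrite /e /w normrM (ger0_norm C0) ler_wpM2l//.
  by rewrite (le_trans (ler_normB _ _))// !ger0_norm ?expR_ge0.
apply: le_trans ew.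
case: (leP 0 t) => t0.
  have := isd_nondecr t0 (cc _ _ hp) (fun s _ => hp s) (fun s _ => dp s).
  have := isd_nondecr t0 (cc _ _ hm) (fun s _ => hm s) (fun s _ => dm s).
  rewrite h0 e0 subr0 addr0 => h1 h2; apply: le_trans (ler_norm _).
  by rewrite ler_norml; apply/andP; split; lra.
have := isd_nondecr (ltW t0) (cc _ _ hp) (fun s _ => hp s) (fun s _ => dp s).
have := isd_nondecr (ltW t0) (cc _ _ hm) (fun s _ => hm s) (fun s _ => dm s).
rewrite h0 e0 subr0 addr0 => h1 h2; rewrite -[`|e t|]normrN; apply: le_trans (ler_norm _).
by rewrite ler_norml; apply/andP; split; lra.
Qed.

Variables (x0 u0 : R).

Fixpoint picard (n : nat) : (R -> R) * (R -> R) :=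
  if n is n'.+1 then
    let: (x, u) := picard n' in
    (fun t => x0 + integral_from0 (fun s => u s - F (x s)) t,
     fun t => u0 + integral_from0 (fun s => - g (x s)) t)
  else (fun=> x0, fun=> u0).

Let px n := (picard n).1.
Let pu n := (picard n).2.

Let pS n : picard n.+1 = (fun t => x0 + integral_from0 (fun s => pu n s - F (px n s)) t,
     fun t => u0 + integral_from0 (fun s => - g (px n s)) t).
Proof. by rewrite /= /px /pu; case: (picard n). Qed.

Let cF : continuous F. Proof. exact: lip_cont lipF. Qed.
Let cg : continuous g. Proof. exact: lip_cont lipg. Qed.

Let cont_rhs (x u : R -> R) : continuous x -> continuous u ->
  continuous (fun s => u s - F (x s)) /\ continuous (fun s => - g (x s)).
Proof.
move=> cx cu; split=> t.
  apply: (@continuousB _ _ _ u (F \o x)); first exact: cu.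
  by apply: continuous_comp; [exact: cx|exact: cF].
apply: (@continuousN _ _ _ (g \o x)).
by apply: continuous_comp; [exact: cx|exact: cg].
Qed.

Let cpic n : continuous (px n) /\ continuous (pu n).
Proof.
elim: n => [|n [cx cu]]; first by split=> t; exact: cst_continuous.
have [c1 c2] := cont_rhs cx cu.
rewrite /px /pu pS /=; split=> t; apply: (@isd_cont R).
  exact: (isdD (isd_cst _ _) (isd_integral_from0 _ c1)).
exact: (isdD (isd_cst _ _) (isd_integral_from0 _ c2)).
Qed.

Let dpx n t : isd (px n.+1) t (pu n t - F (px n t)).
Proof.
have [cx cu] := cpic n; have [c1 _] := cont_rhs cx cu.
rewrite /px pS /=.
by apply: (isd_eq (isdD (isd_cst _ _) (isd_integral_from0 _ c1))); rewrite add0r.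
Qed.

Let dpu n t : isd (pu n.+1) t (- g (px n t)).
Proof.
have [cx cu] := cpic n; have [_ c1] := cont_rhs cx cu.
rewrite /pu pS /=.
by apply: (isd_eq (isdD (isd_cst _ _) (isd_integral_from0 _ c1))); rewrite add0r.
Qed.

Let px0 n : px n 0 = x0.
Proof. by case: n => [//|n]; rewrite /px pS /= integral_from0_0 addr0. Qed.
Let pu0 n : pu n 0 = u0.
Proof. by case: n => [//|n]; rewrite /pu pS /= integral_from0_0 addr0. Qed.

Let M := (`|u0 - F x0| + `|g x0|).

Let M0 : 0 <= M. Proof. by rewrite addr_ge0. Qed.

Let w1 t : 1 <= w t.
Proof.
rewrite /w; case: (leP 0 t) => t0.
  have := expR_ge0 (- (K * t)).
  have : 1 <= expR (K * t) by rewrite -expR0 ler_expR mulr_ge0// ltW.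
  lra.
have := expR_ge0 (K * t).
have : 1 <= expR (- (K * t)) by rewrite -expR0 ler_expR oppr_ge0 pmulr_rle0// ltW.
lra.
Qed.

Let step n t : `|px n.+1 t - px n t| <= M * 2^-1 ^+ n * w t /\
               `|pu n.+1 t - pu n t| <= M * 2^-1 ^+ n * w t.
Proof.
elim: n t => [|n IH] t.
  rewrite expr0 mulr1.
  have wK s : M <= M * K * w s.
    rewrite -mulrA ler_peMr// -[1]mulr1 ler_pM//.
    by rewrite /K; move: L0; lra.
  split; [apply: (@weight_bound (fun s => px 1 s - px 0 s) (fun s => u0 - F x0 - 0))
    |apply: (@weight_bound (fun s => pu 1 s - pu 0 s) (fun s => - g x0 - 0))];
    rewrite ?px0 ?pu0 ?subrr//.
  - by move=> s; exact: (isdB (dpx 0 s) (isd_cst _ _)).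
  - by move=> s /=; rewrite subr0 (le_trans _ (wK s))// lerDl.
  - by move=> s; exact: (isdB (dpu 0 s) (isd_cst _ _)).
  - by move=> s /=; rewrite subr0 (le_trans _ (wK s))// normrN lerDr.
have q s : M * 2^-1 ^+ n * w s * (L + 1) = M * 2^-1 ^+ n.+1 * K * w s.
  by rewrite /K exprS; field.
split; [apply: (@weight_bound (fun s => px n.+2 s - px n.+1 s)
     (fun s => pu n.+1 s - F (px n.+1 s) - (pu n s - F (px n s))))
  |apply: (@weight_bound (fun s => pu n.+2 s - pu n.+1 s)
     (fun s => - g (px n.+1 s) - - g (px n s)))]; rewrite ?px0 ?pu0 ?subrr//.
- by move=> s; exact: (isdB (dpx n.+1 s) (dpx n s)).
- move=> s /=; have [h1 h2] := IH s; rewrite -q.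
  have := lipF (px n.+1 s) (px n s).
  have : L * `|px n.+1 s - px n s| <= L * (M * 2^-1 ^+ n * w s) by rewrite ler_wpM2l.
  move=> h3 h4.
  have -> : pu n.+1 s - F (px n.+1 s) - (pu n s - F (px n s)) =
    (pu n.+1 s - pu n s) - (F (px n.+1 s) - F (px n s)) by ring.
  apply: le_trans (ler_normB _ _) _; rewrite mulrDr mulr1 [_ * L]mulrC addrC.
  by apply: lerD => //; apply: le_trans h4 _.
- by move=> s; exact: (isdB (dpu n.+1 s) (dpu n s)).
- move=> s /=; have [h1 h2] := IH s; rewrite -q.
  have := lipg (px n.+1 s) (px n s).
  have : L * `|px n.+1 s - px n s| <= L * (M * 2^-1 ^+ n * w s) by rewrite ler_wpM2l.
  move=> h3 h4.
  have -> : - g (px n.+1 s) - - g (px n s) = - (g (px n.+1 s) - g (px n s)) by ring.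
  rewrite normrN mulrDr mulr1 [_ * L]mulrC; apply: le_trans h4 _; apply: le_trans h3 _.
  by rewrite lerDl !mulr_ge0 ?exprn_ge0 ?invr_ge0 ?(ltW (w0 _)).
Qed.

(** The intervals of radius 2 C / 2^n around [v n] are nested, and their common point is at the
    stated distance from every term. *)
Lemma geometric_limit (v : nat -> R) (C : R) : 0 <= C ->
  (forall n, `|v n.+1 - v n| <= C * 2^-1 ^+ n) ->
  exists l, forall n, `|v n - l| <= 2 * C * 2^-1 ^+ n.
Proof.
move=> C0 h.
pose a n := v n - 2 * C * 2^-1 ^+ n; pose b n := v n + 2 * C * 2^-1 ^+ n.
have p n : 0 <= C * 2^-1 ^+ n by rewrite mulr_ge0// exprn_ge0// invr_ge0.
have aS n : a n <= a n.+1.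
  have := h n; rewrite ler_norml /a exprS => /andP[h1 _].
  rewrite (_ : 2 * C * (2^-1 * 2^-1 ^+ n) = C * 2^-1 ^+ n); last by field.
  by rewrite -mulrA; lra.
have bS n : b n.+1 <= b n.
  have := h n; rewrite ler_norml /b exprS => /andP[_ h1].
  rewrite (_ : 2 * C * (2^-1 * 2^-1 ^+ n) = C * 2^-1 ^+ n); last by field.
  by rewrite -mulrA; lra.
have am n k : a n <= a (n + k)%N.
  by elim: k => [|k IH]; rewrite ?addn0 ?addnS //; apply: le_trans IH _.
have bm n k : b (n + k)%N <= b n.
  by elim: k => [|k IH]; rewrite ?addn0 ?addnS //; apply: le_trans _ IH.
have ab n m : a n <= b m.
  apply: le_trans (am n m) _; apply: le_trans _ (bm m n); rewrite addnC /a /b.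
  by have := p (m + n)%N; rewrite -mulrA; lra.
exists (sup (range a)) => n.
have h1 : a n <= sup (range a).
  apply: ub_le_sup; last by exists n.
  by exists (b 0%N) => _ [m _ <-].
have h2 : sup (range a) <= b n.
  by apply: ge_sup; [exists (a 0%N), 0%N|move=> _ [m _ <-]].
by rewrite ler_norml; move: h1 h2; rewrite /a /b; move: (2 * C * _) => c; lra.
Qed.

(** The iterates converge at a geometric rate weighted by w, hence uniformly on bounded intervals;
    the limit is continuous and satisfies the integral equations, which gives its derivative. *)
Lemma picard_global : exists x u : R -> R, [/\ x 0 = x0, u 0 = u0,
  forall t, isd x t (u t - F (x t)) & forall t, isd u t (- g (x t))].
Proof.
have ex t : exists l : R * R, forall n, `|px n t - l.1| <= 2 * (M * w t) * 2^-1 ^+ n /\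
    `|pu n t - l.2| <= 2 * (M * w t) * 2^-1 ^+ n.
  have Mw : 0 <= M * w t by rewrite mulr_ge0// ltW.
  have [|l hl] := @geometric_limit (px^~ t) _ Mw.
    by move=> n; have [+ _] := step n t; rewrite mulrAC.
  have [|k hk] := @geometric_limit (pu^~ t) _ Mw.
    by move=> n; have [_ +] := step n t; rewrite mulrAC.
  by exists (l, k) => n; split; [exact: hl|exact: hk].
pose l t := projT1 (cid (ex t)).
have hl t n : `|px n t - (l t).1| <= 2 * (M * w t) * 2^-1 ^+ n /\
    `|pu n t - (l t).2| <= 2 * (M * w t) * 2^-1 ^+ n.
  by rewrite /l; case: cid.
pose x t := (l t).1; pose u t := (l t).2.
have small (C e : R) : 0 <= C -> 0 < e -> exists n, C * 2^-1 ^+ n < e.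
  move=> C0 e0; have : (fun n : nat => C * 2^-1 ^+ n) @ \oo --> (0 : R).
    rewrite -[0](mulr0 C); apply: cvgMr; apply: cvg_expr.
    by rewrite ger0_norm ?invr_ge0//; lra.
  move=> /cvgr0_norm_lt => /(_ e e0) [N _ /(_ N (leqnn N))] hN.
  by exists N; apply: le_lt_trans hN; exact: ler_norm.
have wloc (t : R) : exists W : R, forall s, `|s - t| < 1 -> w s <= W.
  exists (expR (K * (`|t| + 1)) + expR (K * (`|t| + 1))) => s st.
  have hs : `|s| <= `|t| + 1 by have := ler_normD (s - t) t; rewrite subrK; lra.
  by rewrite /w lerD// ler_expR -?mulrN ler_pM2l// (le_trans _ hs)// ?ler_norm// -normrN ler_norm.
have lim_cont (v : nat -> R -> R) (y : R -> R) :
    (forall n, continuous (v n)) -> (forall n t, `|v n t - y t| <= 2 * (M * w t) * 2^-1 ^+ n) ->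
    continuous y.
  move=> cv hv t; apply/cvgrPdist_lt => e e0.
  have [W hW] := wloc t.
  have W0 : 0 <= W by apply: le_trans (ltW (w0 t)) (hW _ _); rewrite subrr normr0.
  have [||n hn] := small (2 * (M * W)) (e / 3); [by rewrite !mulr_ge0|by rewrite divr_gt0|].
  near=> s.
  have st' : `|t - s| < 1 by near: s; apply: cvgr_dist_lt => //; exact: cvg_id.
  have st : `|s - t| < 1 by rewrite distrC.
  have h1 : `|v n t - v n s| < e / 3.
    by near: s; apply: cvgr_dist_lt; [exact: cv|rewrite divr_gt0].
  have bnd r : w r <= W -> `|v n r - y r| < e / 3.
    move=> rW; apply: le_lt_trans (hv n r) _; apply: le_lt_trans hn.
    by rewrite ler_wpM2r ?exprn_ge0 ?invr_ge0// ler_wpM2l// ler_wpM2l.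
  have h2 := bnd t (hW t _); have h3 := bnd s (hW s st).
  have {}h2 : `|v n t - y t| < e / 3 by apply: h2; rewrite subrr normr0.
  by move: h1 h2 h3; rewrite !ltr_norml; lra.
have cx : continuous x by apply: (lim_cont px) => n; [have [] := cpic n|move=> t; have [] := hl t n].
have cu : continuous u by apply: (lim_cont pu) => n; [have [] := cpic n|move=> t; have [] := hl t n].
have [c1 c2] := cont_rhs cx cu.
have zero (c : R) : (forall n, `|c| <= 2 * (M * w 0) * 2^-1 ^+ n) -> c = 0.
  move=> hc; apply/eqP; rewrite -normr_le0 leNgt; apply/negP => c0.
  have [|n] := small (2 * (M * w 0)) `|c| _ c0; first by rewrite !mulr_ge0// ltW.
  by rewrite ltNge hc.
have x00 : x 0 = x0.
  by apply/eqP; rewrite eq_sym -subr_eq0; apply/eqP/zero => n; rewrite -[in x0](px0 n); have [] := hl 0 n.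
have u00 : u 0 = u0.
  by apply/eqP; rewrite eq_sym -subr_eq0; apply/eqP/zero => n; rewrite -[in u0](pu0 n); have [] := hl 0 n.
(* The iterate [v n.+1] is close to the limit y by hypothesis, and close to A plus the primitive of
   k by [weight_bound], since the difference vanishes at 0 and has derivative [dv n - k]. *)
have lim_eq (v dv : nat -> R -> R) (y k : R -> R) (A : R) : continuous k ->
    (forall n t, isd (v n.+1) t (dv n t)) -> (forall n, v n 0 = A) ->
    (forall n t, `|dv n t - k t| <= (L + 1) * (2 * (M * w t) * 2^-1 ^+ n)) ->
    (forall n t, `|v n t - y t| <= 2 * (M * w t) * 2^-1 ^+ n) ->
    forall t, y t = A + integral_from0 k t.
  move=> ck hd h0 hdv hv t.
  have key n : `|v n.+1 t - (A + integral_from0 k t)| <= M * 2^-1 ^+ n * w t.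
    apply: (@weight_bound (fun t => v n.+1 t - (A + integral_from0 k t)) (fun t => dv n t - k t)).
    - by rewrite h0 integral_from0_0 addr0 subrr.
    - move=> s; apply: (isd_eq (isdB (hd n s) (isdD (isd_cst _ _) (isd_integral_from0 _ ck)))).
      by rewrite add0r.
    - move=> s; apply: le_trans (hdv n s) _; rewrite /K le_eqVlt; apply/orP; left; apply/eqP; ring.
  apply/eqP; rewrite -subr_eq0 -normr_le0 leNgt; apply/negP => c0.
  have [|n] := small (2 * (M * w t)) _ _ c0; first by rewrite !mulr_ge0// ltW.
  rewrite ltNge => /negP; apply.
  have -> : y t - (A + integral_from0 k t) =
     (v n.+1 t - (A + integral_from0 k t)) - (v n.+1 t - y t) by ring.
  apply: le_trans (ler_normB _ _) _; apply: le_trans (lerD (key n) (hv n.+1 t)) _.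
  by rewrite exprS le_eqVlt; apply/orP; left; apply/eqP; field.
have dlim (y k : R -> R) A : continuous k -> (forall t, y t = A + integral_from0 k t) ->
    forall t, isd y t (k t).
  move=> ck hy t; have -> : y = (fun t => A + integral_from0 k t) by apply/funext.
  by apply: (isd_eq (isdD (isd_cst _ _) (isd_integral_from0 _ ck))); rewrite add0r.
exists x, u; split => //.
  apply: (dlim _ _ x0 c1); apply: (lim_eq px (fun n t => pu n t - F (px n t))) => //.
    move=> n t; have [h1 h2] := hl t n.
    have -> : pu n t - F (px n t) - (u t - F (x t)) =
      (pu n t - u t) - (F (px n t) - F (x t)) by ring.
    apply: le_trans (ler_normB _ _) _; rewrite mulrDl mul1r addrC lerD//.
    by apply: le_trans (lipF _ _) _; rewrite ler_wpM2l.
  by move=> n t; have [] := hl t n.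
apply: (dlim _ _ u0 c2); apply: (lim_eq pu (fun n t => - g (px n t))) => //.
  move=> n t; have [h1 h2] := hl t n.
  have -> : - g (px n t) - (- g (x t)) = - (g (px n t) - g (x t)) by ring.
  rewrite normrN; apply: le_trans (lipg _ _) _.
  rewrite mulrDl mul1r; apply: (@le_trans _ _ (L * (2 * (M * w t) * 2^-1 ^+ n))).
    by rewrite ler_wpM2l.
  by rewrite lerDl !mulr_ge0 ?exprn_ge0 ?invr_ge0 ?(ltW (w0 _)).
by move=> n t; have [] := hl t n.
Unshelve. all: by end_near. Qed.

End Picard.

(** * Orbits in the right half-plane *)

Section PolyBounds.
Variable R : realType.
Implicit Types (p : {poly R}) (x y B : R).

Lemma poly_bounded p B : exists M, 0 <= M /\ forall x, `|x| <= B -> `|p.[x]| <= M.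
Proof.
elim/poly_ind: p => [|p c [M [M0 IH]]].
  by exists 0; split => // x _; rewrite horner0 normr0.
exists (M * `|B| + `|c|); split; first by rewrite addr_ge0// mulr_ge0.
move=> x xB; rewrite !hornerE; apply: le_trans (ler_normD _ _) _.
by rewrite lerD2r normrM ler_pM ?IH// (le_trans xB) ?ler_norm.
Qed.

Lemma poly_lipschitz p B : exists L, 0 <= L /\
  forall x y, `|x| <= B -> `|y| <= B -> `|p.[x] - p.[y]| <= L * `|x - y|.
Proof.
elim/poly_ind: p => [|p c [L [L0 IH]]].
  by exists 0; split => // x y _ _; rewrite !horner0 subrr normr0 mul0r.
have [M [M0 hM]] := poly_bounded p B.
exists (L * `|B| + M); split; first by rewrite addr_ge0// mulr_ge0.
move=> x y xB yB; rewrite !hornerE.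
have -> : p.[x] * x + c - (p.[y] * y + c) = (p.[x] - p.[y]) * x + p.[y] * (x - y) by ring.
apply: le_trans (ler_normD _ _) _; rewrite !normrM mulrDl lerD//.
  rewrite mulrAC ler_pM ?IH// (le_trans xB) ?ler_norm//.
by rewrite ler_wpM2r// hM.
Qed.

Definition clamp (B x : R) := Num.max (- B) (Num.min x B).

Lemma clampE B x : `|x| <= B -> clamp B x = x.
Proof. by rewrite ler_norml => h; exact: clamp_in. Qed.

Lemma clamp_norm B x : 0 <= B -> `|clamp B x| <= B.
Proof.
move=> B0; rewrite /clamp ler_norml le_max lexx /= ge_max ge_min lexx orbT andbT.
by lra.
Qed.

Lemma clamp_lip B x y : 0 <= B -> `|clamp B x - clamp B y| <= `|x - y|.
Proof.
move=> B0; rewrite /clamp /Num.max /Num.min; wlog xy : x y / x <= y => [H|].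
  by case: (leP x y) => [/H//|/ltW/H]; rewrite distrC [leRHS]distrC.
rewrite [leRHS]distrC [leLHS]distrC (@ger0_norm _ (y - x)) ?subr_ge0//.
by rewrite ler_norml; repeat case: ifPn; rewrite -?leNgt => *; apply/andP; split; lra.
Qed.

Lemma poly_clamp_lip p B : 0 <= B -> exists L, 0 <= L /\
  forall x y, `|p.[clamp B x] - p.[clamp B y]| <= L * `|x - y|.
Proof.
move=> B0; have [L [L0 hL]] := poly_lipschitz p B; exists L; split => // x y.
apply: le_trans (hL _ _ (clamp_norm _ B0) (clamp_norm _ B0)) _.
by rewrite ler_wpM2l// clamp_lip.
Qed.

End PolyBounds.

(** * Uniqueness by a Gronwall estimate *)

Section Uniqueness.
Variable R : realType.

(** The squared distance N of the two solutions satisfies |N'| <= (1 + 3 L) N, so that exp (- K t) N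
    does not increase and exp (K t) N does not decrease; a zero of N spreads to both sides. F and g
    are arbitrary functions, Lipschitz on [-B, B], in order to cover both the polynomials and their
    clamped versions. *)
Lemma gronwall_pair (F g : R -> R) (L B a b s : R) (x1 u1 x2 u2 : R -> R) :
  0 <= L ->
  (forall x y, `|x| <= B -> `|y| <= B -> `|F x - F y| <= L * `|x - y|) ->
  (forall x y, `|x| <= B -> `|y| <= B -> `|g x - g y| <= L * `|x - y|) ->
  continuous x1 -> continuous u1 -> continuous x2 -> continuous u2 ->
  (forall t, a < t < b -> isd x1 t (u1 t - F (x1 t)) /\ isd u1 t (- g (x1 t))) ->
  (forall t, a < t < b -> isd x2 t (u2 t - F (x2 t)) /\ isd u2 t (- g (x2 t))) ->
  (forall t, a < t < b -> `|x1 t| <= B /\ `|x2 t| <= B) ->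
  a <= s <= b -> x1 s = x2 s -> u1 s = u2 s ->
  forall t, a <= t <= b -> x1 t = x2 t /\ u1 t = u2 t.
Proof.
move=> L0 lF lg cx1 cu1 cx2 cu2 h1 h2 hB sI ex eu.
pose N t := (x1 t - x2 t) ^+ 2 + (u1 t - u2 t) ^+ 2.
pose dN t := 2 * (x1 t - x2 t) * ((u1 t - u2 t) - (F (x1 t) - F (x2 t)))
             - 2 * (u1 t - u2 t) * (g (x1 t) - g (x2 t)).
pose K := 1 + 3 * L.
have hN t : a < t < b -> isd N t (dN t).
  move=> tI; have [d1 d2] := h1 _ tI; have [d3 d4] := h2 _ tI.
  by rewrite /N; der; rewrite /dN; ring.
have dNK t : a < t < b -> `|dN t| <= K * N t.
  move=> tI; have [B1 B2] := hB _ tI; have := lF _ _ B1 B2; have := lg _ _ B1 B2.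
  rewrite /dN /N; move: (x1 t - x2 t) (u1 t - u2 t) (F _ - _) (g _ - _) => p q f h.
  move=> hh hf; have p0 := normr_ge0 p; have q0 := normr_ge0 q.
  apply: le_trans (ler_normB _ _) _; rewrite !normrM !(ger0_norm (ler0n _ 2)).
  have -> : p ^+ 2 = `|p| ^+ 2 by rewrite real_normK// num_real.
  have -> : q ^+ 2 = `|q| ^+ 2 by rewrite real_normK// num_real.
  have hd := ler_normB q f.
  have e1 : `|p| * `|q - f| <= `|p| * (`|q| + L * `|p|).
    by rewrite ler_wpM2l// (le_trans hd)// lerD2l.
  have e2 : `|q| * `|h| <= `|q| * (L * `|p|) by rewrite ler_wpM2l.
  rewrite /K; move: (`|p|) (`|q|) (`|q - f|) (`|h|) p0 q0 e1 e2 => P Q D H p0 q0 e1 e2.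
  by have := sqr_ge0 (P - Q); have := mulr_ge0 L0 (sqr_ge0 (P - Q));
    have := mulr_ge0 L0 (sqr_ge0 Q); have := mulr_ge0 L0 (sqr_ge0 P); nra.
have cN : continuous N.
  move=> t; apply: (@continuousD _ _ _ (fun t => (x1 t - x2 t) ^+ 2) (fun t => (u1 t - u2 t) ^+ 2)).
    apply: (@continuous_comp _ _ _ (fun t => x1 t - x2 t) (fun y => y ^+ 2)); last exact: exprn_continuous.
    by apply: (@continuousB _ _ _ x1 x2); [exact: cx1|exact: cx2].
  apply: (@continuous_comp _ _ _ (fun t => u1 t - u2 t) (fun y => y ^+ 2)); last exact: exprn_continuous.
  by apply: (@continuousB _ _ _ u1 u2); [exact: cu1|exact: cu2].
have cE (c : R) : continuous (fun t => expR (c * t) * N t).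
  move=> t; apply: (@continuousM _ _ (fun t => expR (c * t)) N); last exact: cN.
  apply: (@isd_cont R _ _ (expR (c * t) * c)).
  by der; rewrite ?mul0r ?add0r ?mulr1.
have dE c t : a < t < b -> isd (fun t => expR (c * t) * N t) t (expR (c * t) * (c * N t + dN t)).
  move=> /hN h; der.
  ring.
have N0 t : 0 <= N t by rewrite addr_ge0 ?sqr_ge0.
have Ns : N s = 0 by rewrite /N ex eu !subrr expr0n addr0.
move=> t tI; suff : N t = 0.
  move/eqP; rewrite paddr_eq0 ?sqr_ge0// !sqrf_eq0 !subr_eq0 => /andP[/eqP -> /eqP ->].
  by [].
apply/eqP; rewrite eq_le N0 andbT.
move: sI tI => /andP[as_ sb] /andP[at_ tb].
case: (leP s t) => st.
  have ins r : s < r < t -> a < r < b.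
    by move=> /andP[r1 r2]; rewrite (le_lt_trans as_ r1) (lt_le_trans r2 tb).
  have H : expR (- K * t) * N t <= expR (- K * s) * N s.
    apply: (isd_nonincr st (cE _) (fun r h => dE _ r (ins r h))) => r rI.
    rewrite pmulr_rle0 ?expR_gt0//; have := dNK r (ins r rI).
    by rewrite ler_norml => /andP[_]; rewrite mulNr; lra.
  by move: H; rewrite Ns mulr0 pmulr_rle0// expR_gt0.
have ins r : t < r < s -> a < r < b.
  by move=> /andP[r1 r2]; rewrite (le_lt_trans at_ r1) (lt_le_trans r2 sb).
have H : expR (K * t) * N t <= expR (K * s) * N s.
  apply: (isd_nondecr (ltW st) (cE _) (fun r h => dE _ r (ins r h))) => r rI.
  rewrite pmulr_rge0 ?expR_gt0//; have := dNK r (ins r rI).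
  by rewrite ler_norml => /andP[]; lra.
by move: H; rewrite Ns mulr0 pmulr_rle0// expR_gt0.
Qed.

(* The Lienard system x' = u - F(x), u' = -G'(x), which is x' = y,
   y' = -g(x) - f(x) y for y = u - F(x), g = G', f = F'. *)
Definition lienard (G F : {poly R}) (x u : R -> R) (t : R) :=
  isd x t (u t - F.[x t]) /\ isd u t (- G^`().[x t]).

Lemma bounded_on (h : R -> R) a b : continuous h -> a <= b ->
  exists2 M, 0 <= M & forall t, a <= t <= b -> `|h t| <= M.
Proof.
move=> ch ab.
have cn : continuous (fun t => `|h t|).
  by move=> t; apply: (@continuous_comp _ _ _ h Num.norm); [exact: ch|exact: norm_continuous].
have [c _ hc] := EVT_max ab (cont_within cn).
by exists `|h c| => // t tI; apply: hc; rewrite in_itv.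
Qed.

Lemma lienard_uniq (G F : {poly R}) a b s (x1 u1 x2 u2 : R -> R) :
  continuous x1 -> continuous u1 -> continuous x2 -> continuous u2 ->
  (forall t, a < t < b -> lienard G F x1 u1 t) ->
  (forall t, a < t < b -> lienard G F x2 u2 t) ->
  a <= s <= b -> x1 s = x2 s -> u1 s = u2 s ->
  forall t, a <= t <= b -> x1 t = x2 t /\ u1 t = u2 t.
Proof.
move=> cx1 cu1 cx2 cu2 h1 h2 sI ex eu.
have ab : a <= b by move: sI => /andP[]; exact: le_trans.
have [B1 B10 hB1] := bounded_on cx1 ab; have [B2 B20 hB2] := bounded_on cx2 ab.
pose B := B1 + B2.
have [L1 [L10 hL1]] := poly_lipschitz F B; have [L2 [L20 hL2]] := poly_lipschitz G^`() B.
apply: (@gronwall_pair (horner F) (horner G^`()) (L1 + L2) B a b s) => //.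
- exact: addr_ge0.
- by move=> x y xB yB; apply: le_trans (hL1 _ _ xB yB) _; rewrite ler_wpM2r// lerDl.
- by move=> x y xB yB; apply: le_trans (hL2 _ _ xB yB) _; rewrite ler_wpM2r// lerDr.
- move=> t /andP[/ltW a1 /ltW a2].
  by split; [apply: le_trans (hB1 t _) _|apply: le_trans (hB2 t _) _]; rewrite ?a1 ?a2 ?lerDl ?lerDr.
Qed.

End Uniqueness.

(** * Bounds on orbits as long as they stay in x >= 0 *)

Section RightHalf.
Variable R : realType.
Implicit Types (G F : {poly R}).

(** The squared radius in the coordinates (sqrt (2 G), u). The quotient u / sqrt rho of [isd_ratio]
    is then the sine of the polar angle. *)
Definition rho G (x u : R) := 2 * G.[x] + u ^+ 2.

(* What is needed of the system on x >= 0.  The last clause says that the orbits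
   turn around the origin both near it and far from it. *)
Definition right_data G F :=
  [/\ G.[0] = 0 /\ F.[0] = 0, G^`().[0] = 0,
      forall x, 0 < x -> 0 < G^`().[x],
      (forall Z, exists X, forall x, X <= x -> Z <= G.[x]) &
      exists k r0 R0 : R, [/\ 0 < k < 1, 0 < r0 <= R0 &
        forall x u, 0 <= x -> 0 < rho G x u -> rho G x u <= r0 \/ R0 <= rho G x u ->
          `|u * F.[x]| <= k * rho G x u /\ F.[x] ^+ 2 <= 4 * rho G x u]].

Lemma right_data_opp G F : right_data G F -> right_data G (- F).
Proof.
move=> [[G0 F0] g0 gp Gy [k [r0 [R0 [k01 r0R0 h]]]]]; split => //.
  by rewrite hornerN F0 oppr0.
exists k, r0, R0; split => // x u x0 p0 hr.
by rewrite hornerN mulrN normrN sqrrN; exact: h.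
Qed.

Lemma cont_horner_comp (p : {poly R}) (x : R -> R) : continuous x ->
  continuous (fun t => p.[x t]).
Proof.
by move=> cx t; apply: (@continuous_comp _ _ _ x (horner p)); [exact: cx|exact: continuous_horner].
Qed.

Section Data.
Variables (G F : {poly R}).
Hypothesis rd : right_data G F.
Notation g := G^`().

Lemma rd_incr x y : 0 <= x -> x < y -> G.[x] < G.[y].
Proof.
move=> x0 xy; case: rd => _ _ gp _ _.
apply: (@isd_incr R (horner G) (horner g)) => //; first exact: continuous_horner.
  by move=> t _; exact: is_derive_poly.
by move=> t /andP[xt _]; apply: gp; exact: le_lt_trans xt.
Qed.

Lemma rd_G0 : G.[0] = 0. Proof. by case: rd => -[]. Qed.
Lemma rd_F0 : F.[0] = 0. Proof. by case: rd => -[]. Qed.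
Lemma rd_g0 : g.[0] = 0. Proof. by case: rd. Qed.
Lemma rd_gp x : 0 < x -> 0 < g.[x]. Proof. by case: rd => _ _ + _ _; apply. Qed.

Lemma rd_Gpos x : 0 < x -> 0 < G.[x].
Proof. by rewrite -{2}rd_G0; exact: rd_incr. Qed.

Lemma rd_Gge0 x : 0 <= x -> 0 <= G.[x].
Proof. by rewrite le_eqVlt => /predU1P[<-|/rd_Gpos/ltW//]; rewrite rd_G0. Qed.

Lemma rd_rho_gt0 x u : 0 <= x -> (x, u) != (0, 0) -> 0 < rho G x u.
Proof.
move=> x0 h; have := rd_Gge0 x0; have := sqr_ge0 u; rewrite /rho => u2 Gx.
rewrite lt_def (addr_ge0 (mulr_ge0 (ler0n _ 2) Gx) u2) andbT; apply: contra h.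
rewrite (paddr_eq0 (mulr_ge0 (ler0n _ 2) Gx) u2) mulf_eq0 pnatr_eq0 /= sqrf_eq0 => /andP[/eqP Gx0 /eqP ->].
rewrite xpair_eqE eqxx andbT; apply: contraT => xn0.
by have := @rd_Gpos x; rewrite lt_def xn0 x0 => /(_ isT); rewrite Gx0 ltxx.
Qed.

Lemma isd_rho x u t : lienard G F x u t ->
  isd (fun s => rho G (x s) (u s)) t (- 2 * g.[x t] * F.[x t]).
Proof.
move=> [dx du]; rewrite /rho; der.
ring.
Qed.

Lemma isd_ratio x u t : lienard G F x u t -> 0 < rho G (x t) (u t) ->
  isd (fun s => u s * (Num.sqrt (rho G (x s) (u s)))^-1) t
    (- (g.[x t] / Num.sqrt (rho G (x t) (u t))) *
       (1 - u t * F.[x t] / rho G (x t) (u t))).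
Proof.
move=> hl r0; have dr := isd_rho hl; have [dx du] := hl.
have q0 : Num.sqrt (rho G (x t) (u t)) != 0 by rewrite gt_eqF// sqrtr_gt0.
have dq := @isd_sqrt R (fun s => rho G (x s) (u s)) t _ r0 dr.
apply: (isd_eq (isdM du (@isdV R (fun s => Num.sqrt (rho G (x s) (u s))) t _ q0 dq))).
have e : rho G (x t) (u t) = Num.sqrt (rho G (x t) (u t)) ^+ 2 by rewrite sqr_sqrtr// ltW.
by move: q0 e; move: (Num.sqrt _) => q q0 ->; field.
Qed.

Lemma ratio_bound (r u : R) : 0 < r -> u ^+ 2 <= r -> `|u / Num.sqrt r| <= 1.
Proof.
move=> r0 h; rewrite normrM normfV (ger0_norm (sqrtr_ge0 _)).
rewrite ler_pdivrMr ?sqrtr_gt0// mul1r -sqrtr_sqr ler_wsqrtr//.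
Qed.

(** Along orbits (ln rho)' = - 2 g F / rho is at most 4 g / sqrt rho in absolute value where F^2 <=
    4 rho, while v = u / sqrt rho has v' <= - (1 - k) g / sqrt rho. With A = 4 / (1 - k) the second
    dominates: where rho <= r0 or rho >= R0, ln rho + A v does not increase and ln rho - A v does
    not decrease. Since |v| <= 1, each bound loses a factor exp (2 A). The equation is assumed only
    where rho <= exp (2 A + 1) P, because the lemma is applied to solutions of a clamped system; the
    additional 1 is the width of the collar in [barrier]. *)
Lemma confine (k r0 R0 A T P : R) (x u : R -> R) :
  0 < k < 1 -> 0 < r0 <= R0 -> A = 4 / (1 - k) ->
  (forall x u, 0 <= x -> 0 < rho G x u -> rho G x u <= r0 \/ R0 <= rho G x u ->
     `|u * F.[x]| <= k * rho G x u /\ F.[x] ^+ 2 <= 4 * rho G x u) ->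
  0 <= T -> continuous x -> continuous u ->
  (forall t, 0 <= t <= T -> 0 <= x t) ->
  (forall t, 0 <= t <= T -> 0 < rho G (x t) (u t)) ->
  P = Num.max (rho G (x 0) (u 0)) R0 ->
  (forall t, 0 < t < T -> rho G (x t) (u t) <= expR (2 * A + 1) * P -> lienard G F x u t) ->
  expR (- 2 * A) * Num.min (rho G (x 0) (u 0)) r0 <= rho G (x T) (u T) <= expR (2 * A) * P.
Proof.
move=> /andP[k0 k1] /andP[r00 r0R0] AE hyp T0 cx cu x0 rpos PE hl.
pose r t := rho G (x t) (u t).
have cr : continuous r.
  move=> t; apply: (@continuousD _ _ _ (fun t => 2 * G.[x t]) (fun t => u t ^+ 2)).
    by apply: (@continuousM _ _ (fun=> 2) (fun t => G.[x t])); [exact: cst_continuous|exact: cont_horner_comp].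
  by apply: (@continuous_comp _ _ _ u (fun y => y ^+ 2)); [exact: cu|exact: exprn_continuous].
pose v t := u t * (Num.sqrt (r t))^-1.
have A0 : 0 < A by rewrite AE divr_gt0//; lra.
have P0 : 0 < P by rewrite PE lt_max (lt_le_trans r00 r0R0) orbT.
have u2r t : 0 <= t <= T -> u t ^+ 2 <= r t.
  by move=> /x0/rd_Gge0 Gt; rewrite /r /rho lerDr mulr_ge0.
have vb t : 0 <= t <= T -> - 1 <= v t <= 1.
  by move=> tI; rewrite -ler_norml; apply: ratio_bound; [exact: rpos|exact: u2r].
have TI : 0 <= T <= T by rewrite T0 lexx.
have OI : (0 : R) <= 0 <= T by rewrite lexx.
have oc t : 0 < t < T -> 0 <= t <= T by move=> /andP[a b]; rewrite !ltW.
(* outside [0, T] the function is frozen, so that it is continuous everywhere *)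
pose cl (t : R) := Num.max 0 (Num.min t T).
have clI t : 0 <= cl t <= T by rewrite le_max lexx /= ge_max T0 ge_min lexx orbT.
have ccl (h : R -> R) : (forall t, 0 <= t <= T -> {for t, continuous h}) ->
    continuous (fun t => h (cl t)).
  move=> ch t; apply: (@continuous_comp _ _ _ cl h); last exact/ch/clI.
  exact: continuous_clamp.
have clN (h : R -> R) d t : 0 < t < T -> isd h t d -> isd (fun t => h (cl t)) t d.
  move=> tI; apply: isd_ext; apply: (@near_oo R 0 T t (fun s => h s = h (cl s)) tI) => s sI.
  by rewrite /cl clamp_in// oc.
have cv t : 0 <= t <= T -> {for t, continuous v}.
  move=> tI; apply: (@continuousM _ _ u (fun t => (Num.sqrt (r t))^-1)); first exact: cu.
  apply: (@continuousV _ _ (fun t => Num.sqrt (r t))).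
    by rewrite gt_eqF// sqrtr_gt0 rpos.
  apply: (@continuous_comp _ _ _ r Num.sqrt); first exact: cr.
  exact: sqrt_continuous.
have cln t : 0 <= t <= T -> {for t, continuous (fun t => ln (r t))}.
  move=> tI; apply: (@continuous_comp _ _ _ r (@ln R)); first exact: cr.
  by apply: continuous_ln; exact: rpos.
pose Lam (e : R) t := ln (r t) + e * A * v t.
have cL e t : 0 <= t <= T -> {for t, continuous (Lam e)}.
  move=> tI; apply: (@continuousD _ _ _ (fun t => ln (r t)) (fun t => e * A * v t)); first exact: cln.
  by apply: (@continuousM _ _ (fun=> e * A) v); [exact: cst_continuous|exact: cv].
pose dL e t := - (g.[x t] / r t) * (2 * F.[x t] +
    e * A * (Num.sqrt (r t) * (1 - u t * F.[x t] / r t))).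
have hL e t : 0 < t < T -> lienard G F x u t -> isd (Lam e) t (dL e t).
  move=> tI lt; have rt := rpos t (oc _ tI).
  have q0 : Num.sqrt (r t) != 0 by rewrite gt_eqF// sqrtr_gt0.
  apply: (isd_eq (isdD (@isd_ln R r t _ rt (isd_rho lt)) (isdM (isd_cst _ _) (isd_ratio lt rt)))).
  rewrite /dL -/(r t).
  have er : r t = Num.sqrt (r t) ^+ 2 by rewrite sqr_sqrtr// ltW.
  by move: q0 er; move: (Num.sqrt _) => q q0 ->; field.
have sgn t : 0 < t < T -> r t <= r0 \/ R0 <= r t -> dL 1 t <= 0 /\ 0 <= dL (- 1) t.
  move=> tI h; have tI' := oc _ tI.
  have [h1 h2] := hyp _ _ (x0 _ tI') (rpos _ tI') h.
  have rt := rpos t tI'; rewrite -/(r t) in h1 h2 rt.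
  have gt0 : 0 <= g.[x t].
    have := x0 _ tI'; rewrite le_eqVlt => /predU1P[<-|/rd_gp/ltW//].
    by rewrite rd_g0.
  have gr : 0 <= g.[x t] / r t by rewrite divr_ge0// ltW.
  have q0 : 0 < Num.sqrt (r t) by rewrite sqrtr_gt0.
  set q := Num.sqrt (r t) in q0.
  have Fq : `|F.[x t]| <= 2 * q.
    rewrite -ler_sqr ?nnegrE ?mulr_ge0 ?(ltW q0)// exprMn real_normK ?num_real// sqr_sqrtr ?(ltW rt)//.
    by rewrite (le_trans h2)// ler_wpM2r ?(ltW rt)//; lra.
  have Aq : 4 * q <= A * (q * (1 - u t * F.[x t] / r t)).
    have : 1 - k <= 1 - u t * F.[x t] / r t.
      rewrite lerD2l lerN2 ler_pdivrMr//; apply: le_trans h1; exact: ler_norm.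
    move=> h3; rewrite mulrCA; rewrite [leLHS]mulrC ler_wpM2l ?(ltW q0)//.
    by rewrite -[4](divfK (_ : 1 - k != 0)) -?AE ?ler_wpM2l ?(ltW A0)// gt_eqF// subr_gt0.
  move: Fq; rewrite ler_norml => /andP[F1 F2].
  rewrite /dL -/q mul1r mulN1r mulNr [- A * _]mulNr -mulrN; split.
    by rewrite mulr_ge0_le0//; move: Aq F1 F2; clear; lra.
  by rewrite mulr_le0// ?oppr_le0//; move: Aq F1 F2; clear; lra.
have end_ t : 0 <= t <= T -> cl t = t by move=> tI; rewrite /cl clamp_in.
have rexp t : 0 <= t <= T -> r t = expR (ln (r t)) by move=> tI; rewrite lnK// posrE rpos.
have Pexp : P = expR (ln P) by rewrite lnK// posrE.
apply/andP; split.
  pose m := Num.min (r 0) r0.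
  have m0 : 0 < m by rewrite lt_min r00 rpos.
  have mexp : m = expR (ln m) by rewrite lnK// posrE.
  have : ln m - A - Lam (- 1) T <= 0.
    rewrite -{1}(end_ T TI).
    apply: (@barrier R (fun t => ln m - A - Lam (- 1) (cl t)) (fun t => - dL (- 1) t) 1 0 T _ T0 ltr01).
    - by apply: (ccl (fun t => ln m - A - Lam (- 1) t)) => t tI; apply: (@continuousB _ _ _ (fun=> ln m - A) (Lam (- 1))); [exact: cst_continuous|exact: cL].
    - rewrite (end_ _ OI) /Lam; have /andP[v1 v2] := vb 0 OI.
      have : ln m <= ln (r 0) by rewrite ler_ln ?posrE ?rpos// ge_min lexx.
      by nra.
    - move=> t tI; rewrite (end_ _ (oc _ tI)) => /andP[p1 _].
      have tI' := oc _ tI.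
      have rt : r t <= m.
        rewrite [r t]rexp// mexp ler_expR; move: p1; rewrite /Lam.
        by move: (vb t tI') A0; clear; nra.
      have lt : lienard G F x u t.
        apply: hl => //; apply: le_trans rt _; apply: (@le_trans _ _ R0).
          by rewrite ge_min r0R0 orbT.
        apply: (@le_trans _ _ P); first by rewrite PE le_max lexx orbT.
        by rewrite ler_peMl ?(ltW P0)// -[leLHS]expR0 ler_expR; lra.
      apply: (clN (fun t => ln m - A - Lam (- 1) t) _ _ tI).
      by apply: (isd_eq (isdB (isd_cst _ _) (hL (- 1) t tI lt))); rewrite sub0r.
    - move=> t tI; rewrite (end_ _ (oc _ tI)) => /andP[p1 _].
      have tI' := oc _ tI.
      have rt : r t <= m.
        rewrite [r t]rexp// mexp ler_expR; move: p1; rewrite /Lam.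
        by move: (vb t tI') A0; clear; nra.
      rewrite oppr_le0; apply: (proj2 (sgn _ tI _)); left.
      by apply: le_trans rt _; rewrite ge_min lexx orbT.
  move=> h; rewrite -/(r T) -/(r 0) -/m [r T]rexp// mexp -expRD ler_expR.
  by move: h; rewrite /Lam; have /andP[v1 v2] := vb T TI; nra.
have : Lam 1 T - (ln P + A) <= 0.
  rewrite -{1}(end_ T TI).
  apply: (@barrier R (fun t => Lam 1 (cl t) - (ln P + A)) (dL 1) 1 0 T _ T0 ltr01).
  - by apply: (ccl (fun t => Lam 1 t - (ln P + A))) => t tI; apply: (@continuousB _ _ _ (Lam 1) (fun=> ln P + A)); [exact: cL|exact: cst_continuous].
  - rewrite (end_ _ OI) /Lam; have /andP[v1 v2] := vb 0 OI.
    have : ln (r 0) <= ln P by rewrite ler_ln ?posrE ?rpos// PE le_max lexx.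
    by nra.
  - move=> t tI; rewrite (end_ _ (oc _ tI)) => /andP[_ p2].
    have tI' := oc _ tI.
    have lt : lienard G F x u t.
      apply: hl => //; rewrite -/(r t) [r t]rexp// Pexp -expRD ler_expR.
      by move: p2; rewrite /Lam; have /andP[v1 v2] := vb t tI'; nra.
    apply: (clN (fun t => Lam 1 t - (ln P + A)) _ _ tI).
    by apply: (isd_eq (isdB (hL 1 t tI lt) (isd_cst _ _))); rewrite subr0.
  - move=> t tI; rewrite (end_ _ (oc _ tI)) => /andP[p1 _].
    have tI' := oc _ tI.
    apply: (proj1 (sgn _ tI _)); right.
    apply: (@le_trans _ _ P); first by rewrite PE le_max lexx orbT.
    rewrite [r t]rexp// Pexp ler_expR; move: p1; rewrite /Lam.
    by have /andP[v1 v2] := vb t tI'; nra.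
move=> h; rewrite -/(r T) [r T]rexp// Pexp -expRD ler_expR.
by move: h; rewrite /Lam; have /andP[v1 v2] := vb T TI; nra.
Qed.

End Data.
End RightHalf.

(** * Every orbit leaves the right half-plane *)

Section Exit.
Variable R : realType.
Implicit Types (G F : {poly R}).

Lemma poly_small_near0 (p : {poly R}) (e : R) : p.[0] = 0 -> 0 < e ->
  exists2 d, 0 < d & forall x, 0 <= x <= d -> `|p.[x]| < e.
Proof.
move=> p0 e0; have [L [L0 hL]] := poly_lipschitz p 1.
exists (Num.min 1 (e / (L + 1) / 2)).
  by rewrite lt_min ltr01 /= !divr_gt0//; lra.
move=> x /andP[x0]; rewrite le_min => /andP[x1 x2].
have := hL x 0; rewrite p0 !subr0 normr0 (ger0_norm x0) => /(_ x1 ler01) h.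
apply: le_lt_trans h _.
have L1 : 0 < L + 1 by lra.
apply: (@le_lt_trans _ _ ((L + 1) * x)); first by rewrite ler_wpM2r//; lra.
have : (L + 1) * x <= (L + 1) * (e / (L + 1) / 2) by rewrite ler_wpM2l// ltW.
rewrite (_ : (L + 1) * (e / (L + 1) / 2) = e / 2); first by lra.
by field; rewrite gt_eqF.
Qed.

Section Data.
Variables (G F : {poly R}).
Hypothesis rd : right_data G F.
Notation g := G^`().

Lemma rd_big (P : R) : exists B : R, 0 < B /\ forall x u, 0 <= x -> rho G x u <= P -> x <= B.
Proof.
case: rd => _ _ _ Gy _; have [X hX] := Gy (`|P| + 1).
exists (`|X| + 1); split; first by have := normr_ge0 X; lra.
move=> x u x0 hr; rewrite leNgt; apply/negP => xX.
have := hX x; have -> : X <= x by have := ler_norm X; lra.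
move=> /(_ isT); move: hr; rewrite /rho; have := sqr_ge0 u; have := ler_norm P.
by have := normr_ge0 P; lra.
Qed.

(** The bounded quantity is minus the derivative of W = u - eta x u. For small x the force g may be
    small, but then rho >= P makes u^2 large against F^2 and the term with eta is positive; for the
    other x <= B, g has a positive minimum and eta is small enough for g / 2 to dominate eta F^2 /
    4. *)
Lemma drift (P B : R) : 0 < P -> 0 < B -> exists eta c : R, [/\ 0 < eta, 0 < c, eta * B <= 2^-1 &
  forall x u, 0 <= x <= B -> P <= rho G x u ->
    c <= g.[x] * (1 - eta * x) + eta * (u * (u - F.[x]))].
Proof.
move=> P0 B0.
have [|d1 d10 h1] := @poly_small_near0 G (P / 4) (rd_G0 rd); first by lra.
have F20 : (F ^+ 2).[0] = 0 by rewrite horner_exp (rd_F0 rd) expr0n.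
have [|d2 d20 h2] := @poly_small_near0 (F ^+ 2) (P / 8) F20; first by lra.
pose xa := Num.min B (Num.min d1 d2).
have xa0 : 0 < xa by rewrite !lt_min B0 d10 d20.
have xaB : xa <= B by rewrite ge_min lexx.
have [x1 x1I gmin] := EVT_min xaB (cont_within (@continuous_horner R g)).
have g0 : 0 < g.[x1].
  by apply: (rd_gp rd); move: x1I; rewrite in_itv /= => /andP[h _]; exact: lt_le_trans h.
have [M [M0 hM]] := poly_bounded F B.
pose eta := Num.min (B^-1 / 2) (g.[x1] / (M ^+ 2 + 1)).
have M1 : 0 < M ^+ 2 + 1 by have := sqr_ge0 M; lra.
have eta0 : 0 < eta by rewrite lt_min !divr_gt0// invr_gt0.
have etaB : eta * B <= 2^-1.
  have : eta * B <= (B^-1 / 2) * B by rewrite ler_wpM2r ?(ltW B0)// ge_min lexx.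
  by rewrite (_ : B^-1 / 2 * B = 2^-1)//; field; rewrite gt_eqF.
have etaM : eta * (M ^+ 2 + 1) <= g.[x1].
  rewrite -ler_pdivlMr// ge_min lexx orbT//.
exists eta, (Num.min (eta * P / 4) (g.[x1] / 4)); split => //.
  by rewrite lt_min !divr_gt0// mulr_gt0.
move=> x u /andP[x0 xB] hr.
have ex : eta * x <= 2^-1 by apply: le_trans etaB; rewrite ler_wpM2l// ltW.
case: (leP x xa) => xxa.
  rewrite ge_min; apply/orP; left.
  have gx : 0 <= g.[x].
    by move: x0; rewrite le_eqVlt => /predU1P[<-|/(rd_gp rd)/ltW//]; rewrite (rd_g0 rd).
  have := h1 x; rewrite x0 (le_trans xxa) ?ge_min ?lexx ?orbT// => /(_ isT).
  have := h2 x; rewrite x0 (le_trans xxa) ?ge_min ?lexx ?orbT// => /(_ isT).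
  rewrite horner_exp (ger0_norm (sqr_ge0 _)) ltr_norml => F2 /andP[_ Gs].
  move: hr; rewrite /rho => hr.
  have u2 : P / 2 <= u ^+ 2 by move: hr Gs; clear; lra.
  have uF : P / 4 <= u * (u - F.[x]) by have := sqr_ge0 (u / 2 - F.[x]); move: u2 F2; clear; nra.
  have : 0 <= g.[x] * (1 - eta * x) by rewrite mulr_ge0//; move: ex; clear; lra.
  have : eta * (P / 4) <= eta * (u * (u - F.[x])) by rewrite ler_wpM2l// ltW.
  by clear; lra.
rewrite ge_min; apply/orP; right.
have gx : g.[x1] <= g.[x] by apply: gmin; rewrite in_itv /= (ltW xxa).
have Fx : F.[x] ^+ 2 <= M ^+ 2.
  by rewrite -[F.[x] ^+ 2]real_normK ?num_real// ler_sqr ?nnegrE// hM// ger0_norm.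
have uF : - (M ^+ 2 + 1) / 4 <= u * (u - F.[x]) by have := sqr_ge0 (u - F.[x] / 2); move: Fx; clear; nra.
have : eta * (- (M ^+ 2 + 1) / 4) <= eta * (u * (u - F.[x])) by rewrite ler_wpM2l// ltW.
have : g.[x1] * 2^-1 <= g.[x] * (1 - eta * x) by apply: ler_pM => //; [exact: ltW|move: ex; clear; lra].
by move: etaM; clear; lra.
Qed.

(** The clamped system has a global solution. While x >= 0, [confine] keeps rho below P2, hence x
    below B, where the clamp does nothing. If x stayed nonnegative, W of [drift] would be bounded
    and would decrease at rate c for ever. *)
Lemma right_exit (x0 u0 : R) : 0 < x0 \/ x0 = 0 /\ 0 < u0 ->
  exists (T : R) (x u : R -> R), [/\ [/\ 0 < T, continuous x & continuous u], x 0 = x0 /\ u 0 = u0,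
    forall t, 0 <= t <= T -> lienard G F x u t,
    forall t, 0 < t < T -> 0 < x t & x T = 0 /\ u T < 0].
Proof.
move=> start; have [k [r0 [R0 [k01 r0R0 hyp]]]] : exists k r0 R0 : R, [/\ 0 < k < 1, 0 < r0 <= R0 &
        forall x u, 0 <= x -> 0 < rho G x u -> rho G x u <= r0 \/ R0 <= rho G x u ->
          `|u * F.[x]| <= k * rho G x u /\ F.[x] ^+ 2 <= 4 * rho G x u] by case: rd.
pose A := 4 / (1 - k).
have A0 : 0 < A by move: k01 => /andP[_ k1]; rewrite divr_gt0// subr_gt0.
have x00 : 0 <= x0 by case: start => [/ltW//|[->]].
have sn0 : (x0, u0) != (0, 0).
  by rewrite xpair_eqE; case: start => [/gt_eqF -> //|[-> /gt_eqF ->]]; rewrite andbF.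
have r00 := rd_rho_gt0 rd x00 sn0.
pose P := Num.max (rho G x0 u0) R0.
have P0 : 0 < P by rewrite lt_max r00.
pose P2 := expR (2 * A + 1) * P.
have [B [B0 hB]] := rd_big P2.
have [LF [LF0 hLF]] := poly_clamp_lip F (ltW B0).
have [Lg [Lg0 hLg]] := poly_clamp_lip g (ltW B0).
have L0 : 0 <= LF + Lg by exact: addr_ge0.
have hLF' x y : `|F.[clamp B x] - F.[clamp B y]| <= (LF + Lg) * `|x - y|.
  by apply: le_trans (hLF x y) _; rewrite ler_wpM2r// lerDl.
have hLg' x y : `|g.[clamp B x] - g.[clamp B y]| <= (LF + Lg) * `|x - y|.
  by apply: le_trans (hLg x y) _; rewrite ler_wpM2r// lerDr.
have [x [u [ex eu dx du]]] := picard_global L0 hLF' hLg' x0 u0.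
have cx : continuous x by move=> t; exact: (isd_cont (dx t)).
have cu : continuous u by move=> t; exact: (isd_cont (du t)).
have true_ t : `|x t| <= B -> lienard G F x u t.
  by move=> xB; have := dx t; have := du t; rewrite clampE.
have c00 : clamp B 0 = 0 :> R by rewrite clampE// normr0 ltW.
(* Uniqueness against the zero solution: an orbit that starts elsewhere does not reach the origin,
   so rho stays positive. *)
have not0 t : 0 <= t -> (x t, u t) != (0, 0).
  move=> t0; apply: contra sn0; rewrite !xpair_eqE => /andP[/eqP xt /eqP ut].
  have B1 : 0 <= `|t| + 1 by rewrite addr_ge0.
  have [M1 M10 hM1] := bounded_on cx t0.
  have [] : x 0 = 0 /\ u 0 = 0; last by rewrite ex eu => -> ->; rewrite eqxx.
  apply: (@gronwall_pair R (fun y => F.[clamp B y]) (fun y => g.[clamp B y])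
    (LF + Lg) M1 0 t t x u (fun=> 0) (fun=> 0) L0 _ _ cx cu _ _ _ _ _ _ xt ut).
  - by move=> y z _ _; exact: hLF'.
  - by move=> y z _ _; exact: hLg'.
  - by move=> s; exact: cst_continuous.
  - by move=> s; exact: cst_continuous.
  - by move=> s _; split; [exact: dx|exact: du].
  - move=> s _; rewrite c00 (rd_F0 rd) (rd_g0 rd) subrr oppr0; split; exact: isd_cst.
  - by move=> s /andP[s0 s1]; rewrite normr0 hM1 ?(ltW s0) ?(ltW s1).
  - by rewrite t0 lexx.
  - by rewrite lexx.
have conf T : 0 <= T -> (forall t, 0 <= t <= T -> 0 <= x t) ->
    expR (- 2 * A) * Num.min (rho G x0 u0) r0 <= rho G (x T) (u T) <= expR (2 * A) * P.
  move=> T0 xp; rewrite -ex -eu; apply: (confine rd k01 r0R0 _ hyp T0 cx cu xp) => //.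
  - by move=> t /[dup] /andP[t0 _] tI; apply: (rd_rho_gt0 rd); [exact: xp|exact: not0].
  - by rewrite /P ex eu.
  - move=> t /andP[t0 tT] hr; apply: true_.
    have xt : 0 <= x t by apply: xp; rewrite !ltW.
    by rewrite ger0_norm//; apply: (hB _ (u t)).
have P1P : expR (2 * A) * P <= P2.
  by rewrite /P2 ler_wpM2r ?(ltW P0)// ler_expR lerDl.
pose P1 := expR (- 2 * A) * Num.min (rho G x0 u0) r0.
have P10 : 0 < P1 by rewrite mulr_gt0 ?expR_gt0// lt_min r00 /=; move: r0R0 => /andP[].
have [eta [c [eta0 c0 etaB hdrift]]] := drift P10 B0.
have exit : exists2 t, 0 <= t & x t < 0.
  (* |W| <= 2 (1 + P2), and c T exceeds the largest possible difference of two values of W. *)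
  pose T := (2 * (2 * (1 + P2)) + 1) / c.
  have P20 : 0 <= P2 by rewrite mulr_ge0 ?expR_ge0// ltW.
  have T0 : 0 <= T by rewrite divr_ge0 ?(ltW c0)//; move: P20; clear; lra.
  have [//|noexit] := pselect (exists2 t, 0 <= t & x t < 0).
  have xp t : 0 <= t -> 0 <= x t.
    by move=> t0; rewrite leNgt; apply/negP => xt; apply: noexit; exists t.
  have cf t : 0 <= t -> [/\ P1 <= rho G (x t) (u t), rho G (x t) (u t) <= P2 & 0 <= x t <= B].
    move=> t0; have /andP[c1 c2] := conf t t0 (fun s h => xp s (proj1 (andP h))).
    have c3 := le_trans c2 P1P.
    by split => //; rewrite xp//=; apply: (hB _ (u t)) => //; exact: xp.
  pose W t := u t - eta * (x t * u t).
  have bW t : 0 <= t -> `|W t| <= 2 * (1 + P2).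
    move=> t0; have [_ h2 /andP[h3 h4]] := cf t t0.
    have u2 : u t ^+ 2 <= P2.
      by apply: le_trans h2; rewrite /rho lerDr mulr_ge0// (rd_Gge0 rd).
    have -> : W t = u t * (1 - eta * x t) by rewrite /W; ring.
    have e1 : eta * x t <= 2^-1 by apply: le_trans etaB; rewrite ler_wpM2l// ltW.
    have e2 : 0 <= eta * x t by rewrite mulr_ge0// ltW.
    rewrite normrM (@ger0_norm _ (1 - _)); last by move: e1; clear; lra.
    have un : `|u t| <= 1 + P2.
      have := real_normK (num_real (u t)); have := normr_ge0 (u t).
      by move: (`|u t|) => v v0 ve; nra.
    apply: (@le_trans _ _ (`|u t| * 1)); first by rewrite ler_wpM2l//; move: e2; clear; lra.
    by rewrite mulr1; move: (normr_ge0 (u t)) un; clear; lra.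
  have dW t : 0 <= t -> isd W t (- (g.[x t] * (1 - eta * x t) + eta * (u t * (u t - F.[x t])))).
    move=> t0; have [_ _ /andP[h3 h4]] := cf t t0.
    have [hx hu] : lienard G F x u t by apply: true_; rewrite ger0_norm.
    by rewrite /W; der; ring.
  have cW : continuous W.
    move=> t; apply: (@continuousB _ _ _ u (fun t => eta * (x t * u t))); first exact: cu.
    apply: (@continuousM _ _ (fun=> eta) (fun t => x t * u t)); first exact: cst_continuous.
    by apply: (@continuousM _ _ x u); [exact: cx|exact: cu].
  have : W T + c * T <= W 0 + c * 0.
    apply: (@isd_nonincr R (fun t => W t + c * t) (fun t =>
      - (g.[x t] * (1 - eta * x t) + eta * (u t * (u t - F.[x t]))) + c) 0 T T0).
    - move=> t; apply: (@continuousD _ _ _ W (fun t => c * t)); first exact: cW.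
      by apply: (@continuousM _ _ (fun=> c) id); [exact: cst_continuous|exact: cvg_id].
    - move=> t /andP[t0 _]; apply: (isd_eq (isdD (dW t (ltW t0)) (isdM (isd_cst _ _) (isd_id _)))).
      by rewrite mul0r add0r mulr1.
    - move=> t /andP[t0 _]; have [h1 _ h3] := cf t (ltW t0).
      by have := hdrift _ (u t) h3 h1; clear; lra.
  have cT : c * T = 2 * (2 * (1 + P2)) + 1 by rewrite /T mulrCA mulfV ?mulr1// gt_eqF.
  have := bW T T0; have := bW 0 (lexx 0); rewrite !ler_norml => /andP[w1 w2] /andP[w3 w4].
  by rewrite mulr0 cT; move: w2 w3; clear; lra.
have [t1 t10 xt1] := exit.
(* If the start is on the u-axis, x vanishes at time 0; the search for the exit begins at a later
   time e where x is already positive. *)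
have [e [e0 et1 he]] : exists e, [/\ 0 <= e, e <= t1 & 0 < x e /\ forall t, 0 < t <= e -> 0 < x t].
  case: start => [x0p|[x0E u0p]].
    by exists 0; split => //; split; [rewrite ex|move=> t /andP[a /(lt_le_trans a)]; rewrite ltxx].
  have := dx 0; rewrite ex x0E c00 (rd_F0 rd) subr0 eu => d0.
  have [e e0 [he _]] := isd_gt0_near d0 u0p.
  have pos t : 0 < t < e -> 0 < x t.
    by move=> tI; have := he t; rewrite add0r ex x0E; apply.
  have eh : e / 2 < e by rewrite ltr_pdivrMr// ltr_pMr// ltr1n.
  exists (e / 2); split; first by rewrite divr_ge0 ?ltW.
    rewrite leNgt; apply/negP => te.
    have t1p : 0 < t1.
      rewrite lt_neqAle t10 andbT; apply/eqP => t1E.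
      by move: xt1; rewrite -t1E ex x0E ltxx.
    by have := pos t1; rewrite t1p /= (_ : t1 < e) => [/(_ isT)|]; [move: xt1|move: te e0]; clear; lra.
  split; first by apply: pos; rewrite divr_gt0.
  by move=> t /andP[a b]; apply: pos; rewrite a (le_lt_trans b).
have [xe he'] := he.
have [T [/andP[eT Tt1] xT pT]] := first_zero cx et1 xe (ltW xt1).
have T0 : 0 < T by exact: le_lt_trans eT.
have pos t : 0 < t < T -> 0 < x t.
  move=> /andP[a b]; case: (leP t e) => te; first by rewrite he' ?a.
  by apply: pT; rewrite (ltW te).
have pos' t : 0 <= t <= T -> 0 <= x t.
  move=> /andP[]; rewrite le_eqVlt => /predU1P[<-|a]; first by rewrite ex.
  rewrite le_eqVlt => /predU1P[->|b]; first by rewrite xT.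
  by apply/ltW/pos; rewrite a.
have lien t : 0 <= t <= T -> lienard G F x u t.
  move=> tI; have /andP[a b] := tI; apply: true_; rewrite ger0_norm ?pos'//.
  apply: (hB _ (u t)); first exact: pos'.
  have /andP[_ c2] : expR (- 2 * A) * Num.min (rho G x0 u0) r0 <= rho G (x t) (u t) <= expR (2 * A) * P.
    by apply: conf => // s /andP[s0 st]; apply: pos'; rewrite s0 (le_trans st).
  exact: le_trans c2 P1P.
exists T, x, u; split => //; split => //.
have [dxT _] := lien T (introT andP (conj (ltW T0) (lexx T))).
rewrite lt_neqAle; apply/andP; split.
  by have := not0 T (ltW T0); rewrite xT xpair_eqE eqxx.
move: dxT; rewrite xT (rd_F0 rd) subr0 => dxT.
apply: (isd_left_le0 T0 dxT) => s /andP[a b]; rewrite xT; apply: pos'.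
by rewrite a ltW.
Qed.

End Data.
End Exit.

(** * Half orbits from (0, a) to (0, b) and their graphs over u *)

Section Arcs.
Variable R : realType.
Implicit Types (G F : {poly R}) (x u xi : R -> R) (a b T : R).

Definition half_orbit G F a b T x u :=
  [/\ [/\ 0 < a, b < 0 & 0 < T], continuous x /\ continuous u,
      [/\ x 0 = 0, u 0 = a, x T = 0 & u T = b],
      forall t, 0 < t < T -> 0 < x t &
      forall t, 0 <= t <= T -> lienard G F x u t].

Lemma lienard_shift G F x u t c : lienard G F x u (t + c) ->
  lienard G F (fun s => x (s + c)) (fun s => u (s + c)) t.
Proof.
move=> [hx hu]; split.
  by apply: (isd_eq (@isd_comp R x (fun s => s + c) t _ _ hx (isdD (isd_id t) (isd_cst c t)))); rewrite addr0 mulr1.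
by apply: (isd_eq (@isd_comp R u (fun s => s + c) t _ _ hu (isdD (isd_id t) (isd_cst c t)))); rewrite addr0 mulr1.
Qed.

Lemma lienard_rev G F x u t c : lienard G F x u (c - t) ->
  lienard G (- F) (fun s => x (c - s)) (fun s => - u (c - s)) t.
Proof.
move=> [hx hu]; rewrite /lienard; have d1 := isdB (isd_cst c t) (isd_id t); split.
  by apply: (isd_eq (@isd_comp R x (fun s => c - s) t _ _ hx d1)); rewrite hornerN; ring.
by apply: (isd_eq (isdN (@isd_comp R u (fun s => c - s) t _ _ hu d1))); ring.
Qed.

Lemma arc_rev G F a b T x u : half_orbit G F a b T x u ->
  half_orbit G (- F) (- b) (- a) T (fun t => x (T - t)) (fun t => - u (T - t)).
Proof.
move=> [[a0 b0 T0] [cx cu] [x0 u0 xT uT] xp hl]; split.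
- by rewrite oppr_gt0 oppr_lt0.
- split; first exact: continuous_rev.
  by move=> t; apply: (@continuousN _ _ _ (fun t => u (T - t))); exact: continuous_rev.
- by rewrite !subr0 !subrr x0 u0 xT uT.
- by move=> t /andP[t0 tT]; apply: xp; lra.
- by move=> t /andP[t0 tT]; apply: lienard_rev; apply: hl; lra.
Qed.

Lemma arc_uniq_top G F a b b' T T' x u x' u' :
  half_orbit G F a b T x u -> half_orbit G F a b' T' x' u' ->
  [/\ b = b', T = T' & forall t, 0 <= t <= T -> x t = x' t /\ u t = u' t].
Proof.
wlog TT' : b b' T T' x u x' u' / T <= T' => [H|].
  case: (leP T T') => [TT'|/ltW TT'] h1 h2; first exact: (H _ _ _ _ _ _ _ _ TT').
  have [-> -> h] := H _ _ _ _ _ _ _ _ TT' h2 h1; split => // t /h [-> ->] //.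
move=> [[a0 b0 T0] [cx cu] [x0 u0 xT uT] xp hl] [[a0' b0' T0'] [cx' cu'] [x0' u0' xT' uT'] xp' hl'].
have h : forall t, 0 <= t <= T -> x t = x' t /\ u t = u' t.
  apply: (@lienard_uniq R G F 0 T 0) => //.
  - by move=> t /andP[t0 tT]; apply: hl; rewrite !ltW.
  - by move=> t /andP[t0 tT]; apply: hl'; rewrite (ltW t0) (le_trans (ltW tT)).
  - by rewrite lexx ltW.
  - by rewrite x0.
  - by rewrite u0.
have [eT euT] := h T (introT andP (conj (ltW T0) (lexx T))).
have TE : T = T'.
  apply/eqP; rewrite eq_le TT' /= leNgt; apply/negP => lt.
  by have := xp' T; rewrite T0 lt -eT xT ltxx => /(_ isT).
by split => //; rewrite -uT euT TE.
Qed.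

(** Uniqueness backwards from the common point puts the start of the arc with the smaller time on
    the other arc. There x = 0 with u > 0, which happens on an arc only at its own start. *)
Lemma arc_meet G F a b a' b' T T' x u x' u' t t' :
  half_orbit G F a b T x u -> half_orbit G F a' b' T' x' u' ->
  0 <= t <= T -> 0 <= t' <= T' -> x t = x' t' -> u t = u' t' -> a = a'.
Proof.
wlog tt' : a b a' b' T T' x u x' u' t t' / t <= t' => [H|].
  case: (leP t t') => [tt'|/ltW tt'] h1 h2 tI tI' ex eu.
    exact: (H _ _ _ _ _ _ _ _ _ _ _ _ tt' h1 h2).
  exact/esym/(H _ _ _ _ _ _ _ _ _ _ _ _ tt' h2 h1).
move=> [[a0 b0 T0] [cx cu] [x0 u0 xT uT] xp hl] [[a0' b0' T0'] [cx' cu'] [x0' u0' xT' uT'] xp' hl'].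
move=> /andP[t0 tT] /andP[t0' tT'] ex eu.
pose c := t' - t.
have cS (f : R -> R) : continuous f -> continuous (fun s => f (s + c)).
  move=> cf s; apply: (@continuous_comp _ _ _ (fun s => s + c) f); last exact: cf.
  by apply: continuousD; [exact: cvg_id|exact: cst_continuous].
have [] : x 0 = x' (0 + c) /\ u 0 = u' (0 + c).
  apply: (@lienard_uniq R G F 0 t t x u (fun s => x' (s + c)) (fun s => u' (s + c)) cx cu).
  - exact: cS.
  - exact: cS.
  - by move=> s /andP[s0 st]; apply: hl; rewrite (ltW s0) (le_trans (ltW st)).
  - by move=> s /andP[s0 st]; apply: lienard_shift; apply: hl'; rewrite /c; lra.
  - by rewrite t0 lexx.
  - by rewrite ex /c addrC subrK.
  - by rewrite eu /c addrC subrK.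
  - by rewrite lexx t0.
rewrite add0r x0 u0 => e1 e2.
have c0 : 0 <= c by rewrite subr_ge0.
have cT : c <= T' by rewrite /c; lra.
move: c0; rewrite le_eqVlt => /predU1P[c0|c0]; first by rewrite e2 -c0 u0'.
move: cT; rewrite le_eqVlt => /predU1P[cE|cT].
  by move: e2; rewrite cE uT' => e2; lra.
by have := xp' c; rewrite c0 cT -e1 ltxx => /(_ isT).
Qed.

Section Existence.
Variables (G F : {poly R}).
Hypothesis rd : right_data G F.

Lemma arc_top a : 0 < a -> exists b T x u, half_orbit G F a b T x u.
Proof.
move=> a0; have [|T [x [u [[T0 cx cu] [x0 u0] hl xp [xT uT]]]]] := right_exit rd (x0 := 0) (u0 := a).
  by right.
by exists (u T), T, x, u; split.
Qed.

(** The past of the point is the future of (x0, - u0) for - F, which [right_exit] brings to the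
    axis. The arc that starts there follows this past by uniqueness and so passes through the
    point. *)
Lemma arc_through (x0 u0 : R) : 0 < x0 -> exists a b T x u t,
  [/\ half_orbit G F a b T x u, 0 < t < T, x t = x0 & u t = u0].
Proof.
move=> x00.
have [|T1 [x1 [u1 [[T10 cx1 cu1] [x10 u10] hl1 xp1 [xT1 uT1]]]]] :=
  right_exit (right_data_opp rd) (x0 := x0) (u0 := - u0); first by left.
have a0 : 0 < - u1 T1 by rewrite oppr_gt0.
have [b [T [x [u har]]]] := arc_top a0.
have [[_ b0 T0] [cx cu] [x0' u0' xT uT] xp hl] := har.
pose X t := x1 (T1 - t); pose U t := - u1 (T1 - t).
have cX : continuous X by exact: continuous_rev.
have cU : continuous U.
  by move=> t; apply: (@continuousN _ _ _ (fun t => u1 (T1 - t))); exact: continuous_rev.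
have hX t : 0 <= t <= T1 -> lienard G F X U t.
  by move=> tI; rewrite -[F]opprK; apply: lienard_rev; apply: hl1; lra.
pose M := Num.min T T1.
have M0 : 0 < M by rewrite lt_min T0.
have MT : M <= T by rewrite ge_min lexx.
have MT1 : M <= T1 by rewrite ge_min lexx orbT.
have h : forall t, 0 <= t <= M -> x t = X t /\ u t = U t.
  apply: (@lienard_uniq R G F 0 M 0) => //.
  - by move=> t /andP[t0 tT]; apply: hl; rewrite (ltW t0) (le_trans (ltW tT)).
  - by move=> t /andP[t0 tT]; apply: hX; rewrite (ltW t0) (le_trans (ltW tT)).
  - by rewrite lexx ltW.
  - by rewrite x0' /X subr0.
  - by rewrite u0' /U subr0.
have Xp t : 0 < t <= T1 -> 0 < X t.
  move=> /andP[t0]; rewrite le_eqVlt => /predU1P[->|tT]; first by rewrite /X subrr x10.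
  by apply: xp1; lra.
have T1T : T1 < T.
  rewrite ltNge; apply/negP => TT1.
  have MT' : M = T by rewrite /M min_l.
  have [|e _] := h T; first by rewrite MT' lexx ltW.
  by have := Xp T; rewrite T0 TT1 -e xT ltxx => /(_ isT).
have ME : M = T1 by rewrite /M min_r// ltW.
have [e1 e2] := h T1 (introT andP (conj (ltW T10) (eq_ind_r (fun z => T1 <= z) (lexx T1) ME))).
exists (- u1 T1), b, T, x, u, T1; split => //; first by rewrite T10.
  by rewrite e1 /X subrr.
by rewrite e2 /U subrr u10 opprK.
Qed.

Lemma arc_u_decr a b T x u s t : half_orbit G F a b T x u ->
  0 <= s -> s < t -> t <= T -> u t < u s.
Proof.
move=> [_ [_ cu] _ xp hl] s0 st tT.
apply: (@isd_decr R u (fun r => - G^`().[x r])) => // r /andP[r1 r2].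
  by have [] := hl r (introT andP (conj (le_trans s0 (ltW r1)) (le_trans (ltW r2) tT))).
by rewrite oppr_lt0; apply/(rd_gp rd)/xp; rewrite (le_lt_trans s0 r1) (lt_le_trans r2 tT).
Qed.

(* A half orbit is the graph of a function of u, since u decreases along it. *)
Definition arc_graph a b xi :=
  [/\ b < 0 /\ 0 < a, continuous xi, forall v, v <= b \/ a <= v -> xi v = 0,
      forall v, b < v < a -> 0 < xi v &
      forall v, b < v < a -> isd (fun w => G.[xi w]) v (F.[xi v] - v)].

Lemma arc_graphP a b T x u : half_orbit G F a b T x u ->
  exists xi, [/\ arc_graph a b xi, forall t, 0 <= t <= T -> xi (u t) = x t &
    forall v, b <= v <= a -> exists2 t, 0 <= t <= T & u t = v].
Proof.
move=> har; have [[a0 b0 T0] [cx cu] [x0 u0 xT uT] xp hl] := har.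
have oc t : 0 < t < T -> 0 <= t <= T by move=> /andP[p q]; rewrite !ltW.
have du t : 0 < t < T -> isd u t (- G^`().[x t]) by move=> /oc/hl[].
have gp t : 0 < t < T -> 0 < G^`().[x t] by move=> /xp/(rd_gp rd).
have [t tI|tau [ct tK uK dt]] := decr_inverse T0 cu du; first by rewrite oppr_lt0 gp.
rewrite u0 uT in uK.
pose xi v := x (tau (Num.max b (Num.min v a))).
have ba : b <= a by lra.
have xiE v : b <= v <= a -> xi v = x (tau v) by move=> vI; rewrite /xi clamp_in.
have TI : 0 <= T <= T by rewrite lexx ltW.
have OI : (0 : R) <= 0 <= T by rewrite lexx ltW.
have tauI v : b < v < a -> 0 < tau v < T.
  move=> /andP[bv va]; have [/andP[t1 t2] uv] := uK v (introT andP (conj (ltW bv) (ltW va))).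
  rewrite !lt_neqAle t1 t2 !andbT; apply/andP; split; apply/eqP => e.
    by move: va; rewrite -uv -e u0 ltxx.
  by move: bv; rewrite -uv e uT ltxx.
have uI t : 0 <= t <= T -> b <= u t <= a.
  move=> /andP[]; rewrite le_eqVlt => /predU1P[<-|t0]; first by rewrite u0 lexx ba.
  rewrite le_eqVlt => /predU1P[->|tT]; first by rewrite uT lexx ba.
  by rewrite -uT -u0 !ltW// (arc_u_decr har)// ltW.
exists xi; split.
- split => //.
  + move=> v; apply: (@continuous_comp _ _ _ (fun v => tau (Num.max b (Num.min v a))) x); last exact: cx.
    apply: (@continuous_comp _ _ _ (fun v => Num.max b (Num.min v a)) tau); last exact: ct.
    exact: continuous_clamp.
  + move=> v [vb|av]; rewrite /xi.
      rewrite (min_l (le_trans vb ba)) (max_l vb) -uT tK//.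
    by rewrite (min_r av) (max_r ba) -u0 tK.
  + by move=> v /[dup] vI /andP[/ltW bv /ltW va]; rewrite xiE ?bv//; exact/xp/tauI.
  + move=> v /[dup] vI /andP[/ltW bv /ltW va].
    have tI := tauI v vI; have [_ uv] := uK v (introT andP (conj bv va)).
    have [dx _] := hl _ (oc _ tI).
    have := dt _ tI; rewrite uv => dtau.
    have d1 := isd_horner G (isd_comp dx dtau).
    apply: (@isd_ext R (fun w => G.[x (tau w)])).
      apply: (near_oo vI) => w /andP[w1 w2].
      by rewrite xiE// !ltW.
    apply: (isd_eq d1); rewrite uv xiE ?bv//.
    by field; rewrite gt_eqF// gp.
- by move=> t tI; rewrite xiE ?uI// tK.
- by move=> v vI; have [tI uv] := uK v vI; exists (tau v).
Qed.

Lemma rd_inv (z : R) : 0 < z -> exists2 x : R, 0 < x & G.[x] = z.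
Proof.
move=> z0; case: (rd) => _ _ _ Gy _; have [X hX] := Gy z.
have X1 : 0 <= Num.max X 1 by rewrite le_max ler01 orbT.
have [|c /andP[c0 cX] Gc] := @IVT_eq R (horner G) 0 (Num.max X 1) z (@continuous_horner R G) X1.
  by left; rewrite (rd_G0 rd) (ltW z0) hX// le_max lexx.
exists c => //; rewrite lt_neqAle c0 andbT; apply/eqP => e.
by move: Gc z0; rewrite -e (rd_G0 rd) => ->; rewrite ltxx.
Qed.

Lemma rd_le (x y : R) : 0 <= x -> 0 <= y -> (G.[x] <= G.[y]) = (x <= y).
Proof.
move=> x0 y0; case: (leP x y) => [|yx].
  by rewrite le_eqVlt => /predU1P[->|/(rd_incr rd x0)/ltW//]; rewrite lexx.
by apply/negbTE; rewrite -ltNge; exact: (rd_incr rd).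
Qed.

Lemma rd_inj (x y : R) : 0 <= x -> 0 <= y -> G.[x] = G.[y] -> x = y.
Proof.
by move=> x0 y0 e; apply/eqP; rewrite eq_le -(rd_le x0 y0) -(rd_le y0 x0) e lexx.
Qed.

(** F as a function of G has slope f / g, bounded where G >= e because g has a positive minimum
    there. The bound e is essential to the method: at G = 0 the force vanishes and F need not be a
    Lipschitz function of G. *)
Lemma rd_lip (e Z : R) : 0 < e -> exists2 L : R, 0 <= L & forall x y : R, 0 < x -> 0 < y ->
  e <= G.[x] <= Z -> e <= G.[y] <= Z -> `|F.[x] - F.[y]| <= L * `|G.[x] - G.[y]|.
Proof.
move=> e0; have [xe xe0 Ge] := rd_inv e0.
have Z0 : 0 < Num.max e Z by rewrite lt_max e0.
have [xz xz0 Gz] := rd_inv Z0.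
have xez : xe <= xz by rewrite -rd_le ?(ltW xe0) ?(ltW xz0)// Ge Gz le_max lexx.
have [c cI gmin] := EVT_min xez (cont_within (@continuous_horner R G^`())).
have g0 : 0 < G^`().[c].
  by apply: (rd_gp rd); move: cI; rewrite in_itv /= => /andP[h _]; exact: lt_le_trans h.
have [L [L0 hL]] := poly_lipschitz F xz.
exists (L / G^`().[c]); first by rewrite divr_ge0// ltW.
move=> x y x0 y0 /andP[ex xZ] /andP[ey yZ].
wlog xy : x y x0 y0 ex xZ ey yZ / x <= y => [H|].
  case: (leP x y) => [xy|/ltW xy]; first exact: H.
  by rewrite distrC [`|G.[x] - _|]distrC; exact: H.
have xI : xe <= x by rewrite -rd_le ?(ltW xe0) ?(ltW x0)// Ge.
have yI : y <= xz by rewrite -rd_le ?(ltW xz0) ?(ltW y0)// Gz le_max yZ orbT.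
have h1 : `|F.[x] - F.[y]| <= L * (y - x).
  have := hL x y; rewrite (gtr0_norm x0) (gtr0_norm y0) (le_trans xy yI) yI => /(_ isT isT).
  by rewrite [`|x - y|]distrC (ger0_norm (_ : 0 <= y - x)) ?subr_ge0.
apply: le_trans h1 _; rewrite -mulrA ler_wpM2l// mulrC ler_pdivlMr//.
rewrite distrC; apply: le_trans _ (ler_norm _).
have : G.[x] - G^`().[c] * x <= G.[y] - G^`().[c] * y.
  apply: (@isd_nondecr R (fun t => G.[t] - G^`().[c] * t) (fun t => G^`().[t] - G^`().[c])) => //.
  - move=> t; apply: (@continuousB _ _ _ (horner G) (fun t => G^`().[c] * t)); first exact: continuous_horner.
    by apply: (@continuousM _ _ (fun=> G^`().[c]) id); [exact: cst_continuous|exact: cvg_id].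
  - move=> t _; apply: (isd_eq (isdB (isd_horner G (isd_id t)) (isdM (isd_cst _ _) (isd_id _)))).
    by ring.
  - move=> t /andP[xt ty]; rewrite subr_ge0; apply: gmin.
    by rewrite in_itv /= (le_trans xI (ltW xt)) (le_trans (ltW ty) yI).
by lra.
Qed.

End Existence.

(** * Comparison of the equations dG/du = F - u of two systems *)

Section Compare.
Variables (G1 F1 G2 F2 : {poly R}).
Hypotheses (rd1 : right_data G1 F1) (rd2 : right_data G2 F2).
Variables (a1 b1 a2 b2 : R) (xi1 xi2 : R -> R).
Hypotheses (gr1 : arc_graph G1 F1 a1 b1 xi1) (gr2 : arc_graph G2 F2 a2 b2 xi2).
Hypothesis F12 : forall v x : R, b2 < v < a2 -> 0 < x -> G1.[x] = G2.[xi2 v] -> F1.[x] <= F2.[xi2 v].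

Let z1 v := G1.[xi1 v].
Let z2 v := G2.[xi2 v].
Let D v := z2 v - z1 v.

Let cz1 : continuous z1. Proof. by case: gr1 => _ c _ _ _; exact: cont_horner_comp. Qed.
Let cz2 : continuous z2. Proof. by case: gr2 => _ c _ _ _; exact: cont_horner_comp. Qed.
Let cD : continuous D. Proof. by move=> v; apply: continuousB; [exact: cz2|exact: cz1]. Qed.

Let z1p v : b1 < v < a1 -> 0 < z1 v.
Proof. by case: gr1 => _ _ _ p _ /p /(rd_Gpos rd1). Qed.
Let z2p v : b2 < v < a2 -> 0 < z2 v.
Proof. by case: gr2 => _ _ _ p _ /p /(rd_Gpos rd2). Qed.

(** Let x have the G1-value of the second graph at v. Then D' = F2 (xi2) - F1 (xi1) >= F1 x - F1
    (xi1) by [F12], and the last difference is at least - L |D| by [rd_lip]. The interval [p, q]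
    stays inside both ranges, where G is bounded below. *)
Let dD p q : b1 < p -> b2 < p -> p <= q -> q < a1 -> q < a2 ->
  exists2 L : R, 0 <= L & exists dD : R -> R, forall v, p <= v <= q ->
    isd D v (dD v) /\ - L * `|D v| <= dD v.
Proof.
move=> p1 p2 pq q1 q2.
have I1 v : p <= v <= q -> b1 < v < a1.
  by move=> /andP[h1 h2]; rewrite (lt_le_trans p1 h1) (le_lt_trans h2 q1).
have I2 v : p <= v <= q -> b2 < v < a2.
  by move=> /andP[h1 h2]; rewrite (lt_le_trans p2 h1) (le_lt_trans h2 q2).
have [c1 c1I m1] := EVT_min pq (cont_within cz1).
have [c2 c2I m2] := EVT_min pq (cont_within cz2).
have [d1 _ M1] := EVT_max pq (cont_within cz1).
have [d2 _ M2] := EVT_max pq (cont_within cz2).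
rewrite in_itv /= in c1I; rewrite in_itv /= in c2I.
have e0 : 0 < Num.min (z1 c1) (z2 c2) by rewrite lt_min z1p ?z2p// ?I1 ?I2.
have [L L0 hL] := rd_lip rd1 (Num.max (z1 d1) (z2 d2)) e0.
exists L => //; exists (fun v => F2.[xi2 v] - F1.[xi1 v]) => v vI.
have [_ _ _ xp1 h1] := gr1; have [_ _ _ xp2 h2] := gr2.
split; first by apply: (isd_eq (isdB (h2 v (I2 v vI)) (h1 v (I1 v vI)))); ring.
have [x x0 Gx] := rd_inv rd1 (z2p (I2 v vI)).
have vI' : v \in `[p, q]%R by rewrite in_itv.
have := hL x (xi1 v) x0 (xp1 v (I1 v vI)).
have -> : Num.min (z1 c1) (z2 c2) <= G1.[x] <= Num.max (z1 d1) (z2 d2).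
  by rewrite Gx ge_min m2// orbT le_max M2// orbT.
have -> : Num.min (z1 c1) (z2 c2) <= G1.[xi1 v] <= Num.max (z1 d1) (z2 d2).
  by rewrite ge_min m1//= le_max M1.
move=> /(_ isT isT); rewrite Gx -/(D v) ler_norml mulNr => /andP[h _].
by have := F12 (I2 v vI) x0 Gx; lra.
Qed.

Let cexp (c : R) : continuous (fun t => expR (c * t) * D t).
Proof.
move=> t; apply: (@continuousM _ _ (fun t => expR (c * t)) D); last exact: cD.
apply: (@isd_cont R _ _ (expR (c * t) * c)).
by apply: (isd_eq (isd_expR (isdM (isd_cst c t) (isd_id t)))); rewrite mul0r add0r mulr1.
Qed.

Let dexp (c t d : R) : isd D t d -> isd (fun t => expR (c * t) * D t) t (expR (c * t) * (c * D t + d)).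
Proof.
move=> h.
by apply: (isd_eq (isdM (isd_expR (isdM (isd_cst c t) (isd_id t))) h)); ring.
Qed.

(** D' >= - L |D| allows D to leave zero only upwards as v grows: D cannot be negative after v0 or
    positive before it. At [a2] < [a1] it would be negative, and at [b1] > [b2] positive. *)
Lemma arc_compare v0 : b1 < v0 < a1 -> b2 < v0 < a2 -> G1.[xi1 v0] = G2.[xi2 v0] ->
  a1 <= a2 /\ b1 <= b2.
Proof.
move=> /andP[bv1 va1] /andP[bv2 va2] e0.
have D0 : D v0 = 0 by rewrite /D /z1 /z2 e0 subrr.
have zz2 v : v <= b2 \/ a2 <= v -> z2 v = 0.
  by case: gr2 => _ _ h _ _ /h; rewrite /z2 => ->; exact: (rd_G0 rd2).
have zz1 v : v <= b1 \/ a1 <= v -> z1 v = 0.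
  by case: gr1 => _ _ h _ _ /h; rewrite /z1 => ->; exact: (rd_G0 rd1).
split; rewrite leNgt; apply/negP => lt.
  have Da : D a2 < 0.
    by rewrite /D zz2; [|right; exact: lexx]; rewrite sub0r oppr_lt0 z1p// (lt_trans bv1 va2).
  have [|||s [/andP[vs sa] Ds hs]] := @last_zero R (fun v => - D v) v0 a2 _ (ltW va2).
  - by move=> v; apply: continuousN; exact: cD.
  - by rewrite D0 oppr0.
  - by rewrite oppr_gt0.
  (* The Gronwall argument stops half way to [a2], since G vanishes at [a2] and no Lipschitz
     constant is available up to that point. *)
  pose w := (s + a2) / 2.
  have sw : s < w by rewrite /w; lra.
  have wa : w < a2 by rewrite /w; lra.
  have Dneg v : s < v <= w -> D v < 0.
    by move=> /andP[h1 h2]; rewrite -oppr_gt0; apply: hs; rewrite h1 (le_trans h2 (ltW wa)).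
  have [L L0 [dD' hD]] := dD (lt_le_trans bv1 vs) (lt_le_trans bv2 vs) (ltW sw) (lt_trans wa lt) wa.
  have : expR (- L * s) * D s <= expR (- L * w) * D w.
    apply: (isd_nondecr (ltW sw) (@cexp (- L)) (df := fun v => expR (- L * v) * (- L * D v + dD' v))).
      by move=> v /andP[h1 h2]; apply: dexp; apply: (proj1 (hD v _)); rewrite !ltW.
    move=> v /andP[h1 h2]; rewrite mulr_ge0 ?expR_ge0//.
    have [_] := hD v (introT andP (conj (ltW h1) (ltW h2))).
    by rewrite ltr0_norm ?Dneg ?h1 ?(ltW h2)//; lra.
  have -> : D s = 0 by lra.
  by rewrite mulr0 pmulr_rge0 ?expR_gt0// leNgt Dneg// sw lexx.
have Db : 0 < D b1.
  by rewrite /D zz1; [|left; exact: lexx]; rewrite subr0 z2p// lt (lt_trans bv1 va2).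
have [|s [/andP[bs sv] Ds hs]] := @first_zero R D b1 v0 cD (ltW bv1) Db; first by rewrite D0.
pose w := (b1 + s) / 2.
have bw : b1 < w by rewrite /w; lra.
have ws : w < s by rewrite /w; lra.
have Dpos v : w <= v < s -> 0 < D v.
  by move=> /andP[h1 h2]; apply: hs; rewrite h2 (le_trans (ltW bw) h1).
have [L L0 [dD' hD]] := dD bw (lt_trans lt bw) (ltW ws) (le_lt_trans sv va1) (le_lt_trans sv va2).
have : expR (L * w) * D w <= expR (L * s) * D s.
  apply: (isd_nondecr (ltW ws) (@cexp L) (df := fun v => expR (L * v) * (L * D v + dD' v))).
    by move=> v /andP[h1 h2]; apply: dexp; apply: (proj1 (hD v _)); rewrite !ltW.
  move=> v /andP[h1 h2]; rewrite mulr_ge0 ?expR_ge0//.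
  have [_] := hD v (introT andP (conj (ltW h1) (ltW h2))).
  by rewrite gtr0_norm ?Dpos ?h2 ?(ltW h1)//; lra.
by rewrite Ds mulr0 pmulr_rle0 ?expR_gt0// leNgt Dpos// lexx ws.
Qed.

End Compare.

(** * Half orbits are nested, and their bottoms decrease with their tops *)

Section Nested.
Variables (G F : {poly R}).
Hypothesis rd : right_data G F.

(** At v = a the inner graph vanishes and the outer one is positive. A later equality would be a
    common point of the two arcs and would force a = a' by [arc_meet], so the order persists. *)
Lemma arc_nested a b T x u xi a' b' T' x' u' xi' :
  half_orbit G F a b T x u -> half_orbit G F a' b' T' x' u' ->
  arc_graph G F a b xi -> arc_graph G F a' b' xi' ->
  (forall t, 0 <= t <= T -> xi (u t) = x t) ->
  (forall t, 0 <= t <= T' -> xi' (u' t) = x' t) ->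
  (forall v, b <= v <= a -> exists2 t, 0 <= t <= T & u t = v) ->
  (forall v, b' <= v <= a' -> exists2 t, 0 <= t <= T' & u' t = v) ->
  a < a' -> b' < b /\ forall v, b <= v <= a -> xi v < xi' v.
Proof.
move=> h h' g g' k k' s s' aa'.
have [[a0 b0 T0] _ _ _ _] := h; have [[a0' b0' T0'] _ _ _ _] := h'.
have [_ cxi xi0 xip _] := g; have [_ cxi' xi0' xip' _] := g'.
have neq v : b <= v <= a -> b' <= v <= a' -> xi v <> xi' v.
  move=> /s[t tI uv] /s'[t' tI' uv'] e; suff e' : a = a' by move: aa'; rewrite e' ltxx.
  by apply: (arc_meet h h' tI tI'); rewrite ?uv ?uv'// -k// -k'// uv uv'.
have lt v : b <= v <= a -> b' <= v -> xi v < xi' v.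
  move=> /andP[bv va] bv'; rewrite ltNge; apply/negP => le.
  have xa : xi a < xi' a.
    rewrite xi0; last by right; exact: lexx.
    by apply: xip'; rewrite aa' andbT; lra.
  have [||c /andP[c1 c2] ec] := @IVT_eq R (fun v => xi v - xi' v) v a 0 _ va.
  - by move=> w; apply: (@continuousB _ _ _ xi xi'); [exact: cxi|exact: cxi'].
  - by right; rewrite subr_ge0 subr_le0 le ltW.
  apply: (neq c); last by apply/eqP; rewrite -subr_eq0 ec.
    by rewrite (le_trans bv c1).
  by rewrite (le_trans bv' c1) (le_trans c2 (ltW aa')).
have bb : b' < b.
  rewrite ltNge; apply/negP => bb'.
  have := lt b'; rewrite bb' lexx xi0' => [|]; last by left; exact: lexx.
  rewrite (_ : b' <= a); last by lra.
  move=> /(_ isT isT); rewrite ltNge => /negP; apply.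
  move: bb'; rewrite le_eqVlt => /predU1P[<-|bb'].
    by rewrite xi0//; left; exact: lexx.
  by apply/ltW/xip; rewrite bb'; lra.
split=> // v /[dup] vI /andP[bv _]; apply: lt => //; exact: ltW (lt_le_trans bb bv).
Qed.

Lemma arc_bot_decr a b T x u a' b' T' x' u' :
  half_orbit G F a b T x u -> half_orbit G F a' b' T' x' u' -> (a < a') = (b' < b).
Proof.
move=> h h'.
have key a0 b0 T0 x0 u0 a1 b1 T1 x1 u1 : half_orbit G F a0 b0 T0 x0 u0 ->
    half_orbit G F a1 b1 T1 x1 u1 -> a0 < a1 -> b1 < b0.
  move=> h0 h1; have [xi [g k s]] := arc_graphP rd h0.
  have [xi' [g' k' s']] := arc_graphP rd h1.
  by move=> lt; have [] := arc_nested h0 h1 g g' k k' s s' lt.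
case: (ltgtP a a') => [aa'|aa'|aa'].
- by rewrite (key _ _ _ _ _ _ _ _ _ _ h h').
- by apply/esym/negbTE; rewrite -leNgt ltW// (key _ _ _ _ _ _ _ _ _ _ h' h).
- by rewrite aa' in h; have [-> _ _] := arc_uniq_top h h'; rewrite ltxx.
Qed.

End Nested.

(** The comparison cannot begin at the common top, where G = 0 and the equation need not be
    Lipschitz. It begins at height 0 instead, with the arc of the first system that has there the
    same G as the second arc; comparing in both directions identifies both ends, and uniqueness from
    the top identifies this arc with the given one. *)
Lemma arcs_match G1 F1 G2 F2 a b b' T x u T' x' u' :
  right_data G1 F1 -> right_data G2 F2 ->
  (forall x1 x2 : R, 0 < x1 -> 0 < x2 -> G1.[x1] = G2.[x2] -> F1.[x1] = F2.[x2]) ->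
  half_orbit G1 F1 a b T x u -> half_orbit G2 F2 a b' T' x' u' -> b = b'.
Proof.
move=> rd1 rd2 H h1 h2.
have [xi2 [g2 k2 s2]] := arc_graphP rd2 h2.
have [[b0 a0] _ _ xp2 _] := g2.
have z0 : 0 < G2.[xi2 0] by apply: (rd_Gpos rd2); apply: xp2; rewrite b0.
have [x1 x10 Gx1] := rd_inv rd1 z0.
have [a1 [b1 [T1 [y1 [u1 [t1 [h3 tI ey eu]]]]]]] := arc_through rd1 0 x10.
have [xi1 [g1 k1 s1]] := arc_graphP rd1 h3.
have [[b10 a10] _ _ xp1 _] := g1.
have xi10 : xi1 0 = x1.
  by rewrite -eu k1 ?ey//; move: tI => /andP[p q]; rewrite !ltW.
have [||||aa bb] := arc_compare rd1 rd2 g1 g2 _ (v0 := 0).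
- by move=> v y vI y0 e; rewrite (H _ _ y0 _ e)//; exact: xp2.
- by rewrite b10.
- by rewrite b0.
- by rewrite xi10.
have [||||aa' bb'] := arc_compare rd2 rd1 g2 g1 _ (v0 := 0).
- by move=> v y vI y0 e; rewrite -(H _ _ _ y0 (esym e))//; exact: xp1.
- by rewrite b0.
- by rewrite b10.
- by rewrite xi10.
have ea : a1 = a by apply/eqP; rewrite eq_le aa.
have eb : b1 = b' by apply/eqP; rewrite eq_le bb.
by rewrite ea in h3; have [-> _ _] := arc_uniq_top h1 h3.
Qed.

End Arcs.

(** * Closed orbits and their heights *)

Section Periodic.
Variable R : realType.
Implicit Types (G F : {poly R}) (x u xi : R -> R) (a b T t : R).

Lemma mod_period T t : 0 < T -> exists t0 (k : int), 0 <= t0 < T /\ t = t0 + k%:~R * T.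
Proof.
move=> T0; exists (t - (Num.floor (t / T))%:~R * T), (Num.floor (t / T)).
split; last by rewrite subrK.
have /andP[h1 h2] := floor_itv (t / T).
rewrite subr_ge0 -ler_pdivlMr// h1 /= ltrBlDl -[X in _ < _ + X]mul1r -mulrDl -ltr_pdivrMr//.
by rewrite intrD in h2.
Qed.

Lemma periodic_int (X : Type) (f : R -> X) T : (forall t, f (t + T) = f t) ->
  forall (k : int) t, f (t + k%:~R * T) = f t.
Proof.
move=> h; have hn (n : nat) t : f (t + n%:R * T) = f t.
  elim: n t => [|n IH] t; first by rewrite mul0r addr0.
  by rewrite -addn1 natrD mulrDl mul1r addrA h IH.
case=> n t; first by rewrite -pmulrn hn.
by rewrite NegzE mulrNz mulNr -(hn n.+1 (t - _)) -pmulrn subrK.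
Qed.

Lemma cont_shift x c : continuous x -> continuous (fun s => x (s + c)).
Proof.
move=> cx s; apply: (@continuous_comp _ _ _ (fun s => s + c) x); last exact: cx.
by apply: continuousD; [exact: cvg_id|exact: cst_continuous].
Qed.

Lemma lienard_cont G F x u : (forall t, lienard G F x u t) -> continuous x /\ continuous u.
Proof. by move=> h; split => t; have [h1 h2] := h t; [exact: (isd_cont h1)|exact: (isd_cont h2)]. Qed.

Lemma lienard_global_uniq G F x u x' u' : (forall t, lienard G F x u t) ->
  (forall t, lienard G F x' u' t) -> x 0 = x' 0 -> u 0 = u' 0 ->
  forall t, x t = x' t /\ u t = u' t.
Proof.
move=> h h' ex eu t; have [cx cu] := lienard_cont h; have [cx' cu'] := lienard_cont h'.
apply: (@lienard_uniq R G F (Num.min 0 t) (Num.max 0 t) 0) => //.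
- by rewrite ge_min le_max lexx.
- by rewrite ge_min le_max lexx !orbT.
Qed.

Definition refl (p : {poly R}) := p \Po (- 'X).

Lemma refl_horner p t : (refl p).[t] = p.[- t].
Proof. by rewrite /refl horner_comp !hornerE. Qed.

Lemma refl_deriv p t : (refl p)^`().[t] = - p^`().[- t].
Proof. by rewrite /refl deriv_comp hornerM horner_comp derivN derivX !hornerE mulrN mulr1. Qed.

Lemma refl_refl p : refl (refl p) = p.
Proof. by rewrite /refl -comp_polyA raddfN /= comp_polyX opprK comp_polyXr. Qed.

(** The reflection x -> - x combined with time reversal keeps u. Thus left arcs become right arcs of
    the reflected system and also run from a top to a bottom. *)
Lemma lienard_refl G F x u t c : lienard G F x u (c - t) ->
  lienard (refl G) (refl F) (fun s => - x (c - s)) (fun s => u (c - s)) t.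
Proof.
move=> [hx hu]; have d1 := isdB (isd_cst c t) (isd_id t); split.
  apply: (isd_eq (isdN (@isd_comp R x (fun s => c - s) t _ _ hx d1))).
  by rewrite refl_horner opprK; ring.
apply: (isd_eq (@isd_comp R u (fun s => c - s) t _ _ hu d1)).
by rewrite refl_deriv !opprK; ring.
Qed.

Definition loop G F a b T1 T x u :=
  [/\ [/\ 0 < a, b < 0, 0 < T1 & T1 < T], forall t, lienard G F x u t,
      forall t, x (t + T) = x t /\ u (t + T) = u t,
      [/\ x 0 = 0, u 0 = a, x T1 = 0 & u T1 = b] &
      (forall t, 0 < t < T1 -> 0 < x t) /\ (forall t, T1 < t < T -> x t < 0)].

(** Instead of gluing two curves and checking differentiability at the joints, one global solution
    of the clamped system is taken from (0, a). By uniqueness it follows the right arc, then the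
    reversed left arc, and then repeats; so |x| <= B at all times and the clamp is inactive. *)
Lemma arcs_loop G F a b T1 x1 u1 T2 x2 u2 :
  half_orbit G F a b T1 x1 u1 -> half_orbit (refl G) (refl F) a b T2 x2 u2 ->
  exists x u, loop G F a b T1 (T1 + T2) x u.
Proof.
move=> [[a0 b0 T10] [cx1 cu1] [x10 u10 xT1 uT1] xp1 hl1].
move=> [[_ _ T20] [cx2 cu2] [x20 u20 xT2 uT2] xp2 hl2].
pose T := T1 + T2.
have [B1 B10 hB1] := bounded_on cx1 (ltW T10).
have [B2 B20 hB2] := bounded_on cx2 (ltW T20).
pose B := B1 + B2.
have B0 : 0 <= B by exact: addr_ge0.
have [LF [LF0 hLF]] := poly_clamp_lip F B0.
have [Lg [Lg0 hLg]] := poly_clamp_lip G^`() B0.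
have L0 : 0 <= LF + Lg by exact: addr_ge0.
have hLF' p q : `|F.[clamp B p] - F.[clamp B q]| <= (LF + Lg) * `|p - q|.
  by apply: le_trans (hLF p q) _; rewrite ler_wpM2r// lerDl.
have hLg' p q : `|G^`().[clamp B p] - G^`().[clamp B q]| <= (LF + Lg) * `|p - q|.
  by apply: le_trans (hLg p q) _; rewrite ler_wpM2r// lerDr.
pose tr y v t := isd y t (v t - F.[clamp B (y t)]) /\ isd v t (- G^`().[clamp B (y t)]).
have tr_uniq p q s y v y' v' : continuous y -> continuous v -> continuous y' -> continuous v' ->
    (forall t, p < t < q -> tr y v t) -> (forall t, p < t < q -> tr y' v' t) ->
    p <= s <= q -> y s = y' s -> v s = v' s -> forall t, p <= t <= q -> y t = y' t /\ v t = v' t.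
  move=> cy cv cy' cv' h h' sI ey ev.
  have pq : p <= q by move: sI => /andP[]; exact: le_trans.
  have [M M0 hM] := bounded_on cy pq; have [M' M0' hM'] := bounded_on cy' pq.
  apply: (@gronwall_pair R (fun y => F.[clamp B y]) (fun y => G^`().[clamp B y]) (LF + Lg) (M + M') p q s) => //.
  move=> t /andP[/ltW t1 /ltW t2].
  by split; [apply: le_trans (hM t _) _|apply: le_trans (hM' t _) _]; rewrite ?t1 ?t2// ?lerDl ?lerDr.
have [x [u [ex eu dx du]]] := picard_global L0 hLF' hLg' 0 a.
have htr t : tr x u t by split; [exact: dx|exact: du].
have cx : continuous x by move=> t; exact: (isd_cont (dx t)).
have cu : continuous u by move=> t; exact: (isd_cont (du t)).
have E1 t : 0 <= t <= T1 -> x t = x1 t /\ u t = u1 t.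
  apply: (tr_uniq 0 T1 0) => //.
  - move=> s /andP[/ltW s0 /ltW s1]; rewrite /tr clampE.
      by apply: hl1; rewrite s0.
    by apply: le_trans (hB1 _ _) _; rewrite ?s0 ?s1// lerDl.
  - by rewrite lexx ltW.
  - by rewrite ex.
  - by rewrite eu.
pose y t := - x2 (T - t); pose v t := u2 (T - t).
have cy : continuous y.
  by move=> t; apply: (@continuousN _ _ _ (fun t => x2 (T - t))); exact: continuous_rev.
have cv : continuous v by exact: continuous_rev.
have [e1 e2] := E1 T1 (introT andP (conj (ltW T10) (lexx T1))).
have TT : T1 <= T by rewrite lerDl ltW.
have E2 t : T1 <= t <= T -> x t = y t /\ u t = v t.
  apply: (tr_uniq T1 T T1) => //.
  - move=> s /andP[/ltW s0 /ltW s1]; rewrite /tr clampE.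
      rewrite -[F]refl_refl -[G]refl_refl; apply: lienard_refl; apply: hl2.
      by move: s0 s1; rewrite /T; clear; lra.
    rewrite /y normrN; apply: le_trans (hB2 _ _) _; last by rewrite lerDr.
    by move: s0 s1; rewrite /T; clear; lra.
  - by rewrite lexx.
  - by rewrite e1 xT1 /y /T addrAC subrr add0r xT2 oppr0.
  - by rewrite e2 uT1 /v /T addrAC subrr add0r uT2.
have [e3 e4] := E2 T (introT andP (conj TT (lexx T))).
have per t : x t = x (t + T) /\ u t = u (t + T).
  apply: (tr_uniq (Num.min 0 t) (Num.max 0 t) 0 x u (fun s => x (s + T)) (fun s => u (s + T))) => //.
  - exact: cont_shift.
  - exact: cont_shift.
  - move=> s _; have [d1 d2] := htr (s + T); have d0 := isdD (isd_id s) (isd_cst T s).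
    split.
      by apply: (isd_eq (@isd_comp R x (fun s => s + T) s _ _ d1 d0)); rewrite addr0 mulr1.
    by apply: (isd_eq (@isd_comp R u (fun s => s + T) s _ _ d2 d0)); rewrite addr0 mulr1.
  - by rewrite ge_min le_max lexx.
  - by rewrite add0r ex e3 /y subrr x20 oppr0.
  - by rewrite add0r eu e4 /v subrr u20.
  - by rewrite ge_min le_max lexx !orbT.
have T0 : 0 < T by exact: addr_gt0.
have xB t : `|x t| <= B.
  have [t0 [k [/andP[t00 t0T] ->]]] := mod_period t T0.
  rewrite (@periodic_int R x T); last by move=> s; have [->] := per s.
  case: (leP t0 T1) => tt.
    have [-> _] := E1 t0 (introT andP (conj t00 tt)).
    by apply: le_trans (hB1 _ _) _; rewrite ?t00 ?tt// lerDl.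
  have [-> _] := E2 t0 (introT andP (conj (ltW tt) (ltW t0T))).
  rewrite /y normrN; apply: le_trans (hB2 _ _) _; last by rewrite lerDr.
  by move: tt t0T; rewrite /T; clear; lra.
exists x, u; split => //.
- by split => //; rewrite ltrDl.
- by move=> t; have := htr t; rewrite /tr clampE.
- by move=> t; have [<- <-] := per t.
- by rewrite e1 e2.
- split=> t /andP[t1 t2].
    by have [-> _] := E1 t (introT andP (conj (ltW t1) (ltW t2))); apply: xp1; rewrite t1.
  have [-> _] := E2 t (introT andP (conj (ltW t1) (ltW t2))).
  by rewrite /y oppr_lt0; apply: xp2; move: t1 t2; rewrite /T; clear; lra.
Qed.

Lemma loop_right G F a b T1 T x u : loop G F a b T1 T x u -> half_orbit G F a b T1 x u.
Proof.
move=> [[a0 b0 T10 T1T] hl per [x0 u0 xT uT] [xp xn]].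
by have [cx cu] := lienard_cont hl; split.
Qed.

Lemma loop_left G F a b T1 T x u : loop G F a b T1 T x u ->
  half_orbit (refl G) (refl F) a b (T - T1) (fun t => - x (T - t)) (fun t => u (T - t)).
Proof.
move=> [[a0 b0 T10 T1T] hl per [x0 u0 xT uT] [xp xn]].
have [cx cu] := lienard_cont hl; have [p1 p2] := per 0; rewrite add0r in p1 p2.
split.
- by rewrite subr_gt0.
- split; last exact: continuous_rev.
  by move=> t; apply: (@continuousN _ _ _ (fun t => x (T - t))); exact: continuous_rev.
- by rewrite !subr0 p1 p2 !opprB addrC subrK x0 u0 xT uT oppr0.
- by move=> t /andP[t0 tT]; rewrite oppr_gt0; apply: xn; lra.
- by move=> t _; exact: lienard_refl.
Qed.

(** The case [u t = 0] is included so that the lemma also shows that a loop avoids the origin: it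
    would give a = 0. *)
Lemma loop_axis G F a b T1 T x u t : loop G F a b T1 T x u -> x t = 0 -> 0 < u t \/ u t = 0 ->
  u t = a /\ exists k : int, t = k%:~R * T.
Proof.
move=> [[a0 b0 T10 T1T] hl per [x0 u0 xT uT] [xp xn]].
have T0 : 0 < T by exact: lt_trans T1T.
have [t0 [k [/andP[t00 t0T] ->]]] := mod_period t T0.
rewrite (@periodic_int R x T); last by move=> s; have [->] := per s.
rewrite (@periodic_int R u T); last by move=> s; have [_ ->] := per s.
move: t00; rewrite le_eqVlt => /predU1P[<-|t00 xt ut].
  by rewrite add0r u0 => _ _; split => //; exists k.
case: (ltgtP t0 T1) => tt.
- by have := xp t0; rewrite t00 tt xt ltxx => /(_ isT).
- by have := xn t0; rewrite t0T tt xt ltxx => /(_ isT).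
- by move: ut; rewrite tt uT => -[]; lra.
Qed.

Lemma loop_meet G F a b T1 T x u a' b' T1' T' x' u' t t' :
  loop G F a b T1 T x u -> loop G F a' b' T1' T' x' u' ->
  x t = x' t' -> u t = u' t' -> a = a' /\ forall s, x (s + t) = x' (s + t') /\ u (s + t) = u' (s + t').
Proof.
move=> h h' ex eu; have [[a0 b0 T10 T1T] hl per [x0 u0 xT uT] [xp xn]] := h.
have [[a0' b0' T10' T1T'] hl' per' [x0' u0' xT' uT'] [xp' xn']] := h'.
have key : forall s, x (s + t) = x' (s + t') /\ u (s + t) = u' (s + t').
  apply: (@lienard_global_uniq G F (fun s => x (s + t)) (fun s => u (s + t))
    (fun s => x' (s + t')) (fun s => u' (s + t'))); rewrite ?add0r //.
  - by move=> s; exact: lienard_shift.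
  - by move=> s; exact: lienard_shift.
split => //; have [e1 e2] := key (- t'); rewrite addNr x0' u0' in e1 e2.
have [|e3 _] := loop_axis h e1; first by left; rewrite e2.
by rewrite -e3 e2.
Qed.

End Periodic.

(** * Closed orbits through all points, and their height *)

Section Label.
Variable R : realType.
Variables (G F : {poly R}).
Hypotheses (rd : right_data G F) (rdl : right_data (refl G) (refl F)).
Hypothesis sym : forall x1 x2 : R, 0 < x1 -> 0 < x2 -> G.[x1] = (refl G).[x2] -> F.[x1] = (refl F).[x2].
Implicit Types (x u xi : R -> R) (a b T t : R).

Lemma arc_loop a b T1 x u : half_orbit G F a b T1 x u -> exists T y v,
  loop G F a b T1 T y v /\ forall t, 0 <= t <= T1 -> y t = x t /\ v t = u t.
Proof.
move=> h; have [[a0 b0 T0] _ _ _ _] := h.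
have [b' [T2 [x2 [u2 h2]]]] := arc_top rdl a0.
have bb := arcs_match rd rdl sym h h2; rewrite -bb in h2.
have [y [v hl]] := arcs_loop h h2; exists (T1 + T2), y, v; split => //.
by have [_ _ e] := arc_uniq_top (loop_right hl) h.
Qed.

Lemma loop_top a : 0 < a -> exists b T1 T x u, loop G F a b T1 T x u.
Proof.
move=> a0; have [b [T1 [x [u h]]]] := arc_top rd a0.
by have [T [y [v [hl _]]]] := arc_loop h; exists b, T1, T, y, v.
Qed.

Lemma loop_through (x0 u0 : R) : (x0, u0) <> (0, 0) ->
  exists a b T1 T x u t, [/\ loop G F a b T1 T x u, 0 <= t <= T, x t = x0 & u t = u0].
Proof.
move=> n0; case: (ltgtP x0 0) => x00.
- have [|a [b [T2 [x2 [u2 [t [h tI xt ut]]]]]]] := @arc_through R _ _ rdl (- x0) u0.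
    by rewrite oppr_gt0.
  have [[a0 _ _] _ _ _ _] := h.
  have [b' [T1 [T [x [u hl]]]]] := loop_top a0.
  have [bb TT e] := arc_uniq_top h (loop_left hl).
  have /andP[t0 tT] := tI.
  have [e1 e2] := e t (introT andP (conj (ltW t0) (ltW tT))).
  exists a, b', T1, T, x, u, (T - t); split => //.
  + have [[_ _ T10 _] _ _ _ _] := hl.
    by move: t0 tT; rewrite TT => t0 tT; apply/andP; split; lra.
  + by rewrite -[LHS]opprK -e1 xt opprK.
  + by rewrite -e2.
- have [a [b [T1 [x [u [t [h /andP[t0 tT] xt ut]]]]]]] := arc_through rd u0 x00.
  have [T [y [v [hl e]]]] := arc_loop h.
  have [e1 e2] := e t (introT andP (conj (ltW t0) (ltW tT))).
  exists a, b, T1, T, y, v, t; split => //; [|by rewrite e1|by rewrite e2].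
  have [[_ _ _ T1T] _ _ _ _] := hl.
  by rewrite (ltW t0) (le_trans (ltW tT) (ltW T1T)).
- case: (ltgtP u0 0) => u00.
  + have [|b' [T1 [x [u h]]]] := arc_top (right_data_opp rd) (a := - u0); first by rewrite oppr_gt0.
    have := arc_rev h; rewrite !opprK => h'.
    have [T [y [v [hl e]]]] := arc_loop h'.
    have [[_ _ T10 T1T] _ _ [_ _ yT vT] _] := hl.
    exists (- b'), u0, T1, T, y, v, T1; split => //; first by rewrite !ltW.
    by rewrite yT x00.
  + have [b [T1 [T [x [u hl]]]]] := loop_top u00.
    have [[_ _ T10 T1T] _ _ [y0 v0 _ _] _] := hl.
    exists u0, b, T1, T, x, u, 0; split => //; last by rewrite y0 x00.
    by rewrite lexx ltW// (lt_trans T10 T1T).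
  + by case: n0; rewrite x00 u00.
Qed.

(* The height at which the closed orbit through (x0, u0) crosses the positive
   u-axis, and 0 at the origin. *)
Definition label (x0 u0 : R) : R := xget 0 [set a | exists b T1 T x u t,
  [/\ loop G F a b T1 T x u, x t = x0 & u t = u0]].

Lemma label_loop a b T1 T x u t : loop G F a b T1 T x u -> label (x t) (u t) = a.
Proof.
move=> h; rewrite /label; case: xgetP => [a' _ [b' [T1' [T' [x' [u' [t' [h' ex eu]]]]]]]|].
  by have [] := loop_meet h' h ex eu.
by move=> /(_ a); case; exists b, T1, T, x, u, t.
Qed.

Lemma label0 : label 0 0 = 0.
Proof.
rewrite /label; case: xgetP => // a _ [b [T1 [T [x [u [t [h ex eu]]]]]]].
by have [|<- _] := loop_axis h ex => //; right.
Qed.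

Lemma label_spec (x0 u0 : R) : (x0, u0) <> (0, 0) -> exists b T1 T x u t,
  [/\ loop G F (label x0 u0) b T1 T x u, 0 <= t <= T, x t = x0 & u t = u0].
Proof.
move=> /loop_through[a [b [T1 [T [x [u [t [h tI <- <-]]]]]]]].
by rewrite (label_loop t h); exists b, T1, T, x, u, t.
Qed.

Lemma label_gt0 (x0 u0 : R) : (x0, u0) <> (0, 0) -> 0 < label x0 u0.
Proof. by move=> /label_spec[b [T1 [T [x [u [t [[[a0 _ _ _] _ _ _ _] _ _ _]]]]]]]. Qed.

Lemma label_ge0 (x0 u0 : R) : 0 <= label x0 u0.
Proof.
have [[-> ->]|/label_gt0/ltW//] := pselect ((x0, u0) = (0, 0)); by rewrite label0.
Qed.

End Label.

(** * Continuity of the height *)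

Section Cut.
Variable R : realType.

(** The graph of the arc is continued by negative values outside [b, a]. Then, at every height v and
    for every x >= 0, the order of x and xi v tells whether (x, v) is on a lower arc, on the arc
    itself or on a higher one. *)
Lemma arc_cut (G F : {poly R}) a b T x u : right_data G F -> half_orbit G F a b T x u ->
  exists xi : R -> R, [/\ continuous xi, forall v, (0 < xi v) = (b < v < a),
    forall v, (xi v < 0) = (v < b) || (a < v) &
    forall a' b' T' x' u' t, half_orbit G F a' b' T' x' u' -> 0 <= t <= T' ->
     [/\ a' < a -> x' t < xi (u' t), a' = a -> x' t = xi (u' t) & a < a' -> xi (u' t) < x' t]].
Proof.
move=> rd h; have [xi [g k s]] := arc_graphP rd h.
have [[b0 a0] cxi xi0 xip _] := g.
pose xi1 v := xi v + (Num.min 0 (a - v) + Num.min 0 (v - b)).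
have in_ v : b <= v <= a -> xi1 v = xi v.
  by move=> /andP[bv va]; rewrite /xi1 !min_l ?subr_ge0// !addr0.
have out v : v < b \/ a < v -> xi1 v < 0.
  rewrite /xi1 => -[vb|av].
    rewrite xi0; last by left; exact: ltW.
    by rewrite (min_r (_ : v - b <= 0)) ?min_l; lra.
  rewrite xi0; last by right; exact: ltW.
  by rewrite (min_r (_ : a - v <= 0)) ?min_l; lra.
have ge0 v : b <= v <= a -> 0 <= xi1 v.
  move=> /[dup] /in_ -> /andP[]; rewrite le_eqVlt => /predU1P[<-|bv].
    by rewrite xi0//; left; exact: lexx.
  rewrite le_eqVlt => /predU1P[->|va]; last by apply/ltW/xip; rewrite bv.
  by rewrite xi0//; right; exact: lexx.
have TI := arc_graphP rd.
exists xi1; split.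
- move=> v; apply: (@continuousD _ _ _ xi (fun v => Num.min 0 (a - v) + Num.min 0 (v - b))); first exact: cxi.
  apply: (@continuousD _ _ _ (fun v => Num.min 0 (a - v)) (fun v => Num.min 0 (v - b))).
    apply: (@continuous_min R R (fun=> 0) (fun v => a - v)); first exact: cst_continuous.
    by apply: (@continuousB _ _ _ (fun=> a) id); [exact: cst_continuous|exact: cvg_id].
  apply: (@continuous_min R R (fun=> 0) (fun v => v - b)); first exact: cst_continuous.
  by apply: (@continuousB _ _ _ id (fun=> b)); [exact: cvg_id|exact: cst_continuous].
- move=> v; apply/idP/idP => [|vI]; last first.
    by have /andP[/ltW h1 /ltW h2] := vI; rewrite in_ ?h1// xip.
  apply: contraLR; rewrite negb_and -!leNgt => /orP[vb|av].
    move: vb; rewrite le_eqVlt => /predU1P[->|vb]; last by apply/ltW/out; left.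
    by rewrite in_ ?lexx ?xi0//; [left; exact: lexx|lra].
  move: av; rewrite le_eqVlt => /predU1P[<-|av]; last by apply/ltW/out; right.
  by rewrite in_ ?lexx ?xi0//; [right; exact: lexx|lra].
- move=> v; apply/idP/idP => [|/orP[vb|av]]; [|by apply: out; left|by apply: out; right].
  by apply: contraLR; rewrite negb_or -!leNgt => /ge0.
- move=> a' b' T' x' u' t h' tI.
  have [xi' [g' k' s']] := arc_graphP rd h'.
  have uI : b' <= u' t <= a'.
    have [_ _ [_ u0 _ uT] _ _] := h'; move: tI => /andP[].
    rewrite le_eqVlt => /predU1P[<-|t0].
      by rewrite u0 lexx andbT; have [[p q r] _ _ _ _] := h'; lra.
    rewrite le_eqVlt => /predU1P[->|tT].
      by rewrite uT lexx /=; have [[p q r] _ _ _ _] := h'; lra.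
    by rewrite -uT -u0 !ltW// (arc_u_decr rd h')// ltW.
  rewrite -k'//; split.
  + move=> aa; have [bb lt] := arc_nested h' h g' g k' k s' s aa.
    by rewrite in_ ?lt//; move: uI => /andP[p q]; apply/andP; split; lra.
  + move=> aa; rewrite aa in h'; have [bb TT e] := arc_uniq_top h' h.
    rewrite in_ -?bb -?aa// k'//; have [-> ->] := e t tI; rewrite k//.
    by rewrite -TT.
  + move=> aa; have [bb lt] := arc_nested h h' g g' k k' s s' aa.
    have [uJ|] := boolP (b <= u' t <= a); first by rewrite in_ ?lt.
    rewrite negb_and -!ltNge => /orP uo; apply: (lt_le_trans (out _ uo)).
    rewrite k'//; have [_ _ [x0 _ xT _] xp _] := h'; move: tI => /andP[].
    rewrite le_eqVlt => /predU1P[<-|t0]; first by rewrite x0.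
    rewrite le_eqVlt => /predU1P[->|tT]; first by rewrite xT.
    by apply/ltW/xp; rewrite t0.
Qed.

Variables (G F : {poly R}).
Hypotheses (rd : right_data G F) (rdl : right_data (refl G) (refl F)).
Hypothesis sym : forall x1 x2 : R, 0 < x1 -> 0 < x2 -> G.[x1] = (refl G).[x2] -> F.[x1] = (refl F).[x2].
Notation label := (label G F).

Lemma label_right (x0 u0 : R) : (x0, u0) <> (0, 0) -> 0 <= x0 -> exists b T x u t,
  [/\ half_orbit G F (label x0 u0) b T x u, 0 <= t <= T, x t = x0 & u t = u0].
Proof.
move=> n0 x00; have [b [T1 [T [x [u [t [h /andP[t0 tT] ex eu]]]]]]] := label_spec rd rdl sym n0.
have hr := loop_right h; have [[a0 b0 T10 T1T] hl per [y0 v0 xT uT] [xp xn]] := h.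
exists b, T1, x, u; case: (leP t T1) => tT1; first by exists t; rewrite t0 tT1.
have tE : t = T.
  apply/eqP; rewrite eq_le tT leNgt; apply/negP => lt.
  by have := xn t; rewrite tT1 lt ex ltNge x00 => /(_ isT).
have [p1 p2] := per 0; rewrite add0r in p1 p2.
by exists 0; split => //; rewrite ?lexx ?(ltW T10) -?ex -?eu ?tE.
Qed.

Lemma label_left (x0 u0 : R) : (x0, u0) <> (0, 0) -> x0 <= 0 -> exists b T x u t,
  [/\ half_orbit (refl G) (refl F) (label x0 u0) b T x u, 0 <= t <= T, x t = - x0 & u t = u0].
Proof.
move=> n0 x00; have [b [T1 [T [x [u [t [h /andP[t0 tT] ex eu]]]]]]] := label_spec rd rdl sym n0.
have hr := loop_left h; have [[a0 b0 T10 T1T] hl per [y0 v0 xT uT] [xp xn]] := h.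
exists b, (T - T1), (fun t => - x (T - t)), (fun t => u (T - t)); case: (leP T1 t) => tT1.
  exists (T - t); rewrite subKr ex eu; split => //.
  by apply/andP; split; lra.
have tE : t = 0.
  apply/eqP; rewrite eq_le t0 andbT leNgt; apply/negP => lt.
  by have := xp t; rewrite tT1 lt ex ltNge x00 => /(_ isT).
have [p1 p2] := per 0; rewrite add0r in p1 p2.
have e1 : x 0 = x0 by rewrite -tE.
have e2 : u 0 = u0 by rewrite -tE.
exists 0; rewrite subr0 p1 p2 e1 e2; split => //.
by rewrite lexx subr_ge0 ltW.
Qed.

(** Sublevel and superlevel sets are described by strict inequalities between continuous functions,
    hence are open. The right and left cut functions belong to arcs with the same ends a and b, so
    they have the same sign at each u; this disposes of the inequality that concerns the half-plane
    not containing the point. *)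
Lemma label_cut (a : R) : 0 < a -> exists xr xl : R -> R,
  [/\ continuous xr, continuous xl &
   forall x u, (label x u < a <-> - xl u < x < xr u) /\ (a < label x u <-> xr u < x \/ xl u < - x)].
Proof.
move=> a0; have [b [T1 [T [y [v hl]]]]] := loop_top rd rdl sym a0.
have [xr [cr pr nr hr]] := arc_cut rd (loop_right hl).
have [xl [cl pl nl hl']] := arc_cut rdl (loop_left hl).
have [[_ b0 _ _] _ _ _ _] := hl.
exists xr, xl; split => // x u.
have right_ : 0 <= x -> [/\ label x u < a -> x < xr u, label x u = a -> x = xr u & a < label x u -> xr u < x].
  move=> x0; have [[-> ->]|n0] := pselect ((x, u) = (0, 0)).
    by rewrite label0; split; [rewrite pr b0 a0| |]; lra.
  have [b' [T' [x' [u' [t [h tI ex eu]]]]]] := label_right n0 x0.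
  by have := hr _ _ _ _ _ _ h tI; rewrite ex eu.
have left_ : x <= 0 -> [/\ label x u < a -> - x < xl u, label x u = a -> - x = xl u & a < label x u -> xl u < - x].
  move=> x0; have [[-> ->]|n0] := pselect ((x, u) = (0, 0)).
    by rewrite label0 oppr0; split; [rewrite pl b0 a0| |]; lra.
  have [b' [T' [x' [u' [t [h tI ex eu]]]]]] := label_left n0 x0.
  by have := hl' _ _ _ _ _ _ h tI; rewrite ex eu.
have posE w : (0 < xr w) = (0 < xl w) by rewrite pr pl.
have negE w : (xr w < 0) = (xl w < 0) by rewrite nr nl.
split; split.
- move=> la; case: (leP 0 x) => x0.
    have [h1 _ _] := right_ x0; have h := h1 la; rewrite h andbT.
    have : 0 < xl u by rewrite -posE; exact: le_lt_trans h.
    by lra.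
  have [h1 _ _] := left_ (ltW x0); have h := h1 la; apply/andP; split; first by lra.
  have : 0 < xr u by rewrite posE; lra.
  by lra.
- move=> /andP[h1 h2]; rewrite ltNge le_eqVlt; apply/negP => /predU1P la.
  case: (leP 0 x) => x0.
    have [_ e1 e2] := right_ x0.
    by case: la => [/esym/e1|/e2]; lra.
  have [_ e1 e2] := left_ (ltW x0).
  by case: la => [/esym/e1|/e2]; lra.
- move=> la; case: (leP 0 x) => x0.
    by left; have [_ _ h] := right_ x0; exact: h.
  by right; have [_ _ h] := left_ (ltW x0); exact: h.
- move=> h; rewrite ltNge le_eqVlt; apply/negP => /predU1P la.
  case: (leP 0 x) => x0.
    have [e1 e2 _] := right_ x0.
    case: h => h; first by case: la => [/e2|/e1]; lra.
    have : xr u < 0 by rewrite negE; lra.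
    by case: la => [/e2|/e1]; lra.
  have [e1 e2 _] := left_ (ltW x0).
  case: h => h; last by case: la => [/e2|/e1]; lra.
  have : xl u < 0 by rewrite -negE; lra.
  by case: la => [/e2|/e1]; lra.
Qed.

Lemma label_continuous (X : topologicalType) (p q : X -> R) (t : X) :
  {for t, continuous p} -> {for t, continuous q} ->
  {for t, continuous (fun s => label (p s) (q s))}.
Proof.
move=> cp cq; apply/cvgrPdist_lt => e e0.
set l := label (p t) (q t).
have l0 : 0 <= l by exact: label_ge0.
have le0 : 0 < l + e by rewrite ltr_wpDl.
have [xr [xl [cr cl h]]] := label_cut le0.
have up : \forall s \near t, label (p s) (q s) < l + e.
  have /andP[h1 h2] : - xl (q t) < p t < xr (q t).
    by apply/((h (p t) (q t)).1); rewrite -/l ltrDl.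
  have c1 : {for t, continuous (fun s => p s + xl (q s))}.
    apply: (@continuousD _ _ _ p (fun s => xl (q s))) => //.
    by apply: (@continuous_comp _ _ _ q xl) => //; exact: cl.
  have c2 : {for t, continuous (fun s => xr (q s) - p s)}.
    apply: (@continuousB _ _ _ (fun s => xr (q s)) p) => //.
    by apply: (@continuous_comp _ _ _ q xr) => //; exact: cr.
  have n1 : \forall s \near t, 0 < p s + xl (q s) by apply: (cvgr_gt _ c1); lra.
  have n2 : \forall s \near t, 0 < xr (q s) - p s by apply: (cvgr_gt _ c2); lra.
  near=> s; apply/(h (p s) (q s)).1.
  have m1 : 0 < p s + xl (q s) by near: s.
  have m2 : 0 < xr (q s) - p s by near: s.
  by apply/andP; split; lra.
have low : \forall s \near t, l - e < label (p s) (q s).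
  case: (ltP 0 l) => [lp|l0'].
    (* [label_cut] needs a positive level; b is positive and lies in [l - e, l). *)
    pose b := Num.max (l - e) (l / 2).
    have b0 : 0 < b by rewrite lt_max divr_gt0 ?orbT.
    have bl : b < l by rewrite gt_max; apply/andP; split; lra.
    have [xr' [xl' [cr' cl' h']]] := label_cut b0.
    have [/(_ bl)h1 _] := (h' (p t) (q t)).2.
    have c1 : {for t, continuous (fun s => - p s - xl' (q s))}.
      apply: (@continuousB _ _ _ (fun s => - p s) (fun s => xl' (q s))).
        exact: continuousN.
      by apply: (@continuous_comp _ _ _ q xl') => //; exact: cl'.
    have c2 : {for t, continuous (fun s => p s - xr' (q s))}.
      apply: (@continuousB _ _ _ p (fun s => xr' (q s))) => //.
      by apply: (@continuous_comp _ _ _ q xr') => //; exact: cr'.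
    have n1 : \forall s \near t, 0 < - p s - xl' (q s) \/ 0 < p s - xr' (q s).
      case: h1 => h1.
        have : \forall s \near t, 0 < p s - xr' (q s) by apply: (cvgr_gt _ c2); lra.
        by apply: filterS => s; right.
      have : \forall s \near t, 0 < - p s - xl' (q s) by apply: (cvgr_gt _ c1); lra.
      by apply: filterS => s; left.
    near=> s; apply: (@le_lt_trans _ _ b); first by rewrite le_max lexx.
    apply/(h' (p s) (q s)).2.
    have m1 : 0 < - p s - xl' (q s) \/ 0 < p s - xr' (q s) by near: s.
    by case: m1; [right|left]; lra.
  near=> s; apply: (@lt_le_trans _ _ 0); first by lra.
  exact: label_ge0.
near=> s; rewrite ltr_distl.
have m1 : label (p s) (q s) < l + e by near: s.
have m2 : l - e < label (p s) (q s) by near: s.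
by apply/andP; split; lra.
Unshelve. all: by end_near. Qed.

End Cut.

(** * The height and rho control each other *)

Section Bounds.
Variable R : realType.

(** [confine] along the arc from its top bounds rho by a^2; applied to the reversed arc from the
    given point back to the top it bounds a^2 by rho. The maximum with R0 in [confine] is absorbed
    by (1 + R0) (1 + P). *)
Lemma half_orbit_rho (G F : {poly R}) : right_data G F -> exists K : R, 0 < K /\
  forall a b T x u t, half_orbit G F a b T x u -> 0 <= t <= T ->
    rho G (x t) (u t) <= K * (1 + a ^+ 2) /\ a ^+ 2 <= K * (1 + rho G (x t) (u t)).
Proof.
move=> rd.
have [k [r0 [R0 [k01 r0R0 hyp]]]] : exists k r0 R0 : R, [/\ 0 < k < 1, 0 < r0 <= R0 &
        forall x u, 0 <= x -> 0 < rho G x u -> rho G x u <= r0 \/ R0 <= rho G x u ->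
          `|u * F.[x]| <= k * rho G x u /\ F.[x] ^+ 2 <= 4 * rho G x u] by case: rd.
have hyp' (x u : R) : 0 <= x -> 0 < rho G x u -> rho G x u <= r0 \/ R0 <= rho G x u ->
    `|u * (- F).[x]| <= k * rho G x u /\ (- F).[x] ^+ 2 <= 4 * rho G x u.
  by rewrite hornerN mulrN normrN sqrrN; exact: hyp.
pose A := 4 / (1 - k).
have R00 : 0 < R0 by move: r0R0 => /andP[]; exact: lt_le_trans.
have e0 : 0 < expR (2 * A) by exact: expR_gt0.
exists (expR (2 * A) * (1 + R0)); split; first by rewrite mulr_gt0//; lra.
move=> a b T x u t h /andP[t0 tT]; have [[a0 b0 T0] [cx cu] [x0 u0 xT uT] xp hl] := h.
have xp' s : 0 <= s <= T -> 0 <= x s.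
  move=> /andP[]; rewrite le_eqVlt => /predU1P[<-|s0]; first by rewrite x0.
  rewrite le_eqVlt => /predU1P[->|sT]; first by rewrite xT.
  by apply/ltW/xp; rewrite s0.
have rp s : 0 <= s <= T -> 0 < rho G (x s) (u s).
  move=> sI; apply: (rd_rho_gt0 rd); first exact: xp'.
  move: sI => /andP[]; rewrite le_eqVlt => /predU1P[<-|s0]; first by rewrite u0 xpair_eqE (gt_eqF a0) andbF.
  rewrite le_eqVlt => /predU1P[->|sT]; first by rewrite uT xpair_eqE (lt_eqF b0) andbF.
  by rewrite xpair_eqE gt_eqF// xp ?s0.
have inT s : 0 <= s <= t -> 0 <= s <= T by move=> /andP[-> /le_trans ->].
have r0a : rho G (x 0) (u 0) = a ^+ 2 by rewrite /rho x0 u0 (rd_G0 rd) mulr0 add0r.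
have comb (P Q : R) : 0 <= P -> 0 <= Q -> Q <= expR (2 * A) * Num.max P R0 ->
    Q <= expR (2 * A) * (1 + R0) * (1 + P).
  move=> P0 Q0 QP; apply: le_trans QP _; rewrite -mulrA ler_wpM2l ?(ltW e0)// ge_max.
  by have := mulr_ge0 P0 (ltW R00); move: P0 R00; clear; nra.
have tI : 0 <= t <= T by rewrite t0.
split.
  apply: comb; [exact: sqr_ge0|exact/ltW/rp|].
  have /andP[_] := @confine R G F rd k r0 R0 A t _ x u k01 r0R0 erefl hyp t0 cx cu
    (fun s sI => xp' s (inT s sI)) (fun s sI => rp s (inT s sI)) erefl
    (fun s sI _ => hl s (inT s (introT andP (conj (ltW (proj1 (andP sI))) (ltW (proj2 (andP sI))))))).
  by rewrite r0a.
apply: comb; [exact/ltW/rp|exact: sqr_ge0|].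
have rI s : 0 <= s <= t -> 0 <= t - s <= T by move=> /andP[s0 st]; lra.
have cu' : continuous (fun s => - u (t - s)).
  by move=> s; apply: (@continuousN _ _ _ (fun s => u (t - s))); exact: continuous_rev.
have rho' s : rho G (x (t - s)) (- u (t - s)) = rho G (x (t - s)) (u (t - s)).
  by rewrite /rho sqrrN.
have rr s : 0 <= s <= t -> 0 < rho G (x (t - s)) (- u (t - s)).
  by move=> sI; rewrite rho'; exact/rp/rI.
have /andP[_] := @confine R G (- F) (right_data_opp rd) k r0 R0 A t _ (fun s => x (t - s)) (fun s => - u (t - s))
    k01 r0R0 erefl hyp' t0 (continuous_rev cx) cu'
    (fun s sI => xp' _ (rI s sI)) rr erefl
    (fun s sI _ => lienard_rev (hl _ (rI s (introT andP (conj (ltW (proj1 (andP sI))) (ltW (proj2 (andP sI)))))))).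
by rewrite !rho' subr0 subrr r0a.
Qed.

End Bounds.

(** * The conditions on the coefficients *)

Section Asymptotics.
Variable R : realType.
Implicit Types (p q g f : {poly R}) (c : nat -> R).

Lemma expr_invr (x : R) i j : x != 0 -> (i <= j)%N -> x ^+ j * x^-1 ^+ (j - i) = x ^+ i.
Proof.
by move=> x0 ij; rewrite -{1}(subnK ij) exprD mulrAC -exprMn divff// expr1n mul1r.
Qed.

Lemma expr_odd_split (x : R) i : x ^+ (2 * i + 1) = x ^+ i.+1 * x ^+ i.
Proof. by rewrite -exprD; congr (x ^+ _); lia. Qed.

Lemma poly_between_horner lo hi c (x : R) :
  (poly_between lo hi c).[x] = \sum_(lo <= i < hi.+1) c i * x ^+ i.
Proof. by rewrite horner_sum; apply: eq_bigr => i _; rewrite hornerZ hornerXn. Qed.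

Lemma poly_between_low lo hi c : (lo <= hi)%N ->
  exists p, p.[0] = c lo /\ forall x, (poly_between lo hi c).[x] = x ^+ lo * p.[x].
Proof.
move=> lh; exists (\sum_(lo <= i < hi.+1) c i *: 'X^(i - lo)); split.
  rewrite big_ltn// hornerD horner_sum big_nat big1 => [|i /andP[li _]].
    by rewrite subnn expr0 hornerZ hornerC mulr1 addr0.
  by rewrite hornerZ hornerXn expr0n subn_eq0 leqNgt li mulr0.
move=> x; rewrite poly_between_horner horner_sum mulr_sumr big_nat [RHS]big_nat.
by apply: eq_bigr => i /andP[li _]; rewrite hornerZ hornerXn mulrCA -exprD subnKC.
Qed.

Lemma poly_between_high lo hi c : (lo <= hi)%N ->
  exists p, p.[0] = c hi /\
    forall x, x != 0 -> (poly_between lo hi c).[x] = x ^+ hi * p.[x^-1].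
Proof.
move=> lh; exists (\sum_(lo <= i < hi.+1) c i *: 'X^(hi - i)); split.
  rewrite big_nat_recr// hornerD horner_sum /= big_nat big1 => [|i /andP[_ ih]].
    by rewrite subnn expr0 hornerZ hornerC mulr1 add0r.
  by rewrite hornerZ hornerXn expr0n subn_eq0 leqNgt ih mulr0.
move=> x x0; rewrite poly_between_horner horner_sum mulr_sumr big_nat [RHS]big_nat.
apply: eq_bigr => i /andP[_]; rewrite ltnS => ih.
by rewrite hornerZ hornerXn mulrCA expr_invr.
Qed.

Definition primitive_between lo hi c := poly_between lo.+1 hi.+1 (fun i => c i.-1 / i%:R).

Lemma primitive_between_deriv lo hi c :
  (primitive_between lo hi c)^`() = poly_between lo hi c.
Proof.
rewrite /primitive_between /poly_between big_add1 /= raddf_sum /=; apply: eq_bigr => i _.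
by rewrite derivZ derivXn /= -[X in _ *: X = _]scaler_nat scalerA divfK ?pnatr_eq0.
Qed.

Lemma primitive_between0 lo hi c : (primitive_between lo hi c).[0] = 0.
Proof.
rewrite poly_between_horner big_nat big1// => i /andP[li _].
by rewrite expr0n gtn_eqF ?mulr0//; exact: leq_trans li.
Qed.

Lemma halfway_to1 (k : R) : 0 < k < 1 -> 0 < (1 + k) / 2 - k /\ 0 < (1 + k) / 2 < 1.
Proof. by move=> /andP[k0 k1]; split; [lra|apply/andP; split; lra]. Qed.

Lemma poly_pos_near0 p : 0 < p.[0] -> exists2 d : R, 0 < d & forall x, 0 <= x <= d -> 0 < p.[x].
Proof.
move=> p0; have [|d d0 h] := @poly_small_near0 R (p - p.[0]%:P) p.[0] _ p0.
  by rewrite hornerD hornerN hornerC subrr.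
exists d => // x /h; rewrite hornerD hornerN hornerC ltr_norml => /andP[h1 _]; lra.
Qed.

Lemma poly_cons p : exists q, forall x, p.[x] = p.[0] + x * q.[x].
Proof.
elim/poly_ind: p => [|p c _]; first by exists 0 => x; rewrite !horner0 mulr0 addr0.
by exists p => x; rewrite !hornerD !hornerM !hornerX !hornerC mulr0 add0r addrC mulrC.
Qed.

(** Used with F^2 = x^(j + d) q^2 and G = x^d p, and at infinity in the variable 1/x; j = 0 is the
    borderline case of equal orders. The number e is the value at 0 of x^j q^2 / (8 p), which is
    below 1, and k = (1 + e) / 2 satisfies k^2 > e, so that 8 k^2 p - x^j q^2 is a polynomial
    positive at 0. *)
Lemma discriminant_near0 p q (j : nat) : 0 < p.[0] -> (0 < j)%N \/ q.[0] ^+ 2 < 8 * p.[0] ->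
  exists k d : R, [/\ 0 < k < 1, 0 < d & forall x, 0 <= x <= d ->
    x ^+ j * q.[x] ^+ 2 <= 8 * k ^+ 2 * p.[x]].
Proof.
move=> p0 h; pose e : R := if (0 < j)%N then 0 else q.[0] ^+ 2 / (8 * p.[0]).
have p80 : 0 < 8 * p.[0] by rewrite mulr_gt0.
have e0 : 0 <= e by rewrite /e; case: ifP => // _; rewrite divr_ge0 ?sqr_ge0 ?(ltW p80).
have e1 : e < 1.
  by rewrite /e; case: ifP => // j0; case: h => [|h]; [rewrite j0|rewrite ltr_pdivrMr// mul1r].
pose k := (1 + e) / 2.
have ek : e < k ^+ 2.
  have : 0 < (1 - e) ^+ 2 by rewrite exprn_gt0//; lra.
  by rewrite /k => hh; nra.
pose P := (8 * k ^+ 2) *: p - 'X^j * q ^+ 2.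
have [|d d0 hd] := @poly_pos_near0 P.
  rewrite /P hornerD hornerN hornerZ hornerM hornerXn horner_exp.
  have -> : 0 ^+ j * q.[0] ^+ 2 = e * (8 * p.[0]).
    rewrite /e; case: j {P h e e0 e1 k ek} => [|j]; last by rewrite expr0n /= !mul0r.
    by rewrite expr0 mul1r /= divfK// gt_eqF.
  have : 0 < (k ^+ 2 - e) * (8 * p.[0]) by rewrite mulr_gt0// subr_gt0.
  by lra.
exists k, d; split => //; first by rewrite /k; apply/andP; split; lra.
move=> x /hd; rewrite /P hornerD hornerN hornerZ hornerM hornerXn horner_exp; lra.
Qed.

Section Conditions.
Variables (m n r s : nat) (a b : nat -> R).
Hypotheses (hrm : (r <= m)%N) (hsn : (s <= n)%N).
Let g := poly_between r m a.
Let f := poly_between s n b.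
Let G := primitive_between r m a.
Let F := primitive_between s n b.

(** F^2 <= 8 k^2 G holds for x near 0 and for large x. Small rho forces x to be near 0, but large
    rho does not force x to be large, as u may be large instead; hence the bound F^2 <= 8 k1^2 G +
    B0 for all x >= 0, whose constant is absorbed by passing from k1 to k2. *)
Lemma right_data_conditions : (0 < r)%N -> (forall x : R, 0 < x -> 0 < g.[x]) -> 0 < a r -> 0 < a m ->
  (r < 2 * s + 1)%N \/ r = (2 * s + 1)%N /\ b s ^+ 2 < 2 * (r%:R + 1) * a r ->
  (2 * n + 1 < m)%N \/ m = (2 * n + 1)%N /\ b n ^+ 2 < 4 * (n%:R + 1) * a m ->
  right_data G F.
Proof.
move=> r0 gp ar0 am0 c0 coo.
have GE : G^`() = g by exact: primitive_between_deriv.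
have [G1 [G10 hG1]] := @poly_between_low r.+1 m.+1 (fun i => a i.-1 / i%:R) hrm.
have [F1 [F10 hF1]] := @poly_between_low s.+1 n.+1 (fun i => b i.-1 / i%:R) hsn.
have [G2 [G20 hG2]] := @poly_between_high r.+1 m.+1 (fun i => a i.-1 / i%:R) hrm.
have [F2 [F20 hF2]] := @poly_between_high s.+1 n.+1 (fun i => b i.-1 / i%:R) hsn.
rewrite /= in G10 F10 G20 F20; rewrite -/G in hG1 hG2; rewrite -/F in hF1 hF2.
have G1p : 0 < G1.[0] by rewrite G10 divr_gt0.
have G2p : 0 < G2.[0] by rewrite G20 divr_gt0.
have disc (i j : nat) (A B : R) : j = (2 * i + 1)%N -> B ^+ 2 < 4 * (i%:R + 1) * A ->
    (B / i.+1%:R) ^+ 2 < 8 * (A / j.+1%:R).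
  move=> -> h; have -> : (2 * i + 1).+1%:R = 2 * (i%:R + 1) :> R by rewrite -natr1 natrD natrM; ring.
  rewrite -addn1 natrD; have i0 : 0 < i%:R + 1 :> R by rewrite ltr_wpDl.
  have -> : 8 * (A / (2 * (i%:R + 1))) = (4 * (i%:R + 1) * A) / (i%:R + 1) ^+ 2.
    by field; rewrite gt_eqF.
  by rewrite exprMn exprVn ltr_pM2r// invr_gt0 exprn_gt0.
have [|k0 [d0 [k01 d00 h0]]] := @discriminant_near0 G1 F1 (2 * s.+1 - r.+1) G1p.
  case: c0 => [c0|[rE c0]]; first by left; clear -c0; lia.
  right; rewrite F10 G10; apply: disc => //; apply: lt_le_trans c0 _.
  by rewrite rE natrD natrM le_eqVlt; apply/orP; left; apply/eqP; ring.
have [|k1 [d1 [k11 d10 h1]]] := @discriminant_near0 G2 F2 (m.+1 - 2 * n.+1) G2p.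
  case: coo => [coo|[mE coo]]; first by left; clear -coo; lia.
  by right; rewrite F20 G20; apply: disc.
have near0 (x : R) : 0 <= x <= d0 -> F.[x] ^+ 2 <= 8 * k0 ^+ 2 * G.[x].
  move=> xI; rewrite hF1 hG1 exprMn -exprM.
  have e : (s.+1 * 2 = r.+1 + (2 * s.+1 - r.+1))%N by clear -c0; case: c0 => [|[]]; lia.
  rewrite e exprD -mulrA [leRHS]mulrCA; apply: ler_wpM2l; last exact: h0.
  by rewrite exprn_ge0//; case/andP: xI.
have nearoo (x : R) : d1^-1 <= x -> F.[x] ^+ 2 <= 8 * k1 ^+ 2 * G.[x].
  move=> xd; have xp : 0 < x by apply: lt_le_trans xd; rewrite invr_gt0.
  have x0 : x != 0 by rewrite gt_eqF.
  rewrite hF2// hG2// exprMn -exprM.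
  have e : (m.+1 = n.+1 * 2 + (m.+1 - 2 * n.+1))%N by clear -coo; case: coo => [|[]]; lia.
  have e2 : x ^+ m.+1 = x ^+ (n.+1 * 2) * x ^+ (m.+1 - 2 * n.+1) by rewrite -exprD -e.
  have xi : 0 <= x^-1 <= d1 by rewrite invr_ge0 (ltW xp)/= -[d1]invrK lef_pV2// posrE invr_gt0.
  have hX := h1 _ xi; rewrite exprVn in hX; rewrite e2.
  have X10 : 0 <= x ^+ (n.+1 * 2) by rewrite exprn_ge0// ltW.
  have X20 : 0 < x ^+ (m.+1 - 2 * n.+1) by rewrite exprn_gt0.
  move: hX X10 X20; move: (x ^+ (m.+1 - _)) (x ^+ (n.+1 * 2)) (F2.[_]) (G2.[_]) => X2 X1 f_ g_ hX X10 X20.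
  rewrite ler_pdivrMl// in hX.
  have -> : 8 * k1 ^+ 2 * (X1 * X2 * g_) = X1 * (X2 * (8 * k1 ^+ 2 * g_)) by ring.
  exact: ler_wpM2l.
have gp' (x : R) : 0 < x -> 0 < G^`().[x] by rewrite GE; exact: gp.
have G00 : G.[0] = 0 by exact: primitive_between0.
have Ginc (x y : R) : 0 <= x -> x < y -> G.[x] < G.[y].
  move=> x0 xy; apply: (@isd_incr R (horner G) (horner G^`())) => //; first exact: continuous_horner.
    by move=> t _; exact: is_derive_poly.
  by move=> t /andP[xt _]; apply: gp'; exact: le_lt_trans xt.
have Gge0 (x : R) : 0 <= x -> 0 <= G.[x].
  by rewrite le_eqVlt => /predU1P[<-|/(Ginc 0 x (lexx 0))/ltW]; rewrite G00.
(* Completing the square: 4 k (k (2 t + u^2) - |u y|) is at least (2 k |u| - |y|)^2. *)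
have split_ (k u y t : R) : 0 < k -> y ^+ 2 <= 8 * k ^+ 2 * t -> `|u * y| <= k * (2 * t + u ^+ 2).
  move=> k_0 h; rewrite normrM.
  have := sqr_ge0 (2 * k * `|u| - `|y|).
  rewrite -[u ^+ 2]real_normK ?num_real//.
  move: h; rewrite -[y ^+ 2]real_normK ?num_real//.
  move: (`|u|) (`|y|) => U Y h sq.
  have : 0 <= (4 * k) * (k * (2 * t + U ^+ 2) - U * Y) by nra.
  by rewrite pmulr_rge0 ?mulr_gt0//; lra.
have kk (k : R) : 0 < k < 1 -> k ^+ 2 < 1 by move=> /andP[p q]; rewrite expr_lt1// ltW.
have [MF [MF0 hMF]] := poly_bounded F d1^-1.
pose B0 := MF ^+ 2 + 1.
have B00 : 0 < B0 by rewrite ltr_wpDl// sqr_ge0.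
have all_ (x : R) : 0 <= x -> F.[x] ^+ 2 <= 8 * k1 ^+ 2 * G.[x] + B0.
  move=> x0; case: (leP d1^-1 x) => xd; first by apply: le_trans (nearoo _ xd) _; rewrite lerDl ltW.
  have : F.[x] ^+ 2 <= MF ^+ 2.
    by rewrite -[F.[x] ^+ 2]real_normK ?num_real// ler_sqr ?nnegrE// hMF// ger0_norm// ltW.
  move=> h; apply: le_trans h _; apply: (@le_trans _ _ B0); first by rewrite lerDl.
  rewrite lerDr; apply: mulr_ge0; last exact: Gge0.
  by apply: mulr_ge0; rewrite ?sqr_ge0.
pose k2 := (1 + k1) / 2.
have [k12 k21] : 0 < k2 - k1 /\ 0 < k2 < 1 by exact: halfway_to1.
have k1p : 0 < k1 by case/andP: k11.
(* Above R1 the constant B0 / (4 k1) fits into (k2 - k1) rho; above R2 the constant B0 fits into 4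
   (1 - k1^2) rho. *)
pose R1 := B0 / (4 * k1) / (k2 - k1).
pose R2 := B0 / (4 * (1 - k1 ^+ 2)).
have k1s : 0 < 1 - k1 ^+ 2 by rewrite subr_gt0; exact: kk.
pose R0 := Num.max (G.[d0]) (Num.max R1 R2).
have Gd0 : 0 < G.[d0] by rewrite -G00; exact: Ginc.
split.
- by rewrite G00 primitive_between0.
- by rewrite GE /g poly_between_horner big_nat big1// => i /andP[ri _]; rewrite expr0n gtn_eqF ?mulr0// (leq_trans r0).
- exact: gp'.
- have [|d dp hd] := @poly_pos_near0 (G2 - (G2.[0] / 2)%:P).
    by rewrite hornerD hornerN hornerC; move: G2p; clear -hrm hsn F G f g; lra.
  move=> Z; exists (Num.max 1 (Num.max d^-1 (2 * `|Z| / G2.[0]))) => x.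
  rewrite !ge_max => /andP[x1 /andP[xd xZ]].
  have xp : 0 < x by exact: lt_le_trans x1.
  rewrite hG2 ?gt_eqF//.
  have xi : 0 <= x^-1 <= d by rewrite invr_ge0 (ltW xp)/= -[d]invrK lef_pV2// posrE invr_gt0.
  have := hd _ xi; rewrite hornerD hornerN hornerC => h2.
  have h3 : x <= x ^+ m.+1 by rewrite exprS ler_peMr ?(ltW xp)// exprn_ege1.
  have h4 : `|Z| <= x * (G2.[0] / 2).
    by rewrite ler_pdivrMr// in xZ; move: xZ; clear -hrm hsn F G f g; lra.
  apply: le_trans (ler_norm _) _; apply: le_trans h4 _.
  by apply: ler_pM => //; [exact: ltW|move: G2p; clear -hrm hsn F G f g; lra|move: h2; clear -hrm hsn F G f g; lra].
- exists (Num.max k0 k2), G.[d0], R0; split.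
  + by move: k01 k21 => /andP[p q] /andP[p' q']; rewrite lt_max p /= gt_max q.
  + by rewrite Gd0 le_max lexx.
  + move=> x u x0 rp [rr|rr].
      have xd : x <= d0.
        rewrite leNgt; apply/negP => dx; have := Ginc _ _ (ltW d00) dx.
        by move: Gd0 rr; rewrite /rho; have := sqr_ge0 u; clear -hrm hsn F G f g; lra.
      have hF := near0 x (introT andP (conj x0 xd)).
      have k0p : 0 < k0 by case/andP: k01.
      split.
        apply: le_trans (split_ _ u _ _ k0p hF) _.
        by rewrite /rho ler_wpM2r ?(ltW rp)// le_max lexx.
      apply: le_trans hF _; rewrite /rho.
      have : k0 ^+ 2 * G.[x] <= 1 * G.[x] by rewrite ler_wpM2r ?Gge0// ltW// kk.
      by have := sqr_ge0 u; clear -hrm hsn F G f g; lra.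
    move: rr; rewrite !ge_max => /andP[_ /andP[rr1 rr2]].
    have hF := all_ x x0.
    have e1 : B0 / (4 * k1) <= (k2 - k1) * rho G x u by rewrite [leRHS]mulrC -ler_pdivrMr.
    have e2 : B0 <= 4 * (1 - k1 ^+ 2) * rho G x u by rewrite [leRHS]mulrC -ler_pdivrMr// mulr_gt0.
    split.
      have : `|u * F.[x]| <= k1 * (2 * (G.[x] + B0 / (8 * k1 ^+ 2)) + u ^+ 2).
        apply: split_ => //; rewrite mulrDr (_ : 8 * k1 ^+ 2 * (B0 / _) = B0)//.
        by field; rewrite gt_eqF.
      have -> : k1 * (2 * (G.[x] + B0 / (8 * k1 ^+ 2)) + u ^+ 2) = k1 * rho G x u + B0 / (4 * k1).
        by rewrite /rho; field; rewrite gt_eqF.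
      move=> h; apply: le_trans h _; apply: (@le_trans _ _ (k2 * rho G x u)); first by move: e1; clear -hrm hsn F G f g; lra.
      by rewrite ler_wpM2r ?(ltW rp)// le_max lexx orbT.
    apply: le_trans hF _; move: e2; rewrite /rho => e2.
    by have := mulr_ge0 (sqr_ge0 k1) (sqr_ge0 u); move: e2; clear -hrm hsn F G f g; lra.
Qed.

(** For phi = k x^(s+1) - A x^(s+2), the quantity phi (f - phi') - g is x^(2s+1) times a polynomial
    with constant term (s+1) k^2 - a' >= 0, where a' is the coefficient of g at that order. The
    remaining terms are x times P, and A is chosen so that P is at least 1 at 0; this decides the
    case where the constant term vanishes. *)
Lemma trap_near0 : 0 < b s -> (2 * s + 1 < r)%N \/ r = (2 * s + 1)%N /\ 2 * (r%:R + 1) * a r <= b s ^+ 2 ->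
  exists (phi : {poly R}) (d : R), [/\ 0 < d, phi.[0] = 0 & forall x, 0 < x <= d ->
    0 < phi.[x] /\ g.[x] < phi.[x] * (f.[x] - phi^`().[x])].
Proof.
move=> bs0 hc.
have [g1 [g10 hg1]] := @poly_between_low r m a hrm; rewrite -/g in hg1.
have [f1 [f10 hf1]] := @poly_between_low s n b hsn; rewrite -/f in hf1.
have [f2 hf2] := poly_cons f1; rewrite f10 in hf2.
have S0 : 0 < s%:R + 1 :> R by rewrite ltr_wpDl.
have [k [k0 bE]] : exists k, 0 < k /\ b s = 2 * (s%:R + 1) * k.
  exists (b s / (2 * (s%:R + 1))); split; first by rewrite divr_gt0// mulr_gt0.
  by field; rewrite gt_eqF.
have [a' [g3 [ha' hg]]] : exists a' g3, a' <= (s%:R + 1) * k ^+ 2 /\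
    forall x : R, g.[x] = x ^+ (2 * s + 1) * (a' + x * g3.[x]).
  case: hc => [lt|[rE hd]].
    exists 0, ('X^(r - (2 * s + 2)) * g1); split; first by rewrite mulr_ge0 ?sqr_ge0// ltW.
    move=> x; rewrite add0r hornerM hornerXn hg1 !mulrA -exprSr -exprD.
    by congr (x ^+ _ * _); lia.
  have [g2 hg2] := poly_cons g1; rewrite g10 in hg2.
  exists (a r), g2; split; last by move=> x; rewrite hg1 hg2 rE.
  move: hd; rewrite bE rE natrD natrM => hd.
  have : 0 <= 4 * (s%:R + 1) * ((s%:R + 1) * k ^+ 2 - a (2 * s + 1)%N) by lra.
  by rewrite pmulr_rge0 ?mulr_gt0//; lra.
have [A [kA A0]] : exists A, k * A = `|k * f2.[0]| + `|g3.[0]| + 1 /\ 0 < A.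
  exists ((`|k * f2.[0]| + `|g3.[0]| + 1) / k); split; first by rewrite mulrC divfK// gt_eqF.
  by rewrite divr_gt0// ltr_wpDl// addr_ge0.
pose P := k *: f2 + (k * A)%:P - g3 - A *: ('X * (f2 + ((s%:R + 2) * A)%:P)).
have [|d d0 hd] := @poly_pos_near0 P.
  rewrite /P !(hornerD, hornerN, hornerZ, hornerC, hornerM, hornerX) mul0r mulr0 subr0 kA.
  by have := ler_norm (- (k * f2.[0])); have := ler_norm g3.[0]; rewrite normrN; lra.
exists (k *: 'X^(s.+1) - A *: 'X^(s.+2)), (Num.min d (k / A / 2)); split.
- by rewrite lt_min d0 !divr_gt0.
- by rewrite hornerD hornerN !hornerZ !hornerXn !expr0n !mulr0 subrr.
- move=> x /andP[x0]; rewrite le_min => /andP[xd xk].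
  have kx : 0 < k - A * x.
    have : A * x <= A * (k / A / 2) by rewrite ler_wpM2l// ltW.
    by rewrite (_ : A * (k / A / 2) = k / 2); [lra|field; rewrite gt_eqF].
  have xs : 0 < x ^+ s.+1 by rewrite exprn_gt0.
  rewrite !(derivD, derivN, derivZ, derivXn) !(hornerMn, hornerD, hornerN, hornerZ, hornerXn) !succnK hf1 hf2 hg.
  have -> : k * x ^+ s.+1 - A * x ^+ s.+2 = x ^+ s.+1 * (k - A * x) by rewrite !exprS; ring.
  split; first exact: mulr_gt0.
  have := hd x (introT andP (conj (ltW x0) xd)).
  rewrite /P !(hornerD, hornerN, hornerZ, hornerC, hornerM, hornerX) => hP.
  rewrite expr_odd_split.
  have -> : x ^+ s * (b s + x * f2.[x]) - (k * (x ^+ s *+ s.+1) - A * (x ^+ s.+1 *+ s.+2)) =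
     x ^+ s * ((s%:R + 1) * k + x * (f2.[x] + (s%:R + 2) * A)).
    by rewrite bE -(mulr_natr (x ^+ s)) -(mulr_natr (x ^+ s.+1)) exprS -!natr1; ring.
  rewrite -!mulrA ltr_pM2l// [X in _ < X]mulrCA ltr_pM2l ?exprn_gt0//.
  have : 0 < x * (k * f2.[x] + k * A - g3.[x] - A * (x * (f2.[x] + (s%:R + 2) * A))) by exact: mulr_gt0.
  by lra.
Qed.

(** The computation near 0 repeated in powers of 1/x. The correction now has lower degree than the
    main term k x^(n+1), which reverses its sign: + A x^n. *)
Lemma trap_infty : b n < 0 -> (m < 2 * n + 1)%N \/ m = (2 * n + 1)%N /\ 4 * (n%:R + 1) * a m <= b n ^+ 2 ->
  exists (phi : {poly R}) (M : R), 0 < M /\ forall x, M <= x ->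
    0 < phi.[x] /\ g.[x] < phi.[x] * (- f.[x] - phi^`().[x]).
Proof.
move=> bn0 hc.
have [g1 [g10 hg1]] := @poly_between_high r m a hrm; rewrite -/g in hg1.
have [f1 [f10 hf1]] := @poly_between_high s n b hsn; rewrite -/f in hf1.
have [f2 hf2] := poly_cons f1; rewrite f10 in hf2.
have S0 : 0 < n%:R + 1 :> R by rewrite ltr_wpDl.
have [k [k0 bE]] : exists k, 0 < k /\ b n = - (2 * (n%:R + 1) * k).
  exists (- b n / (2 * (n%:R + 1))); split; first by rewrite divr_gt0 ?oppr_gt0// mulr_gt0.
  by field; rewrite gt_eqF.
have [a' [g3 [ha' hg]]] : exists a' g3, a' <= (n%:R + 1) * k ^+ 2 /\
    forall x : R, x != 0 -> g.[x] = x ^+ (2 * n + 1) * (a' + x^-1 * g3.[x^-1]).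
  case: hc => [lt|[mE hd]].
    exists 0, ('X^(2 * n - m) * g1); split; first by rewrite mulr_ge0 ?sqr_ge0// ltW.
    move=> x x0; rewrite add0r hornerM hornerXn hg1// -(@expr_invr x m (2 * n + 1))//; last by lia.
    by rewrite (_ : (2 * n + 1 - m = (2 * n - m).+1)%N) ?[in LHS]exprS; [ring|lia].
  have [g2 hg2] := poly_cons g1; rewrite g10 in hg2.
  exists (a m), g2; split; last by move=> x x0; rewrite hg1// hg2 mE.
  move: hd; rewrite bE => hd.
  have : 0 <= 4 * (n%:R + 1) * ((n%:R + 1) * k ^+ 2 - a m) by lra.
  by rewrite pmulr_rge0 ?mulr_gt0//; lra.
have [A [kA A0]] : exists A, k * A = `|k * f2.[0]| + `|g3.[0]| + 1 /\ 0 < A.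
  exists ((`|k * f2.[0]| + `|g3.[0]| + 1) / k); split; first by rewrite mulrC divfK// gt_eqF.
  by rewrite divr_gt0// ltr_wpDl// addr_ge0.
pose P := - k *: f2 + (k * A)%:P - g3 - A *: ('X * (f2 + (n%:R * A)%:P)).
have [|d d0 hd] := @poly_pos_near0 P.
  rewrite /P !(hornerD, hornerN, hornerZ, hornerC, hornerM, hornerX) mul0r mulr0 subr0 kA.
  by have := ler_norm (k * f2.[0]); have := ler_norm g3.[0]; lra.
exists (k *: 'X^(n.+1) + A *: 'X^n), d^-1; split; first by rewrite invr_gt0.
move=> x xd; have xp : 0 < x by apply: lt_le_trans xd; rewrite invr_gt0.
have x0 : x != 0 by rewrite gt_eqF.
have xi : 0 <= x^-1 <= d by rewrite invr_ge0 (ltW xp)/= -[d]invrK lef_pV2// posrE invr_gt0.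
have ei : 0 < x^-1 by rewrite invr_gt0.
rewrite !(derivD, derivN, derivZ, derivXn) !(hornerMn, hornerD, hornerN, hornerZ, hornerXn) !succnK hf1// hf2 hg//.
have -> : k * x ^+ n.+1 + A * x ^+ n = x ^+ n.+1 * (k + A * x^-1).
  by rewrite exprS; field.
have kx : 0 < k + A * x^-1 by rewrite addr_gt0// mulr_gt0.
split; first by rewrite mulr_gt0// exprn_gt0.
have := hd _ xi.
rewrite /P !(hornerD, hornerN, hornerZ, hornerC, hornerM, hornerX) => hP.
(* For n = 0 the predecessor is truncated, but the factor n annihilates both sides. *)
have dX : x ^+ n.-1 *+ n = x ^+ n * (n%:R * x^-1).
  case: (n) => [|j]; first by rewrite mulr0n mul0r mulr0.
  by rewrite /= exprS -mulr_natr; field.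
rewrite expr_odd_split.
have -> : - (x ^+ n * (b n + x^-1 * f2.[x^-1])) - (k * (x ^+ n *+ n.+1) + A * (x ^+ n.-1 *+ n)) =
     x ^+ n * ((n%:R + 1) * k - x^-1 * (f2.[x^-1] + n%:R * A)).
  by rewrite bE dX -[_ *+ _.+1]mulr_natr -addn1 natrD; ring.
rewrite -!mulrA ltr_pM2l ?exprn_gt0// [X in _ < X]mulrCA ltr_pM2l ?exprn_gt0//.
have := mulr_gt0 ei hP; move: (x^-1) => e h.
by lra.
Qed.

End Conditions.
End Asymptotics.

(** * Necessity of the conditions *)

Section Necessity.
Variable R : realType.
Implicit Types (G F phi : {poly R}) (x u : R -> R) (a b T t : R).

(** What necessity takes from the global center property, expressed in the coordinates (x, u):
    through every point but the origin there is a periodic solution that is not constant. *)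
Definition closed_orbits G F := forall x0 u0 : R, (x0, u0) <> (0, 0) ->
  exists (T : R) (x u : R -> R), [/\ 0 < T, forall t, lienard G F x u t,
    forall t, x (t + T) = x t /\ u (t + T) = u t,
    x 0 = x0 /\ u 0 = u0 & ~ forall t, x t = x0 /\ u t = u0].

Lemma lienard_at_cst G F (x0 u0 : R) t : G^`().[x0] = 0 -> u0 = F.[x0] ->
  lienard G F (fun=> x0) (fun=> u0) t.
Proof.
move=> g0 ->; split; first by apply: (isd_eq (isd_cst x0 t)); rewrite subrr.
by apply: (isd_eq (isd_cst F.[x0] t)); rewrite g0 oppr0.
Qed.

Lemma closed_orbits_opp G F : closed_orbits G F -> closed_orbits G (- F).
Proof.
move=> h x0 u0 n0; have [|T [x [u [T0 hl hp [e1 e2] hn]]]] := h x0 (- u0).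
  by move=> [e1 e2]; apply: n0; rewrite e1 -[u0]opprK e2 oppr0.
exists T, (fun t => x (0 - t)), (fun t => - u (0 - t)); split => //.
- by move=> t; exact: lienard_rev.
- move=> t; have [] := hp (0 - (t + T)).
  by rewrite (_ : 0 - (t + T) + T = 0 - t) => [->->|]; last ring.
- by rewrite subr0 e1 e2 opprK.
- move=> hc; apply: hn => t; have [] := hc (- t); rewrite sub0r opprK => -> h2.
  by rewrite -h2 opprK.
Qed.

Lemma closed_orbits_refl G F : closed_orbits G F -> closed_orbits (refl G) (refl F).
Proof.
move=> h x0 u0 n0; have [|T [x [u [T0 hl hp [e1 e2] hn]]]] := h (- x0) u0.
  by move=> [e1 e2]; apply: n0; rewrite e2 -[x0]opprK e1 oppr0.
exists T, (fun t => - x (0 - t)), (fun t => u (0 - t)); split => //.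
- by move=> t; exact: lienard_refl.
- move=> t; have [] := hp (0 - (t + T)).
  by rewrite (_ : 0 - (t + T) + T = 0 - t) => [->->|]; last ring.
- by rewrite subr0 e1 e2 opprK.
- move=> hc; apply: hn => t; have [] := hc (- t); rewrite sub0r opprK => h1 ->.
  by rewrite -h1 opprK.
Qed.

Lemma isd_velocity G F x u t : lienard G F x u t ->
  isd (fun s => u s - F.[x s]) t (- G^`().[x t] - F^`().[x t] * (u t - F.[x t])).
Proof. by move=> [hx hu]; der. Qed.

Lemma continuous_velocity F x u : continuous x -> continuous u ->
  continuous (fun s => u s - F.[x s]).
Proof. by move=> cx cu t; apply: (@continuousB _ _ _ u (fun s => F.[x s])); [exact: cu|exact: cont_horner_comp]. Qed.

Section Orbits.
Variables (G F : {poly R}).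
Hypothesis co : closed_orbits G F.

Lemma closed_orbits_regular (x0 : R) : x0 != 0 -> G^`().[x0] != 0.
Proof.
move=> n0; apply/eqP => g0.
have [|T [x [u [T0 hl hp [e1 e2] hn]]]] := co (x0 := x0) (u0 := F.[x0]).
  by move=> [e _]; rewrite e eqxx in n0.
by apply: hn; apply: (lienard_global_uniq hl) => // t; exact: lienard_at_cst.
Qed.

Lemma closed_orbits_returns x u T : 0 < T -> (forall t, x (t + T) = x t) ->
  (forall t, 0 <= t <= T -> 0 < u t - F.[x t]) -> ~ (forall t, lienard G F x u t).
Proof.
move=> T0 hp h hl; have [cx cu] := lienard_cont hl.
have : x 0 < x T.
  apply: (@isd_incr R x (fun t => u t - F.[x t]) 0 T T0 cx) => t /andP[t0 tT].
    by case: (hl t).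
  by apply: h; rewrite !ltW.
by rewrite -{1}[T]add0r hp ltxx.
Qed.

(** If g were negative at x0 it would be negative on all of [x0, oo), as it has no zero there. An
    orbit that starts at x0 with velocity y = 1 then keeps y > 0, because y' = - g > 0 at a first
    zero of y; its x only increases and it cannot return. *)
Lemma closed_orbits_pos (x0 : R) : 0 < x0 -> 0 < G^`().[x0].
Proof.
move=> x00; have g0 := closed_orbits_regular (lt0r_neq0 x00).
rewrite lt_neqAle eq_sym g0 /= leNgt; apply/negP => gneg.
have gn (x1 : R) : x0 <= x1 -> G^`().[x1] < 0.
  move=> x01; rewrite ltNge; apply/negP => gp.
  have [c /andP[c1 _] c0] := @IVT_eq R (horner G^`()) x0 x1 0 (@continuous_horner _ _) x01
     (or_introl (introT andP (conj (ltW gneg) gp))).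
  by have := closed_orbits_regular (lt0r_neq0 (lt_le_trans x00 c1)); rewrite c0 eqxx.
have [|T [x [u [T0 hl hp [e1 e2] hn]]]] := co (x0 := x0) (u0 := F.[x0] + 1).
  by move=> [e _]; move: x00; rewrite e ltxx.
have [cx cu] := lienard_cont hl.
apply: (@closed_orbits_returns x u T T0 _ _ hl); first by move=> t; case: (hp t).
move=> T1 /andP[T10 _]; rewrite ltNge; apply/negP => y1.
have y0 : 0 < u 0 - F.[x 0] by rewrite e1 e2 addrAC subrr add0r.
have [s [/andP[s0 sT] ys hy]] := first_zero (@continuous_velocity F x u cx cu) T10 y0 y1.
have xs : x0 <= x s.
  rewrite -e1; apply: (@isd_nondecr R x (fun t => u t - F.[x t]) 0 s (ltW s0) cx) => t /andP[t0 ts].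
    by case: (hl t).
  by apply/ltW/hy; rewrite (ltW t0).
have := @isd_left_le0 R _ 0 s _ s0 (isd_velocity (hl s)).
rewrite ys mulr0 subr0 => /(_ _)/wrap[t /hy/ltW //|].
by rewrite oppr_le0 leNgt gn.
Qed.

End Orbits.

(** * Regions from which orbits do not return *)

Section Traps.
Variables (G F : {poly R}).
Hypothesis co : closed_orbits G F.

(** The region 0 < x <= d, - phi (x) < y < 0 is forward invariant. On y = 0 the field gives y' = - g
    < 0, on y = - phi it gives (y + phi)' = phi (f - phi') - g > 0, and the corner at the origin is
    excluded by uniqueness. Inside it x decreases, so its orbits are not periodic. *)
Lemma closed_orbits_not_trap_near0 phi (d : R) : G^`().[0] = 0 -> F.[0] = 0 ->
  0 < d -> phi.[0] = 0 ->
  ~ forall y, 0 < y <= d -> 0 < phi.[y] /\ G^`().[y] < phi.[y] * (F^`().[y] - phi^`().[y]).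
Proof.
move=> g0 F0 d0 phi0 hphi.
have gp := closed_orbits_pos co.
have [pd _] := hphi d (introT andP (conj d0 (lexx _))).
have [|T [x [u [T0 hl hp [e1 e2] hn]]]] := co (x0 := d) (u0 := F.[d] - phi.[d] / 2).
  by move=> [e _]; move: d0; rewrite e ltxx.
have [cx cu] := lienard_cont hl.
have no t : x t = 0 -> u t = 0 -> False.
  move=> ex eu; apply: hn => s.
  have hs c : x c = 0 /\ u c = 0.
    have [||||] := @lienard_global_uniq R G F (fun s => x (s + t)) (fun s => u (s + t)) (fun=> 0) (fun=> 0) _ _ _ _ (c - t).
    - by move=> t0; exact: lienard_shift.
    - by move=> t0; apply: lienard_at_cst.
    - by rewrite add0r.
    - by rewrite add0r.
    - by rewrite subrK.
  by move: d0; rewrite -e1; case: (hs 0) => ->; rewrite ltxx.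
pose y t := u t - F.[x t].
have cy : continuous y by exact: continuous_velocity.
pose w t := y t + phi.[x t].
have cw : continuous w by move=> t; apply: (@continuousD _ _ _ y (fun s => phi.[x s])); [exact: cy|exact: cont_horner_comp].
(* The first zero of the minimum of the three defining quantities is the first exit from the region,
   whichever side it uses. *)
pose q t := Num.min (Num.min (- y t) (w t)) (x t).
have cq : continuous q.
  move=> t; apply: (@continuous_min R R (fun t => Num.min (- y t) (w t)) x); [apply: (@continuous_min R R (fun t => - y t) w); [apply: (@continuousN _ _ _ y); exact: cy|exact: cw]|exact: cx].
have y0 : y 0 = - (phi.[d] / 2) by rewrite /y e1 e2; ring.
have q0 : 0 < q 0.
  by rewrite /q !lt_min /w y0 e1 d0 andbT; apply/andP; split; lra.
have qT T1 : 0 <= T1 -> 0 < q T1.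
  move=> T10; rewrite ltNge; apply/negP => q1.
  have [s [/andP[s0 _] qs hq]] := first_zero cq T10 q0 q1.
  have hq' t : 0 <= t < s -> [/\ 0 < - y t, 0 < w t & 0 < x t].
    by move=> /hq; rewrite /q !lt_min => /andP[/andP[]].
  have xs : x s <= d.
    rewrite -e1; apply: (@isd_nonincr R x y 0 s (ltW s0) cx) => t /andP[t0 ts].
      by case: (hl t).
    by have [|h _ _] := hq' t; [rewrite (ltW t0)|lra].
  have : (0 <= - y s) && (0 <= w s) && (0 <= x s) by rewrite -!le_min -/(q s) qs.
  case/andP => /andP[ys ws] xs0.
  have dy := isd_velocity (hl s); rewrite -/(y s) in dy.
  have dw : isd w s (- G^`().[x s] - F^`().[x s] * y s + phi^`().[x s] * y s).
    by apply: isdD => //; apply: isd_horner; case: (hl s).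
  have [x0|xn0] := eqVneq (x s) 0.
    have y00 : y s = 0 by move: ws ys; rewrite /w x0 phi0; lra.
    by apply: (no s) => //; move: y00; rewrite /y x0 F0; lra.
  have xp : 0 < x s by rewrite lt_neqAle eq_sym xn0.
  have [p1 p2] := hphi (x s) (introT andP (conj xp xs)).
  have [w0|wn0] := eqVneq (w s) 0.
    have := @isd_left_le0 R w 0 s _ s0 dw; rewrite w0 => /(_ _)/wrap[t /hq'[_ /ltW] //|].
    have -> : y s = - phi.[x s] by move: w0; rewrite /w; lra.
    by lra.
  have y00 : y s = 0.
    apply/eqP; apply: contraT => yn0; move: (qs); suff : 0 < q s by move=> + e; rewrite e ltxx.
    by rewrite /q !lt_min xp andbT !lt_neqAle ws ys !andbT eq_sym oppr_eq0 yn0 eq_sym wn0.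
  have := @isd_left_le0 R (fun t => - y t) 0 s _ s0 (isdN dy); rewrite y00 oppr0 => /(_ _)/wrap[t /hq'[/ltW] //|].
  by have := gp _ xp; lra.
have : x T < x 0.
  apply: (@isd_decr R x y 0 T T0 cx) => t /andP[t0 tT]; first by case: (hl t).
  by have := qT t (ltW t0); rewrite /q !lt_min => /andP[/andP[h _] _]; lra.
by rewrite -{1}[T]add0r; case: (hp 0) => -> _; rewrite ltxx.
Qed.

(** The region x >= M, y > phi (x) is forward invariant: x increases in it, so only the side y = phi
    remains, where (y - phi)' = phi (- f - phi') - g > 0. *)
Lemma closed_orbits_not_trap_infty phi (M : R) : 0 < M ->
  ~ forall y, M <= y -> 0 < phi.[y] /\ G^`().[y] < phi.[y] * (- F^`().[y] - phi^`().[y]).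
Proof.
move=> M0 hphi.
have [|T [x [u [T0 hl hp [e1 e2] hn]]]] := co (x0 := M) (u0 := F.[M] + phi.[M] + 1).
  by move=> [e _]; move: M0; rewrite e ltxx.
have [cx cu] := lienard_cont hl.
pose y t := u t - F.[x t].
pose w t := y t - phi.[x t].
have cw : continuous w.
  by move=> t; apply: (@continuousB _ _ _ y (fun s => phi.[x s])); [exact: continuous_velocity|exact: cont_horner_comp].
have w0 : 0 < w 0 by rewrite /w /y e1 e2 (_ : _ - _ = 1)//; ring.
apply: (@closed_orbits_returns G F x u T T0 _ _ hl); first by move=> t; case: (hp t).
have wT T1 : 0 <= T1 -> 0 < w T1 /\ M <= x T1.
  have xM t1 : 0 <= t1 -> (forall t, 0 <= t < t1 -> 0 < w t) -> M <= x t1.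
    move=> t10 hw; rewrite leNgt; apply/negP => xt.
    have [|||s [/andP[s1 s2] xs hs]] := @last_zero R (fun t => M - x t) 0 t1 _ t10 _ _.
    - by move=> t; apply: (@continuousB _ _ _ (fun=> M) x); [exact: cst_continuous|exact: cx].
    - by rewrite e1 subrr.
    - by rewrite subr_gt0.
    have hM : phi.[M] > 0 by case: (hphi M (lexx _)).
    have xsM : x s = M by lra.
    have dx : isd (fun t => M - x t) s (0 - y s) by apply: isdB; [exact: isd_cst|case: (hl s)].
    have := @isd_right_ge0 R _ t1 s _ s2 dx; rewrite xs => /(_ _)/wrap[t /hs/ltW //|].
    have := hw s; rewrite s1 s2 => /(_ isT); rewrite /w xsM; lra.
  move=> T10; suff wp t : 0 <= t -> 0 < w t.
    by split; [exact: wp|apply: xM => // t /andP[t0 _]; exact: wp].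
  move=> t0; rewrite ltNge; apply/negP => w1.
  have [s [/andP[s0 _] ws hw]] := first_zero cw t0 w0 w1.
  have [p1 p2] := hphi _ (xM s (ltW s0) hw).
  have dy := isd_velocity (hl s); rewrite -/(y s) in dy.
  have dw : isd w s (- G^`().[x s] - F^`().[x s] * y s - phi^`().[x s] * y s).
    by apply: isdB => //; apply: isd_horner; case: (hl s).
  have := @isd_left_le0 R w 0 s _ s0 dw; rewrite ws => /(_ _)/wrap[t' /hw/ltW //|].
  have -> : y s = phi.[x s] by move: ws; rewrite /w; lra.
  by lra.
move=> t /andP[t0 _]; have [h1 h2] := wT t t0; have [h3 _] := hphi _ h2.
by move: h1; rewrite /w /y; lra.
Qed.

End Traps.

(** Near 0 the factor p has the sign of p (0), so y^(k+1) p (0) > 0 for small y of both signs.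
    Applied to the factor of g at infinity, in the variable 1/x, it gives the parity and sign of the
    top term. *)
Lemma odd_sign_near0 (k : nat) (p : {poly R}) : p.[0] != 0 ->
  (forall y : R, y != 0 -> 0 < y ^+ k.+1 * p.[y]) -> odd k /\ 0 < p.[0].
Proof.
move=> c0 h; have [q hq] := poly_cons p; set c := p.[0] in c0 hq *.
have cp : 0 < `|c| by rewrite normr_gt0.
have [d [d0 hd]] : exists d : R, 0 < d /\ forall y : R, `|y| <= d -> 0 < c * p.[y].
  have [M [M0 hM]] := poly_bounded q 1.
  have M10 : 0 < M + 1 by rewrite ltr_wpDl.
  exists (Num.min 1 (`|c| / (M + 1) / 2)); split.
    by rewrite lt_min ltr01 !divr_gt0.
  move=> y; rewrite le_min => /andP[y1 yd].
  have h1 : `|y * q.[y]| <= `|c| / 2.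
    rewrite normrM; apply: (@le_trans _ _ (`|c| / (M + 1) / 2 * M)).
      by apply: ler_pM => //; exact: hM.
    rewrite [leLHS](_ : _ = `|c| / 2 * (M / (M + 1))); last by field; rewrite gt_eqF.
    by rewrite ger_pMr ?divr_gt0// ler_pdivrMr//; lra.
  rewrite hq mulrDr; have := ler_norm (- (c * (y * q.[y]))).
  rewrite normrN normrM -expr2 -[c ^+ 2]real_normK ?num_real// => h2.
  have h3 : `|c| * `|y * q.[y]| <= `|c| * (`|c| / 2) by rewrite ler_wpM2l.
  have : 0 < `|c| ^+ 2 by rewrite exprn_gt0.
  by lra.
have hpos (y : R) : y != 0 -> `|y| <= d -> 0 < y ^+ k.+1 * c.
  move=> y0 yd; have := mulr_gt0 (h y y0) (hd y yd).
  rewrite (_ : y ^+ k.+1 * p.[y] * (c * p.[y]) = (y ^+ k.+1 * c) * p.[y] ^+ 2); last by ring.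
  rewrite pmulr_lgt0// lt_neqAle sqr_ge0 andbT eq_sym expf_neq0//.
  by apply: contraTneq (hd y yd) => ->; rewrite mulr0 ltxx.
have c1 : 0 < c.
  by have := hpos d (lt0r_neq0 d0); rewrite gtr0_norm// lexx => /(_ isT); rewrite pmulr_rgt0// exprn_gt0.
split => //; have := hpos (- d); rewrite oppr_eq0 lt0r_neq0// normrN gtr0_norm// lexx => /(_ isT isT).
rewrite exprNn pmulr_lgt0// -signr_odd /=; case: (odd k) => //=.
by rewrite expr1 mulN1r oppr_gt0 ltNge exprn_ge0// ltW.
Qed.

Lemma odd_signs (r m : nat) (c : nat -> R) : (r <= m)%N -> c r != 0 -> c m != 0 ->
  (forall y : R, y != 0 -> 0 < y * (poly_between r m c).[y]) ->
  [/\ odd r, 0 < c r, odd m & 0 < c m].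
Proof.
move=> rm cr cm h; have [p [p0 hp]] := @poly_between_low R r m c rm.
have [q [q0 hq]] := @poly_between_high R r m c rm.
have [||or c1] := @odd_sign_near0 r p; first by rewrite p0.
  by move=> y y0; have := h y y0; rewrite hp mulrA -exprS.
have [||om c2] := @odd_sign_near0 m q; first by rewrite q0.
  move=> y y0; have yi : y^-1 != 0 by rewrite invr_eq0.
  have := h _ yi; rewrite hq// invrK mulrA -exprS => h1.
  have ym : y ^+ m.+1 != 0 by rewrite expf_neq0.
  have -> : y ^+ m.+1 * q.[y] = (y^-1 ^+ m.+1 * q.[y]) * (y ^+ m.+1) ^+ 2.
    by rewrite exprVn; move: (y ^+ m.+1) ym => z z0; field.
  by rewrite mulr_gt0// lt_neqAle sqr_ge0 andbT eq_sym expf_neq0.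
by rewrite -p0 -q0.
Qed.

Lemma orbit_half_orbit G F a b T x u X U t0 t : (forall s, lienard G F X U s) ->
  half_orbit G F a b T x u -> 0 <= t <= T -> X t0 = x t -> U t0 = u t ->
  (exists t1, X t1 = 0 /\ U t1 = a) /\ (exists t2, X t2 = 0 /\ U t2 = b).
Proof.
move=> hl [[a0 b0 T0] [cx cu] [x0 u0 xT uT] _ hl'] tI ex eu.
have [cX cU] := lienard_cont hl.
have h := @lienard_uniq R G F 0 T t (fun s => X (s + (t0 - t))) (fun s => U (s + (t0 - t))) x u
  (@cont_shift R X (t0 - t) cX) (@cont_shift R U (t0 - t) cU) cx cu.
have {}h s : 0 <= s <= T -> X (s + (t0 - t)) = x s /\ U (s + (t0 - t)) = u s.
  apply: h => //; first by move=> s' _; exact: lienard_shift.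
  - by move=> s' /andP[s0 sT]; apply: hl'; rewrite !ltW.
  - by rewrite addrC subrK.
  - by rewrite addrC subrK.
split.
  by exists (0 + (t0 - t)); have := h 0; rewrite lexx (ltW T0) x0 u0; apply.
by exists (T + (t0 - t)); have := h T; rewrite lexx (ltW T0) xT uT; apply.
Qed.

(** * Closed orbits give left and right arcs the same bottom *)

Section ClosedArcs.
Variables (G F : {poly R}).
Hypotheses (rd : right_data G F) (rdl : right_data (refl G) (refl F)).
Hypothesis co : closed_orbits G F.

Let orbit_left a b T x u X U t0 t : (forall s, lienard G F X U s) ->
  half_orbit (refl G) (refl F) a b T x u -> 0 <= t <= T -> - X t0 = x t -> U t0 = u t ->
  (exists t1, X t1 = 0 /\ U t1 = a) /\ (exists t2, X t2 = 0 /\ U t2 = b).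
Proof.
move=> hl ha tI ex eu.
have hl' s : lienard (refl G) (refl F) (fun s => - X (0 - s)) (fun s => U (0 - s)) s.
  exact: lienard_refl.
have [||[t1 [h1 h2]] [t2 [h3 h4]]] := @orbit_half_orbit (refl G) (refl F) a b T x u _ _ (- t0) t hl' ha tI.
- by rewrite sub0r opprK.
- by rewrite sub0r opprK.
by split; [exists (0 - t1)|exists (0 - t2)]; split => //; apply: oppr_inj; rewrite oppr0.
Qed.

(** A closed orbit may a priori cross the u-axis many times. Let aM be its highest crossing. Both
    arcs from aM belong to the orbit; if their bottoms differed, the arc on the other side ending at
    the lower bottom would start above aM by monotonicity of bottoms, yet belong to the same orbit.
    So the arcs from aM close up into a loop, which is the whole orbit, and its only crossing with u
    > 0 is aM; hence a = aM. *)
Lemma closed_orbits_bottom a b b' T x u T' x' u' :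
  half_orbit G F a b T x u -> half_orbit (refl G) (refl F) a b' T' x' u' -> b = b'.
Proof.
move=> ha hb; have a0 : 0 < a by case: ha => -[].
have [|tau [X [U [tau0 hl hp [X0 U0] _]]]] := co (x0 := 0) (u0 := a).
  by move=> [e]; move: a0; rewrite e ltxx.
have [cX cU] := lienard_cont hl.
pose K := [set t : R | 0 <= t <= tau /\ X t = 0].
have K0 : K !=set0 by exists 0; rewrite /K /= lexx ltW.
have cK : compact K.
  apply: (@subclosed_compact _ _ `[0, tau]); [|exact: segment_compact|by move=> t [h _]; rewrite /= in_itv].
  rewrite (_ : K = `[0, tau] `&` X @^-1` [set 0]); last first.
    by apply/seteqP; split => t; rewrite /K /= in_itv /=.
  apply: closedI; first exact: itv_closed.
  by apply: closed_comp => [t _|]; [exact: cX|exact: closed_eq].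
have [tM + hM] := compact_EVT_max K0 cK (continuous_subspaceT cU).
rewrite inE => -[tMI XM]; pose aM := U tM.
have top t : X t = 0 -> U t <= aM.
  move=> Xt; have [t1 [k [t1I et]]] := mod_period t tau0.
  have hx : forall t, X (t + tau) = X t by move=> s; case: (hp s).
  have hu : forall t, U (t + tau) = U t by move=> s; case: (hp s).
  move: Xt; rewrite et (periodic_int hx) (periodic_int hu) => Xt.
  by apply: hM; rewrite inE; split => //; case/andP: t1I => -> /ltW.
have aM0 : 0 < aM by apply: lt_le_trans a0 _; rewrite -U0; exact: top.
have [bM [TM [xM [uM hMr]]]] := arc_top rd aM0.
have [bL [TL [xL [uL hMl]]]] := arc_top rdl aM0.
have st G' F' (al be S : R) y v : half_orbit G' F' al be S y v -> 0 <= (0 : R) <= S /\ 0 <= S <= S.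
  by case=> -[_ _ S0] *; rewrite !lexx ltW.
have [_ [tb [Xb Ub]]] : (exists t1, X t1 = 0 /\ U t1 = aM) /\ (exists t2, X t2 = 0 /\ U t2 = bM).
  case: (hMr) (st _ _ _ _ _ _ _ hMr) => _ _ [e1 e2 _ _] _ _ [h _].
  by apply: (orbit_half_orbit hl hMr h (t0 := tM)); rewrite ?e1 ?e2.
have [_ [tc [Xc Uc]]] : (exists t1, X t1 = 0 /\ U t1 = aM) /\ (exists t2, X t2 = 0 /\ U t2 = bL).
  case: (hMl) (st _ _ _ _ _ _ _ hMl) => _ _ [e1 e2 _ _] _ _ [h _].
  by apply: (orbit_left hl hMl h (t0 := tM)); rewrite ?e1 ?e2 ?XM ?oppr0.
have bot G' F' be : right_data G' F' -> be < 0 -> exists al S y v, half_orbit G' F' al be S y v.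
  move=> rd' be0; have [|be' [S [y [v hh]]]] := arc_top (right_data_opp rd') (a := - be).
    by rewrite oppr_gt0.
  have := arc_rev hh; rewrite !opprK => hh'.
  by exists (- be'), S; eexists; eexists; exact: hh'.
have bE : bM = bL.
  apply: le_anti; apply/andP; split.
    have bL0 : bL < 0 by case: hMl => -[].
    have [al [S [y [v hh]]]] := bot _ _ _ rd bL0.
    rewrite leNgt -(arc_bot_decr rd hMr hh) -leNgt.
    case: (hh) (st _ _ _ _ _ _ _ hh) => _ _ [_ _ e1 e2] _ _ [_ h].
    have [||[t1 [h1 <-]] _] := orbit_half_orbit hl hh h (t0 := tc); rewrite ?e1 ?e2//.
    exact: top.
  have bM0 : bM < 0 by case: hMr => -[].
  have [al [S [y [v hh]]]] := bot _ _ _ rdl bM0.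
  rewrite leNgt -(arc_bot_decr rdl hMl hh) -leNgt.
  case: (hh) (st _ _ _ _ _ _ _ hh) => _ _ [_ _ e1 e2] _ _ [_ h].
  have [||[t1 [h1 <-]] _] := orbit_left hl hh h (t0 := tb); rewrite ?e1 ?e2 ?Xb ?oppr0//.
  exact: top.
rewrite -bE in hMl.
have [y [v hloop]] := arcs_loop hMr hMl.
have [[_ _ _ _] hl' _ [y0 v0 _ _] _] := hloop.
have hs t : lienard G F (fun s => X (s + tM)) (fun s => U (s + tM)) t by exact: lienard_shift.
have eqv := lienard_global_uniq hs hl' (_ : X (0 + tM) = y 0) (_ : U (0 + tM) = v 0).
have [||aE _] := loop_axis hloop (t := - tM).
- by have [||<- _] := eqv _ _ (- tM); rewrite ?addNr ?add0r ?XM ?y0 ?v0.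
- by left; have [||_ <-] := eqv _ _ (- tM); rewrite ?addNr ?U0 ?add0r ?XM ?y0 ?v0.
have {}aE : a = aM by rewrite -aE; have [||_ <-] := eqv _ _ (- tM); rewrite ?addNr ?U0 ?add0r ?XM ?y0 ?v0.
move: ha hb; rewrite aE => ha hb.
by have [-> _ _] := arc_uniq_top ha hMr; have [-> _ _] := arc_uniq_top hb hMl.
Qed.

End ClosedArcs.

Lemma single_sign_change (h dh : R -> R) (t0 b c : R) : continuous h ->
  (forall t, b < t < c -> isd h t (dh t)) ->
  (forall t, b < t < c -> h t = 0 -> dh t < 0) -> b < t0 < c -> h t0 = 0 ->
  (forall t, t0 < t < c -> h t < 0) /\ (forall t, b < t < t0 -> 0 < h t).
Proof.
move=> ch dd hd t0I h0; have /andP[bt tc] := t0I.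
have [e e0 [r l]] := isd_lt0_near (dd t0 t0I) (hd t0 t0I h0).
rewrite h0 in r l; split=> t /andP[t1 t2]; rewrite ltNge; apply/negP => ht.
  pose s0 := Num.min t (t0 + e / 2).
  have [s1 s2] : t0 < s0 /\ s0 <= t by rewrite lt_min t1 ltrDl divr_gt0// ge_min lexx.
  have s3 : h s0 < 0.
    by apply: r; rewrite s1 gt_min orbC ltrD2l ltr_pdivrMr// ltr_pMr ?ltr1n.
  have cN : continuous (fun s => - h s) by move=> s; apply: (@continuousN _ _ _ h); exact: ch.
  have [||s [/andP[p1 p2] p3 p4]] := first_zero cN s2; rewrite ?oppr_gt0 ?oppr_le0//.
  have sI : b < s < c by rewrite (lt_trans bt (lt_trans s1 p1)) (le_lt_trans p2 t2).
  have := @isd_left_le0 R _ s0 s _ p1 (isdN (dd s sI)).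
  rewrite p3 => /(_ _)/wrap[w /p4/ltW //|].
  have hs : h s = 0 by lra.
  by have := hd s sI hs; lra.
pose s0 := Num.max t (t0 - e / 2).
have [s1 s2] : s0 < t0 /\ t <= s0 by rewrite gt_max t2 ltrBlDr ltrDl divr_gt0// le_max lexx.
have s3 : 0 < h s0.
  by apply: l; rewrite s1 lt_max andbT orbC ltrD2l ltrN2 ltr_pdivrMr// ltr_pMr ?ltr1n.
have [||s [/andP[p1 p2] p3 p4]] := last_zero ch s2; rewrite ?ht//.
have sI : b < s < c by rewrite (lt_le_trans t1 p1) (lt_trans p2 (lt_trans s1 tc)).
have := @isd_right_ge0 R _ s0 s _ p2 (dd s sI).
rewrite p3 => /(_ _)/wrap[w /p4/ltW //|].
by rewrite leNgt hd.
Qed.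

Lemma arc_max (G F : {poly R}) a b T x u t0 : right_data G F -> half_orbit G F a b T x u ->
  0 < t0 < T -> u t0 = F.[x t0] -> forall t, 0 <= t <= T -> x t <= x t0.
Proof.
move=> rd [[a0 b0 T0] [cx cu] [x0 u0 xT uT] xp hl] t0I e0 t /andP[t1 t2].
have /andP[t00 t0T] := t0I.
have hl' s : 0 < s < T -> lienard G F x u s by move=> /andP[s1 s2]; apply: hl; rewrite !ltW.
have [|||||h1 h2] := @single_sign_change (fun s => u s - F.[x s])
   (fun s => - G^`().[x s] - F^`().[x s] * (u s - F.[x s])) t0 0 T.
- exact: continuous_velocity.
- by move=> s /hl' hs; exact: isd_velocity.
- by move=> s sI ->; rewrite mulr0 subr0 oppr_lt0; apply: (rd_gp rd); exact: xp.
- by [].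
- by rewrite e0 subrr.
have [tt|tt] := leP t t0.
  apply: (@isd_nondecr R x (fun s => u s - F.[x s]) t t0 tt cx) => s /andP[s1 s2].
    by case: (hl' s) => //; rewrite (le_lt_trans t1 s1) (lt_trans s2 t0T).
  by apply/ltW/h2; rewrite (le_lt_trans t1 s1).
apply: (@isd_nonincr R x (fun s => u s - F.[x s]) t0 t (ltW tt) cx) => s /andP[s1 s2].
  by case: (hl' s) => //; rewrite (lt_trans t00 s1) (lt_le_trans s2 t2).
by apply/ltW/h1; rewrite s1 (lt_le_trans s2 t2).
Qed.

(** The arc of the second system through (X2, F2 X2) has its rightmost point there, so the
    inequality is needed only up to X2. For a point of this arc take the arc of the first system
    with the same G at the same height: [arc_compare] puts its top and its bottom weakly below those
    of the second arc, while equal bottoms and their monotonicity make a strictly lower top give a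
    strictly higher bottom. So the tops agree, and the two arcs have the same G at every height.
    Equating the derivatives F - u at height F2 X2 contradicts the strict inequality. *)
Lemma same_bottoms_not_strict (G1 F1 G2 F2 : {poly R}) (X1 X2 : R) :
  right_data G1 F1 -> right_data G2 F2 ->
  (forall a b b' T x u T' x' u', half_orbit G1 F1 a b T x u ->
     half_orbit G2 F2 a b' T' x' u' -> b = b') ->
  0 < X1 -> 0 < X2 -> G1.[X1] = G2.[X2] -> F1.[X1] < F2.[X2] ->
  ~ forall x1 x2 : R, 0 < x1 -> 0 < x2 <= X2 -> G1.[x1] = G2.[x2] -> F1.[x1] <= F2.[x2].
Proof.
move=> rd1 rd2 same X10 X20 eG ltF leF.
have [a [b [T [x [u [t0 [h2 t0I ex eu]]]]]]] := arc_through rd2 F2.[X2] X20.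
have xM t : 0 <= t <= T -> x t <= X2.
  by rewrite -ex; apply: (arc_max rd2 h2 t0I); rewrite eu ex.
have [xi2 [gr2 E2 S2]] := arc_graphP rd2 h2.
have a0 : 0 < a by case: h2 => -[].
have [b1 [T1 [y1 [v1 h1]]]] := arc_top rd1 a0.
have [xi1 [gr1 E1 S1]] := arc_graphP rd1 h1.
have bE : b1 = b := same _ _ _ _ _ _ _ _ _ h1 h2.
rewrite bE in h1 gr1 S1.
have le v y : b < v < a -> 0 < y -> G1.[y] = G2.[xi2 v] -> F1.[y] <= F2.[xi2 v].
  move=> vI y0 e; apply: leF => //; case: gr2 => _ _ _ -> //=.
  by have [|s sI <-] := S2 v; [case/andP: vI => *; rewrite !ltW|rewrite E2// xM].
have key v : b < v < a -> G1.[xi1 v] = G2.[xi2 v].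
  move=> vI; have xv : 0 < xi2 v by case: gr2 => _ _ _ ->.
  have [y y0 ey] := rd_inv rd1 (rd_Gpos rd2 xv).
  have [a' [b' [T' [x' [u' [t' [h' t'I ex' eu']]]]]]] := arc_through rd1 v y0.
  have t'I' : 0 <= t' <= T' by case/andP: t'I => *; rewrite !ltW.
  have [xi' [gr' E' S']] := arc_graphP rd1 h'.
  have xiv : xi' v = y by rewrite -eu' E'.
  have vI' : b' < v < a'.
    have [_ _ z _ _] := gr'; rewrite !ltNge; apply/andP; split; apply/negP => hv; have := z v.
      by rewrite hv xiv => /(_ (or_introl isT)) y00; rewrite y00 ltxx in y0.
    by rewrite hv xiv => /(_ (or_intror isT)) y00; rewrite y00 ltxx in y0.
  have [||la lb] := arc_compare rd1 rd2 gr' gr2 _ vI' vI.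
  - by move=> w z wI; apply: le.
  - by rewrite xiv.
  have aE : a' = a.
    apply/eqP; rewrite eq_le la leNgt; apply/negP => aa.
    have a'0 : 0 < a' by case: h' => -[].
    have [b2 [T2 [x2 [u2 hh]]]] := arc_top rd2 a'0.
    have bb := same _ _ _ _ _ _ _ _ _ h' hh.
    have := arc_bot_decr rd2 hh h2; rewrite aa -bb => /esym; rewrite ltNge lb.
    by [].
  rewrite aE in h'; have [_ _ hE] := arc_uniq_top h1 h'.
  have [|s sI sv] := S1 v; first by case/andP: vI => *; rewrite !ltW.
  have sT : s = t'.
    have [_ TE _] := arc_uniq_top h1 h'; have [_ e] := hE s sI.
    have [st|st] := ltP s t'.
      by have := arc_u_decr rd1 h'; move=> /(_ s t'); case/andP: sI => s0 _; case/andP: t'I' => _ tt; move=> /(_ s0 st tt); rewrite eu' -e sv ltxx.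
    move: st; rewrite le_eqVlt => /predU1P[//|st].
    by have := arc_u_decr rd1 h'; move=> /(_ t' s); case/andP: sI => _ s0; case/andP: t'I' => tt _; rewrite -TE => /(_ tt st s0); rewrite eu' -e sv ltxx.
  by rewrite -[in LHS]sv E1//; have [-> _] := hE s sI; rewrite sT ex' ey.
pose v0 := F2.[X2].
have t0I' : 0 <= t0 <= T by case/andP: t0I => *; rewrite !ltW.
have x2v : xi2 v0 = X2 by rewrite /v0 -eu E2.
have v0I : b < v0 < a.
  have [_ _ z _ _] := gr2; rewrite !ltNge; apply/andP; split; apply/negP => hv; have := z v0.
    by rewrite hv x2v => /(_ (or_introl isT)) y00; rewrite y00 ltxx in X20.
  by rewrite hv x2v => /(_ (or_intror isT)) y00; rewrite y00 ltxx in X20.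
have x1v : xi1 v0 = X1.
  apply: (rd_inj rd1); [by case: gr1 => _ _ _ h _; apply/ltW/h|exact: ltW|].
  by rewrite key// x2v.
have [_ _ _ _ /(_ v0 v0I) d1] := gr1; have [_ _ _ _ /(_ v0 v0I) d2] := gr2.
have d1' : isd (fun w => G2.[xi2 w]) v0 (F1.[xi1 v0] - v0).
  apply: isd_ext d1.
  by apply: (near_oo v0I) => w; exact: key.
by have := isd_uniq d1' d2; rewrite x1v x2v; lra.
Qed.

End Necessity.

(** * The sign of F(x1) - F(x2) along the curve G(x1) = G(x2) *)

Section Branches.
Variable R : realType.

(** i is the end of the longest interval [0, i] on which d vanishes. The local dichotomy forbids
    oscillation to the right of i: there d has no zeros, since vanishing would prolong the interval,
    and it keeps its sign by continuity. *)
Lemma sign_start (d : R -> R) (x0 : R) : continuous d -> d 0 = 0 -> 0 < x0 -> d x0 != 0 ->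
  (forall i : R, 0 <= i < x0 -> exists2 e, 0 < e &
     (forall x, i < x < i + e -> x < x0 -> d x = 0) \/
     (forall x, i < x < i + e -> x < x0 -> d x != 0)) ->
  exists X, [/\ 0 < X < x0, d X != 0 & forall x, 0 < x <= X -> 0 <= d x * d X].
Proof.
move=> cd d0 x00 dx0 hloc.
pose S := [set x : R | 0 <= x <= x0 /\ forall y, 0 <= y <= x -> d y = 0].
have S0 : S 0 by split=> [|y]; [rewrite lexx ltW|rewrite -eq_le => /eqP<-].
have hS : has_sup S by split; [exists 0|exists x0 => x [/andP[]]].
pose i := sup S.
have i0 : 0 <= i by apply: ub_le_sup => //; case: hS.
have ix0 : i <= x0 by apply: ge_sup => [|x [/andP[]]//]; exists 0.
have dlt x : 0 <= x -> x < i -> d x = 0.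
  move=> x00' /(sup_gt (proj1 hS))[y [_ hy] xy]; by apply: hy; rewrite x00' ltW.
have di : d i = 0.
  move: i0; rewrite le_eqVlt => /predU1P[<-//|i0].
  apply/eqP; apply: contraT => din.
  have [e e0 he] : exists2 e : R, 0 < e & forall x, `|i - x| < e -> d x != 0.
    have : \forall x \near i, d x != 0.
      have := cd i; move/cvgr_neq0 => /(_ din); exact.
    by move=> /nbhs_ballP[e /= e0 he]; exists e => // x xe; exact: he.
  pose x := Num.max 0 (i - e / 2).
  have xi : x < i by rewrite gt_max i0 ltrBlDr ltrDl divr_gt0.
  have := he x; rewrite dlt ?le_max ?lexx// eqxx => /(_ _)/wrap[|//].
  by rewrite gtr0_norm ?subr_gt0// ltrBlDr -ltrBlDl lt_max [X in _ || X]ltrD2l ltrN2 ltr_pdivrMr// ltr_pMr ?ltr1n// orbT.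
have ilt : i < x0.
  by rewrite lt_neqAle ix0 andbT; apply: contraNneq dx0 => <-; rewrite di.
have [|e e0 hd] := hloc i; first by rewrite i0.
pose X := Num.min ((i + x0) / 2) (i + e / 2).
have iX : i < X by rewrite lt_min; apply/andP; split; lra.
have Xx0 : X < x0 by rewrite gt_min; apply/orP; left; lra.
have Xe : X < i + e by rewrite gt_min; apply/orP; right; lra.
case: hd => hd.
  have : X <= i.
    apply: ub_le_sup => //; first by case: hS.
    split; first by rewrite (le_trans i0 (ltW iX)) ltW.
    move=> y /andP[y0 yX]; have [yi|yi] := ltP y i; first exact: dlt.
    move: yi; rewrite le_eqVlt => /predU1P[<-//|yi].
    by apply: hd; [rewrite yi (le_lt_trans yX)|exact: le_lt_trans Xx0].
  by rewrite leNgt iX.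
have dX : d X != 0 by apply: hd; rewrite ?iX.
exists X; split => //; first by rewrite (le_lt_trans i0 iX).
move=> x /andP[x_0 xX]; have [xi|xi] := ltP x i; first by rewrite dlt ?mul0r// ltW.
move: xi; rewrite le_eqVlt => /predU1P[<-|xi]; first by rewrite di mul0r.
rewrite leNgt; apply/negP => neg.
have [|c /andP[c1 c2] dc] := @IVT_eq R d x X 0 cd xX.
  by have [h|h] := leP (d x) 0; [left|right]; apply/andP; split => //; nra.
by have := hd c; rewrite dc eqxx (lt_le_trans xi c1) (le_lt_trans c2 Xe) (le_lt_trans c2 Xx0) => /(_ isT isT).
Qed.

Lemma poly_nonzero_right (p : {poly R}) (i : R) : p != 0 ->
  exists2 e, 0 < e & forall x, i < x < i + e -> p.[x] != 0.
Proof.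
move=> p0; have [k [q]] := multiplicity_XsubC p i; rewrite p0 /= => qi pE.
have [e e0 he] : exists2 e : R, 0 < e & forall x, `|i - x| < e -> q.[x] != 0.
  have : \forall x \near i, q.[x] != 0.
    have := @continuous_horner R q i; move/cvgr_neq0; apply; exact: qi.
  by move=> /nbhs_ballP[e /= e0 he]; exists e => // x xe; exact: he.
exists e => // x /andP[x1 x2]; rewrite pE hornerM horner_exp !hornerE mulf_neq0//.
  by apply: he; rewrite distrC gtr0_norm ?subr_gt0// ltrBlDl.
by rewrite expf_neq0// subr_eq0 gt_eqF.
Qed.

Lemma continuous_horner2 (p : {poly {poly R}}) (h k : R -> R) :
  continuous h -> continuous k -> continuous (fun t => p.[(h t)%:P].[k t]).
Proof.
move=> ch ck; elim/poly_ind: p => [|p c IH].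
  by move=> t; under eq_fun do rewrite horner0 horner0; exact: cst_continuous.
rewrite (_ : (fun t => _) = (fun t => p.[(h t)%:P].[k t] * h t + c.[k t])); last first.
  by apply/funext => t; rewrite hornerMXaddC hornerD hornerM hornerC.
move=> t; apply: (@continuousD _ _ _ (fun t => p.[(h t)%:P].[k t] * h t) (fun t => c.[k t])).
  by apply: (@continuousM _ _ (fun t => p.[(h t)%:P].[k t]) h); [exact: IH|exact: ch].
exact: cont_horner_comp.
Qed.

(** The polynomials are taken in X with coefficients in R[Y], which is not a field; cofactors and
    the Bezout relation exist up to nonzero multipliers from R[Y], each with finitely many zeros. *)
Lemma pseudo_gcd (p q : {poly {poly R}}) : p != 0 -> exists (d p1 q1 s1 s2 : {poly {poly R}}) (c1 c2 c : {poly R}),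
  [/\ [/\ c1 != 0, c2 != 0 & c != 0], c1 *: p = p1 * d, c2 *: q = q1 * d & s1 * p1 + s2 * q1 = c%:P].
Proof.
move=> p0; pose d := gcdp p q.
have d0 : d != 0 by rewrite gcdp_eq0 negb_and p0.
have /Pdiv.Idomain.dvdpP[[c1 p1] /= c10 e1] := dvdp_gcdl p q.
have /Pdiv.Idomain.dvdpP[[c2 q1] /= c20 e2] := dvdp_gcdr p q.
have [[s1 s2] /=] := Bezoutp p q; case/eqpP => -[k k'] /= /andP[k0 k'0] e3.
exists d, p1, q1, ((k * c2) *: s1), ((k * c1) *: s2), c1, c2, (c1 * c2 * k'); split => //.
  by rewrite !mulf_neq0.
apply: (mulIf d0); rewrite mulrDl -!mulrA -!scalerAl -e1 -e2.
rewrite -/d in e3; rewrite mul_polyC.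
rewrite [RHS](_ : _ = (c1 * c2) *: (k *: (s1 * p + s2 * q))); last by rewrite e3 scalerA mulrA.
by rewrite -!scalerAr !scalerDr !scalerA; congr (_ *: _ + _ *: _); ring.
Qed.

(* On the curve [G1 x1 = G2 x2] the functions [F1] and [F2] either agree or
   differ on whole intervals.  For [P = G1(X) - G2(Y)], [Q = F1(X) - F2(Y)] and
   their (pseudo-)gcd [D], away from finitely many [Y] the curve is the disjoint
   union of [D = 0], on which [Q = 0], and [P / D = 0], on which [Q != 0]; these
   do not meet because [dP/dX = G1' > 0]. *)
Lemma branch_dichotomy (G1 F1 G2 F2 : {poly R}) (h : R -> R) (x0 i : R) :
  continuous h -> G1 != 0 -> G1.[0] = 0 -> (forall x, 0 < x <= x0 -> G1.[h x] = G2.[x]) ->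
  (forall x, 0 < x <= x0 -> 0 < G1^`().[h x]) -> 0 <= i < x0 ->
  exists2 e : R, 0 < e &
     (forall x, i < x < i + e -> x < x0 -> F2.[x] - F1.[h x] = 0) \/
     (forall x, i < x < i + e -> x < x0 -> F2.[x] - F1.[h x] != 0).
Proof.
move=> ch G10 G100 eG gp /andP[i0 ix0].
pose P := G1^:P - (G2%:P); pose Q := F1^:P - (F2%:P).
have evP x y : P.[x%:P].[y] = G1.[x] - G2.[y].
  by rewrite /P !hornerE horner_map /= hornerC.
have evQ x y : Q.[x%:P].[y] = F1.[x] - F2.[y].
  by rewrite /Q !hornerE horner_map /= hornerC.
have P0 : P != 0.
  apply: contraNneq G10 => PE; apply/eqP.
  have hc x : G1.[x] = G2.[0] by apply/eqP; rewrite -subr_eq0 -evP PE !horner0.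
  have := G100; rewrite hc => e0; apply: contra_eq (e0) => g1.
  have [c c1] : exists c : R, G1.[c] != 0.
    have [p [pE]] := multiplicity_XsubC G1 0.
    have [e e0' he] := poly_nonzero_right 0 g1.
    by exists (e / 2); apply: he; apply/andP; split; lra.
  by rewrite hc e0 eqxx in c1.
have [D [P1 [Q1 [s1 [s2 [c1 [c2 [c [[c10 c20 c0] eP eQ eB]]]]]]]]] := pseudo_gcd Q P0.
have [e e0 he] := poly_nonzero_right i (mulf_neq0 (mulf_neq0 c10 c20) c0).
pose ev (p : {poly {poly R}}) x := p.[(h x)%:P].[x].
have evM (p q : {poly {poly R}}) x : ev (p * q) x = ev p x * ev q x by rewrite /ev !hornerM.
have evD (p q : {poly {poly R}}) x : ev (p + q) x = ev p x + ev q x by rewrite /ev !hornerD.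
have evZ (k : {poly R}) p x : ev (k *: p) x = k.[x] * ev p x by rewrite /ev hornerZ hornerM.
have evC (k : {poly R}) x : ev k%:P x = k.[x] by rewrite /ev hornerC.
(* On the curve D P1 = 0, and differentiating P1 D = c1 P in X shows that D and P1 do not vanish
   together. So H is nonzero and its sign tells which factor vanishes; one continuous function
   without zeros thus decides for the whole interval. *)
pose H x := ev D x ^+ 2 - ev P1 x ^+ 2.
have cev p : continuous (ev p) by apply: (@continuous_horner2 p h id) => // t; exact: cvg_id.
have cH : continuous H.
  rewrite (_ : H = (fun x => ev (D * D - P1 * P1) x)); first exact: cev.
  by apply/funext => x; rewrite /H evD /ev hornerN hornerN -!/(ev _ _) !evM !expr2.
have facts x : i < x < i + e -> x < x0 ->
    [/\ H x != 0, 0 < H x -> F2.[x] - F1.[h x] != 0 & H x < 0 -> F2.[x] - F1.[h x] = 0].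
  move=> xI xx0; have := he x xI; rewrite !hornerM !mulf_eq0 !negb_or => /andP[/andP[n1 n2] n3].
  have xI' : 0 < x <= x0 by rewrite (ltW xx0) andbT; apply: le_lt_trans i0 _; case/andP: xI.
  have z1 : ev P1 x * ev D x = 0.
    by rewrite -evM -eP evZ /ev evP eG// subrr mulr0.
  have z2 : ev Q1 x * ev D x = c2.[x] * (F1.[h x] - F2.[x]) by rewrite -evM -eQ evZ /ev evQ.
  have z3 : ev s1 x * ev P1 x + ev s2 x * ev Q1 x = c.[x] by rewrite -!evM -evD eB evC.
  have z4 : ev P1^`() x * ev D x + ev P1 x * ev D^`() x = c1.[x] * G1^`().[h x].
    rewrite -!evM -evD -derivM -eP derivZ evZ; congr (_ * _).
    by rewrite /ev /P derivB derivC subr0 deriv_map horner_map /= hornerC.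
  have n4 : c1.[x] * G1^`().[h x] != 0 by rewrite mulf_neq0// gt_eqF// gp.
  split.
  - apply/eqP => H0; move: z1 H0 => /eqP; rewrite mulf_eq0 /H => /orP[]/eqP z.
      rewrite z expr0n subr0 => /eqP; rewrite expf_eq0 /= => /eqP z'.
      by move: n4; rewrite -z4 z z' !(mulr0, mul0r) addr0 eqxx.
    rewrite z expr0n sub0r => /eqP; rewrite oppr_eq0 expf_eq0 /= => /eqP z'.
    by move: n4; rewrite -z4 z z' !(mulr0, mul0r) addr0 eqxx.
  - move=> Hp; have Dn : ev D x != 0.
      by apply: contraTneq Hp => z; rewrite /H z expr0n sub0r oppr_gt0 -leNgt sqr_ge0.
    have P1z : ev P1 x = 0 by move: z1 => /eqP; rewrite mulf_eq0 (negPf Dn) orbF => /eqP.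
    have Qn : ev Q1 x != 0 by apply: contraNneq n3 => z; rewrite -z3 P1z z !mulr0 addr0.
    apply: contraTneq (mulf_neq0 Qn Dn) => z; rewrite z2 negbK -opprB z oppr0 mulr0; exact: eqxx.
  - move=> Hn; have Pn : ev P1 x != 0.
      by apply: contraTneq Hn => z; rewrite /H z expr0n subr0 -leNgt sqr_ge0.
    have Dz : ev D x = 0 by move: z1 => /eqP; rewrite mulf_eq0 (negPf Pn) => /eqP.
    move: z2; rewrite Dz mulr0 => /esym/eqP; rewrite mulf_eq0 (negPf n2) /= => /eqP.
    by lra.
exists e => //.
pose m := Num.min (i + e / 2) ((i + x0) / 2).
have mI : i < m < i + e by rewrite lt_min gt_min; apply/andP; split; [apply/andP; split|apply/orP; left]; lra.
have mx : m < x0 by rewrite gt_min; apply/orP; right; lra.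
have sgn x : i < x < i + e -> x < x0 -> 0 < H m * H x.
  move=> xI xx0; have [Hmn _ _] := facts m mI mx; have [Hxn _ _] := facts x xI xx0.
  rewrite lt_neqAle eq_sym mulf_neq0//=.
  rewrite leNgt; apply/negP => neg.
  have hz (z w : R) : i < z < i + e -> z < x0 -> i < w < i + e -> w < x0 -> z <= w -> H z * H w < 0 -> False.
    move=> zI zx wI wx zw ng.
    have [|k /andP[k1 k2] Hk] := @IVT_eq R H z w 0 cH zw.
      by have [q|q] := leP (H z) 0; [left|right]; apply/andP; split => //; nra.
    move/andP: zI => [z1 z2]; move/andP: wI => [w1 w2].
    have [||] := facts k; first by rewrite (lt_le_trans z1 k1) (le_lt_trans k2 w2).
      exact: le_lt_trans k2 wx.
    by rewrite Hk eqxx.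
  by have [xm|/ltW xm] := leP x m; [apply: (hz x m); rewrite // mulrC|apply: (hz m x)].
have [Hm0 _ _] := facts m mI mx.
move: Hm0; rewrite neq_lt => /orP[Hm|Hm].
  by left=> x xI xx; have [_ _] := facts x xI xx; apply; have := sgn x xI xx; rewrite nmulr_rgt0.
by right=> x xI xx; have [_ + _] := facts x xI xx; apply; have := sgn x xI xx; rewrite pmulr_rgt0.
Qed.

Lemma right_data_neq0 (G F : {poly R}) : right_data G F -> G != 0.
Proof. by move=> rd; apply: contraTneq (rd_Gpos rd ltr01) => ->; rewrite horner0 ltxx. Qed.

(** h = G^-1 composed with [refl G] parametrises the curve by its left coordinate, and d is the
    difference of the two F along it. If d does not vanish identically, it has a constant sign on an
    initial interval; according to that sign the right or the left system plays the first role in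
    [same_bottoms_not_strict]. *)
Lemma closed_orbits_sym (G F : {poly R}) : right_data G F -> right_data (refl G) (refl F) ->
  closed_orbits G F -> forall x1 x2 : R, 0 < x1 -> 0 < x2 ->
  G.[x1] = (refl G).[x2] -> F.[x1] = (refl F).[x2].
Proof.
move=> rd rdl co x1 x2 x10 x20 eG; apply/eqP; apply: contraT => nF.
have x11 : 0 < x1 + 1 by rewrite addr_gt0.
have [|t _|t /andP[t0 _]|inv [cinv invK invP _]] := @incr_inverse R (horner G) (horner G^`()) 0 (x1 + 1) x11.
- exact: continuous_horner.
- exact: is_derive_poly.
- exact: (rd_gp rd).
rewrite (rd_G0 rd) in invP.
pose h x := inv (refl G).[x].
have ch : continuous h by move=> t; apply: (@continuous_comp _ _ _ (horner (refl G)) inv); [exact: continuous_horner|exact: cinv].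
have hx2 : h x2 = x1 by rewrite /h -eG invK// (ltW x10) lerDl ler01.
have h0 : h 0 = 0 by rewrite /h (rd_G0 rdl) -[X in inv X](rd_G0 rd) invK// lexx (ltW x11).
have hP x : 0 < x <= x2 -> 0 < h x /\ G.[h x] = (refl G).[x].
  move=> /andP[x0 xx]; have [|/andP[p1 p2] p3] := invP (refl G).[x].
    rewrite (rd_Gge0 rdl (ltW x0)) (@le_trans _ _ (refl G).[x2])//.
      by rewrite (rd_le rdl (ltW x0) (ltW x20)).
    by rewrite -eG (rd_le rd) ?ltW// ?lerDl// ltrDl.
  split=> //; rewrite lt_neqAle p1 andbT; apply: contraTneq (rd_Gpos rdl x0) => e.
  by rewrite -p3 -/(h x) -e (rd_G0 rd) ltxx.
pose d x := (refl F).[x] - F.[h x].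
have cd : continuous d.
  by move=> t; apply: (@continuousB _ _ _ (horner (refl F)) (fun x => F.[h x])); [exact: continuous_horner|exact: cont_horner_comp].
have [||i iI|X [/andP[X0 Xx] dX sX]] := @sign_start d x2 cd _ x20.
- by rewrite /d h0 (rd_F0 rd) (rd_F0 rdl) subrr.
- by rewrite /d hx2 subr_eq0 eq_sym.
- apply: (@branch_dichotomy G F (refl G) (refl F) h x2 i ch _ _ _ _ iI).
  + exact: right_data_neq0 rd.
  + exact: rd_G0 rd.
  + by move=> x /hP[].
  + by move=> x /hP[h1 _]; exact: (rd_gp rd).
have XI : 0 < X <= x2 by rewrite X0 ltW.
have [hX0 hXG] := hP X XI.
have hE y1 y2 : 0 < y1 -> 0 < y2 <= x2 -> G.[y1] = (refl G).[y2] -> y1 = h y2.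
  by move=> p1 p2 e; have [q1 q2] := hP y2 p2; apply: (rd_inj rd); rewrite ?ltW// e q2.
exfalso; move: dX; rewrite neq_lt => /orP[dX|dX].
  apply: (@same_bottoms_not_strict R (refl G) (refl F) G F X (h X) rdl rd) => //.
  - move=> a b b' T x u T' x' u' ha hb; apply/esym; exact: closed_orbits_bottom hb ha.
  - by move: dX; rewrite /d subr_lt0.
  - move=> y1 y2 p1 /andP[p2 p3] e.
    have p4 : y1 <= X by rewrite -(rd_le rdl (ltW p1) (ltW X0)) e -hXG (rd_le rd (ltW p2) (ltW hX0)).
    have p5 : 0 < y1 <= x2 by rewrite p1 (le_trans p4 (ltW Xx)).
    rewrite (hE _ _ p2 p5 (esym e)) -subr_le0 -/(d y1).
    have := sX y1; rewrite p1 p4 => /(_ isT).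
    by rewrite nmulr_lge0.
apply: (@same_bottoms_not_strict R G F (refl G) (refl F) (h X) X rd rdl) => //.
- move=> a b b' T x u T' x' u' ha hb; exact: closed_orbits_bottom ha hb.
- by move: dX; rewrite /d subr_gt0.
- move=> y1 y2 p1 /andP[p2 p3] e.
  have p5 : 0 < y2 <= x2 by rewrite p2 (le_trans p3 (ltW Xx)).
  rewrite (hE _ _ p1 p5 e) -subr_ge0 -/(d y2).
  have := sX y2; rewrite p2 p3 => /(_ isT).
  by rewrite pmulr_lge0.
Qed.

Section Conditions.
Variables (m n r s : nat) (a b : nat -> R).
Hypotheses (hrm : (r <= m)%N) (hsn : (s <= n)%N).
Hypotheses (ar : a r != 0) (am : a m != 0) (bs : b s != 0) (bn : b n != 0).
Let g := poly_between r m a.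
Let f := poly_between s n b.
Let G := primitive_between r m a.
Let F := primitive_between s n b.

Lemma refl_primitive_between lo hi (c : nat -> R) :
  refl (primitive_between lo hi c) = primitive_between lo hi (fun i => (-1) ^+ i.+1 * c i).
Proof.
rewrite /primitive_between /poly_between big_add1 [in RHS]big_add1 /= /refl raddf_sum /=.
apply: eq_bigr => i _; rewrite linearZ /= comp_Xn_poly -[- 'X]scaleN1r exprZn scalerA.
by congr (_ *: _); ring.
Qed.

Lemma right_data_both : (0 < r)%N -> (forall x : R, x != 0 -> 0 < x * g.[x]) ->
  (r < 2 * s + 1)%N \/ r = (2 * s + 1)%N /\ b s ^+ 2 < 2 * (r%:R + 1) * a r ->
  (2 * n + 1 < m)%N \/ m = (2 * n + 1)%N /\ b n ^+ 2 < 4 * (n%:R + 1) * a m ->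
  right_data G F /\ right_data (refl G) (refl F).
Proof.
move=> r0 xg c0 coo; have [ro ar0 mo am0] := odd_signs hrm ar am xg.
split; first by apply: right_data_conditions => // x x0; rewrite -(pmulr_rgt0 _ x0) xg// gt_eqF.
rewrite !refl_primitive_between; apply: right_data_conditions => //.
- move=> x x0; rewrite -primitive_between_deriv -refl_primitive_between refl_deriv primitive_between_deriv.
  have := xg (- x); rewrite oppr_eq0 gt_eqF// => /(_ isT).
  by rewrite mulNr -mulrN pmulr_rgt0.
- by rewrite -signr_odd /= ro expr0 mul1r.
- by rewrite -signr_odd /= mo expr0 mul1r.
- by rewrite exprMn sqrr_sign mul1r -[X in _ * (X * _)]signr_odd /= ro expr0 mul1r.
- by rewrite exprMn sqrr_sign mul1r -[X in _ * (X * _)]signr_odd /= mo expr0 mul1r.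
Qed.

Lemma closed_orbits_conditions : (0 < r)%N -> closed_orbits G F ->
  [/\ forall x : R, x != 0 -> 0 < x * g.[x],
  (r < 2 * s + 1)%N \/ r = (2 * s + 1)%N /\ b s ^+ 2 < 2 * (r%:R + 1) * a r &
  (2 * n + 1 < m)%N \/ m = (2 * n + 1)%N /\ b n ^+ 2 < 4 * (n%:R + 1) * a m].
Proof.
move=> r0 co.
have GE : G^`() = g by exact: primitive_between_deriv.
have FE : F^`() = f by exact: primitive_between_deriv.
have g0 : G^`().[0] = 0.
  by rewrite GE /g poly_between_horner big_nat big1// => i /andP[ri _]; rewrite expr0n gtn_eqF ?mulr0// (leq_trans r0).
have xg (x : R) : x != 0 -> 0 < x * g.[x].
  rewrite neq_lt => /orP[x0|x0].
    have := closed_orbits_pos (closed_orbits_refl co) (x0 := - x).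
    by rewrite oppr_gt0 refl_deriv opprK GE nmulr_rgt0// oppr_gt0 => /(_ x0).
  by rewrite pmulr_rgt0// -GE; exact: (closed_orbits_pos co x0).
have [ro ar0 mo am0] := odd_signs hrm ar am xg.
have F0 : F.[0] = 0 by exact: primitive_between0.
have opp (c : nat -> R) lo hi : primitive_between lo hi (fun i => - c i) = - primitive_between lo hi c.
  rewrite /primitive_between /poly_between -sumrN; apply: eq_bigr => i _.
  by rewrite mulNr scaleNr.
have oppf (c : nat -> R) lo hi : poly_between lo hi (fun i => - c i) = - poly_between lo hi c.
  by rewrite /poly_between -sumrN; apply: eq_bigr => i _; rewrite scaleNr.
have coN := closed_orbits_opp co.
split => //.
- have [|h1] := ltnP r (2 * s + 1); first by left.
  have [h2|] := boolP ((r == (2 * s + 1)%N) && (b s ^+ 2 < 2 * (r%:R + 1) * a r)).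
    by right; case/andP: h2 => /eqP.
  rewrite negb_and -leNgt => h2; exfalso.
  have {h2} h2 : (2 * s + 1 < r)%N \/ r = (2 * s + 1)%N /\ 2 * (r%:R + 1) * a r <= b s ^+ 2.
    move: h1; rewrite leq_eqVlt => /predU1P[e|]; last by left.
    by right; move: h2; rewrite -e eqxx.
  move: bs; rewrite neq_lt => /orP[bs0|bs0].
    have [||phi [d [d0 p0 hp]]] := @trap_near0 R m n r s a (fun i => - b i) hrm hsn.
    - by rewrite oppr_gt0.
    - by rewrite sqrrN.
    apply: (@closed_orbits_not_trap_near0 _ G (- F) coN phi d g0 _ d0 p0).
      by rewrite hornerN F0 oppr0.
    by move=> y /hp; rewrite oppf derivN GE FE.
  have [phi [d [d0 p0 hp]]] := @trap_near0 R m n r s a b hrm hsn bs0 h2.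
  apply: (@closed_orbits_not_trap_near0 _ G F co phi d g0 F0 d0 p0).
  by move=> y /hp; rewrite GE FE.
- have [|h1] := ltnP (2 * n + 1) m; first by left.
  have [h2|] := boolP ((m == (2 * n + 1)%N) && (b n ^+ 2 < 4 * (n%:R + 1) * a m)).
    by right; case/andP: h2 => /eqP.
  rewrite negb_and -leNgt => h2; exfalso.
  have {h2} h2 : (m < 2 * n + 1)%N \/ m = (2 * n + 1)%N /\ 4 * (n%:R + 1) * a m <= b n ^+ 2.
    move: h1; rewrite leq_eqVlt => /predU1P[e|]; last by left.
    by right; move: h2; rewrite e eqxx.
  move: bn; rewrite neq_lt => /orP[bn0|bn0].
    have [phi [M [M0 hp]]] := @trap_infty R m n r s a b hrm hsn bn0 h2.
    apply: (@closed_orbits_not_trap_infty _ G F co phi M M0).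
    by move=> y /hp; rewrite GE FE.
  have [||phi [M [M0 hp]]] := @trap_infty R m n r s a (fun i => - b i) hrm hsn.
  - by rewrite oppr_lt0.
  - by rewrite sqrrN.
  apply: (@closed_orbits_not_trap_infty _ G (- F) coN phi M M0).
  by move=> y /hp; rewrite oppf derivN GE FE.
Qed.

End Conditions.
End Branches.

(** * The planar system *)

Section Vectors.
Variable R : realType.

Lemma row2_coords (p : 'rV[R]_2) : row2 (xcoord p) (ycoord p) = p.
Proof.
apply/rowP => -[[|[|//]] i]; rewrite mxE /=; congr (p _ _); apply/val_inj => //=.
by rewrite inordK.
Qed.

Lemma row2_eqP (p q : 'rV[R]_2) : xcoord p = xcoord q -> ycoord p = ycoord q -> p = q.
Proof. by move=> e1 e2; rewrite -(row2_coords p) -(row2_coords q) e1 e2. Qed.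

Lemma xcoord0 n : xcoord (0 : 'rV[R]_n.+1) = 0. Proof. by rewrite /xcoord mxE. Qed.
Lemma ycoord0 n : ycoord (0 : 'rV[R]_n.+2) = 0. Proof. by rewrite /ycoord mxE. Qed.

Lemma row2_decomp (a b : R) : row2 a b = a *: row2 1 0 + b *: row2 0 1.
Proof.
by apply/rowP => -[[|[|//]] i]; rewrite !mxE /= !(mulr0, mulr1, add0r, addr0).
Qed.

Lemma row2_continuous (T : topologicalType) (f h : T -> R) (t : T) :
  {for t, continuous f} -> {for t, continuous h} -> {for t, continuous (fun s => row2 (f s) (h s))}.
Proof.
move=> cf ch; rewrite (_ : (fun s => _) = (fun s => f s *: row2 1 0 + h s *: row2 0 1)); last first.
  by apply/funext => s; exact: row2_decomp.
by apply: (@continuousD _ _ _ (fun s => f s *: row2 1 0) (fun s => h s *: row2 0 1)); exact: continuousZr_tmp.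
Qed.

Lemma coord_comp_continuous (T : topologicalType) n (p : T -> 'rV[R]_n) (i : 'I_n) (t : T) :
  {for t, continuous p} -> {for t, continuous (fun s => p s 0 i)}.
Proof.
move=> cp; apply: (@continuous_comp _ _ _ p (fun M : 'rV[R]_n => M 0 i)) => //.
exact: coord_continuous.
Qed.

Lemma row2_derive (f h : R -> R) (t a b : R) :
  is_derive t (1 : R) (fun s => row2 (f s) (h s)) (row2 a b) <-> isd f t a /\ isd h t b.
Proof.
split=> [/is_derive_rVP d|[d1 d2]].
  split; [have := d ord0|have := d (inord 1)]; rewrite !mxE ?inordK//=.
    by apply: isd_ext; near=> s; rewrite mxE.
  by apply: isd_ext; near=> s; rewrite mxE inordK.
apply/is_derive_rVP => -[[|[|//]] i]; rewrite mxE /=.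
  by apply: isd_ext d1; near=> s; rewrite mxE.
by apply: isd_ext d2; near=> s; rewrite mxE.
Unshelve. all: by end_near. Qed.

Lemma coords_derive (gamma : R -> 'rV[R]_2) (t a b : R) :
  is_derive t (1 : R) gamma (row2 a b) <->
  isd (fun s => xcoord (gamma s)) t a /\ isd (fun s => ycoord (gamma s)) t b.
Proof.
rewrite -row2_derive (_ : (fun s => row2 _ _) = gamma)//.
by apply/funext => s; rewrite row2_coords.
Qed.

Lemma solution_on_clamp (V : normedModType R) (X : V -> V) (T : R) (gamma : R -> V) :
  0 <= T -> solution_on X T gamma -> exists delta : R -> V, [/\ continuous delta,
    forall t, 0 <= t <= T -> delta t = gamma t &
    forall t, 0 < t < T -> is_derive t (1 : R) delta (X (delta t))].
Proof.
move=> T0 [cg dg]; pose delta t := gamma (Num.max 0 (Num.min t T)).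
have dE t : 0 <= t <= T -> delta t = gamma t by move=> h; rewrite /delta clamp_in.
exists delta; split => //; first exact: within_clamp.
move=> t tI; rewrite dE; last by case/andP: tI => *; rewrite !ltW.
apply: near_eq_is_derive (dg t _); last by rewrite in_itv.
by apply: (near_oo tI) => s /andP[s1 s2]; rewrite dE// !ltW.
Qed.

Lemma solution_onT (V : normedModType R) (X : V -> V) (T : R) (gamma : R -> V) :
  (forall t, is_derive t (1 : R) gamma (X (gamma t))) -> solution_on X T gamma.
Proof.
move=> h; split=> [|t _]; last exact: h.
apply: continuous_subspaceT => t; have [d _] := h t.
by apply: differentiable_continuous; apply/derivable1_diffP.
Qed.

End Vectors.

Section Plane.
Variable R : realType.
Variables (G F : {poly R}).
Notation g := G^`().
Notation f := F^`().
Notation X := (vector_field (lienard_system g f)).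

Definition curve (x u : R -> R) (t : R) := row2 (x t) (u t - F.[x t]).

Lemma curve_solution x u t : lienard G F x u t ->
  is_derive t (1 : R) (curve x u) (X (curve x u t)).
Proof.
move=> hl; rewrite vector_field_lienard /curve xcoord2 ycoord2; apply/row2_derive; split.
  by case: hl.
exact: isd_velocity.
Qed.

Lemma solution_lienard (gamma : R -> 'rV[R]_2) t : is_derive t (1 : R) gamma (X (gamma t)) ->
  lienard G F (fun s => xcoord (gamma s)) (fun s => ycoord (gamma s) + F.[xcoord (gamma s)]) t.
Proof.
rewrite vector_field_lienard => /coords_derive[dx dy]; split; first by rewrite addrK.
by apply: isd_eq; [apply: isdD; [exact: dy|apply: isd_horner; exact: dx]|ring].
Qed.

Lemma curve_eq x u x' u' t t' : curve x u t = curve x' u' t' <-> x t = x' t' /\ u t = u' t'.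
Proof.
split=> [e|[e1 e2]]; last by rewrite /curve e1 e2.
have := congr1 (@xcoord R _) e; have := congr1 (@ycoord R _) e.
rewrite /curve !ycoord2 !xcoord2 => + e1; rewrite e1 => e2; split=> //.
by move: e2; exact: addIr.
Qed.

Lemma periodic_orbits_closed_orbits : F.[0] = 0 ->
  (forall q, q <> 0 -> exists O, periodic_orbit X O /\ O q) -> closed_orbits G F.
Proof.
move=> F0 h x0 u0 n0.
have [|O [[T [gamma [T0 hd hp [t1 ht1] ->]]] [t0 _ gt0]]] := h (row2 x0 (u0 - F.[x0])).
  move=> e; apply: n0; have := congr1 (@xcoord R _) e; have := congr1 (@ycoord R _) e.
  rewrite ycoord2 xcoord2 xcoord0 ycoord0 => + e1; rewrite e1 F0 subr0 => ->//.
pose x s := xcoord (gamma (s + t0)); pose u s := ycoord (gamma (s + t0)) + F.[x s].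
exists T, x, u; split => //.
- by move=> t; have := lienard_shift (solution_lienard (hd (t + t0))).
- by move=> t; rewrite /u /x addrAC hp.
- by rewrite /u /x add0r gt0 ycoord2 xcoord2 subrK.
- move=> hc; apply: ht1.
  have hE t : gamma t = row2 x0 (u0 - F.[x0]).
    have [] := hc (t - t0); rewrite /u /x subrK => <- <-; rewrite addrK row2_coords//.
  by rewrite !hE.
Qed.

Section Cycles.
Hypotheses (rd : right_data G F) (rdl : right_data (refl G) (refl F)).
Hypothesis sym : forall x1 x2 : R, 0 < x1 -> 0 < x2 -> G.[x1] = (refl G).[x2] -> F.[x1] = (refl F).[x2].

Definition height (p : 'rV[R]_2) := label G F (xcoord p) (ycoord p + F.[xcoord p]).

Lemma plane_neq0 (p : 'rV[R]_2) : p <> 0 -> (xcoord p, ycoord p + F.[xcoord p]) <> (0, 0).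
Proof.
move=> p0 [e1]; rewrite e1 (rd_F0 rd) addr0 => e2; apply: p0.
by apply: row2_eqP; rewrite ?xcoord0 ?ycoord0.
Qed.

Lemma height0 : height 0 = 0.
Proof. by rewrite /height xcoord0 ycoord0 add0r (rd_F0 rd) label0. Qed.

Lemma height_gt0 p : p <> 0 -> 0 < height p.
Proof. by move=> /plane_neq0 p0; apply: label_gt0. Qed.

Lemma height_loop p : p <> 0 -> exists b T1 T x u t,
  [/\ loop G F (height p) b T1 T x u, 0 <= t <= T & curve x u t = p].
Proof.
move=> /plane_neq0 p0; have [b [T1 [T [x [u [t [hl tI ex eu]]]]]]] := label_spec rd rdl sym p0.
exists b, T1, T, x, u, t; split => //.
by rewrite /curve ex eu addrK row2_coords.
Qed.

Lemma height_curve a b T1 T x u t : loop G F a b T1 T x u -> height (curve x u t) = a.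
Proof. by move=> hl; rewrite /height /curve xcoord2 ycoord2 subrK; apply: label_loop; exact: hl. Qed.

Lemma height_continuous : continuous height.
Proof.
move=> p; apply: label_continuous => //; first exact: coord_continuous.
apply: (@continuousD _ _ _ (fun p : 'rV[R]_2 => ycoord p) (fun p => F.[xcoord p])); first exact: coord_continuous.
apply: (@continuous_comp _ _ _ (fun p : 'rV[R]_2 => xcoord p) (horner F)); first exact: coord_continuous.
exact: continuous_horner.
Qed.

Lemma loop_level a b T1 T x u : loop G F a b T1 T x u ->
  range (curve x u) = [set q | height q = a].
Proof.
move=> hl; have a0 : 0 < a by case: hl => -[].
apply/seteqP; split=> [q [t _ <-]|q /= hq]; first exact: height_curve hl.
have q0 : q <> 0 by move=> q0; move: hq a0; rewrite q0 height0 => ->; rewrite ltxx.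
have [b' [T1' [T' [x' [u' [t [hl' _ <-]]]]]]] := height_loop q0.
rewrite hq in hl'; exists t => //.
have e : (x 0 = x' 0) /\ (u 0 = u' 0).
  by case: hl hl' => _ _ _ [-> -> _ _] _ [_ _ _ [-> -> _ _] _].
have [_ h1 _ _ _] := hl; have [_ h2 _ _ _] := hl'.
by apply/curve_eq; have [] := lienard_global_uniq h1 h2 _ _ t => //; case: e.
Qed.

Lemma loop_periodic_orbit a b T1 T x u : loop G F a b T1 T x u ->
  periodic_orbit X (range (curve x u)).
Proof.
case=> -[a0 b0 T10 T1T] hl hp [x0 u0 xT uT] _.
exists T, (curve x u); split => //.
- exact: lt_trans T1T.
- by move=> t; exact: curve_solution.
- by move=> t; apply/curve_eq; exact: hp.
- exists T1; move=> /curve_eq[_]; rewrite uT u0 => ba.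
  by move: (lt_trans b0 a0); rewrite ba ltxx.
Qed.

Lemma height_bound (c : R) : exists M : R, forall p, height p <= c -> `|p| <= M.
Proof.
have bnd G' F' : right_data G' F' -> exists B : R, 0 <= B /\ forall a b T x u t,
    half_orbit G' F' a b T x u -> a <= c -> 0 <= t <= T -> `|x t| <= B /\ `|u t| <= B.
  move=> rd'; have [K [K0 hK]] := half_orbit_rho rd'.
  have [B [B0 hB]] := rd_big rd' (K * (1 + c ^+ 2)).
  have C0 : 0 <= K * (1 + c ^+ 2) by rewrite mulr_ge0 ?(ltW K0)// addr_ge0 ?sqr_ge0.
  exists (Num.max B (1 + K * (1 + c ^+ 2))); split; first by rewrite le_max (ltW B0).
  move=> a b T x u t ho ac tI; have [h1 _] := hK _ _ _ _ _ _ ho tI.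
  have a0 : 0 < a by case: ho => -[].
  have xt0 : 0 <= x t.
    case: ho => _ _ [x0 _ xT _] xp _; case/andP: tI.
    rewrite le_eqVlt => /predU1P[<-|t0]; first by rewrite x0.
    by rewrite le_eqVlt => /predU1P[->|tT]; [rewrite xT|rewrite ltW// xp// t0].
  have h2 : rho G' (x t) (u t) <= K * (1 + c ^+ 2).
    apply: le_trans h1 _; rewrite ler_wpM2l ?(ltW K0)// lerD2l ler_sqr ?nnegrE ?(ltW a0)//.
    exact: le_trans (ltW a0) ac.
  split; first by rewrite ger0_norm// le_max (hB _ _ xt0 h2).
  rewrite le_max; apply/orP; right.
  have h3 : u t ^+ 2 <= K * (1 + c ^+ 2).
    by apply: le_trans h2; rewrite /rho lerDr mulr_ge0// (rd_Gge0 rd').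
  rewrite -[leRHS]ger0_norm ?addr_ge0// -ler_sqr ?nnegrE// !real_normK ?num_real//.
  by apply: le_trans h3 _; nra.
have [B1 [B10 h1]] := bnd _ _ rd; have [B2 [B20 h2]] := bnd _ _ rdl.
pose B := Num.max B1 B2; have [M [M0 hM]] := poly_bounded F B.
exists (B * `|row2 1 0 : 'rV[R]_2| + (B + M) * `|row2 0 1 : 'rV[R]_2|) => p hp.
have B0 : 0 <= B by rewrite le_max B10.
have [hx hu] : `|xcoord p| <= B /\ `|ycoord p + F.[xcoord p]| <= B.
  have [->|/eqP/plane_neq0 p0] := eqVneq p 0.
    by rewrite xcoord0 ycoord0 add0r (rd_F0 rd) normr0.
  have [x0|/ltW x0] := leP 0 (xcoord p).
    have [b [T [x [u [t [ho tI <- <-]]]]]] := label_right rd rdl sym p0 x0.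
    by have [k1 k2] := h1 _ _ _ _ _ _ ho hp tI; rewrite !le_max k1 k2.
  have [b [T [x [u [t [ho tI ex <-]]]]]] := label_left rd rdl sym p0 x0.
  have [k1 k2] := h2 _ _ _ _ _ _ ho hp tI.
  by rewrite -normrN -ex !le_max k1 k2 !orbT.
have hy : `|ycoord p| <= B + M.
  by rewrite -[ycoord p](addrK F.[xcoord p]) (le_trans (ler_normB _ _))// lerD// hM.
rewrite -(row2_coords p) row2_decomp (le_trans (ler_normD _ _))// !normrZ.
by apply: lerD; rewrite ler_wpM2r.
Qed.

(** The height is continuous and vanishes at the origin, so on a connected set that contains the
    origin and avoids the level c it stays below c; such points are bounded. *)
Lemma level_surrounds (c : R) : 0 < c -> surrounds [set q : 'rV[R]_2 | height q = c] 0.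
Proof.
move=> c0; split; first by rewrite /= height0 => e; rewrite e ltxx in c0.
have [M hM] := height_bound c.
rewrite /= /bounded_near; near=> B => p Cp.
apply: (@le_trans _ _ M); last by near: B; exact: nbhs_pinfty_ge (num_real _).
apply: hM; rewrite leNgt; apply/negP => cp.
set C := connected_component _ _ in Cp.
have cC : connected C by exact: component_connected.
have C0 : C 0.
  by apply: connected_component_refl => //=; rewrite height0 => e; rewrite e ltxx in c0.
have /connected_intervalP ci : connected (height @` C).
  by apply: connected_continuous_connected => //; exact: continuous_subspaceT height_continuous.
have [|||q Cq hq] := ci (height 0) (height p) _ _ c.
- by exists 0.
- by exists p.
- by rewrite height0 !ltW.
by have := connected_component_sub Cq; rewrite /= hq.
Unshelve. all: by end_near. Qed.

Lemma periodic_orbit_through p : p <> 0 ->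
  periodic_orbit X [set q | height q = height p] /\ surrounds [set q | height q = height p] 0.
Proof.
move=> p0; have [b [T1 [T [x [u [t [hl _ _]]]]]]] := height_loop p0.
split; last exact/level_surrounds/height_gt0.
by rewrite -(loop_level hl); exact: loop_periodic_orbit hl.
Qed.

(** Uniqueness keeps the height constant along any trajectory. Conversely two points of a loop are
    joined in forward time, the time difference being reduced modulo the period. *)
Lemma orbit_level p : p <> 0 -> Defs.orbit X p = [set q | height q = height p].
Proof.
move=> p0; have [b [T1 [T [x [u [t [hl tI ep]]]]]]] := height_loop p0.
have [[_ _ T10 T1T] hs hp _ _] := hl; have T0 := lt_trans T10 T1T.
have key W p' q' : reaches X W p' q' -> height q' = height p'.
  move=> [T' [gamma [T'0 sol g0 gT _]]].
  have [delta [cd dE dd]] := solution_on_clamp T'0 sol.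
  have d0 : delta 0 = p' by rewrite dE ?lexx ?T'0.
  have dT : delta T' = q' by rewrite dE ?lexx ?T'0.
  have cx : continuous (fun s => xcoord (delta s)) by move=> s; exact: (@coord_comp_continuous R _ 2 delta ord0 s (cd s)).
  have cy : continuous (fun s => ycoord (delta s) + F.[xcoord (delta s)]).
    move=> s; apply: (@continuousD _ _ _ (fun s => ycoord (delta s)) (fun s => F.[xcoord (delta s)])).
      exact: (@coord_comp_continuous R _ 2 delta (inord 1) s (cd s)).
    exact: cont_horner_comp.
  have [z|/eqP/height_loop[b' [T1' [T2' [x' [u' [t' [hl' _ e']]]]]]]] := eqVneq p' 0.
    have hun := @lienard_uniq R G F 0 T' 0 _ _ (fun=> 0) (fun=> 0) cx cy (@cst_continuous _ _ 0) (@cst_continuous _ _ 0).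
    have [||||||] := hun _ _ _ _ _ T'; rewrite ?lexx ?T'0//.
    - by move=> s sI; apply: solution_lienard; exact: dd.
    - by move=> s _; apply: lienard_at_cst; rewrite ?(rd_g0 rd) ?(rd_F0 rd).
    - by rewrite d0 z xcoord0.
    - by rewrite d0 z xcoord0 ycoord0 add0r (rd_F0 rd).
    by rewrite dT => e1 e2; rewrite z /height e2 e1 xcoord0 ycoord0 add0r (rd_F0 rd).
  have [_ hs' _ _ _] := hl'; have [cx' cu'] := lienard_cont hs'.
  have hun := @lienard_uniq R G F 0 T' 0 _ _ (fun s => x' (s + t')) (fun s => u' (s + t')) cx cy (cont_shift cx') (cont_shift cu').
  have ex : xcoord p' = x' t' by rewrite -e' /curve xcoord2.
  have eu : ycoord p' + F.[xcoord p'] = u' t' by rewrite -e' /curve xcoord2 ycoord2 subrK.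
  have [||||||] := hun _ _ _ _ _ T'; rewrite ?lexx ?T'0//.
  - by move=> s sI; apply: solution_lienard; exact: dd.
  - by move=> s _; exact: lienard_shift.
  - by rewrite d0 add0r ex.
  - by rewrite d0 add0r eu.
  by rewrite dT => e1 e2; rewrite [LHS]/height e2 e1; apply: label_loop; exact: hl'.
apply/seteqP; split=> q /=; first by move=> [/key|/key].
move=> hq; left; have {hq} [t' _ <-] : range (curve x u) q by rewrite (loop_level hl).
have hx : forall s, x (s + T) = x s by move=> s; case: (hp s).
have hu : forall s, u (s + T) = u s by move=> s; case: (hp s).
have [s [k [sI sE]]] := mod_period (t' - t) T0.
exists s, (fun w => curve x u (w + t)); split => //.
- by case/andP: sI.
- apply: solution_onT => w; apply: curve_solution (lienard_shift _) => //.
- by rewrite add0r.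
- have e : t' = (s + t) + k%:~R * T by rewrite -[t'](subrK t) sE; ring.
  by apply/curve_eq; rewrite e (periodic_int hx) (periodic_int hu).
Qed.

Lemma equilibrium_origin : (forall x : R, x != 0 -> 0 < x * g.[x]) ->
  forall p, equilibrium X p <-> p = 0.
Proof.
move=> xg p; rewrite /equilibrium vector_field_lienard; split=> [e|->].
  have := congr1 (@xcoord R _) e; have := congr1 (@ycoord R _) e.
  rewrite xcoord2 ycoord2 ycoord0 xcoord0 => + y0; rewrite y0 mulr0 subr0 => /eqP g0.
  apply: row2_eqP; rewrite ?xcoord0 ?ycoord0 ?y0//; apply/eqP; apply: contraTT g0 => x0.
  by rewrite oppr_eq0; apply: contraTneq (xg _ x0) => ->; rewrite mulr0 ltxx.
by apply: row2_eqP; rewrite ?xcoord2 ?ycoord2 ?xcoord0 ?ycoord0 ?(rd_g0 rd) ?mulr0 ?oppr0 ?addr0.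
Qed.

(** Every closed orbit is connected and meets the positive y-axis; the punctured plane is the union
    of the orbits, each joined to this ray. *)
Lemma punctured_plane_connected : connected (~` [set (0 : 'rV[R]_2)]).
Proof.
pose ray : set 'rV[R]_2 := (fun y : R => row2 0 y) @` `]0, +oo[.
have ray_c : connected ray.
  apply: connected_continuous_connected; first by apply/connected_intervalP; exact: interval_is_interval.
  apply: continuous_subspaceT => y; apply: row2_continuous; first exact: cst_continuous.
  exact: cvg_id.
have rayE y : 0 < y -> ray (row2 0 y) by move=> y0; exists y => //=; rewrite in_itv /= y0.
rewrite (_ : ~` _ = \bigcup_(q in ~` [set 0]) (ray `|` [set p | height p = height q])).
  apply: bigcup_connected.
    by exists (row2 0 1) => q _; left; exact: rayE.
  move=> q /= q0; have [b [T1 [T [x [u [t [hl _ _]]]]]]] := height_loop q0.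
  have [[a0 _ _ _] hs _ [x0 u0 _ _] _] := hl.
  rewrite -(loop_level hl); apply: connectedU => //.
    exists (row2 0 (height q)); split; first exact: rayE.
    by exists 0 => //; rewrite /curve x0 u0 (rd_F0 rd) subr0.
  apply: connected_continuous_connected; first by apply/connected_intervalP => a c _ _ d _.
  apply: continuous_subspaceT => s; have [cx cu] := lienard_cont hs.
  apply: (@row2_continuous _ _ x (fun s => u s - F.[x s]) s); first exact: cx.
  exact: continuous_velocity.
apply/seteqP; split=> [q q0|p [q /= q0 [[y /=]|/= hp]]]; first by exists q => //; right.
  rewrite in_itv /= andbT => y0 <- /(congr1 (@ycoord R _)); rewrite ycoord2 ycoord0 => e.
  by rewrite e ltxx in y0.
by move=> p0; have := height_gt0 q0; rewrite -hp p0 height0 ltxx.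
Qed.

Lemma global_center_origin : (forall x : R, x != 0 -> 0 < x * g.[x]) -> global_center X 0.
Proof.
move=> xg.
have lev0 (q : 'rV[R]_2) : q <> 0 -> [set p | height p = height q] `<=` ~` [set 0].
  move=> q0 p /= hp p0; have := height_gt0 q0; by rewrite -hp p0 height0 ltxx.
split.
  split; first exact/equilibrium_origin.
  exists setT; first exact: filterT.
  move=> q _ q0; have [h1 h2] := periodic_orbit_through q0.
  by exists [set p | height p = height q]; split => // p /(lev0 _ q0).
split.
  split; [|exact: punctured_plane_connected|split].
  - move=> q /= q0; have [h1 h2] := periodic_orbit_through q0.
    by exists [set p | height p = height q]; split => //; exact: lev0.
  - move=> B B0; have : \forall e \near (0 : R), B (row2 0 e).
      have : {for (0 : R), continuous (fun e : R => row2 0 e)}.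
        by apply: row2_continuous; [exact: cst_continuous|exact: cvg_id].
      move=> /(_ B); rewrite (_ : row2 0 0 = 0); last by apply: row2_eqP; rewrite ?xcoord2 ?ycoord2 ?xcoord0 ?ycoord0.
      by move=> /(_ B0).
    move=> /nbhs_ballP[e /= e0 he]; exists (row2 0 (e / 2)); split.
      move=> /= /(congr1 (@ycoord R _)); rewrite ycoord2 ycoord0 => e1.
      by move: (divr_gt0 e0 (ltr0n R 2)); rewrite e1 ltxx.
    by apply: he; rewrite /ball /= sub0r normrN gtr0_norm ?divr_gt0// ltr_pdivrMr// ltr_pMr// ltr1n.
  - by move=> /interior_subset /=.
(* Maximality: a union of orbits surrounding the origin does not contain it, so nothing can be added
   to the punctured plane. *)
move=> B [hB _ _] sB; apply/seteqP; split => // q Bq /= q0; rewrite q0 in Bq.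
by have [orb [_ [n0 _] orb0 _]] := hB _ Bq.
Unshelve. all: by end_near. Qed.

End Cycles.

(** The eigenvalues are the roots of l^2 + d l + c. The quadratic formula in R[i] supplies one root;
    if it is 0 then c = 0, so - d is also a root and vanishes. *)
Lemma eigenvalue_companion (c d : R) :
  (forall l : R[i], eigenvalue (map_mx (real_complex R)
     (\matrix_(i < 2, j < 2) (if i == ord0 then (if j == ord0 then 0 else - c)
        else (if j == ord0 then 1 else - d)))) l -> l = 0) <-> c = 0 /\ d = 0.
Proof.
set A := map_mx _ _; pose C := real_complex R.
have AE (v : 'rV[R[i]]_2) (l : R[i]) : v *m A = l *: v <->
    v 0 (inord 1) = l * v 0 ord0 /\
    - C c * v 0 ord0 - C d * v 0 (inord 1) = l * v 0 (inord 1).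
  have vA j : (v *m A) 0 j = v 0 ord0 * A ord0 j + v 0 (inord 1) * A (inord 1) j.
    rewrite mxE big_ord_recl big_ord1; congr (_ + v _ _ * A _ _); apply/val_inj; by rewrite /= inordK.
  have i10 : (inord 1 == ord0 :> 'I_2) = false by apply/negbTE/eqP => /(congr1 val); rewrite /= inordK.
  have A00 : A ord0 ord0 = 0 by rewrite !mxE.
  have A01 : A ord0 (inord 1) = - C c by rewrite !mxE i10 rmorphN.
  have A10 : A (inord 1) ord0 = 1 by rewrite !mxE i10.
  have A11 : A (inord 1) (inord 1) = - C d by rewrite !mxE i10 rmorphN.
  split=> [/rowP e|[e1 e2]].
    have := e ord0; have := e (inord 1); rewrite !vA ![(l *: v) _ _]mxE A00 A01 A10 A11.
    rewrite mulr0 add0r mulr1 => e1 e2; split => //; rewrite -e1; ring.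
  apply/rowP => j; rewrite vA [RHS]mxE.
  have [->|->] : j = ord0 \/ j = inord 1.
    by case: j => -[|[|//]] i; [left|right]; apply/val_inj; rewrite //= inordK.
    by rewrite A00 A10 mulr0 add0r mulr1.
  by rewrite A01 A11 -e2; ring.
have ev (l : R[i]) : eigenvalue A l <-> l ^+ 2 + C d * l + C c = 0.
  split=> [/eigenvalueP[v /AE[e1 e2] v0]|e].
    have w0 : v 0 ord0 != 0.
      apply: contraNneq v0 => w0; apply/eqP/rowP => j; rewrite mxE.
      case: j => -[|[|//]] i; first by rewrite -[RHS]w0; congr (v _ _); apply/val_inj.
      rewrite (_ : Ordinal i = inord 1); last by apply/val_inj; rewrite /= inordK.
      by rewrite e1 w0 mulr0.
    apply: (mulIf w0); rewrite mul0r.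
    move: e2; rewrite e1 => /eqP; rewrite -subr_eq0 => /eqP e2.
    by apply: oppr_inj; rewrite oppr0 -e2; ring.
  apply/eigenvalueP; exists (\row_j (if j == ord0 then 1 else l)).
    apply/AE; rewrite !mxE eqxx (_ : (inord 1 == ord0 :> 'I_2) = false); last first.
      by apply/negbTE/eqP => /(congr1 val); rewrite /= inordK.
    rewrite !mulr1; split => //; apply/eqP; rewrite -subr_eq0; apply/eqP.
    by apply: oppr_inj; rewrite oppr0 -e; ring.
  by apply/eqP => /rowP /(_ ord0) /eqP; rewrite !mxE eqxx oner_eq0.
split=> [h|[c0 d0] l /ev]; last first.
  by rewrite c0 d0 /C rmorph0 mul0r !addr0 => /eqP; rewrite expf_eq0 /= => /eqP.
have Cinj : injective C by exact: fmorph_inj.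
pose q := sqrtC (C d ^+ 2 - 4 * C c); pose l := (q - C d) / 2.
have q2 : q ^+ 2 = C d ^+ 2 - 4 * C c by exact: sqrtCK.
have le : l ^+ 2 + C d * l + C c = 0.
  have -> : l ^+ 2 + C d * l + C c = (q ^+ 2 - (C d ^+ 2 - 4 * C c)) / 4 by rewrite /l; field.
  by rewrite q2 subrr mul0r.
have c0 : C c = 0.
  by have := le; rewrite (h l (proj2 (ev l) le)) expr0n mulr0 !add0r.
have d0 : - C d = 0 by apply/h/ev; rewrite c0; ring.
have C0 : C 0 = 0 by exact: rmorph0.
by split; apply: Cinj; rewrite C0//; apply: oppr_inj; rewrite oppr0.
Qed.

Lemma lienard_differentiable (p : 'rV[R]_2) : differentiable X p.
Proof.
have hor (h : {poly R}) : differentiable (fun q : 'rV[R]_2 => h.[xcoord q]) p.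
  apply: (@differentiable_comp _ _ _ _ (fun q : 'rV[R]_2 => xcoord q) (horner h)); first exact: differentiable_coord.
  by apply/derivable1_diffP; have [] := is_derive_poly h (xcoord p).
have dy : differentiable (fun q : 'rV[R]_2 => ycoord q) p by exact: differentiable_coord.
rewrite (_ : X = (fun q => ycoord q *: row2 1 0) + (fun q => (- g.[xcoord q] - f.[xcoord q] * ycoord q) *: row2 0 1)).
  apply: differentiableD; apply: differentiableZl => //.
  have -> : (fun q : 'rV[R]_2 => - g.[xcoord q] - f.[xcoord q] * ycoord q) =
      (- (fun q : 'rV[R]_2 => g.[xcoord q])) - ((fun q => f.[xcoord q]) * (fun q => ycoord q)) by apply/funext.
  by apply: differentiableB; [exact: differentiableN|exact: differentiableM].
by apply/funext => q; rewrite vector_field_lienard row2_decomp.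
Qed.

Lemma lienard_jacobian : 'J X 0 =
  \matrix_(i < 2, j < 2) (if i == ord0 then (if j == ord0 then 0 else - g^`().[0])
        else (if j == ord0 then 1 else - f.[0])).
Proof.
have lineD (v w : 'rV[R]_2) : is_derive (0 : R) (1 : R) (fun h : R => X (h *: v)) w ->
    'D_v X 0 = w.
  move=> [_ <-]; rewrite /derive.
  rewrite (_ : (fun h : R => h^-1 *: ((X \o shift 0) (h *: v) - X 0)) =
    (fun h : R => h^-1 *: (((fun h : R => X (h *: v)) \o shift 0) (h *: 1) - X (0 *: v))))//.
  by apply/funext => h /=; rewrite !addr0 scale0r [h *: 1](mulr1 h).
have row_ (v : 'rV[R]_2) w : is_derive (0 : R) (1 : R) (fun h : R => X (h *: v)) w -> v *m 'J X 0 = w.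
  by move=> /lineD <-; rewrite deriveEjacobian//; exact: lienard_differentiable.
have e1 : row2 1 0 *m 'J X 0 = row2 0 (- g^`().[0]).
  apply: row_; rewrite (_ : (fun h : R => _) = (fun h => row2 0 (- g.[h]))).
    by apply/row2_derive; split; [exact: isd_cst|apply: isdN; exact: is_derive_poly].
  apply/funext => h; rewrite vector_field_lienard /xcoord /ycoord !mxE inordK//=.
  by rewrite !mulr0 mulr1 subr0.
have e2 : row2 0 1 *m 'J X 0 = row2 1 (- f.[0]).
  apply: row_; rewrite (_ : (fun h : R => _) = (fun h => row2 h (- g.[0] - f.[0] * h))).
    apply/row2_derive; split; first exact: isd_id.
    by apply: (isd_eq (isdB (isd_cst (- g.[0]) 0) (isdM (isd_cst f.[0] 0) (isd_id 0)))); rewrite mul0r add0r mulr1 add0r.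
  apply/funext => h; rewrite vector_field_lienard /xcoord /ycoord !mxE inordK//=.
  by rewrite !mulr0 mulr1.
have mulE (M : 'M[R]_2) a b j : (row2 a b *m M) 0 j = a * M ord0 j + b * M (inord 1) j.
  rewrite mxE big_ord_recl big_ord1 !mxE /=; congr (_ + _ * M _ _).
  by apply/val_inj; rewrite /= inordK.
apply/matrixP => i j; rewrite [RHS]mxE.
have [->|->] : i = ord0 \/ i = inord 1.
  by case: i => -[|[|//]] i; [left|right]; apply/val_inj; rewrite //= inordK.
  have := congr1 (fun M : 'rV[R]_2 => M 0 j) e1; rewrite /= mulE mul1r mul0r addr0 => ->.
  by rewrite mxE; case: j => -[|[|//]] j.
have := congr1 (fun M : 'rV[R]_2 => M 0 j) e2; rewrite /= mulE mul1r mul0r add0r => ->.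
rewrite (_ : (inord 1 == ord0 :> 'I_2) = false); last first.
  by apply/negbTE/eqP => /(congr1 val); rewrite /= inordK.
by rewrite mxE; case: j => -[|[|//]] j.
Qed.

Lemma nilpotent_linear_partP : nilpotent_linear_part X 0 <-> g^`().[0] = 0 /\ f.[0] = 0.
Proof.
rewrite -eigenvalue_companion /nilpotent_linear_part lienard_jacobian.
split=> [[]//|h]; split => //.
move=> /matrixP/(_ (inord 1) ord0)/eqP; rewrite !mxE eqxx.
rewrite (_ : (inord 1 == ord0 :> 'I_2) = false) ?oner_eq0//.
by apply/negbTE/eqP => /(congr1 val); rewrite /= inordK.
Qed.

End Plane.

(** * Growth of the height *)

Section Growth.
Variable R : realType.

Lemma size_poly_between lo hi (c : nat -> R) : (size (poly_between lo hi c) <= hi.+1)%N.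
Proof.
rewrite /poly_between; apply: (leq_trans (size_sum _ _ _)).
rewrite big_nat; apply/bigmax_leqP_seq => i _ /andP[_ ih].
by apply: leq_trans (size_scale_leq _ _) _; rewrite size_polyXn.
Qed.

Lemma poly_between_coefs (p : {poly R}) hi : (size p <= hi.+1)%N ->
  p = poly_between 0 hi (fun i => p`_i).
Proof.
move=> sp; apply/polyP => i; rewrite /poly_between big_mkord -poly_def coef_poly.
by case: ltnP => // hi_i; rewrite nth_default// (leq_trans sp).
Qed.

(** Both polynomials are written as x^hi times a polynomial in t = 1/x in [-1, 1]. The one for the
    dominating polynomial has no zero there, t = 0 included because its value is the top
    coefficient, so its absolute value has a positive minimum. *)
Lemma poly_dominated lo hi (c : nat -> R) (p : {poly R}) : (lo <= hi)%N -> c hi != 0 ->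
  (forall x : R, 1 <= `|x| -> 0 < (poly_between lo hi c).[x]) -> (size p <= hi.+1)%N ->
  exists C : R, 0 <= C /\ forall x : R, 1 <= `|x| -> `|p.[x]| <= C * (poly_between lo hi c).[x].
Proof.
move=> lh ch hw sp.
have [q [q0 hq]] := @poly_between_high R lo hi c lh.
have [p' [_ hp]] := @poly_between_high R 0 hi (fun i => p`_i) (leq0n _).
rewrite -(poly_between_coefs sp) in hp.
have [M [M0 hM]] := poly_bounded p' 1.
have [||t0 t0I hmin] := @EVT_min R (fun t => `|q.[t]|) (-1) 1; first by lra.
  apply: continuous_subspaceT => t; apply: (@continuous_comp _ _ _ (horner q) (fun x : R => `|x|)).
    exact: continuous_horner.
  exact: norm_continuous.
have x_neq0 (x : R) : 1 <= `|x| -> x != 0 by move=> x1; rewrite -normr_gt0 (lt_le_trans ltr01).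
have e0 : 0 < `|q.[t0]|.
  rewrite normr_gt0; have [->|tn0] := eqVneq t0 0; first by rewrite q0.
  have x1 : 1 <= `|t0^-1|.
    by rewrite normfV invf_ge1 ?normr_gt0// ler_norml; move: t0I; rewrite in_itv.
  apply: contraTneq (hw _ x1) => z; rewrite hq ?x_neq0// invrK z mulr0 ltxx//.
exists (M / `|q.[t0]|); split; first by rewrite divr_ge0// ltW.
move=> x x1; have x0 := x_neq0 _ x1.
have xi : `|x^-1| <= 1 by rewrite normfV invf_le1// (lt_le_trans ltr01).
have xI : x^-1 \in `[-1, 1] by rewrite in_itv /= -ler_norml.
rewrite hp// normrM -[(poly_between _ _ _).[x]]gtr0_norm ?hw// hq// normrM.
rewrite [leRHS]mulrCA ler_wpM2l//; apply: le_trans (hM _ xi) _.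
by rewrite -{1}(divfK (lt0r_neq0 e0) M) ler_wpM2l ?divr_ge0// ?(ltW e0)// hmin.
Qed.

Section Heights.
Variables (G F : {poly R}).
Hypotheses (rd : right_data G F) (rdl : right_data (refl G) (refl F)).
Hypothesis sym : forall x1 x2 : R, 0 < x1 -> 0 < x2 -> G.[x1] = (refl G).[x2] -> F.[x1] = (refl F).[x2].
Notation height := (height G F).

Lemma height_rho : exists K : R, 0 < K /\ forall p, p <> 0 ->
  let r := rho G (xcoord p) (ycoord p + F.[xcoord p]) in
  r <= K * (1 + height p ^+ 2) /\ height p ^+ 2 <= K * (1 + r).
Proof.
have [K1 [K10 h1]] := half_orbit_rho rd; have [K2 [K20 h2]] := half_orbit_rho rdl.
exists (K1 + K2); split; first exact: addr_gt0.
move=> p /plane_neq0 => /(_ _ _ rd) p0 r.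
have r0 : 0 <= r.
  rewrite /r /rho addr_ge0 ?sqr_ge0// mulr_ge0//.
  have [x0|/ltW x0] := leP 0 (xcoord p); first exact: (rd_Gge0 rd).
  by rewrite -[xcoord p]opprK -refl_horner (rd_Gge0 rdl)// oppr_ge0.
have h0 := sqr_ge0 (height p).
have le1 (x : R) : 0 <= x -> K1 * (1 + x) <= (K1 + K2) * (1 + x).
  by move=> x0; rewrite ler_wpM2r ?lerDl ?(ltW K20)// addr_ge0.
have le2 (x : R) : 0 <= x -> K2 * (1 + x) <= (K1 + K2) * (1 + x).
  by move=> x0; rewrite ler_wpM2r ?lerDr ?(ltW K10)// addr_ge0.
have [x0|/ltW x0] := leP 0 (xcoord p).
  have [b [T [x [u [t [ho tI ex eu]]]]]] := label_right rd rdl sym p0 x0.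
  have := h1 _ _ _ _ _ _ ho tI; rewrite ex eu -/r -/(height p) => -[q1 q2].
  by split; [exact: le_trans q1 (le1 _ h0)|exact: le_trans q2 (le1 _ r0)].
have [b [T [x [u [t [ho tI ex eu]]]]]] := label_left rd rdl sym p0 x0.
have := h2 _ _ _ _ _ _ ho tI; rewrite ex eu /rho refl_horner opprK -/(rho _ _ _) -/r -/(height p) => -[q1 q2].
by split; [exact: le_trans q1 (le2 _ h0)|exact: le_trans q2 (le2 _ r0)].
Qed.

End Heights.

Section Infinity.
Variables (m n r s : nat) (a b : nat -> R).
Let g := poly_between r m a.
Let f := poly_between s n b.
Let G := primitive_between r m a.
Let F := primitive_between s n b.
Hypotheses (hrm : (r <= m)%N) (n0 : (0 < n)%N) (nm : (2 * n + 1 <= m)%N) (am : a m != 0).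
Hypotheses (rd : right_data G F) (rdl : right_data (refl G) (refl F)).
Hypothesis sym : forall x1 x2 : R, 0 < x1 -> 0 < x2 -> G.[x1] = (refl G).[x2] -> F.[x1] = (refl F).[x2].
Hypothesis xg : forall x : R, x != 0 -> 0 < x * g.[x].
Notation height := (height G F).

Let w : {poly R} := poly_between r.+1 m.+1 (fun i => a i.-1).

Let wE x : w.[x] = x * g.[x].
Proof.
rewrite !poly_between_horner big_add1 /= mulr_sumr.
by apply: eq_bigr => i _; rewrite exprS mulrCA.
Qed.

Let norm_ge1_neq0 (x : R) : 1 <= `|x| -> x != 0.
Proof. by move=> x1; rewrite -normr_gt0 (lt_le_trans ltr01). Qed.

Let dom (p : {poly R}) : (size p <= m.+2)%N ->
  exists C : R, 0 <= C /\ forall x : R, 1 <= `|x| -> `|p.[x]| <= C * (x * g.[x]).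
Proof.
move=> sp; have [||C [C0 hC]] := @poly_dominated r.+1 m.+1 (fun i => a i.-1) p _ am _ sp.
- exact: hrm.
- by move=> x /norm_ge1_neq0 x0; rewrite -/w wE xg.
by exists C; split => // x /hC; rewrite -/w wE.
Qed.

Let Gpos (x : R) : x != 0 -> 0 < G.[x].
Proof.
rewrite neq_lt => /orP[x0|x0]; last exact: (rd_Gpos rd).
by rewrite -[x]opprK -refl_horner (rd_Gpos rdl)// oppr_gt0.
Qed.

Let size_sq (p : {poly R}) : (size p <= n.+2)%N -> (size (p ^+ 2) <= m.+2)%N.
Proof.
move=> sp; rewrite expr2; apply: leq_trans (size_polyMleq _ _) _.
by move: sp nm; clear; lia.
Qed.

Let dom_f : exists C0 C1 C2 : R, [/\ 0 <= C0, 0 <= C1, 0 <= C2 &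
  forall x : R, 1 <= `|x| -> [/\ (x * f.[x]) ^+ 2 <= C0 * (x * g.[x]), G.[x] <= C1 * (x * g.[x]) &
    F.[x] ^+ 2 <= C2 * (x * g.[x])]].
Proof.
have [|C0 [C00 h0]] := dom (p := ('X * f) ^+ 2).
  apply: size_sq; rewrite mulrC; have [->|f0] := eqVneq f 0; first by rewrite mul0r size_poly0.
  by rewrite size_mulX// ltnS; exact: size_poly_between.
have [|C1 [C10 h1]] := dom (p := G); first exact: size_poly_between.
have [|C2 [C20 h2]] := dom (p := F ^+ 2); first by apply: size_sq; exact: size_poly_between.
exists C0, C1, C2; split => // x x1; split.
- by apply: le_trans (h0 x x1); rewrite horner_exp hornerM hornerX ler_norm.
- by apply: le_trans (h1 x x1); rewrite ler_norm.
- by apply: le_trans (h2 x x1); rewrite horner_exp ler_norm.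
Qed.

(** G has degree m + 1 >= 2 n + 2 >= 4, so for |x| >= 1 it dominates x^4, while rho >= 2 G is
    controlled by 1 + h^2 for the height h. The point is that x / h tends to 0 as h grows, uniformly
    in y. *)
Lemma xcoord_height : exists C : R, 0 < C /\ forall p, p <> 0 -> xcoord p ^+ 2 <= C * (1 + height p).
Proof.
have [K [K0 hK]] := height_rho rd rdl sym.
have [| | | |C [C0 hC]] := @poly_dominated r.+1 m.+1 (fun i => a i.-1 / i%:R) 'X^4.
- exact: hrm.
- by rewrite /= mulf_neq0// invr_eq0 pnatr_eq0.
- by move=> x /norm_ge1_neq0; exact: Gpos.
- by rewrite size_polyXn; move: n0 nm; clear; lia.
have B0 : 0 <= C * K by rewrite mulr_ge0// ltW.
exists (C * K + 1); split; first by rewrite ltr_wpDl.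
move=> p p0; have [h1 _] := hK p p0; set x := xcoord p in h1 *; set L := height p in h1 *.
have L0 : 0 < L by exact: height_gt0.
have [x1|/ltW x1] := leP 1 `|x|.
  have h2 : x ^+ 4 <= C * G.[x] by have := hC x x1; rewrite hornerXn; apply: le_trans; exact: ler_norm.
  have h3 : C * G.[x] <= C * (K * (1 + L ^+ 2)).
    rewrite ler_wpM2l//; apply: le_trans h1; rewrite /rho.
    have : 0 < G.[x] by exact/Gpos/norm_ge1_neq0.
    by have := sqr_ge0 (ycoord p + F.[x]); lra.
  have h4 : (x ^+ 2) ^+ 2 <= ((C * K + 1) * (1 + L)) ^+ 2.
    rewrite -exprM; apply: le_trans h2 _; apply: le_trans h3 _.
    by rewrite mulrA; move: (C * K) B0 => B B0; nra.
  rewrite -ler_sqr ?nnegrE ?sqr_ge0// mulr_ge0 ?addr_ge0//; exact: ltW.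
apply: (@le_trans _ _ 1); first by rewrite -real_normK ?num_real// expr_le1.
have h5 : 0 <= C * K * (1 + L) by rewrite mulr_ge0// addr_ge0// ltW.
by lra.
Qed.

(** The expression is y^2 times the derivative of x/y + A x/h along orbits. Only x f y can be
    negative. For |x| <= 1 a large height makes y larger than |x f|. Otherwise, if that term
    outweighs y^2 + W with W = x g, then (x f)^2 <= C0 W gives |x f| <= C0 y and W <= C0 y^2; so rho
    is at most C3 y^2, the height at most B y, and A y^3 / h exceeds C0 y^2 because A = C0 B + 1. *)
Lemma turning_bound : exists A L0 : R, [/\ 0 < A, 0 < L0 & forall p, 0 < ycoord p -> L0 <= height p ->
  let x := xcoord p in let y := ycoord p in
  0 < y ^+ 2 + x * f.[x] * y + x * g.[x] + A * y ^+ 3 / height p].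
Proof.
have [K [K0 hK]] := height_rho rd rdl sym.
have [C0 [C1 [C2 [C00 C10 C20 hC]]]] := dom_f.
have [M1 [M10 hM1]] := poly_bounded ('X * f) 1.
have [M2 [M20 hM2]] := poly_bounded F 1.
have [M3 [M30 hM3]] := poly_bounded G 1.
pose C3 := 2 * C1 * C0 + 2 + 2 * C2 * C0.
have C30 : 0 <= C3 by rewrite /C3 !addr_ge0// !mulr_ge0.
pose B := 2 * K * C3 + 1.
have B1 : 1 <= B by rewrite /B lerDr !mulr_ge0// ltW.
pose N := K * (1 + 2 * M3 + (M1 + M2) ^+ 2).
have N0 : 0 <= N by have h := sqr_ge0 (M1 + M2); apply: mulr_ge0; [exact: ltW|lra].
exists (C0 * B + 1), (N + 2 * K + 1); split.
- by rewrite ltr_wpDl// mulr_ge0//; lra.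
- by lra.
move=> p y0 hL /=.
have p0 : p <> 0 by move=> p0; move: y0; rewrite p0 ycoord0 ltxx.
set x := xcoord p; set y := ycoord p in y0 *; set L := height p in hL *.
have L1 : 1 <= L by lra.
have Lp : 0 < L by lra.
have xg0 : 0 <= x * g.[x] by have [->|/xg/ltW//] := eqVneq x 0; rewrite mul0r.
have tail : 0 < (C0 * B + 1) * y ^+ 3 / L.
  by rewrite divr_gt0// mulr_gt0 ?exprn_gt0// ltr_wpDl// mulr_ge0//; lra.
have LL : L <= L ^+ 2 by rewrite expr2 ler_peMr// ltW.
have [_ h2] := hK p p0; rewrite -/L -/x -/y in h2.
have [x1|/ltW x1] := leP 1 `|x|; last first.
  have f1 : `|x * f.[x]| <= M1 by have := hM1 x x1; rewrite hornerM hornerX.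
  have yM : M1 < y.
    rewrite ltNge; apply/negP => yM.
    have : rho G x (y + F.[x]) <= 2 * M3 + (M1 + M2) ^+ 2.
      rewrite /rho lerD//; first by rewrite ler_wpM2l// (le_trans (ler_norm _))// hM3.
      rewrite -real_normK ?num_real// ler_sqr ?nnegrE ?addr_ge0// (le_trans (ler_normD _ _))// lerD//.
        by rewrite gtr0_norm.
      exact: hM2.
    move=> h3; have : L ^+ 2 <= N.
      by apply: le_trans h2 _; rewrite /N ler_wpM2l ?(ltW K0)// -addrA lerD2l.
    by move: LL hL K0; clear -dom_f size_sq Gpos dom norm_ge1_neq0 wE n0 xg sym rd rdl; lra.
  have h3 : - (M1 * y) <= x * f.[x] * y.
    rewrite -mulNr ler_wpM2r ?(ltW y0)//; move: f1; rewrite ler_norml => /andP[] //.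
  have : 0 < y * (y - M1) by rewrite mulr_gt0// subr_gt0.
  by move: h3 tail xg0; clear -dom_f size_sq Gpos dom norm_ge1_neq0 wE n0 xg sym rd rdl; lra.
have [h0 h1 h4] := hC x x1.
have [Q0|Q0] := leP 0 (y ^+ 2 + x * f.[x] * y + x * g.[x]); first by move: tail; clear -Q0 dom_f size_sq Gpos dom norm_ge1_neq0 wE n0 xg sym rd rdl; lra.
pose v := `|x * f.[x]|.
have vE : (x * f.[x]) ^+ 2 = v ^+ 2 by rewrite real_normK// num_real.
have vy : - (v * y) <= x * f.[x] * y by rewrite -mulNr ler_wpM2r ?(ltW y0)// lerNl /v -normrN ler_norm.
have wv : y ^+ 2 + x * g.[x] < v * y by move: Q0 vy; clear -dom_f size_sq Gpos dom norm_ge1_neq0 wE n0 xg sym rd rdl; lra.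
move: h0 h1 h4; rewrite vE; set W := x * g.[x] in xg0 Q0 wv *; move=> h0 h1 h4.
have v0 : 0 < v.
  rewrite lt_neqAle normr_ge0 andbT; apply: contraTneq wv => <-.
  by rewrite mul0r -leNgt addr_ge0// sqr_ge0.
have y20 := sqr_ge0 y.
have vC : v <= C0 * y.
  rewrite -(ler_pM2l v0) -expr2; apply: le_trans h0 _.
  by rewrite [leRHS]mulrCA ler_wpM2l//; move: wv y20 xg0; clear -dom_f size_sq Gpos dom norm_ge1_neq0 wE n0 xg sym rd rdl; lra.
have WC : W <= C0 * y ^+ 2.
  apply: (@le_trans _ _ (v * y)); first by move: wv y20; clear -dom_f size_sq Gpos dom norm_ge1_neq0 wE n0 xg sym rd rdl; lra.
  by rewrite expr2 mulrA ler_wpM2r// ltW.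
have rC : rho G x (y + F.[x]) <= C3 * y ^+ 2.
  have g1 : G.[x] <= C1 * (C0 * y ^+ 2) by apply: le_trans h1 _; rewrite ler_wpM2l.
  have g2 : F.[x] ^+ 2 <= C2 * (C0 * y ^+ 2) by apply: le_trans h4 _; rewrite ler_wpM2l.
  have : (y + F.[x]) ^+ 2 <= 2 * y ^+ 2 + 2 * F.[x] ^+ 2.
    by have := sqr_ge0 (y - F.[x]); clear -dom_f size_sq Gpos dom norm_ge1_neq0 wE n0 xg sym rd rdl; lra.
  by move: g1 g2; rewrite /rho /C3; clear -dom_f size_sq Gpos dom norm_ge1_neq0 wE n0 xg sym rd rdl; lra.
have L2 : L ^+ 2 <= (B * y) ^+ 2.
  have : L ^+ 2 <= K * (1 + C3 * y ^+ 2) by apply: le_trans h2 _; rewrite ler_wpM2l ?(ltW K0)// lerD2l.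
  have k1 : 2 * K <= L ^+ 2 by move: LL hL N0; clear -dom_f size_sq Gpos dom norm_ge1_neq0 wE n0 xg sym rd rdl; lra.
  have : 2 * K * C3 * y ^+ 2 <= B ^+ 2 * y ^+ 2.
    rewrite ler_wpM2r// /B; have : 0 <= 2 * K * C3 by rewrite !mulr_ge0// ltW.
    by move: (2 * K * C3) => z; nra.
  by rewrite exprMn; move: k1; clear -dom_f size_sq Gpos dom norm_ge1_neq0 wE n0 xg sym rd rdl; lra.
have By : 0 <= B * y by rewrite mulr_ge0 ?(ltW y0)//; exact: le_trans B1.
have LB : L <= B * y by move: L2; rewrite ler_sqr ?nnegrE// ltW.
have key : C0 * y ^+ 2 < (C0 * B + 1) * y ^+ 3 / L.
  rewrite ltr_pdivlMr//; apply: (@le_lt_trans _ _ (C0 * y ^+ 2 * (B * y))).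
    by rewrite ler_wpM2l// mulr_ge0.
  rewrite [ltLHS](_ : _ = (C0 * B) * y ^+ 3); last by ring.
  by rewrite ltr_pM2r ?exprn_gt0// ltrDl.
have : v * y <= C0 * y ^+ 2 by rewrite expr2 mulrA ler_wpM2r// ltW.
by move: key vy y20 xg0; clear -dom_f size_sq Gpos dom norm_ge1_neq0 wE n0 xg sym rd rdl; lra.
Qed.

(** In a cone |x| <= C y with y < 1 both coordinates, hence rho and the height, are bounded. On the
    sphere the conclusion reads z <= y, which keeps the sector away from y = 0. *)
Lemma ycoord_large (C : R) : exists2 L : R, 0 < L & forall p, 0 < ycoord p ->
  `|xcoord p| <= C * ycoord p -> L <= height p -> 1 <= ycoord p.
Proof.
have [K [K0 hK]] := height_rho rd rdl sym.
have [M2 [M20 hM2]] := poly_bounded F `|C|.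
have [M3 [M30 hM3]] := poly_bounded G `|C|.
pose N := K * (1 + 2 * M3 + (1 + M2) ^+ 2).
have N0 : 0 <= N by have h := sqr_ge0 (1 + M2); apply: mulr_ge0; [exact: ltW|lra].
exists (N + 1); first by lra.
move=> p y0 hx hL; rewrite leNgt; apply/negP => y1.
have p0 : p <> 0 by move=> p0; move: y0; rewrite p0 ycoord0 ltxx.
have [_ h2] := hK p p0; set x := xcoord p in hx h2; set y := ycoord p in hx h2 y0 y1.
set L := height p in hL h2.
have x1 : `|x| <= `|C|.
  apply: le_trans hx _; apply: le_trans (ler_norm _) _; rewrite normrM ler_piMr//.
  by rewrite gtr0_norm// ltW.
have h3 : rho G x (y + F.[x]) <= 2 * M3 + (1 + M2) ^+ 2.
  rewrite /rho lerD//; first by rewrite ler_wpM2l// (le_trans (ler_norm _))// hM3.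
  rewrite -real_normK ?num_real// ler_sqr ?nnegrE ?addr_ge0// (le_trans (ler_normD _ _))// lerD//.
    by rewrite gtr0_norm// ltW.
  exact: hM2.
have : L ^+ 2 <= N.
  by apply: le_trans h2 _; rewrite /N ler_wpM2l ?(ltW K0)// -addrA lerD2l.
have : L <= L ^+ 2 by rewrite expr2 ler_peMr//; lra.
by lra.
Qed.

End Infinity.
End Growth.

(** * The field at infinity *)

Section Vectors3.
Variable R : realType.

Lemma row3_coords (q : 'rV[R]_3) : row3 (xcoord q) (ycoord q) (zcoord q) = q.
Proof.
apply/rowP => -[[|[|[|//]]] i]; rewrite mxE /=; congr (q _ _); apply/val_inj => //=;
  by rewrite inordK.
Qed.

Lemma row3_eqP (p q : 'rV[R]_3) : xcoord p = xcoord q -> ycoord p = ycoord q ->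
  zcoord p = zcoord q -> p = q.
Proof. by move=> e1 e2 e3; rewrite -(row3_coords p) -(row3_coords q) e1 e2 e3. Qed.

Lemma zcoord0 n : zcoord (0 : 'rV[R]_n.+3) = 0. Proof. by rewrite /zcoord mxE. Qed.

Lemma row3_decomp (a b c : R) : row3 a b c = a *: row3 1 0 0 + b *: row3 0 1 0 + c *: row3 0 0 1.
Proof.
by apply/rowP => -[[|[|[|//]]] i]; rewrite !mxE /= !(mulr0, mulr1, add0r, addr0).
Qed.

Lemma row3_continuous (T : topologicalType) (e f h : T -> R) (t : T) :
  {for t, continuous e} -> {for t, continuous f} -> {for t, continuous h} ->
  {for t, continuous (fun s => row3 (e s) (f s) (h s))}.
Proof.
move=> ce cf ch.
rewrite (_ : (fun s => _) = (fun s => e s *: row3 1 0 0 + f s *: row3 0 1 0 + h s *: row3 0 0 1)); last first.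
  by apply/funext => s; exact: row3_decomp.
apply: (@continuousD _ _ _ (fun s => e s *: row3 1 0 0 + f s *: row3 0 1 0) (fun s => h s *: row3 0 0 1)).
  by apply: (@continuousD _ _ _ (fun s => e s *: row3 1 0 0) (fun s => f s *: row3 0 1 0)); exact: continuousZr_tmp.
exact: continuousZr_tmp.
Qed.

Lemma coords_derive3 (gamma : R -> 'rV[R]_3) (t a b c : R) :
  is_derive t (1 : R) gamma (row3 a b c) <->
  [/\ isd (fun s => xcoord (gamma s)) t a, isd (fun s => ycoord (gamma s)) t b &
      isd (fun s => zcoord (gamma s)) t c].
Proof.
split=> [/is_derive_rVP d|[d1 d2 d3]].
  split; [have := d ord0|have := d (inord 1)|have := d (inord 2)]; by rewrite mxE ?inordK.
apply/is_derive_rVP => -[[|[|[|//]]] i]; rewrite mxE /=.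
- by apply: isd_ext d1; near=> s; congr (gamma s _ _); apply/val_inj.
- by apply: isd_ext d2; near=> s; congr (gamma s _ _); apply/val_inj; rewrite /= inordK.
- by apply: isd_ext d3; near=> s; congr (gamma s _ _); apply/val_inj; rewrite /= inordK.
Unshelve. all: by end_near. Qed.

End Vectors3.

(** * The compactified field on the circle at infinity *)

Section Homogenization.
Variable R : realType.
Implicit Types (u : {poly {poly R}}) (x y z : R).

Lemma total_degree_le u d : (forall i j, u`_i`_j != 0 -> (i + j <= d)%N) -> (total_degree u <= d)%N.
Proof.
move=> h; rewrite /total_degree; apply/bigop.bigmax_leqP => i _.
by apply/bigop.bigmax_leqP => j; exact: h.
Qed.

Lemma total_degree_ge u i j : u`_i`_j != 0 -> (i + j <= total_degree u)%N.
Proof.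
move=> h; have ui : (i < size u)%N.
  by rewrite ltnNge; apply: contra h => ui; rewrite (nth_default _ ui) coef0.
have uj : (j < size (u`_i)%R)%N by rewrite ltnNge; apply: contra h => uj; rewrite (nth_default _ uj).
rewrite /total_degree; apply: (bigop.bigmax_sup (Ordinal ui)) => //=.
exact: (bigop.bigmax_sup (Ordinal uj)).
Qed.

Lemma poly_eq_at0 (p q : {poly R}) : (forall z, z != 0 -> p.[z] = q.[z]) -> p.[0] = q.[0].
Proof.
move=> h; suff -> : p = q by [].
apply/eqP; rewrite -subr_eq0; apply: contraT => /(poly_nonzero_right 0)[e e0 he].
have e20 : 0 < e / 2 by rewrite divr_gt0.
have := he (e / 2); rewrite add0r e20 ltr_pdivrMr// ltr_pMr// ltr1n => /(_ isT).
by rewrite hornerD hornerN h ?subrr ?eqxx// gt_eqF.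
Qed.

(** The homogenization is a polynomial in z, so its value on the equator z = 0 can be read off from
    a formula that is valid only for z != 0. *)
Lemma homogenization_at0 d u x y (p : {poly R}) :
  (forall z, z != 0 -> homogenization d u x y z = p.[z]) -> homogenization d u x y 0 = p.[0].
Proof.
pose q : {poly R} := \sum_(i < size u) \sum_(j < size u`_i) (u`_i`_j * x ^+ i * y ^+ j) *: 'X^(d - (i + j)).
have qE z : homogenization d u x y z = q.[z].
  rewrite /homogenization /q horner_sum; apply: eq_bigr => i _; rewrite horner_sum.
  by apply: eq_bigr => j _; rewrite hornerZ hornerXn.
by move=> h; rewrite qE; apply: poly_eq_at0 => z z0; rewrite -qE h.
Qed.

Lemma homogenization_neq0 d u x y z : z != 0 -> (total_degree u <= d)%N ->
  homogenization d u x y z = z ^+ d * u.[(x / z)%:P].[y / z].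
Proof.
move=> z0 ud; rewrite -homogenizationE//.
by congr (homogenization _ _ _ _ _); rewrite mulrC divfK.
Qed.

Lemma continuous_sum_ord (k : nat) (h : 'I_k -> R -> R) : (forall i, continuous (h i)) ->
  continuous (fun t => \sum_(i < k) h i t).
Proof.
elim: k h => [|k IH] h ch.
  by move=> t; under eq_fun do rewrite big_ord0; exact: cst_continuous.
move=> t; under eq_fun do rewrite big_ord_recl.
apply: (@continuousD _ _ _ (h ord0) (fun t => \sum_(i < k) h (lift ord0 i) t)); first exact: ch.
by apply: IH => i; exact: ch.
Qed.

Lemma continuous_exp (x : R -> R) k : continuous x -> continuous (fun t => x t ^+ k).
Proof.
move=> cx; rewrite (_ : (fun t => _) = (fun t => ('X^k : {poly R}).[x t])).
  exact: cont_horner_comp.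
by apply/funext => t; rewrite hornerXn.
Qed.

Lemma homogenization_continuous d u (x y z : R -> R) : continuous x -> continuous y -> continuous z ->
  continuous (fun t => homogenization d u (x t) (y t) (z t)).
Proof.
move=> cx cy cz; rewrite /homogenization.
apply: (@continuous_sum_ord _ (fun i t => \sum_(j < size u`_i) u`_i`_j * x t ^+ i * y t ^+ j * z t ^+ (d - (i + j)))) => i.
apply: (@continuous_sum_ord _ (fun j t => u`_i`_j * x t ^+ i * y t ^+ j * z t ^+ (d - (i + j)))) => j t.
apply: (@continuousM _ _ (fun t => u`_i`_j * x t ^+ i * y t ^+ j) (fun t => z t ^+ (d - (i + j)))); last exact: continuous_exp.
apply: (@continuousM _ _ (fun t => u`_i`_j * x t ^+ i) (fun t => y t ^+ j)); last exact: continuous_exp.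
by apply: (@continuousM _ _ (fun=> u`_i`_j) (fun t => x t ^+ i)); [exact: cst_continuous|exact: continuous_exp].
Qed.

Lemma homogenization_sum lo hi (c : nat -> R) d x z : z != 0 -> (hi <= d)%N ->
  z ^+ d * (poly_between lo hi c).[x / z] = \sum_(lo <= i < hi.+1) (c i * x ^+ i) * z ^+ (d - i).
Proof.
move=> z0 hd; rewrite poly_between_horner mulr_sumr big_nat [RHS]big_nat.
apply: eq_bigr => i /andP[_]; rewrite ltnS => ih.
rewrite -[in z ^+ d](subnK (leq_trans ih hd)) exprD exprMn exprVn.
by move: (z ^+ i) (expf_neq0 i z0) => w w0; field.
Qed.

Section Lienard.
Variables (m n r s : nat) (a b : nat -> R).
Let g := poly_between r m a.
Let f := poly_between s n b.
Let S := lienard_system g f.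
Hypotheses (hrm : (r <= m)%N) (n0 : (0 < n)%N) (nm : (2 * n + 1 <= m)%N) (am : a m != 0).

(** As n > 0, the degree n + 1 of the damping term is below m; hence - a_m x^m is the only term of
    the system that survives at infinity. *)
Let n1m : (n.+1 < m)%N. Proof. by move: n0 nm; clear; lia. Qed.

Let coef_second i j : S.2`_i`_j = - (g`_i *+ (j == 0)%N) - f`_i *+ (j == 1)%N.
Proof.
rewrite /S /= coefB coefN coefMC !coef_map /= coefB coefN coefC coefCM coefX.
by case: (j == 0)%N; rewrite ?mulr1n ?mulr0n mulr_natr.
Qed.

Lemma total_degree_first : (total_degree S.1 <= m)%N.
Proof.
apply: total_degree_le => i j; rewrite /S /= coefC; case: (i =P 0)%N => [->|_]; last by rewrite coef0 eqxx.
by rewrite coefX; case: (j =P 1)%N => [->|_]; rewrite ?eqxx// => _; move: n1m; clear; lia.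
Qed.

Lemma total_degree_second : total_degree S.2 = m.
Proof.
have gm : g`_m = a m.
  rewrite /g /poly_between coef_sum (bigD1_seq m) /= ?mem_index_iota ?iota_uniq ?hrm ?ltnS ?leqnn//.
  rewrite coefZ coefXn eqxx mulr1 big1 ?addr0// => i im.
  by rewrite coefZ coefXn eq_sym (negPf im) mulr0.
apply/eqP; rewrite eqn_leq; apply/andP; split.
  apply: total_degree_le => i j; rewrite coef_second.
  case: (j =P 0)%N => [->|j0] /=.
    rewrite mulr1n mulr0n subr0 oppr_eq0 addn0 => gi; rewrite leqNgt; apply: contra gi => mi.
    by rewrite nth_default// (leq_trans (size_poly_between _ _ _)).
  case: (j =P 1)%N => [->|j1] /=; last by rewrite !mulr0n oppr0 addr0 eqxx.
  rewrite mulr1n mulr0n oppr0 sub0r oppr_eq0 => fi; apply: (@leq_trans n.+1); last exact: ltnW.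
  rewrite addn1 ltnS leqNgt; apply: contra fi => ni.
  by rewrite nth_default// (leq_trans (size_poly_between _ _ _)).
rewrite -[X in (X <= _)%N]addn0; apply: total_degree_ge.
by rewrite coef_second /= mulr1n mulr0n subr0 oppr_eq0 gm.
Qed.

Lemma system_degree_lienard : system_degree S = m.
Proof. by rewrite /system_degree total_degree_second; apply/maxn_idPr/total_degree_first. Qed.

Lemma homogenization_first_neq0 x y z : z != 0 ->
  homogenization m S.1 x y z = z ^+ m * (y / z).
Proof.
move=> z0; rewrite homogenization_neq0//; last exact: total_degree_first.
by rewrite /S /= hornerC hornerX.
Qed.

Lemma homogenization_second_neq0 x y z : z != 0 ->
  homogenization m S.2 x y z = z ^+ m * (- g.[x / z] - f.[x / z] * (y / z)).
Proof.
move=> z0; rewrite homogenization_neq0//; last by rewrite total_degree_second.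
by rewrite /S /= !(hornerD, hornerN, hornerM, hornerC, hornerX, horner_map).
Qed.

Lemma homogenization_first_at0 x y : homogenization m S.1 x y 0 = 0.
Proof.
rewrite (@homogenization_at0 _ _ _ _ (y *: 'X^(m.-1))).
  by rewrite hornerZ hornerXn expr0n (_ : (m.-1 == 0)%N = false) ?mulr0//; move: n1m; clear; lia.
move=> z z0; rewrite homogenization_first_neq0// hornerZ hornerXn.
have -> : z ^+ m = z ^+ m.-1 * z by rewrite -exprSr prednK//; move: n1m; clear; lia.
by field.
Qed.

Lemma homogenization_second_at0 x y : homogenization m S.2 x y 0 = - (a m * x ^+ m).
Proof.
pose p : {poly R} := - (\sum_(r <= i < m.+1) (a i * x ^+ i) *: 'X^(m - i))
  - y *: \sum_(s <= i < n.+1) (b i * x ^+ i) *: 'X^(m.-1 - i).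
rewrite (@homogenization_at0 _ _ _ _ p).
  rewrite /p hornerD !hornerN hornerZ !horner_sum big_nat_recr//= big_nat big1 => [|i /andP[_ im]].
    rewrite subnn expr0 hornerZ hornerC mulr1 add0r big_nat big1 ?mulr0 ?subr0// => i /andP[_].
    rewrite ltnS => ni; rewrite hornerZ hornerXn expr0n (_ : (m.-1 - i == 0)%N = false) ?mulr0//.
    by move: ni n1m; clear; lia.
  by rewrite hornerZ hornerXn expr0n subn_eq0 leqNgt im mulr0.
move=> z z0; rewrite homogenization_second_neq0//.
have z1 : z ^+ m = z ^+ m.-1 * z by rewrite -exprSr prednK//; move: n1m; clear; lia.
have -> : z ^+ m * (- g.[x / z] - f.[x / z] * (y / z)) =
    - (z ^+ m * g.[x / z]) - y * (z ^+ m.-1 * f.[x / z]) by rewrite z1; field.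
rewrite !homogenization_sum//; last by move: n1m; clear; lia.
rewrite /p hornerD !hornerN hornerZ !horner_sum.
by congr (- _ - y * _); apply: eq_bigr => i _; rewrite hornerZ hornerXn.
Qed.

Lemma poincare_field_coords q :
  let P := homogenization m S.1 (xcoord q) (ycoord q) (zcoord q) in
  let Q := homogenization m S.2 (xcoord q) (ycoord q) (zcoord q) in
  let phi := xcoord q * P + ycoord q * Q in
  poincare_field S q = row3 (P - xcoord q * phi) (Q - ycoord q * phi) (- (zcoord q * phi)).
Proof.
rewrite /poincare_field system_degree_lienard /=; apply/rowP => -[[|[|[|//]]] i]; rewrite !mxE /=.
- by congr (_ - _); rewrite mulrC; congr (q _ _ * _); apply/val_inj.
- by congr (_ - _); rewrite mulrC; congr (q _ _ * _); apply/val_inj; rewrite /= inordK.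
- by rewrite sub0r; congr (- _); rewrite mulrC; congr (q _ _ * _); apply/val_inj; rewrite /= inordK.
Qed.

(** On the equator the y-component of the field is - a_m x^m (1 - y^2) = - a_m x^(m+2), which
    vanishes only at x = 0. *)
Lemma equilibria_at_infinity q : at_infinity q ->
  (equilibrium (poincare_field S) q <-> q = y_axis_top R \/ q = y_axis_bottom R).
Proof.
move=> [[q1 _] z0]; rewrite /equilibrium poincare_field_coords z0.
rewrite homogenization_first_at0 homogenization_second_at0 mulr0 !add0r mul0r oppr0.
move: q1; rewrite z0 expr0n addr0.
set x := xcoord q; set y := ycoord q => q1.
have x0top : x = 0 -> q = y_axis_top R \/ q = y_axis_bottom R.
  move=> x0; move: q1; rewrite x0 expr0n add0r => /eqP; rewrite -subr_eq0 subr_sqr_1 mulf_eq0 subr_eq0 addr_eq0.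
  move=> /orP[]/eqP y1; [left|right]; apply: row3_eqP; rewrite ?xcoord3 ?ycoord3 ?zcoord3//.
split=> [e|h].
  apply: x0top; have := congr1 (@ycoord R _) e; rewrite ycoord3 ycoord0 => e1.
  have {e1} : a m * x ^+ m.+2 = 0.
    have -> : a m * x ^+ m.+2 = (a m * x ^+ m) * (1 - y ^+ 2) by rewrite -q1 !exprSr; ring.
    by rewrite -[RHS]oppr0 -e1; ring.
  by move/eqP; rewrite mulf_eq0 (negPf am) expf_eq0 /= => /eqP.
have x0 : x = 0 by rewrite /x; case: h => ->; rewrite xcoord3.
have m0 : (m == 0)%N = false by move: n1m; clear; lia.
rewrite x0 expr0n m0 !(mulr0, mul0r, oppr0, subr0, addr0).
by apply: row3_eqP; rewrite ?xcoord3 ?ycoord3 ?zcoord3 ?xcoord0 ?ycoord0 ?zcoord0.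
Qed.

End Lienard.
End Homogenization.

(** * The model saddle *)

Section Flows.
Variable R : realType.

Lemma isd_clamp (f df : R -> R) a b : a <= b -> (forall t, a <= t <= b -> isd f t (df t)) ->
  exists h : R -> R, [/\ continuous h, forall t, a <= t <= b -> h t = f t &
    forall t, a < t < b -> isd h t (df t)].
Proof.
move=> ab hd; pose h t := f (Num.max a (Num.min t b)).
have hE t : a <= t <= b -> h t = f t by move=> tI; rewrite /h clamp_in.
exists h; split => //.
  apply: within_clamp => //; apply: continuous_in_subspaceT => t; rewrite inE /= in_itv /= => tI.
  exact: isd_cont (hd t tI).
move=> t tI; have tI' : a <= t <= b by case/andP: tI => *; rewrite !ltW.
apply: isd_ext (hd t tI'); apply: (near_oo tI) => s /andP[s1 s2].
by rewrite hE// !ltW.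
Qed.

Lemma isd_incr_itv (f df : R -> R) a b : a < b -> (forall t, a <= t <= b -> isd f t (df t)) ->
  (forall t, a <= t <= b -> 0 < df t) -> f a < f b.
Proof.
move=> ab hd hp; have [h [ch hE dh]] := isd_clamp (ltW ab) hd.
rewrite -(hE a) ?lexx ?ltW// -(hE b) ?lexx ?ltW//.
by apply: (isd_incr ab ch dh) => t /andP[t1 t2]; apply: hp; rewrite !ltW.
Qed.

(** [reaches] asks for solutions of X itself. A solution of rho X with rho > 0 is reparametrised by
    the inverse of the primitive of rho; this removes the factors z^(m-1) that relate the planar
    field to the one on the sphere. *)
Lemma time_change n (X : 'rV[R]_n -> 'rV[R]_n) (W : set 'rV[R]_n) (q : R -> 'rV[R]_n) (rho : R -> R) a b :
  a <= b -> continuous q -> continuous rho -> (forall t, a <= t <= b -> 0 < rho t) ->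
  (forall t, a < t < b -> is_derive t (1 : R) q (rho t *: X (q t))) ->
  (forall t, a <= t <= b -> W (q t)) -> reaches X W (q a) (q b).
Proof.
move=> ab cq cr rp dq Wq.
have qa : W (q a) by apply: Wq; rewrite lexx.
move: ab; rewrite le_eqVlt => /predU1P[<-|ab].
  exists 0, (fun=> q a); split => //.
    split; first by apply: continuous_subspaceT => t; exact: cst_continuous.
    by move=> t; rewrite in_itv /= => /andP[t1 t2]; move: (lt_trans t1 t2); rewrite ltxx.
  by move=> _ [t _ <-].
have dtau t : isd (integral_from0 rho) t (rho t) by exact: isd_integral_from0.
have [|t _|t /andP[t1 t2]|inv [cinv invK invP dinv]] := @incr_inverse R (integral_from0 rho) rho a b ab.
- by move=> t; exact: isd_cont (dtau t).
- exact: dtau.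
- by apply: rp; rewrite !ltW.
set tau := integral_from0 rho in dtau invK invP dinv.
have tab : tau a < tau b.
  apply: (isd_incr_itv ab (df := rho)) => t tI; [exact: dtau|exact: rp].
exists (tau b - tau a), (fun s => q (inv (s + tau a))).
have invI s : 0 <= s <= tau b - tau a -> a <= inv (s + tau a) <= b /\ tau (inv (s + tau a)) = s + tau a.
  by move=> /andP[s0 s1]; apply: invP; apply/andP; split; lra.
split.
- by rewrite subr_ge0 ltW.
- split.
    apply: continuous_subspaceT => s; apply: (@continuous_comp _ _ _ (fun s => inv (s + tau a)) q); last exact: cq.
    exact: cont_shift.
  move=> s; rewrite in_itv /= => /andP[s0 s1].
  have [|/andP[i1 i2] iE] := invI s; first by rewrite !ltW.
  have i3 : a < inv (s + tau a).
    rewrite lt_neqAle i1 andbT; apply: contraTneq s0 => e; rewrite -leNgt.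
    by move: iE; rewrite -e; lra.
  have i4 : inv (s + tau a) < b.
    rewrite lt_neqAle i2 andbT; apply: contraTneq s1 => e; rewrite -leNgt.
    by move: iE; rewrite e; lra.
  set t := inv (s + tau a) in i1 i2 i3 i4 iE *.
  have tI : a < t < b by rewrite i3.
  have di : isd (fun s => inv (s + tau a)) s (rho t)^-1.
    have d1 := dinv t tI; rewrite iE in d1.
    have d2 := isdD (isd_id s) (isd_cst (tau a) s).
    by apply: (isd_eq (@isd_comp R inv (fun s => s + tau a) s _ _ d1 d2)); rewrite addr0 mulr1.
  apply/is_derive_rVP => i; have /is_derive_rVP/(_ i) d3 := dq t tI.
  apply: (isd_eq (@isd_comp R (fun t => q t 0 i) (fun s => inv (s + tau a)) s _ _ d3 di)).
  by rewrite !mxE; have := rp t; rewrite (ltW i3) (ltW i4) => /(_ isT) r0; field; rewrite gt_eqF.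
- by rewrite add0r invK// lexx ltW.
- by rewrite subrK invK// lexx ltW.
- by move=> _ [s sI <-]; move: sI; rewrite /= in_itv /= => /invI[h _]; exact: Wq.
Qed.

(** x exp (- Phi) is constant for a primitive Phi of phi. So invariant lines such as the axes of the
    saddle or the equator z = 0 are neither reached nor left. *)
Lemma linear_sign (x phi : R -> R) (T : R) : 0 <= T -> continuous x -> continuous phi ->
  (forall t, 0 < t < T -> isd x t (x t * phi t)) -> forall t, 0 <= t <= T ->
  exists2 k, 0 < k & x t = k * x 0.
Proof.
move=> T0 cx cphi dx t /andP[t0 tT].
have dP s : isd (integral_from0 phi) s (phi s) by exact: isd_integral_from0.
move: (integral_from0 phi) dP => P dP.
have cP : continuous P by move=> s; exact: isd_cont (dP s).
pose v s := x s * expR (- P s).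
have cv : continuous v.
  move=> s; apply: (@continuousM _ _ x (fun s => expR (- P s))); first exact: cx.
  apply: (@continuous_comp _ _ _ (fun s => - P s) expR); last exact: continuous_expR.
  by apply: (@continuousN _ _ _ P); exact: cP.
have dv s : 0 < s < t -> isd v s 0.
  move=> /andP[s0 st]; have hx : isd x s (x s * phi s) by apply: dx; rewrite s0 (lt_le_trans st).
  have hP := isd_expR (isdN (dP s)).
  by apply: (isd_eq (isdM hx hP)); ring.
have e1 : v 0 <= v t by apply: (isd_nondecr t0 cv dv).
have e2 : v t <= v 0 by apply: (isd_nonincr t0 cv dv).
have e : v t = v 0 by apply/le_anti/andP.
clear e1 e2.
exists (expR (- P 0) * expR (P t)); first by rewrite mulr_gt0 ?expR_gt0.
move: e; rewrite /v => e.
have : x t * expR (- P t) * expR (P t) = x 0 * expR (- P 0) * expR (P t) by rewrite e.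
by rewrite -mulrA -expRD addNr expR0 mulr1 => ->; ring.
Qed.

(* The order relation of points of the quadrant (or of the disc near the top)
   along trajectories, in terms of a first integral [c] and of a monotone
   coordinate [p]. *)
Definition precedes (p c p' c' : R) :=
  [/\ c = c', p <= p' & c = 0 -> [\/ p = p', 0 < p | p' < 0]].

(** Bounding the first integral and the monotone coordinate, rather than a norm, makes every
    trajectory between two points of the box stay inside. *)
Definition saddle_box (d e : R) : set 'rV[R]_2 :=
  [set v | [/\ closed_quadrant v, `|xcoord v - ycoord v| <= d & xcoord v * ycoord v <= e]].

Lemma saddle_forward d e v v' (T : R) : saddle_box d e v -> saddle_box d e v' -> 0 <= T ->
  xcoord v' = xcoord v * expR T -> ycoord v' = ycoord v * expR (- T) ->
  reaches (@linear_saddle R) (saddle_box d e) v v'.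
Proof.
move=> [[x0 y0] p1 c1] [[x0' y0'] p1' c1'] T0 ex ey.
exists T, (fun t => row2 (xcoord v * expR t) (ycoord v * expR (- t))).
have dx t : isd (fun t => xcoord v * expR t) t (xcoord v * expR t).
  by apply: (isd_eq (isdM (isd_cst (xcoord v) t) (isd_expR (isd_id t)))); ring.
have dy t : isd (fun t => ycoord v * expR (- t)) t (- (ycoord v * expR (- t))).
  by apply: (isd_eq (isdM (isd_cst (ycoord v) t) (isd_expR (isdN (isd_id t))))); ring.
split => //.
- apply: solution_onT => t; rewrite /linear_saddle xcoord2 ycoord2.
  by apply/row2_derive; split.
- by rewrite oppr0 expR0 !mulr1 row2_coords.
- by rewrite -ex -ey row2_coords.
- move=> _ [t tI <-]; move: tI; rewrite /= in_itv /= => /andP[t0 tT].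
  have h1 : xcoord v <= xcoord v * expR t <= xcoord v'.
    by rewrite ex; apply/andP; split; [rewrite ler_peMr// -[leLHS]expR0 ler_expR|rewrite ler_wpM2l// ler_expR].
  have h2 : ycoord v' <= ycoord v * expR (- t) <= ycoord v.
    by rewrite ey; apply/andP; split; [rewrite ler_wpM2l// ler_expR lerN2|rewrite ler_piMr// -[leRHS]expR0 ler_expR oppr_le0].
  move: h1 h2 => /andP[h1 h2] /andP[h3 h4].
  split; rewrite /closed_quadrant /= ?xcoord2 ?ycoord2.
  + by rewrite !mulr_ge0 ?expR_ge0.
  + move: p1 p1'; rewrite !ler_norml => /andP[q1 q2] /andP[q3 q4].
    by apply/andP; split; lra.
  + by rewrite mulrACA -expRD subrr expR0 mulr1.
Qed.

Lemma quadrant_eq v v' : closed_quadrant v -> closed_quadrant v' ->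
  xcoord v - ycoord v = xcoord v' - ycoord v' :> R -> xcoord v * ycoord v = xcoord v' * ycoord v' ->
  v = v'.
Proof.
move=> [x0 y0] [x0' y0'] ep ec.
have es : xcoord v + ycoord v = xcoord v' + ycoord v'.
  apply/eqP; rewrite -(@eqrXn2 _ 2) ?addr_ge0//; apply/eqP.
  have -> : (xcoord v + ycoord v) ^+ 2 = (xcoord v - ycoord v) ^+ 2 + 4 * (xcoord v * ycoord v) by ring.
  by rewrite ep ec; ring.
by apply: row2_eqP; lra.
Qed.

Lemma saddle_reaches d e v v' : saddle_box d e v -> saddle_box d e v' ->
  reaches (@linear_saddle R) (saddle_box d e) v v' <->
  precedes (xcoord v - ycoord v) (xcoord v * ycoord v) (xcoord v' - ycoord v') (xcoord v' * ycoord v').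
Proof.
move=> hv hv'; split.
  move=> [T [gamma [T0 sol g0 gT gW]]].
  have [delta [cd dE dd]] := solution_on_clamp T0 sol.
  have d0 : delta 0 = v by rewrite dE ?lexx ?T0.
  have dT : delta T = v' by rewrite dE ?lexx ?T0.
  pose x t := xcoord (delta t); pose y t := ycoord (delta t).
  have cx : continuous x by move=> s; exact: (@coord_comp_continuous R _ 2 delta ord0 s (cd s)).
  have cy : continuous y by move=> s; exact: (@coord_comp_continuous R _ 2 delta (inord 1) s (cd s)).
  have dxy t : 0 < t < T -> isd x t (x t) /\ isd y t (- y t).
    by move=> tI; apply/coords_derive; exact: dd.
  have quad t : 0 <= t <= T -> 0 <= x t /\ 0 <= y t.
    move=> tI; have [|[h1 h2] _ _] := gW (gamma t); first by exists t => //=; rewrite in_itv.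
    by rewrite /x /y dE.
  have [TT|T00] := boolP (0 < T); last first.
    have TE : T = 0 by apply/eqP; rewrite eq_le T0 leNgt T00.
    by rewrite -d0 -dT TE; split => // _; apply: Or31.
  have cc : x 0 * y 0 = x T * y T.
    have cxy : continuous (fun t => x t * y t).
      by move=> t; apply: (@continuousM _ _ x y); [exact: cx|exact: cy].
    have dc t : 0 < t < T -> isd (fun t => x t * y t) t 0.
      by move=> /dxy[h1 h2]; apply: (isd_eq (isdM h1 h2)); ring.
    apply/eqP; rewrite eq_le; apply/andP; split.
      exact: (isd_nondecr T0 cxy dc).
    exact: (isd_nonincr T0 cxy dc).
  have pp : x 0 - y 0 <= x T - y T.
    have cp : continuous (fun t => x t - y t).
      by move=> t; apply: (@continuousB _ _ _ x y); [exact: cx|exact: cy].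
    apply: (@isd_nondecr R (fun t => x t - y t) (fun t => x t + y t) 0 T T0 cp) => t tI.
      by have [h1 h2] := dxy t tI; apply: (isd_eq (isdB h1 h2)); rewrite opprK.
    by have [|h1 h2] := quad t; [case/andP: tI => *; rewrite !ltW|rewrite addr_ge0].
  have cs (k : R) : continuous (fun _ : R => k) by move=> ?; exact: cst_continuous.
  have [||kx kx0 ex] := @linear_sign x (fun=> 1) T T0 cx (cs 1) _ T.
    by move=> t /dxy[h1 _]; rewrite mulr1.
    by rewrite lexx T0.
  have [||ky ky0 ey] := @linear_sign y (fun=> -1) T T0 cy (cs (-1)) _ T.
    by move=> t /dxy[_ h1]; rewrite mulrN1.
    by rewrite lexx T0.
  have [|x0 y0] := quad 0; first by rewrite lexx.
  rewrite -d0 -dT -!/(x _) -!/(y _); split => // /eqP; rewrite mulf_eq0 => /orP[]/eqP z.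
    move: y0; rewrite le_eqVlt => /predU1P[y0|y0].
      by apply: Or31; rewrite ex ey z -y0 !mulr0.
    by apply: Or33; rewrite ex z mulr0 sub0r oppr_lt0 ey mulr_gt0.
  move: x0; rewrite le_eqVlt => /predU1P[x0|x0].
    by apply: Or31; rewrite ex ey z -x0 !mulr0.
  by apply: Or32; rewrite z subr0.
case: (hv) (hv') => -[x0 y0] _ _ [[x0' y0'] _ _].
set x := xcoord v in x0 *; set y := ycoord v in y0 *.
set x' := xcoord v' in x0' *; set y' := ycoord v' in y0' *.
move=> [cE pE h].
suff [T [T0 e1 e2]] : exists T : R, [/\ 0 <= T, x' = x * expR T & y' = y * expR (- T)].
  exact: saddle_forward T0 e1 e2.
have viax : 0 < x -> x <= x' -> (x' * y' = x * y) -> exists T : R, [/\ 0 <= T, x' = x * expR T & y' = y * expR (- T)].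
  move=> xp xx e'; have x'p := lt_le_trans xp xx.
  have r0 : 0 < x' / x by rewrite divr_gt0.
  exists (ln (x' / x)); split.
  - by rewrite ln_ge0// ler_pdivlMr// mul1r.
  - by rewrite lnK ?posrE//; field; rewrite gt_eqF.
  - rewrite expRN lnK ?posrE// invf_div mulrA -[y * x]mulrC -e'; field.
    by rewrite gt_eqF.
(* Off the axes x y is a fixed positive number, so x - y can grow only if x grows, and x determines
   the travel time. On the axes the last clause of [precedes] keeps both points on one side of the
   equilibrium. *)
have [c0|cn0] := eqVneq (x * y) 0; last first.
  have xp : 0 < x by rewrite lt_neqAle eq_sym x0 andbT; apply: contraNneq cn0 => ->; rewrite mul0r.
  have yp : 0 < y by rewrite lt_neqAle eq_sym y0 andbT; apply: contraNneq cn0 => ->; rewrite mulr0.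
  apply: viax => //; rewrite leNgt; apply/negP => xx.
  have yy : y' < y by lra.
  have : x' * y' < x * y by apply: (@le_lt_trans _ _ (x * y')); [rewrite ler_wpM2r// ltW|rewrite ltr_pM2l].
  by rewrite cE ltxx.
have [pp|pp|pp] := h c0.
- have vv : v = v' by apply: quadrant_eq.
  by exists 0; rewrite oppr0 expR0 !mulr1 /x /x' /y /y' vv.
- have xp : 0 < x by lra.
  have yz : y = 0 by move: c0 => /eqP; rewrite mulf_eq0 gt_eqF//= => /eqP.
  have xp' : 0 < x' by lra.
  have yz' : y' = 0 by move: c0; rewrite cE => /eqP; rewrite mulf_eq0 (gt_eqF xp')//= => /eqP.
  by apply: viax => //; lra.
have yp' : 0 < y' by lra.
have xz' : x' = 0 by move: c0; rewrite cE => /eqP; rewrite mulf_eq0 (gt_eqF yp') orbF => /eqP.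
have yp : 0 < y by lra.
have xz : x = 0 by move: c0 => /eqP; rewrite mulf_eq0 (gt_eqF yp) orbF => /eqP.
have r0 : 0 < y / y' by rewrite divr_gt0.
exists (ln (y / y')); split.
- by rewrite ln_ge0// ler_pdivlMr// mul1r; lra.
- by rewrite xz xz' mul0r.
- rewrite expRN lnK ?posrE// invf_div; field.
  by rewrite gt_eqF.
Qed.

End Flows.

(** * The part of a closed orbit above the x-axis *)

Section UpperArc.
Variable R : realType.
Variables (G F : {poly R}).
Hypotheses (rd : right_data G F) (rdl : right_data (refl G) (refl F)).

(** At a zero of y one has y' = - g, negative for x > 0 and positive for x < 0, so y changes sign
    once on each half of the loop. The zero on the left half is moved back by one period, which
    makes the interval with y > 0 contain time 0. *)
Lemma upper_arc a b T1 T x u : loop G F a b T1 T x u ->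
  let y t := u t - F.[x t] in
  exists s1 s2 : R, [/\ s1 < s2, y s1 = 0 /\ y s2 = 0, x s1 < 0 /\ 0 < x s2,
    forall t, s1 < t < s2 -> 0 < y t &
    forall t, 0 < y t -> exists k : int, s1 < t + k%:~R * T < s2].
Proof.
move=> [[a0 b0 T10 T1T] hl hp [x0 u0 xT1 uT1] [xr xl]] y.
have T0 := lt_trans T10 T1T.
have [cx cu] := lienard_cont hl.
have cy : continuous y by exact: continuous_velocity.
have dy t : isd y t (- G^`().[x t] - F^`().[x t] * y t) by exact: isd_velocity.
have hx t : x (t + T) = x t by case: (hp t).
have hu t : u (t + T) = u t by case: (hp t).
have hy t : y (t + T) = y t by rewrite /y hx hu.
have y0 : y 0 = a by rewrite /y x0 u0 (rd_F0 rd) subr0.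
have yT1 : y T1 = b by rewrite /y xT1 uT1 (rd_F0 rd) subr0.
have yT : y T = a by rewrite -[T]add0r hy.
have [|s2 /andP[s20 s2T] ys2] := @IVT_eq R y 0 T1 0 cy (ltW T10).
  by right; rewrite y0 yT1 !ltW.
have s2I : 0 < s2 < T1.
  rewrite !lt_neqAle s20 s2T !andbT; apply/andP; split; apply: contra_eqN ys2 => /eqP.
    by move=> <-; rewrite y0 gt_eqF.
  by move=> ->; rewrite yT1 lt_eqF.
have [|s1 /andP[s1T1 s1T] ys1] := @IVT_eq R y T1 T 0 cy (ltW T1T).
  by left; rewrite yT yT1 !ltW.
have s1I : T1 < s1 < T.
  rewrite !lt_neqAle s1T1 s1T !andbT; apply/andP; split; apply: contra_eqN ys1 => /eqP.
    by move=> <-; rewrite yT1 lt_eqF.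
  by move=> ->; rewrite yT gt_eqF.
have [t tI yt|r1 r2] := @single_sign_change R y _ s2 0 T1 cy (fun t _ => dy t) _ s2I ys2.
  by rewrite yt mulr0 subr0 oppr_lt0; apply: (rd_gp rd); exact: xr.
have cN : continuous (fun t => - y t) by move=> t; apply: (@continuousN _ _ _ y); exact: cy.
have [t tI yt| |l1 l2] := @single_sign_change R (fun t => - y t) _ s1 T1 T cN (fun t _ => isdN (dy t)) _ s1I _.
- have {}yt : y t = 0 by apply: oppr_inj; rewrite oppr0.
  rewrite yt mulr0 subr0 opprK -[x t]opprK -oppr_gt0 -refl_deriv.
  by apply: (rd_gp rdl); rewrite oppr_gt0 xl.
- by rewrite ys1 oppr0.
move: s1I s2I => /andP[p1 p2] /andP[p3 p4].
have s1E : s1 - T + T = s1 by rewrite subrK.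
exists (s1 - T), s2; split.
- by lra.
- by split=> //; rewrite -hy s1E.
- by split; [rewrite -hx s1E xl// p1|rewrite xr// p3].
- move=> t /andP[t1 t2]; have [t0|t0] := ltP t 0.
    by rewrite -hy -oppr_lt0; apply: l1; apply/andP; split; lra.
  move: t0; rewrite le_eqVlt => /predU1P[<-|t0]; first by rewrite y0.
  by apply: r2; rewrite t0.
- move=> t yt; have [t0 [k [/andP[t00 t0T] tE]]] := mod_period t T0.
  have yt0 : 0 < y t0.
    by move: yt; rewrite tE (periodic_int hy).
  have [c|c] := ltP t0 s2.
    exists (- k); rewrite tE mulrNz mulNr addrK c andbT; lra.
  have [c'|c'] := ltP s1 t0.
    exists (- k - 1); rewrite tE rmorphB /= mulrNz mulrBl mulNr mul1r.
    by apply/andP; split; lra.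
  exfalso; move: yt0; apply/negP; rewrite -leNgt.
  have [d|d] := ltP t0 T1.
    move: c; rewrite le_eqVlt => /predU1P[<-|c]; first by rewrite ys2.
    by apply/ltW/r1; rewrite c.
  move: d; rewrite le_eqVlt => /predU1P[<-|d]; first by rewrite yT1 ltW.
  move: c'; rewrite le_eqVlt => /predU1P[->|c']; first by rewrite ys1.
  by rewrite -oppr_ge0; apply/ltW/l2; rewrite d.
Qed.
End UpperArc.

(** * The sectors at infinity *)

Section Topology.
Variable R : realType.

Lemma coord_norm_le n (p : 'rV[R]_n) (i : 'I_n) : `|p 0 i| <= `|p|.
Proof.
rewrite [leRHS]mx_normrE; apply: le_trans (le_bigmax _ (fun ij : 'I_1 * 'I_n => `|p ij.1 ij.2|) (0, i)).
by [].
Qed.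

Lemma compact_inverse_continuous (U V : topologicalType) (W : set U) (N : set V) (h : U -> V) (k : V -> U) :
  hausdorff_space V -> compact W -> {within W, continuous h} ->
  (forall w, W w -> N (h w) /\ k (h w) = w) -> (forall v, N v -> W (k v) /\ h (k v) = v) ->
  {within N, continuous k}.
Proof.
move=> hV cW ch hW hN; apply/continuous_closedP => C cC; apply/closed_subspaceP.
exists (h @` (W `&` C)).
  apply: compact_closed => //; apply: continuous_compact; last exact: compact_closedI.
  by apply: continuous_subspaceW ch => w [].
apply/seteqP; split=> v [].
  move=> [w [Ww Cw] <-] Nv; split => //=.
  by have [_ e] := hW w Ww; change (C (k (h w))); rewrite e.
move=> Cv Nv; split => //; change (C (k v)) in Cv; have [Wk hk] := hN v Nv.
by exists (k v).
Qed.

Lemma continuous_clamp_itv (T : topologicalType) (q : R -> T) a b : a <= b ->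
  (forall t, a <= t <= b -> {for t, continuous q}) ->
  continuous (fun t => q (Num.max a (Num.min t b))).
Proof.
move=> ab cq t; apply: (@continuous_comp _ _ _ (fun t => Num.max a (Num.min t b)) q).
  exact: continuous_clamp.
by apply: cq; rewrite le_max lexx /= ge_max ab ge_min lexx orbT.
Qed.

Lemma isd_nondecr_itv (f df : R -> R) a b : a <= b -> (forall t, a <= t <= b -> {for t, continuous f}) ->
  (forall t, a < t < b -> isd f t (df t)) -> (forall t, a < t < b -> 0 <= df t) -> f a <= f b.
Proof.
move=> ab cf hd hp; rewrite -[in leLHS](@clamp_in _ a a b) ?lexx// -[in leRHS](@clamp_in _ b a b) ?lexx ?ab//.
apply: (@isd_nondecr R (fun t => f (Num.max a (Num.min t b))) df a b ab) => //.
  exact: continuous_clamp_itv.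
move=> t tI; apply: isd_ext (hd t tI); apply: (near_oo tI) => s /andP[s1 s2].
by rewrite clamp_in// !ltW.
Qed.

Lemma time_change_itv n (X : 'rV[R]_n -> 'rV[R]_n) (W : set 'rV[R]_n) (q : R -> 'rV[R]_n) (rho : R -> R) a b :
  a <= b -> (forall t, a <= t <= b -> {for t, continuous q}) ->
  (forall t, a <= t <= b -> {for t, continuous rho}) -> (forall t, a <= t <= b -> 0 < rho t) ->
  (forall t, a < t < b -> is_derive t (1 : R) q (rho t *: X (q t))) ->
  (forall t, a <= t <= b -> W (q t)) -> reaches X W (q a) (q b).
Proof.
move=> ab cq cr rp dq Wq; pose cl t := Num.max a (Num.min t b).
have clE t : a <= t <= b -> cl t = t by exact: clamp_in.
rewrite -[in q a](clE a) ?lexx// -[in q b](clE b) ?lexx ?ab//.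
apply: (@time_change R n X W (q \o cl) (rho \o cl) a b ab).
- exact: continuous_clamp_itv.
- exact: continuous_clamp_itv.
- by move=> t tI; rewrite /= clE// rp.
- move=> t tI; have tI' : a <= t <= b by case/andP: tI => *; rewrite !ltW.
  rewrite /= clE//; apply: near_eq_is_derive (dq t tI).
  by apply: (near_oo tI) => s /andP[s1 s2]; rewrite /= clE// !ltW.
- by move=> t tI; rewrite /= clE//; exact: Wq.
Qed.

End Topology.

(** * The chart of the sector *)

Section Disc.
Variable R : realType.

Definition plane (q : 'rV[R]_3) := row2 (xcoord q / zcoord q) (ycoord q / zcoord q).

Lemma central_projection_coords (p : 'rV[R]_2) : exists w : R, [/\ 0 < w,
  xcoord (central_projection p) = w * xcoord p, ycoord (central_projection p) = w * ycoord p,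
  zcoord (central_projection p) = w & poincare_disc (central_projection p)].
Proof.
pose D := xcoord p ^+ 2 + ycoord p ^+ 2 + 1; exists (Num.sqrt D)^-1.
have D0 : 0 < D by rewrite ltr_wpDl// addr_ge0// sqr_ge0.
have w0 : 0 < (Num.sqrt D)^-1 by rewrite invr_gt0 sqrtr_gt0.
have cx : xcoord (central_projection p) = (Num.sqrt D)^-1 * xcoord p by rewrite /central_projection /xcoord !mxE.
have cy : ycoord (central_projection p) = (Num.sqrt D)^-1 * ycoord p.
  by rewrite /central_projection {1}/ycoord !mxE inordK.
have cz : zcoord (central_projection p) = (Num.sqrt D)^-1.
  by rewrite /central_projection /zcoord !mxE inordK//= mulr1.
split => //; split; rewrite ?cx ?cy cz; last exact: ltW.
rewrite !exprMn; have -> : (Num.sqrt D)^-1 ^+ 2 = D^-1 by rewrite exprVn sqr_sqrtr// ltW.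
by rewrite /D; field; rewrite gt_eqF.
Qed.

Lemma plane_central_projection p : plane (central_projection p) = p.
Proof.
have [w [w0 cx cy cz _]] := central_projection_coords p.
by apply: row2_eqP; rewrite /plane ?xcoord2 ?ycoord2 ?cx ?cy cz mulrC mulKf// gt_eqF.
Qed.

Lemma central_projection_plane q : poincare_disc q -> 0 < zcoord q -> central_projection (plane q) = q.
Proof.
move=> [q1 _] z0; have zn : zcoord q != 0 by rewrite gt_eqF.
have e : (Num.sqrt (xcoord (plane q) ^+ 2 + ycoord (plane q) ^+ 2 + 1))^-1 = zcoord q.
  have -> : xcoord (plane q) ^+ 2 + ycoord (plane q) ^+ 2 + 1 = (zcoord q)^-1 ^+ 2.
    rewrite /plane xcoord2 ycoord2 -[1 in LHS](divff (expf_neq0 2 zn)) !exprMn exprVn -!mulrDl q1 mul1r//.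
  by rewrite sqrtr_sqr ger0_norm ?invr_ge0 ?ltW// invrK.
rewrite /central_projection e; apply: row3_eqP.
- by rewrite {1}/xcoord !mxE /= -/(plane q) /plane xcoord2 mulrC divfK.
- by rewrite {1}/ycoord !mxE inordK//= -/(plane q) /plane ycoord2 mulrC divfK.
- by rewrite {1}/zcoord !mxE inordK//= mulr1.
Qed.

Variables (G F : {poly R}).
Notation height := (height G F).

(* On the saddle x' = x, y' = - y the product x y is a first integral and the
   difference x - y increases.  The chart of the sector is chosen so that its
   product is the inverse height, a first integral, and its difference
   increases along orbits for A large.  At z = 0 the junk values x / 0 = 0 and
   height 0 = 0 extend both functions by continuity. *)
Definition inv_height (q : 'rV[R]_3) := (height (plane q))^-1.
Definition chart_difference (A : R) (q : 'rV[R]_3) := xcoord q / ycoord q + A * (xcoord q / zcoord q * inv_height q).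

Definition sector A (d e : R) : set 'rV[R]_3 :=
  [set q | [/\ poincare_disc q, 0 < ycoord q, inv_height q <= e & `|chart_difference A q| <= d]].

(** The point of the quadrant whose difference of coordinates is p and whose product is c: its
    coordinates are (p + sqrt (p^2 + 4 c)) / 2 and (- p + sqrt (p^2 + 4 c)) / 2. *)
Definition quadrant_chart A q := row2 ((chart_difference A q + Num.sqrt (chart_difference A q ^+ 2 + 4 * inv_height q)) / 2)
  ((- chart_difference A q + Num.sqrt (chart_difference A q ^+ 2 + 4 * inv_height q)) / 2).

Hypotheses (rd : right_data G F) (rdl : right_data (refl G) (refl F)).
Hypothesis sym : forall x1 x2 : R, 0 < x1 -> 0 < x2 -> G.[x1] = (refl G).[x2] -> F.[x1] = (refl F).[x2].

Lemma plane_neq0' q : 0 < ycoord q -> zcoord q != 0 -> plane q <> 0.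
Proof.
move=> y0 z0 /(congr1 (@ycoord R _)); rewrite /plane ycoord2 ycoord0 => /eqP.
by rewrite mulf_eq0 invr_eq0 (negPf z0) orbF gt_eqF.
Qed.

Lemma plane_z0 q : zcoord q = 0 -> plane q = 0.
Proof.
move=> z0; rewrite /plane z0 invr0 !mulr0.
by apply: row2_eqP; rewrite ?xcoord2 ?ycoord2 ?xcoord0 ?ycoord0.
Qed.

Lemma inv_height_z0 q : zcoord q = 0 -> inv_height q = 0.
Proof. by move=> z0; rewrite /inv_height plane_z0// (height0 rd) invr0. Qed.

Lemma chart_difference_z0 A q : zcoord q = 0 -> chart_difference A q = xcoord q / ycoord q.
Proof. by move=> z0; rewrite /chart_difference inv_height_z0// !mulr0 addr0. Qed.

Lemma inv_height_gt0 q : 0 < ycoord q -> zcoord q != 0 -> 0 < inv_height q.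
Proof. by move=> y0 z0; rewrite invr_gt0; apply: height_gt0 => //; exact: plane_neq0'. Qed.

Lemma inv_height_ge0 q : 0 < ycoord q -> 0 <= inv_height q.
Proof.
move=> y0; have [/inv_height_z0->//|z0] := eqVneq (zcoord q) 0.
exact/ltW/inv_height_gt0.
Qed.

Lemma inv_height_eq0 q : 0 < ycoord q -> inv_height q = 0 -> zcoord q = 0.
Proof.
move=> y0 c0; apply/eqP; apply: contraT => z0.
by have := inv_height_gt0 y0 z0; rewrite c0 ltxx.
Qed.

Lemma quadrant_chart_coords A q : 0 < ycoord q ->
  [/\ closed_quadrant (quadrant_chart A q),
      xcoord (quadrant_chart A q) - ycoord (quadrant_chart A q) = chart_difference A q &
      xcoord (quadrant_chart A q) * ycoord (quadrant_chart A q) = inv_height q].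
Proof.
move=> /inv_height_ge0 c0; rewrite /closed_quadrant /quadrant_chart /= xcoord2 ycoord2.
set p := chart_difference A q; set D := p ^+ 2 + 4 * inv_height q.
have D0 : 0 <= D by rewrite addr_ge0 ?sqr_ge0// mulr_ge0.
have pD : `|p| <= Num.sqrt D by rewrite -sqrtr_sqr ler_wsqrtr// lerDl mulr_ge0.
move: (pD); rewrite ler_norml => /andP[h1 h2].
split; first by split; apply: divr_ge0 => //; lra.
- by field.
- have e : Num.sqrt D ^+ 2 = D by rewrite sqr_sqrtr.
  rewrite [LHS](_ : _ = (Num.sqrt D ^+ 2 - p ^+ 2) / 4); last by field.
  by rewrite e /D; field.
Qed.

Lemma coordC n (i : 'I_n) (q : 'rV[R]_n) : {for q, continuous (fun w : 'rV[R]_n => w 0 i : R)}.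
Proof. exact: coord_continuous. Qed.

Lemma plane_continuous q : zcoord q != 0 -> {for q, continuous plane}.
Proof.
move=> z0; have cz : {for q, continuous (fun w : 'rV[R]_3 => (zcoord w)^-1)}.
  by apply: continuousV => //; exact: coordC.
apply: row2_continuous.
  by apply: (@continuousM _ _ (fun w : 'rV[R]_3 => xcoord w) (fun w => (zcoord w)^-1)) => //; exact: coordC.
by apply: (@continuousM _ _ (fun w : 'rV[R]_3 => ycoord w) (fun w => (zcoord w)^-1)) => //; exact: coordC.
Qed.

(** At a point of the equator continuity means that heights tend to infinity: a bound on the height
    bounds the planar point, but its ordinate y / z grows without bound where z -> 0 and y stays
    positive. *)
Lemma inv_height_within q : poincare_disc q -> 0 < ycoord q ->
  inv_height @ within (@poincare_disc R) (nbhs q) --> inv_height q.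
Proof.
move=> Dq y0; have [z0|z0] := eqVneq (zcoord q) 0; last first.
  apply: cvg_within_filter; apply: (@continuousV _ _ (fun w => height (plane w))).
    by rewrite gt_eqF//; apply: height_gt0 => //; exact: plane_neq0'.
  apply: (@continuous_comp _ _ _ plane height); first exact: plane_continuous.
  exact: height_continuous.
rewrite (inv_height_z0 z0); apply/cvgrPdist_le => e e0; rewrite near_withinE.
have [M hM] := height_bound rd rdl sym e^-1.
have M0 : 0 <= M.
  by apply: le_trans (hM 0 _); rewrite ?normr0// (height0 rd) invr_ge0 ltW.
have M1 : 0 < M + 1 by lra.
near=> w => -[_ wz]; rewrite sub0r normrN.
have wy : ycoord q / 2 < ycoord w.
  by near: w; apply: (cvgr_gt _ (@coordC _ (inord 1) q)); rewrite ltr_pdivrMr// ltr_pMr// ltr1n.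
have wz' : zcoord w < ycoord q / 2 / (M + 1).
  by near: w; apply: (cvgr_lt _ (@coordC _ (inord 2) q)); rewrite -/(zcoord q) z0 !divr_gt0.
have yw0 : 0 < ycoord w by apply: lt_trans wy; rewrite divr_gt0.
have [zw0|zw0] := eqVneq (zcoord w) 0; first by rewrite inv_height_z0// normr0 ltW.
have zwp : 0 < zcoord w by rewrite lt_neqAle eq_sym zw0.
rewrite gtr0_norm ?inv_height_gt0//.
have hp := height_gt0 rd rdl sym (plane_neq0' yw0 zw0).
rewrite /inv_height -[e]invrK lef_pV2 ?posrE ?invr_gt0// leNgt; apply/negP => /ltW/hM.
move=> /(le_trans (@coord_norm_le _ _ (plane w) (inord 1))); rewrite -/(ycoord (plane w)) /plane ycoord2.
rewrite gtr0_norm ?divr_gt0// ler_pdivrMr// => h1.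
have : zcoord w * (M + 1) < ycoord q / 2 by rewrite -ltr_pdivlMr.
have : 0 <= zcoord w by exact: ltW.
by move: h1 wy; lra.
Unshelve. all: by end_near. Qed.

(** With X = x / z and c the inverse height, X^2 <= C (1 + 1/c) gives (X c)^2 <= C (c^2 + c), which
    tends to 0 with c at the equator. *)
Lemma xdc_within q (C : R) : (forall p, p <> 0 -> xcoord p ^+ 2 <= C * (1 + height p)) -> 0 < C ->
  poincare_disc q -> 0 < ycoord q ->
  (fun w => xcoord w / zcoord w * inv_height w) @ within (@poincare_disc R) (nbhs q) --> xcoord q / zcoord q * inv_height q.
Proof.
move=> hC C0 Dq y0; have [z0|z0] := eqVneq (zcoord q) 0; last first.
  apply: cvgM; last exact: inv_height_within.
  apply: cvg_within_filter.
  apply: (@continuousM _ _ (fun w : 'rV[R]_3 => xcoord w) (fun w => (zcoord w)^-1)); first exact: coordC.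
  by apply: continuousV => //; exact: coordC.
rewrite (inv_height_z0 z0) mulr0; apply/cvgrPdist_le => e e0.
pose eta := Num.min 1 (e ^+ 2 / (2 * C)).
have C2 : 0 < 2 * C by rewrite mulr_gt0.
have eta0 : 0 < eta by rewrite lt_min ltr01 divr_gt0// exprn_gt0.
have := inv_height_within Dq y0; rewrite (inv_height_z0 z0) => /cvgrPdist_le/(_ _ eta0).
rewrite !near_withinE => hc; near=> w => Dw; rewrite sub0r normrN.
have wy : 0 < ycoord w by near: w; exact: (cvgr_gt _ (@coordC _ (inord 1) q)).
have : poincare_disc w -> `|0 - inv_height w| <= eta by near: w; exact: hc.
move=> /(_ Dw); rewrite sub0r normrN ger0_norm ?inv_height_ge0// => hw.
have [zw0|zw0] := eqVneq (zcoord w) 0; first by rewrite inv_height_z0// mulr0 normr0 ltW.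
have := hC _ (plane_neq0' wy zw0); rewrite /plane xcoord2 -/(plane w).
have -> : height (plane w) = (inv_height w)^-1 by rewrite invrK.
have c0 := inv_height_gt0 wy zw0; set x := xcoord w / zcoord w; set c := inv_height w in c0 hw *.
move=> h1; rewrite -ler_sqr ?nnegrE ?(ltW e0)// real_normK ?num_real// exprMn.
apply: (@le_trans _ _ (C * (1 + c^-1) * c ^+ 2)); first by rewrite ler_wpM2r// sqr_ge0.
have -> : C * (1 + c^-1) * c ^+ 2 = C * (c ^+ 2 + c) by field; rewrite gt_eqF.
move: hw; rewrite le_min => /andP[c1 c2].
have : c * (2 * C) <= e ^+ 2 by rewrite -ler_pdivlMr.
have : C * c ^+ 2 <= C * c by rewrite ler_pM2l// expr2 ler_piMr// ltW.
by rewrite mulrDr; lra.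
Unshelve. all: by end_near. Qed.

Lemma chart_difference_within A q (C : R) : (forall p, p <> 0 -> xcoord p ^+ 2 <= C * (1 + height p)) -> 0 < C ->
  poincare_disc q -> 0 < ycoord q -> chart_difference A @ within (@poincare_disc R) (nbhs q) --> chart_difference A q.
Proof.
move=> hC C0 Dq y0; apply: cvgD.
  apply: cvg_within_filter.
  apply: (@continuousM _ _ (fun w : 'rV[R]_3 => xcoord w) (fun w => (ycoord w)^-1)); first exact: coordC.
  by apply: continuousV; [rewrite gt_eqF|exact: coordC].
by apply: cvgM; [exact: cvg_cst|exact: xdc_within hC C0 Dq y0].
Qed.

Lemma quadrant_chart_within A (T : set_system 'rV[R]_3) (q : 'rV[R]_3) : Filter T ->
  chart_difference A @ T --> chart_difference A q -> inv_height @ T --> inv_height q -> quadrant_chart A @ T --> quadrant_chart A q.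
Proof.
move=> FT hp hc.
have hs : (fun w => Num.sqrt (chart_difference A w ^+ 2 + 4 * inv_height w)) @ T --> Num.sqrt (chart_difference A q ^+ 2 + 4 * inv_height q).
  apply: (@cvg_comp _ _ _ (fun w => chart_difference A w ^+ 2 + 4 * inv_height w) Num.sqrt _ (nbhs (chart_difference A q ^+ 2 + 4 * inv_height q))).
    by apply: cvgD; [apply: cvgM|apply: cvgM => //; exact: cvg_cst].
  exact: sqrt_continuous.
rewrite /quadrant_chart row2_decomp.
rewrite (_ : (fun w => _) = (fun w => ((chart_difference A w + Num.sqrt (chart_difference A w ^+ 2 + 4 * inv_height w)) / 2) *: row2 1 0 +
  ((- chart_difference A w + Num.sqrt (chart_difference A w ^+ 2 + 4 * inv_height w)) / 2) *: row2 0 1)); last first.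
  by apply/funext => w; rewrite row2_decomp.
apply: cvgD; apply: cvgZr_tmp; apply: cvgM; (try exact: cvg_cst); apply: cvgD => //.
exact: cvgN.
Qed.

End Disc.

(** * Conjugacy of the upper sector with the saddle quadrant *)

Section Sector.
Variable R : realType.
Variables (m n r s : nat) (a b : nat -> R).
Let g := poly_between r m a.
Let f := poly_between s n b.
Let G := primitive_between r m a.
Let F := primitive_between s n b.
Hypotheses (hrm : (r <= m)%N) (n0 : (0 < n)%N) (nm : (2 * n + 1 <= m)%N).
Hypotheses (mo : odd m) (am : 0 < a m).
Hypotheses (rd : right_data G F) (rdl : right_data (refl G) (refl F)).
Hypothesis sym : forall x1 x2 : R, 0 < x1 -> 0 < x2 -> G.[x1] = (refl G).[x2] -> F.[x1] = (refl F).[x2].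
Hypothesis xg : forall x : R, x != 0 -> 0 < x * g.[x].
Let S := lienard_system g f.
Notation Y := (poincare_field S).
Notation X := (vector_field S).
Notation height := (height G F).
Notation dc := (inv_height G F).
Notation dp := (chart_difference G F).

Let am0 : a m != 0. Proof. by rewrite gt_eqF. Qed.
Let GE : G^`() = g. Proof. exact: primitive_between_deriv. Qed.
Let FE : F^`() = f. Proof. exact: primitive_between_deriv. Qed.
Let m1E : m = m.-1.+1. Proof. by move: n0 nm; clear; lia. Qed.

Lemma isd_sector_coordinate (x y rho : R -> R) (A c t : R) : 0 < y t ->
  isd x t (rho t * y t) -> isd y t (rho t * (- g.[x t] - f.[x t] * y t)) ->
  isd (fun s => x s / y s + A * (x s * c)) t
   (rho t * ((y t ^+ 2 + x t * f.[x t] * y t + x t * g.[x t] + A * y t ^+ 3 * c) / y t ^+ 2)).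
Proof.
move=> y0 dx dy; have yn : y t != 0 by rewrite gt_eqF.
apply: (isd_eq (isdD (isdM dx (@isdV R y t _ yn dy)) (isdM (isd_cst A t) (isdM dx (isd_cst c t))))).
by field.
Qed.

Lemma scale_row2 (k c d : R) : k *: row2 c d = row2 (k * c) (k * d).
Proof. by apply/rowP => -[[|[|//]] i]; rewrite !mxE. Qed.

Lemma plane_solution (q : R -> 'rV[R]_3) t : zcoord (q t) != 0 ->
  is_derive t (1 : R) q (Y (q t)) ->
  is_derive t (1 : R) (fun t => plane (q t)) (zcoord (q t) ^+ m.-1 *: X (plane (q t))).
Proof.
move=> z0; rewrite (poincare_field_coords s b hrm n0 nm am0) => /coords_derive3.
rewrite (homogenization_first_neq0 r s a b n0 nm)// (homogenization_second_neq0 s b hrm n0 nm am0)//.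
move=> [dx dy dz]; rewrite vector_field_lienard scale_row2 /plane !xcoord2 !ycoord2.
have e : zcoord (q t) ^+ m = zcoord (q t) ^+ m.-1 * zcoord (q t) by rewrite -exprSr -m1E.
rewrite e in dx dy dz.
apply/row2_derive; split.
  apply: (isd_eq (isdM dx (@isdV R (fun t => zcoord (q t)) t _ z0 dz))).
  by rewrite /g /f; field.
apply: (isd_eq (isdM dy (@isdV R (fun t => zcoord (q t)) t _ z0 dz))).
by rewrite -/g -/f; move: (g.[_]) (f.[_]) => gx fx; field.
Qed.

Lemma continuous_div (x y : R -> R) t : {for t, continuous x} -> {for t, continuous y} -> y t != 0 ->
  {for t, continuous (fun s => x s / y s)}.
Proof.
move=> cx cy y0; apply: (@continuousM _ _ x (fun s => (y s)^-1)) => //.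
exact: (@continuousV _ _ y).
Qed.

Lemma chart_difference_plane A q : 0 < ycoord q -> zcoord q != 0 ->
  dp A q = xcoord (plane q) / ycoord (plane q) + A * (xcoord (plane q) * dc q).
Proof.
move=> y0 z0; rewrite /chart_difference /plane xcoord2 ycoord2; congr (_ + _).
by field; rewrite z0 gt_eqF.
Qed.

Lemma reaches_height p q : p <> 0 -> reaches X setT p q -> height q = height p.
Proof.
move=> p0 h; have : Defs.orbit X p q by left.
by rewrite /S -GE -FE (orbit_level rd rdl sym p0).
Qed.

(** The inverse of the chart on the equator, where the chart difference is x / y: the point with y >
    0, z = 0 and x / y = p. *)
Definition equator_point (p : R) : 'rV[R]_3 := row3 (p * (Num.sqrt (1 + p ^+ 2))^-1) (Num.sqrt (1 + p ^+ 2))^-1 0.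

Lemma equator_sqrt (p : R) : let v := (Num.sqrt (1 + p ^+ 2))^-1 in 0 < v /\ v ^+ 2 * (1 + p ^+ 2) = 1.
Proof.
have D0 : 0 < 1 + p ^+ 2 by rewrite ltr_pwDl// sqr_ge0.
split; first by rewrite invr_gt0 sqrtr_gt0.
by rewrite exprVn sqr_sqrtr ?(ltW D0)// mulVf// gt_eqF.
Qed.

Lemma equator_pointE q : poincare_disc q -> 0 < ycoord q -> zcoord q = 0 ->
  q = equator_point (xcoord q / ycoord q).
Proof.
move=> [q1 _] y0 z0; have yn : ycoord q != 0 by rewrite gt_eqF.
have e : Num.sqrt (1 + (xcoord q / ycoord q) ^+ 2) = (ycoord q)^-1.
  have -> : 1 + (xcoord q / ycoord q) ^+ 2 = (ycoord q)^-1 ^+ 2.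
    have e : xcoord q ^+ 2 = 1 - ycoord q ^+ 2 by move: q1; rewrite z0 expr0n addr0 => <-; ring.
    by rewrite exprMn e; field.
  by rewrite sqrtr_sqr ger0_norm// invr_ge0 ltW.
apply: row3_eqP; rewrite /equator_point e invrK ?xcoord3 ?ycoord3 ?zcoord3//.
by rewrite divfK.
Qed.

Section Constants.
Variables (A C e : R).
Hypotheses (A0 : 0 < A) (C0 : 0 < C) (e0 : 0 < e) (e1 : e <= 1).
Hypothesis hturn : forall p, 0 < ycoord p -> e^-1 <= height p ->
  let x := xcoord p in let y := ycoord p in
  0 < y ^+ 2 + x * f.[x] * y + x * g.[x] + A * y ^+ 3 / height p.
Hypothesis hC : forall p, p <> 0 -> xcoord p ^+ 2 <= C * (1 + height p).
Hypothesis hlarge : forall p, 0 < ycoord p -> `|xcoord p| <= (1 + A * (2 * C + 1)) * ycoord p ->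
  e^-1 <= height p -> 1 <= ycoord p.
Notation W := (sector G F A 1 e).

Lemma equator_in_sector p : `|p| <= 1 -> [/\ W (equator_point p), dp A (equator_point p) = p & dc (equator_point p) = 0].
Proof.
move=> p1; have [v0 v1] := equator_sqrt p; rewrite /equator_point; set v := (Num.sqrt _)^-1 in v0 v1 *.
have z0 : zcoord (row3 (p * v) v 0) = 0 by rewrite zcoord3.
have c0 : dc (row3 (p * v) v 0) = 0 by exact: (inv_height_z0 rd z0).
have pE : dp A (row3 (p * v) v 0) = p by rewrite (chart_difference_z0 rd A z0) xcoord3 ycoord3 mulfK// gt_eqF.
split => //; split; rewrite ?ycoord3 ?c0 ?pE ?(ltW e0)//.
split; rewrite ?xcoord3 ?ycoord3 zcoord3 ?lexx//.
by rewrite -v1; ring.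
Qed.

Lemma sector_height w : W w -> zcoord w != 0 -> e^-1 <= height (plane w) /\ 0 < zcoord w.
Proof.
move=> [[_ zw] y0 ce _] z0; split; last by rewrite lt_neqAle eq_sym z0.
rewrite -[height _]invrK lef_pV2 ?posrE//.
by rewrite invr_gt0; apply: (height_gt0 rd rdl sym); exact: plane_neq0'.
Qed.

(** The equator is invariant by [linear_sign], so the trajectory lies in z = 0 or in z > 0. In the
    first case x / y has derivative a_m x^(m+1) / y^2, nonnegative because m is odd, and x keeps its
    sign, which yields the last clause of [precedes]. In the second case the projection to the plane
    is a time change of an orbit: the height is constant and [turning_bound] makes the difference
    increase. *)
Lemma sector_forward w w' : reaches Y W w w' -> precedes (dp A w) (dc w) (dp A w') (dc w').
Proof.
move=> [T [gamma [T0 sol g0 gT gW]]].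
have [q [cq qE dq]] := solution_on_clamp T0 sol.
have q0 : q 0 = w by rewrite qE ?lexx ?T0.
have qT : q T = w' by rewrite qE ?lexx ?T0.
have Wq t : 0 <= t <= T -> W (q t).
  by move=> tI; rewrite qE//; apply: gW; exists t => //=; rewrite in_itv.
have I0 : 0 <= (0 : R) <= T by rewrite lexx.
have IT : 0 <= T <= T by rewrite lexx T0.
pose x t := xcoord (q t); pose y t := ycoord (q t); pose z t := zcoord (q t).
have cx : continuous x by move=> t; exact: (@coord_comp_continuous R _ 3 q ord0 t (cq t)).
have cy : continuous y by move=> t; exact: (@coord_comp_continuous R _ 3 q (inord 1) t (cq t)).
have cz : continuous z by move=> t; exact: (@coord_comp_continuous R _ 3 q (inord 2) t (cq t)).
pose P t := homogenization m S.1 (x t) (y t) (z t).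
pose Q t := homogenization m S.2 (x t) (y t) (z t).
pose phi t := - (x t * P t + y t * Q t).
have cphi : continuous phi.
  have cP : continuous P by exact: homogenization_continuous.
  have cQ : continuous Q by exact: homogenization_continuous.
  move=> t; apply: (@continuousN _ _ _ (fun t => x t * P t + y t * Q t)).
  apply: (@continuousD _ _ _ (fun t => x t * P t) (fun t => y t * Q t)).
    by apply: (@continuousM _ _ x P); [exact: cx|exact: cP].
  by apply: (@continuousM _ _ y Q); [exact: cy|exact: cQ].
have dxyz t : 0 < t < T -> [/\ isd x t (P t + x t * phi t), isd y t (Q t + y t * phi t) & isd z t (z t * phi t)].
  move=> tI; have := dq t tI; rewrite (poincare_field_coords s b hrm n0 nm am0) => /coords_derive3.
  rewrite -/(x t) -/(y t) -/(z t) -/(P t) -/(Q t) => -[h1 h2 h3]; split.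
  - by apply: (isd_eq h1); rewrite /phi mulrN.
  - by apply: (isd_eq h2); rewrite /phi mulrN.
  - by apply: (isd_eq h3); rewrite /phi mulrN.
have zS t tI := @linear_sign R z phi T T0 cz cphi (fun t tI => let: And3 _ _ h := dxyz t tI in h) t tI.
have yp t : 0 <= t <= T -> 0 < y t by move=> /Wq[].
have [z0|z0] := eqVneq (zcoord w) 0.
  have zt t : 0 <= t <= T -> z t = 0.
    by move=> /zS[k k0 ->]; rewrite /z q0 z0 mulr0.
  have PQ t : 0 <= t <= T -> P t = 0 /\ Q t = - (a m * x t ^+ m).
    move=> tI; rewrite /P /Q zt//.
    by rewrite (homogenization_first_at0 r s a b n0 nm) (homogenization_second_at0 s b hrm n0 nm am0).
  have [t tI|kx kx0 ex] := @linear_sign R x phi T T0 cx cphi _ T IT.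
    have [h _ _] := dxyz t tI; apply: (isd_eq h).
    by have [|-> _] := PQ t; [case/andP: tI => *; rewrite !ltW|rewrite add0r].
  have zw' : zcoord w' = 0 by rewrite -qT; exact: zt.
  rewrite /precedes (inv_height_z0 rd z0) (inv_height_z0 rd zw') (chart_difference_z0 rd A z0) (chart_difference_z0 rd A zw').
  rewrite -q0 -qT -!/(x _) -!/(y _).
  have y0p := yp 0 I0; have yTp := yp T IT.
  split => //.
    apply: (@isd_nondecr_itv R (fun t => x t / y t) (fun t => a m * x t ^+ m.+1 / y t ^+ 2) 0 T T0).
    - move=> t tI; apply: continuous_div; [exact: cx|exact: cy|by rewrite gt_eqF// yp].
    - move=> t tI; have tI' : 0 <= t <= T by case/andP: tI => *; rewrite !ltW.
      have yn : y t != 0 by rewrite gt_eqF// yp.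
      have [h1 h2 _] := dxyz t tI; have [hP hQ] := PQ t tI'.
      apply: (isd_eq (isdM h1 (@isdV R y t _ yn h2))); rewrite hP hQ (exprS (x t) m).
      by move: (x t ^+ m) (phi t) => xm ph; field.
    - move=> t tI; rewrite mulr_ge0 ?invr_ge0 ?sqr_ge0// mulr_ge0 ?(ltW am)//.
      by apply: exprn_even_ge0; rewrite /= mo.
  move=> _; have [x0|x0|x0] := ltgtP (x 0) 0.
  - by apply: Or33; rewrite ex pmulr_llt0 ?invr_gt0// pmulr_rlt0.
  - by apply: Or32; rewrite divr_gt0.
  - by apply: Or31; rewrite ex x0 mulr0 !mul0r.
have Ww : W w by rewrite -q0; exact: Wq.
have [hw zw0] := sector_height Ww z0.
have zp t : 0 <= t <= T -> 0 < z t by move=> /zS[k k0 ->]; rewrite /z q0 mulr_gt0.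
have yw : 0 < ycoord w by rewrite -q0; exact: (yp 0 I0).
have cpl t : 0 <= t <= T -> {for t, continuous (fun t => plane (q t))}.
  move=> tI; apply: (@continuous_comp _ _ _ q (@plane R)); first exact: cq.
  by apply: plane_continuous; rewrite gt_eqF// zp.
have hgt t : 0 <= t <= T -> height (plane (q t)) = height (plane w).
  move=> /andP[t0 tT]; apply: reaches_height; first exact: plane_neq0'.
  rewrite -q0; apply: (@time_change_itv R 2 X setT (fun t => plane (q t)) (fun t => z t ^+ m.-1) 0 t t0) => //.
  - by move=> t' /andP[h1 h2]; apply: cpl; rewrite h1 (le_trans h2).
  - by move=> t' _; exact: continuous_exp.
  - by move=> t' /andP[h1 h2]; rewrite exprn_gt0// zp// h1 (le_trans h2).
  - move=> t' /andP[h1 h2]; apply: plane_solution.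
      by rewrite gt_eqF// zp// (ltW h1) (le_trans (ltW h2)).
    by apply: dq; rewrite h1 (lt_le_trans h2).
have zw' : 0 < zcoord w' by rewrite -qT; exact: zp.
have cE : dc w' = dc w by rewrite /inv_height -qT hgt.
have yw' : 0 < ycoord w' by rewrite -qT; exact: yp.
split; [by rewrite cE| |by move=> c0; move: z0; rewrite (inv_height_eq0 rd rdl sym yw c0) eqxx].
rewrite !chart_difference_plane ?gt_eqF// cE; set c := dc w; rewrite -q0 -qT.
pose px t := xcoord (plane (q t)); pose py t := ycoord (plane (q t)).
have pyp t : 0 <= t <= T -> 0 < py t by move=> tI; rewrite /py /plane ycoord2 divr_gt0 ?yp ?zp.
have cpx t : 0 <= t <= T -> {for t, continuous px} by move=> tI; exact: (@coord_comp_continuous R _ 2 _ ord0 t (cpl t tI)).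
have cpy t : 0 <= t <= T -> {for t, continuous py} by move=> tI; exact: (@coord_comp_continuous R _ 2 _ (inord 1) t (cpl t tI)).
apply: (@isd_nondecr_itv R (fun t => px t / py t + A * (px t * c))
  (fun t => z t ^+ m.-1 * ((py t ^+ 2 + px t * f.[px t] * py t + px t * g.[px t] + A * py t ^+ 3 * c) / py t ^+ 2)) 0 T T0).
- move=> t tI; apply: (@continuousD _ _ _ (fun t => px t / py t) (fun t => A * (px t * c))).
    by apply: continuous_div; [exact: cpx|exact: cpy|rewrite gt_eqF// pyp].
  apply: (@continuousM _ _ (fun=> A) (fun t => px t * c)); first exact: cst_continuous.
  by apply: (@continuousM _ _ px (fun=> c)); [exact: cpx|exact: cst_continuous].
- move=> t tI; have tI' : 0 <= t <= T by case/andP: tI => *; rewrite !ltW.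
  have := plane_solution (lt0r_neq0 (zp t tI')) (dq t tI).
  rewrite vector_field_lienard scale_row2 => /coords_derive[h1 h2].
  by apply: (@isd_sector_coordinate px py (fun t => z t ^+ m.-1) A c t _ h1 h2); exact: pyp.
- move=> t tI; have tI' : 0 <= t <= T by case/andP: tI => *; rewrite !ltW.
  rewrite mulr_ge0 ?exprn_ge0 ?(ltW (zp _ _))// mulr_ge0 ?invr_ge0 ?sqr_ge0//.
  have := hturn (pyp t tI'); rewrite hgt// => /(_ hw) /=; rewrite -/(px t) -/(py t) -/c.
  exact: ltW.
Qed.


Lemma arc_coordinate_incr a' b' T1 T x u t1 t2 : loop G F a' b' T1 T x u -> e^-1 <= a' -> t1 < t2 ->
  (forall t, t1 <= t <= t2 -> 0 < u t - F.[x t]) ->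
  x t1 / (u t1 - F.[x t1]) + A * (x t1 * a'^-1) < x t2 / (u t2 - F.[x t2]) + A * (x t2 * a'^-1).
Proof.
move=> hl ha t12 hy; have [_ hs _ _ _] := hl.
pose y t := u t - F.[x t].
apply: (@isd_incr_itv R (fun t => x t / y t + A * (x t * a'^-1))
  (fun t => 1 * ((y t ^+ 2 + x t * f.[x t] * y t + x t * g.[x t] + A * y t ^+ 3 * a'^-1) / y t ^+ 2)) t1 t2 t12).
  move=> t tI; apply: (@isd_sector_coordinate x y (fun=> 1)); first exact: hy.
    by rewrite mul1r; case: (hs t).
  by rewrite mul1r -GE -FE; apply: isd_velocity.
move=> t tI; have y0 : 0 < y t by exact: hy.
have hh := height_curve t hl; have := @hturn (curve F x u t).
rewrite hh /curve xcoord2 ycoord2 => /(_ y0 ha) /= h.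
by rewrite mul1r divr_gt0// exprn_gt0.
Qed.

(** Points of equal height lie on one closed orbit. Its part with y > 0 is a single interval of time
    per period, so after shifts by periods both points lie in the same interval and y > 0 between
    them. *)
Lemma sector_arc w w' : W w -> W w' -> zcoord w != 0 -> dc w = dc w' ->
  exists b' T1 T x u t t', [/\ loop G F (height (plane w)) b' T1 T x u, zcoord w' != 0,
    curve F x u t = plane w, curve F x u t' = plane w' &
    forall k, t <= k <= t' \/ t' <= k <= t -> 0 < u k - F.[x k]].
Proof.
move=> Ww Ww' z0 ce; have [_ y0 _ _] := Ww; have [_ y0' _ _] := Ww'.
have z0' : zcoord w' != 0.
  by apply: contraTneq (inv_height_gt0 rd rdl sym y0 z0) => z; rewrite ce (inv_height_z0 rd z) ltxx.
have [_ zp] := sector_height Ww z0; have [_ zp'] := sector_height Ww' z0'.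
have he : height (plane w') = height (plane w) by apply: invr_inj; rewrite -/(dc w) -/(dc w').
have [b' [T1 [T [x [u [t [hl _ ct]]]]]]] := height_loop rd rdl sym (plane_neq0' y0 z0).
have [t' _ ct'] : range (curve F x u) (plane w') by rewrite (loop_level rd rdl sym hl).
have [s1 [s2 [s12 _ _ hy hk]]] := upper_arc rd rdl hl.
have [_ hs hp _ _] := hl.
have hx k : x (k + T) = x k by case: (hp k).
have hu k : u (k + T) = u k by case: (hp k).
have yc q k : curve F x u k = plane q -> 0 < ycoord q -> 0 < zcoord q -> 0 < u k - F.[x k].
  by move=> /(congr1 (@ycoord R _)); rewrite /curve /plane !ycoord2 => -> p1 p2; rewrite divr_gt0.
have [k kI] := hk t (yc _ _ ct y0 zp); have [k' kI'] := hk t' (yc _ _ ct' y0' zp').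
exists b', T1, T, x, u, (t + k%:~R * T), (t' + k'%:~R * T); split => //.
- by rewrite -ct; apply/curve_eq; rewrite (periodic_int hx) (periodic_int hu).
- by rewrite -ct'; apply/curve_eq; rewrite (periodic_int hx) (periodic_int hu).
- move: kI kI' => /andP[k1 k2] /andP[k3 k4] k0 l; apply: hy.
  by case: l => /andP[l1 l2]; [rewrite (lt_le_trans k1 l1) (le_lt_trans l2 k4)|rewrite (lt_le_trans k3 l1) (le_lt_trans l2 k2)].
Qed.

Lemma arc_dp a' b' T1 T x u q k : loop G F a' b' T1 T x u -> curve F x u k = plane q ->
  0 < ycoord q -> zcoord q != 0 -> dp A q = x k / (u k - F.[x k]) + A * (x k * a'^-1).
Proof.
move=> hl ck y0 z0; rewrite chart_difference_plane// /inv_height -ck (height_curve k hl).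
by rewrite /curve xcoord2 ycoord2.
Qed.

Lemma sector_inj w w' : W w -> W w' -> dc w = dc w' -> dp A w = dp A w' -> w = w'.
Proof.
move=> Ww Ww' ce pe; have [Dw y0 _ _] := Ww; have [Dw' y0' _ _] := Ww'.
have [z0|z0] := eqVneq (zcoord w) 0.
  have z0' : zcoord w' = 0 by apply: (inv_height_eq0 rd rdl sym y0'); rewrite -ce (inv_height_z0 rd z0).
  rewrite (equator_pointE Dw y0 z0) (equator_pointE Dw' y0' z0').
  by rewrite -(chart_difference_z0 rd A z0) -(chart_difference_z0 rd A z0') pe.
have [b' [T1 [T [x [u [t [t' [hl z0' ct ct' hy]]]]]]]] := sector_arc Ww Ww' z0 ce.
have [hw zp] := sector_height Ww z0; have [_ zp'] := sector_height Ww' z0'.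
have p1 := arc_dp hl ct y0 z0; have p2 := arc_dp hl ct' y0' z0'.
suff tt : t = t'.
  by rewrite -(central_projection_plane Dw zp) -(central_projection_plane Dw' zp') -ct -ct' tt.
apply/eqP; rewrite eq_le !leNgt; apply/andP; split; apply/negP => tt.
  have := arc_coordinate_incr hl hw tt (fun k kI => hy k (or_intror kI)).
  by rewrite -p1 -p2 pe ltxx.
have := arc_coordinate_incr hl hw tt (fun k kI => hy k (or_introl kI)).
by rewrite -p1 -p2 pe ltxx.
Qed.

Lemma sector_trivial w : W w -> reaches Y W w w.
Proof.
move=> Ww; apply: (@time_change_itv R 3 Y W (fun=> w) (fun=> 1) 0 0) => //.
- by move=> t _; exact: cst_continuous.
- by move=> t _; exact: cst_continuous.
- by move=> t /andP[t1 t2]; move: (lt_trans t1 t2); rewrite ltxx.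
Qed.

(** With t = x / y as parameter of the equator, [rho] is the inverse of the speed c t^(k+1) v^(k-1)
    of t, written as a quotient in which the exponent k - 1 does not occur. *)
Lemma equator_speed (c t v : R) k : c != 0 -> t != 0 -> v != 0 -> v ^+ 2 = 1 - t ^+ 2 * v ^+ 2 ->
  let q := - (c * (t * v) ^+ k) in
  let rho := v ^+ 3 / (c * t ^+ k.+1 * v ^+ k.+2) in
  rho * (0 - t * v * (t * v * 0 + v * q)) = 1 * v + t * - (t * v ^+ 3) /\
  rho * (q - v * (t * v * 0 + v * q)) = - (t * v ^+ 3).
Proof.
move=> c0 t0 v0 v2 q rho.
have rq : rho * q = - (v / t).
  rewrite /rho /q exprMn (exprS t k) (exprS v k.+1) (exprS v k).
  move: (t ^+ k) (v ^+ k) (expf_neq0 k t0) (expf_neq0 k v0) => tk vk tk0 vk0.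
  by field; rewrite c0 t0 v0 tk0 vk0.
split.
  rewrite (_ : rho * _ = - (rho * q) * (t * v ^+ 2)); last by ring.
  have -> : 1 * v + t * - (t * v ^+ 3) = v * (1 - t ^+ 2 * v ^+ 2) by ring.
  by rewrite rq -v2; field.
rewrite (_ : rho * _ = (rho * q) * (1 - v ^+ 2)); last by ring.
have -> : 1 - v ^+ 2 = t ^+ 2 * v ^+ 2 by rewrite {1}v2; ring.
by rewrite rq; field.
Qed.

Lemma equator_reaches p p' : `|p| <= 1 -> `|p'| <= 1 -> p <= p' -> 0 < p \/ p' < 0 ->
  reaches Y W (equator_point p) (equator_point p').
Proof.
move=> p1 p1' pp ps; pose v t : R := (Num.sqrt (1 + t ^+ 2))^-1.
have dv t : isd v t (- (t * v t ^+ 3)).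
  have D0 : 0 < 1 + t ^+ 2 by rewrite ltr_pwDl// sqr_ge0.
  have dD : isd (fun t : R => 1 + t ^+ 2) t (0 + 2 * t ^+ 1 * 1) by apply: isdD; [exact: isd_cst|apply: isdX; exact: isd_id].
  have sn : Num.sqrt (1 + t ^+ 2) != 0 by rewrite gt_eqF// sqrtr_gt0.
  apply: (isd_eq (@isdV R (fun t => Num.sqrt (1 + t ^+ 2)) t _ sn (@isd_sqrt R (fun t => 1 + t ^+ 2) t _ D0 dD))).
  rewrite /v; move: (Num.sqrt _) sn => w wn; field; exact: wn.
have tn t : p <= t <= p' -> t != 0.
  by move=> /andP[h1 h2]; case: ps => h; [rewrite gt_eqF// (lt_le_trans h)|rewrite lt_eqF// (le_lt_trans h2)].
have tp t : p <= t <= p' -> 0 < t ^+ m.+1.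
  by move=> tI; rewrite lt_neqAle eq_sym expf_neq0 ?tn//=; apply: exprn_even_ge0; rewrite /= mo.
pose rho t := v t ^+ 3 / (a m * t ^+ m.+1 * v t ^+ m.+2).
have v0 t : 0 < v t by have [] := equator_sqrt t.
have den t : p <= t <= p' -> 0 < a m * t ^+ m.+1 * v t ^+ m.+2.
  by move=> tI; apply: mulr_gt0; [apply: mulr_gt0; [exact: am|exact: tp]|exact: exprn_gt0].
apply: (@time_change_itv R 3 Y W equator_point rho p p' pp).
- move=> t _; apply: row3_continuous.
  + by apply: isd_cont; apply: isdM; [exact: isd_id|exact: dv].
  + by apply: isd_cont; exact: dv.
  + exact: cst_continuous.
- move=> t tI; apply: continuous_div; last by rewrite gt_eqF// den.
    by apply: isd_cont; apply: isdX; exact: dv.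
  apply: isd_cont; apply: isdM; last by apply: isdX; exact: dv.
  by apply: isdM; [exact: isd_cst|apply: isdX; exact: isd_id].
- by move=> t tI; rewrite divr_gt0 ?den// exprn_gt0.
- move=> t tI; have tI' : p <= t <= p' by case/andP: tI => *; rewrite !ltW.
  rewrite (poincare_field_coords s b hrm n0 nm am0) /equator_point xcoord3 ycoord3 zcoord3 -/(v t).
  rewrite (homogenization_first_at0 r s a b n0 nm) (homogenization_second_at0 s b hrm n0 nm am0).
  have v2 : v t ^+ 2 = 1 - t ^+ 2 * v t ^+ 2 by have [_ <-] := equator_sqrt t; rewrite -/(v t); ring.
  have vn : v t != 0 by rewrite gt_eqF.
  have amn : a m != 0 by [].
  set V := row3 _ _ _.
  have -> : rho t *: V = row3 (1 * v t + t * - (t * v t ^+ 3)) (- (t * v t ^+ 3)) 0.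
    have [s1 s2] := equator_speed m amn (tn t tI') vn v2.
    apply/rowP => -[[|[|[|//]]] i]; rewrite !mxE /=; [exact: s1|exact: s2|].
    by rewrite mul0r oppr0 mulr0.
  apply/coords_derive3; split.
  + rewrite (_ : (fun s => _) = (fun s => s * v s)); first by apply: isdM; [exact: isd_id|exact: dv].
    by apply/funext => w; rewrite xcoord3.
  + rewrite (_ : (fun s => _) = v); first exact: dv.
    by apply/funext => w; rewrite ycoord3.
  + rewrite (_ : (fun s => _) = (fun=> 0)); first exact: isd_cst.
    by apply/funext => w; rewrite zcoord3.
- move=> t /andP[h1 h2]; have [] := @equator_in_sector t => //.
  move: p1 p1'; rewrite !ler_norml => /andP[l1 l2] /andP[l3 l4].
  by rewrite (le_trans l1) // (le_trans h2).
Qed.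

(** Off the equator the arc of the closed orbit between the two points is lifted to the sphere. The
    order of the chart differences decides which point comes first in time, and their monotonicity
    keeps the lifted arc in the sector. *)
Lemma sector_backward w w' : W w -> W w' -> precedes (dp A w) (dc w) (dp A w') (dc w') -> reaches Y W w w'.
Proof.
move=> Ww Ww' [cE pE h]; have [Dw y0 ce p1] := Ww; have [Dw' y0' ce' p1'] := Ww'.
have [z0|z0] := eqVneq (zcoord w) 0.
  have z0' : zcoord w' = 0 by apply: (inv_height_eq0 rd rdl sym y0'); rewrite -cE (inv_height_z0 rd z0).
  have [pp|pp|pp] := h (inv_height_z0 rd z0).
  - by rewrite (sector_inj Ww Ww' cE pp); exact: sector_trivial.
  - rewrite (equator_pointE Dw y0 z0) (equator_pointE Dw' y0' z0') -(chart_difference_z0 rd A z0) -(chart_difference_z0 rd A z0').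
    by apply: equator_reaches => //; left.
  - rewrite (equator_pointE Dw y0 z0) (equator_pointE Dw' y0' z0') -(chart_difference_z0 rd A z0) -(chart_difference_z0 rd A z0').
    by apply: equator_reaches => //; right.
have [b' [T1 [T [x [u [t [t' [hl z0' ct ct' hy]]]]]]]] := sector_arc Ww Ww' z0 cE.
have [hw zp] := sector_height Ww z0; have [_ zp'] := sector_height Ww' z0'.
have pE1 := arc_dp hl ct y0 z0; have pE2 := arc_dp hl ct' y0' z0'.
have tt : t <= t'.
  rewrite leNgt; apply/negP => tt.
  have := arc_coordinate_incr hl hw tt (fun k kI => hy k (or_intror kI)).
  by rewrite -pE1 -pE2 ltNge pE.
have [_ hs _ _ _] := hl.
have dq k : is_derive k (1 : R) (fun k => central_projection (curve F x u k))
    (zcoord (central_projection (curve F x u k)) ^- m.-1 *: Y (central_projection (curve F x u k))).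
  have := @poincare_field_central_projection R S (curve F x u) k.
  rewrite (system_degree_lienard s b hrm n0 nm am0); apply; first by rewrite m1E.
  by rewrite /S -GE -FE; exact: curve_solution.
have cq k : {for k, continuous (fun k => central_projection (curve F x u k))}.
  by have [d _] := dq k; apply: differentiable_continuous; apply/derivable1_diffP.
rewrite -(central_projection_plane Dw zp) -(central_projection_plane Dw' zp') -ct -ct'.
apply: (@time_change_itv R 3 Y W (fun k => central_projection (curve F x u k))
  (fun k => zcoord (central_projection (curve F x u k)) ^- m.-1) t t' tt).
- by move=> k _; exact: cq.
- move=> k _; have [w0 [w00 _ _ zw _]] := central_projection_coords (curve F x u k).
  apply: (@continuousV _ _ (fun k => zcoord (central_projection (curve F x u k)) ^+ m.-1)).
    by rewrite zw expf_neq0// gt_eqF.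
  apply: (@continuous_exp R (fun k => zcoord (central_projection (curve F x u k))) m.-1) => k'.
  exact: (@coord_comp_continuous R _ 3 _ (inord 2) k' (cq k')).
- move=> k _; have [w0 [w00 _ _ zw _]] := central_projection_coords (curve F x u k).
  by rewrite invr_gt0 exprn_gt0// zw.
- move=> k /andP[k1 k2]; have [w0 [w00 _ yw zw Dk]] := central_projection_coords (curve F x u k).
  set q := central_projection _ in yw zw Dk *.
  have yk : 0 < u k - F.[x k] by apply: hy; left; rewrite k1.
  have yq : 0 < ycoord q by rewrite yw /curve ycoord2 mulr_gt0.
  have zq : zcoord q != 0 by rewrite zw gt_eqF.
  have cq' : curve F x u k = plane q by rewrite plane_central_projection.
  have dcq : dc q = dc w by rewrite /inv_height -cq' (height_curve k hl).
  split => //; first by rewrite dcq.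
  have pq := arc_dp hl cq' yq zq.
  move: p1 p1'; rewrite !ler_norml => /andP[l1 l2] /andP[l3 l4].
  apply/andP; split.
    apply: le_trans l1 _; move: k1; rewrite le_eqVlt => /predU1P[tk|k1]; first by rewrite pE1 pq tk.
    rewrite pE1 pq; apply/ltW/(arc_coordinate_incr hl hw k1) => i /andP[i1 i2].
    by apply: hy; left; rewrite i1 (le_trans i2).
  apply: le_trans l4; move: k2; rewrite le_eqVlt => /predU1P[kt|k2]; first by rewrite pE2 pq kt.
  rewrite pE2 pq; apply/ltW/(arc_coordinate_incr hl hw k2) => i /andP[i1 i2].
  by apply: hy; left; rewrite i2 andbT (le_trans k1).
Qed.

(** For c > 0 the point is sought on the upper part of the orbit of height 1/c, where x/y + A c x
    must equal p. Multiplied by y the equation has no poles at the ends: psi equals x there,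
    negative at one end and positive at the other. *)
Lemma sector_surj v : saddle_box 1 e v -> exists2 q, W q & quadrant_chart G F A q = v.
Proof.
move=> [qv pv cv]; set p := xcoord v - ycoord v in pv; set c := xcoord v * ycoord v in cv.
suff [q [Wq pq cq]] : exists q, [/\ W q, dp A q = p & dc q = c].
  exists q => //; have [_ y0 _ _] := Wq; have [h1 h2 h3] := quadrant_chart_coords rd rdl sym A y0.
  by apply: quadrant_eq => //; rewrite ?h2 ?h3.
have c0 : 0 <= c by case: qv => h1 h2; exact: mulr_ge0.
move: c0; rewrite le_eqVlt => /predU1P[c0|c0].
  by exists (equator_point p); rewrite -c0; exact: equator_in_sector.
have ci0 : 0 < c^-1 by rewrite invr_gt0.
have [b' [T1 [T [x [u hl]]]]] := loop_top rd rdl sym ci0.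
have [s1 [s2 [s12 [y1 y2] [x1 x2] hy _]]] := upper_arc rd rdl hl.
have [_ hs _ _ _] := hl; have [cx cu] := lienard_cont hs.
pose y t := u t - F.[x t]; have cy : continuous y by exact: continuous_velocity.
pose psi t := x t * (1 + A * c * y t) - p * y t.
have cpsi : continuous psi.
  move=> t; apply: (@continuousB _ _ _ (fun t => x t * (1 + A * c * y t)) (fun t => p * y t)).
    apply: (@continuousM _ _ x (fun t => 1 + A * c * y t)); first exact: cx.
    apply: (@continuousD _ R _ (fun _ : R => 1) (fun t => A * c * y t)); first exact: cst_continuous.
    by apply: (@continuousM _ _ (fun=> A * c) y); [exact: cst_continuous|exact: cy].
  by apply: (@continuousM _ _ (fun=> p) y); [exact: cst_continuous|exact: cy].
have ps1 : psi s1 = x s1 by rewrite /psi /y y1 !mulr0 addr0 mulr1 subr0.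
have ps2 : psi s2 = x s2 by rewrite /psi /y y2 !mulr0 addr0 mulr1 subr0.
have [|t /andP[t1 t2] pt] := @IVT_eq R psi s1 s2 0 cpsi (ltW s12).
  by left; rewrite ps1 ps2 !ltW.
have tI : s1 < t < s2.
  rewrite !lt_neqAle t1 t2 !andbT; apply/andP; split; apply: contra_eqN pt => /eqP.
    by move=> <-; rewrite ps1 lt_eqF.
  by move=> ->; rewrite ps2 gt_eqF.
have yt : 0 < y t by exact: hy.
have [w0 [w00 _ yw zw Dk]] := central_projection_coords (curve F x u t).
set q := central_projection _ in yw zw Dk *.
have yq : 0 < ycoord q by rewrite yw /curve ycoord2 mulr_gt0.
have zq : zcoord q != 0 by rewrite zw gt_eqF.
have cq' : curve F x u t = plane q by rewrite plane_central_projection.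
have dcq : dc q = c by rewrite /inv_height -cq' (height_curve t hl) invrK.
have dpq : dp A q = p.
  rewrite (arc_dp hl cq' yq zq) invrK -/(y t).
  have yn : y t != 0 by rewrite gt_eqF.
  apply: (mulIf yn); apply/eqP; rewrite -subr_eq0 -pt /psi; apply/eqP; field.
  exact: yn.
by exists q; split => //; split; rewrite ?dcq ?dpq.
Qed.

(** Compactness replaces a direct proof that the inverse chart is continuous. The sector is defined
    by the open condition y > 0, so closedness needs a positive lower bound on y. *)
Lemma sector_compact : compact W.
Proof.
pose C' := 1 + A * (2 * C + 1).
have AC : 0 < A * (2 * C + 1) by rewrite mulr_gt0// addr_gt0// mulr_gt0.
have C'1 : 1 <= C' by rewrite /C' lerDl ltW.
have bound (w : 'rV[R]_3) : poincare_disc w -> forall i, `|w 0 i| <= 1.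
  move=> [q1 _]; have : xcoord w ^+ 2 <= 1 /\ ycoord w ^+ 2 <= 1 /\ zcoord w ^+ 2 <= 1.
    by have := sqr_ge0 (xcoord w); have := sqr_ge0 (ycoord w); have := sqr_ge0 (zcoord w); lra.
  have sq (k : R) : k ^+ 2 <= 1 -> `|k| <= 1.
    by rewrite -[k ^+ 2]real_normK ?num_real// expr_le1.
  move=> [h1 [h2 h3]] i; have {}h1 := sq _ h1; have {}h2 := sq _ h2; have {}h3 := sq _ h3.
  have -> : w 0 i = [:: xcoord w; ycoord w; zcoord w]`_i by rewrite -{1}(row3_coords w) mxE.
  by case: i => -[|[|[|//]]].
(* x / y is the chart difference minus A (x / z) c, and |(x / z) c| <= 2 C + 1, so |x| <= C' y;
   [hlarge] then gives z <= y. On the unit sphere 1 <= (C'^2 + 2) y^2 <= ((C' + 2) y)^2. *)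
have ylow (w : 'rV[R]_3) : W w -> (C' + 2)^-1 <= ycoord w.
  move=> Ww; have [Dw y0 ce p1] := Ww; have [q1 zw] := Dw.
  have [hx hz] : `|xcoord w| <= C' * ycoord w /\ zcoord w <= ycoord w.
    have rb : `|xcoord w / zcoord w * dc w| <= 2 * C + 1.
      have [z0|z0] := eqVneq (zcoord w) 0.
        by rewrite (inv_height_z0 rd z0) mulr0 normr0 ltW// addr_gt0// mulr_gt0.
      have c0 := inv_height_gt0 rd rdl sym y0 z0.
      have := hC (plane_neq0' y0 z0); rewrite /plane xcoord2 -/(plane w).
      have -> : height (plane w) = (dc w)^-1 by rewrite invrK.
      set X1 := xcoord w / zcoord w; set c := dc w in c0 ce *; move=> h1.
      rewrite -ler_sqr ?nnegrE//; last by rewrite ltW// addr_gt0// mulr_gt0.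
      rewrite real_normK ?num_real// exprMn.
      apply: (@le_trans _ _ (C * (1 + c^-1) * c ^+ 2)); first by rewrite ler_wpM2r// sqr_ge0.
      have -> : C * (1 + c^-1) * c ^+ 2 = C * (c ^+ 2 + c) by field; rewrite gt_eqF.
      have c1 : c <= 1 by exact: le_trans ce e1.
      have : C * c ^+ 2 <= C * 1 by rewrite ler_pM2l// expr_le1// ltW.
      have : C * c <= C * 1 by rewrite ler_pM2l.
      have k3 : 2 * C <= (2 * C + 1) ^+ 2 by have := sqr_ge0 C; have := C0; nra.
      by move=> k1 k2; apply: le_trans k3; lra.
    have hx : `|xcoord w| <= C' * ycoord w.
      rewrite -ler_pdivrMr// -[X in _ / X]gtr0_norm// -normf_div.
      have -> : xcoord w / ycoord w = dp A w - A * (xcoord w / zcoord w * dc w) by rewrite /chart_difference addrK.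
      apply: le_trans (ler_normB _ _) _; rewrite /C' lerD// normrM gtr0_norm// ler_pM2l//.
    split => //; have [z0|z0] := eqVneq (zcoord w) 0; first by rewrite z0 ltW.
    have [hw zp] := sector_height Ww z0.
    have := @hlarge (plane w); rewrite /plane xcoord2 ycoord2 -/(plane w) => hl.
    rewrite -[zcoord w]mul1r -ler_pdivlMr//; apply: hl => //; first by rewrite divr_gt0.
    by rewrite normrM normfV (gtr0_norm zp) mulrA ler_pM2r ?invr_gt0.
  have C20 : 0 < C' + 2 by lra.
  rewrite -[_^-1]mul1r ler_pdivrMr// -(@expr_ge1 _ 2)//; last by rewrite mulr_ge0// ltW.
  have h1 : xcoord w ^+ 2 <= (C' * ycoord w) ^+ 2.
    by rewrite -real_normK ?num_real// ler_sqr ?nnegrE// mulr_ge0 ?(ltW y0)//; lra.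
  have h2 : zcoord w ^+ 2 <= ycoord w ^+ 2 by rewrite ler_sqr ?nnegrE// ltW.
  have y20 := sqr_ge0 (ycoord w).
  rewrite exprMn -[leLHS]q1; apply: (@le_trans _ _ (ycoord w ^+ 2 * (C' ^+ 2 + 2))).
    by move: h1; rewrite exprMn; lra.
  by rewrite ler_wpM2l//; nra.
apply: bounded_closed_compact.
  rewrite /= /bounded_near; near=> B => w [Dw _ _ _].
  apply: (@le_trans _ _ 1); last by near: B; exact: nbhs_pinfty_ge (num_real _).
  rewrite [leLHS]mx_normrE; apply/bigmax_leP; split => // -[i j] _ /=.
  by rewrite ord1; exact: bound.
move=> w clw.
have near_W P : (\forall q \near within (@poincare_disc R) (nbhs w), P q) -> exists2 q, W q & P q.
  rewrite near_withinE => h; have [q [Wq hq]] := clw _ h.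
  by exists q => //; apply: hq; case: Wq.
have closedP (h : 'rV[R]_3 -> R) (k : R) : continuous h -> (forall q, W q -> h q <= k) -> h w <= k.
  move=> ch hW; rewrite leNgt; apply/negP => hk.
  have [|q Wq] := @near_W (fun q => k < h q).
    by apply: cvgr_gt hk; apply: cvg_within_filter; exact: ch.
  by rewrite ltNge hW.
have cc (i : 'I_3) : continuous (fun q : 'rV[R]_3 => q 0 i) by exact: coord_continuous.
have cN (h : 'rV[R]_3 -> R) : continuous h -> continuous (fun q => - h q).
  by move=> ch q; apply: (@continuousN _ _ _ h); exact: ch.
have yw : (C' + 2)^-1 <= ycoord w.
  rewrite -lerN2; apply: (closedP (fun q => - ycoord q)); first exact/cN/cc.
  by move=> q /ylow; rewrite lerN2.
have y0 : 0 < ycoord w by apply: lt_le_trans yw; rewrite invr_gt0; lra.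
have csq : continuous (fun q : 'rV[R]_3 => xcoord q ^+ 2 + ycoord q ^+ 2 + zcoord q ^+ 2).
  have c2 (i : 'I_3) : continuous (fun q : 'rV[R]_3 => q 0 i ^+ 2).
    by move=> q; apply: (@continuousM _ _ (fun q : 'rV[R]_3 => q 0 i) (fun q => q 0 i)); exact: cc.
  move=> q; apply: (@continuousD _ _ _ (fun q : 'rV[R]_3 => xcoord q ^+ 2 + ycoord q ^+ 2) (fun q => zcoord q ^+ 2)); last exact: c2.
  by apply: (@continuousD _ _ _ (fun q : 'rV[R]_3 => xcoord q ^+ 2) (fun q => ycoord q ^+ 2)); exact: c2.
have Dw : poincare_disc w.
  split.
    apply/eqP; rewrite eq_le; apply/andP; split.
      by apply: (closedP _ _ csq) => q [[-> _] _ _ _].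
    rewrite -lerN2; apply: (closedP _ _ (cN _ csq)) => q [[-> _] _ _ _]//.
  rewrite -oppr_le0; apply: (closedP (fun q => - zcoord q)); first exact/cN/cc.
  by move=> q [[_ h] _ _ _]; rewrite oppr_le0.
have within_le (h : 'rV[R]_3 -> R) (k : R) : h @ within (@poincare_disc R) (nbhs w) --> h w ->
    (forall q, W q -> h q <= k) -> h w <= k.
  move=> ch hW; rewrite leNgt; apply/negP => hk.
  have [|q Wq] := @near_W (fun q => k < h q); first exact: cvgr_gt hk.
  by rewrite ltNge hW.
have cp := chart_difference_within rd rdl sym (A := A) hC C0 Dw y0.
split => //.
  by apply: (within_le _ _ (inv_height_within rd rdl sym Dw y0)) => q [].
rewrite ler_norml; apply/andP; split.
  rewrite -lerN2 opprK; apply: (within_le (fun q => - dp A q)); first exact: cvgN.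
  by move=> q [_ _ _]; rewrite ler_norml lerNl => /andP[].
by apply: (within_le _ _ cp) => q [_ _ _]; rewrite ler_norml => /andP[].
Unshelve. all: by end_near. Qed.

Lemma sector_top : one_hyperbolic_sector Y (@poincare_disc R) (y_axis_top R).
Proof.
have topE : y_axis_top R = equator_point 0.
  by rewrite /y_axis_top /equator_point expr0n addr0 sqrtr1 invr1 mul0r.
have [|Wt pt ct] := @equator_in_sector 0; first by rewrite normr0.
pose h := quadrant_chart G F A.
have hc q : W q -> [/\ closed_quadrant (h q), xcoord (h q) - ycoord (h q) = dp A q &
    xcoord (h q) * ycoord (h q) = dc q].
  by move=> [_ y0 _ _]; exact: quadrant_chart_coords.
have hN q : W q -> saddle_box 1 e (h q).
  by move=> Wq; have [h1 h2 h3] := hc q Wq; have [_ _ h4 h5] := Wq; split; rewrite ?h2 ?h3.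
pose k v := xget (y_axis_top R) [set q | W q /\ h q = v].
have kP v : saddle_box 1 e v -> W (k v) /\ h (k v) = v.
  move=> Nv; rewrite /k; case: xgetP => [q _ []//|].
  by have [q Wq hq] := sector_surj Nv => /(_ q); case.
have hinj q q' : W q -> W q' -> h q = h q' -> q = q'.
  move=> Wq Wq' hh; have [_ h2 h3] := hc q Wq; have [_ h2' h3'] := hc q' Wq'.
  by apply: sector_inj => //; [rewrite -h3 -h3' hh|rewrite -h2 -h2' hh].
have kh q : W q -> k (h q) = q.
  by move=> Wq; have [W1 h1] := kP _ (hN q Wq); exact: hinj.
have ch : {within W, continuous h}.
  apply/subspace_continuousP => q Wq; have [Dq y0 _ _] := Wq.
  have sub P : within (@poincare_disc R) (nbhs q) P -> within W (nbhs q) P.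
    move=> hP; change (\forall w \near q, W w -> P w).
    have {}hP : \forall w \near q, poincare_disc w -> P w by exact: hP.
    near=> w => -[Dw _ _ _]; suff : poincare_disc w -> P w by apply.
    by near: w.
  apply: quadrant_chart_within => P hP; apply: sub.
    exact: (chart_difference_within rd rdl sym (A := A) hC C0 Dq y0 hP).
  exact: (inv_height_within rd rdl sym Dq y0 hP).
have Dt : poincare_disc (y_axis_top R) by rewrite topE; case: Wt.
have yt : 0 < ycoord (y_axis_top R) by rewrite topE; case: Wt.
exists W, (saddle_box 1 e), h, k; split.
- split.
  + by move=> q [].
  + have n1 : \forall q \near within (@poincare_disc R) (nbhs (y_axis_top R)), dc q <= e.
      by apply: cvgr_le (inv_height_within rd rdl sym Dt yt) _ _; rewrite topE ct.
    have n2 : \forall q \near within (@poincare_disc R) (nbhs (y_axis_top R)), `|dp A q| <= 1.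
      have := chart_difference_within rd rdl sym (A := A) hC C0 Dt yt; rewrite [in dp A (y_axis_top R)]topE pt.
      by move/cvgr0_norm_le; apply.
    have n3 : \forall q \near within (@poincare_disc R) (nbhs (y_axis_top R)), 0 < ycoord q.
      by apply: cvgr_gt yt; apply: cvg_within_filter; exact: coordC.
    have n4 : \forall q \near within (@poincare_disc R) (nbhs (y_axis_top R)), poincare_disc q by exact: withinT.
    by near=> q; split; near: q.
  + by move=> v [].
  + have n1 : \forall v \near within (@closed_quadrant R) (nbhs (0 : 'rV[R]_2)), xcoord v <= Num.min 1 e.
      by apply: cvgr_le; [apply: cvg_within_filter; exact: coordC|rewrite mxE lt_min ltr01].
    have n2 : \forall v \near within (@closed_quadrant R) (nbhs (0 : 'rV[R]_2)), ycoord v <= 1.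
      by apply: cvgr_le; [apply: cvg_within_filter; exact: coordC|rewrite mxE].
    have n3 : \forall v \near within (@closed_quadrant R) (nbhs (0 : 'rV[R]_2)), closed_quadrant v by exact: withinT.
    have : \forall v \near within (@closed_quadrant R) (nbhs (0 : 'rV[R]_2)), saddle_box 1 e v.
      near=> v; have qv : closed_quadrant v by near: v.
      have : xcoord v <= Num.min 1 e by near: v.
      have y1 : ycoord v <= 1 by near: v.
      rewrite le_min => /andP[x1 x2]; case: (qv) => x0 y0; split => //.
        by rewrite ler_norml; apply/andP; split; lra.
      by apply: le_trans x2; rewrite ler_piMr.
    by [].
- split => //.
  + by move=> _ [q Wq <-]; exact: hN.
  + by move=> _ [v Nv <-]; case: (kP v Nv).
  + by move=> v Nv; case: (kP v Nv).
- split => //; apply: (@compact_inverse_continuous _ _ W (saddle_box 1 e) h k) => //.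
  + exact: sector_compact.
  + by move=> q Wq; split; [exact: hN|exact: kh].
- have Wt' : W (y_axis_top R) by rewrite topE.
  have [h1 h2 h3] := hc _ Wt'; rewrite topE pt in h2; rewrite topE ct in h3.
  have q0 : closed_quadrant (0 : 'rV[R]_2) by rewrite /closed_quadrant /= xcoord0 ycoord0.
  by apply: quadrant_eq; rewrite // topE ?h2 ?h3 xcoord0 ycoord0 ?mulr0 ?subr0.
- move=> w w' Ww Ww'; have [_ h2 h3] := hc w Ww; have [_ h2' h3'] := hc w' Ww'.
  rewrite (saddle_reaches (hN w Ww) (hN w' Ww')) h2 h3 h2' h3'; split; first exact: sector_forward.
  exact: sector_backward.
Unshelve. all: by end_near. Qed.
End Constants.
End Sector.

(** * The lower sector by rotation *)

Section Rotation.
Variable R : realType.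

Definition rotate (q : 'rV[R]_3) : 'rV[R]_3 := row3 (- xcoord q) (- ycoord q) (zcoord q).

Lemma rotateK : involutive rotate.
Proof. by move=> q; rewrite /rotate xcoord3 ycoord3 zcoord3 !opprK row3_coords. Qed.

Lemma rotate_continuous : continuous rotate.
Proof.
move=> q; apply: (@row3_continuous R _ (fun p => - xcoord p) (fun p => - ycoord p) (fun p => zcoord p));
  [| |exact: coord_continuous].
  by apply: (@continuousN _ _ _ (fun p : 'rV[R]_3 => xcoord p)); exact: coord_continuous.
by apply: (@continuousN _ _ _ (fun p : 'rV[R]_3 => ycoord p)); exact: coord_continuous.
Qed.

Lemma rotate_derive (q : R -> 'rV[R]_3) (t : R) (v : 'rV[R]_3) :
  is_derive t (1 : R) q v -> is_derive t (1 : R) (rotate \o q) (rotate v).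
Proof.
rewrite -{1}(row3_coords v) => /coords_derive3[dx dy dz]; apply/coords_derive3; split.
- by rewrite (_ : (fun s => _) = (fun s => - xcoord (q s))); [exact: isdN|apply/funext => s; rewrite /= xcoord3].
- by rewrite (_ : (fun s => _) = (fun s => - ycoord (q s))); [exact: isdN|apply/funext => s; rewrite /= ycoord3].
- by rewrite (_ : (fun s => _) = (fun s => zcoord (q s)))//; apply/funext => s; rewrite /= zcoord3.
Qed.

Section Conjugate.
Variables (Y Y' : 'rV[R]_3 -> 'rV[R]_3).
Hypothesis YY' : forall q, Y' (rotate q) = rotate (Y q).

Lemma reaches_rotate W p q : reaches Y W p q -> reaches Y' (rotate @^-1` W) (rotate p) (rotate q).
Proof.
move=> [T [c [T0 [cc dc'] c0 cT cW]]]; exists T, (rotate \o c).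
split; rewrite /= ?c0 ?cT//.
  split.
    by move=> t P nP; exact: (cc t _ (rotate_continuous nP)).
  by move=> t /dc'; rewrite /= YY'; exact: rotate_derive.
by move=> _ [t tT <-]; rewrite /= rotateK; apply: cW; exists t.
Qed.
End Conjugate.

Lemma poincare_disc_rotate (q : 'rV[R]_3) : poincare_disc (rotate q) <-> poincare_disc q.
Proof. by rewrite /poincare_disc /= /rotate xcoord3 ycoord3 zcoord3 !sqrrN. Qed.

Lemma one_hyperbolic_sector_rotate (Y Y' : 'rV[R]_3 -> 'rV[R]_3) p :
  (forall q, Y' (rotate q) = rotate (Y q)) ->
  one_hyperbolic_sector Y' (@poincare_disc R) (rotate p) ->
  one_hyperbolic_sector Y (@poincare_disc R) p.
Proof.
move=> YY' [W [N [h [k [[WD nW NE nN] [hW kN kh hk] [ch ck] hp hr]]]]].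
exists (rotate @^-1` W), N, (h \o rotate), (rotate \o k); split.
- split => //.
    by move=> q /= /WD /poincare_disc_rotate.
  have n1 : \forall q \near p, poincare_disc (rotate q) -> W (rotate q).
    exact: rotate_continuous nW.
  have : \forall q \near p, poincare_disc q -> W (rotate q).
    by near=> q => /poincare_disc_rotate; near: q.
  by [].
- split.
  + by move=> _ [q Wq <-]; apply: hW; exists (rotate q).
  + by move=> _ [v Nv <-]; rewrite /= rotateK; apply: kN; exists v.
  + by move=> q Wq /=; rewrite kh// rotateK.
  + by move=> v Nv /=; rewrite rotateK hk.
- split.
    apply/subspace_continuousP => q Wq P nP.
    have h1 := (subspace_continuousP _ _).1 ch (rotate q) Wq P nP.
    exact: (rotate_continuous h1).
  by move=> v P nP; exact: (ck v _ (rotate_continuous nP)).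
- exact: hp.
- have YY q : Y (rotate q) = rotate (Y' q) by rewrite -[q in RHS]rotateK YY' rotateK.
  move=> w w' Ww Ww'; split => [rw|/(hr _ _ Ww Ww').2 rw].
    apply/hr => //; have := reaches_rotate YY' rw.
    by rewrite (_ : rotate @^-1` _ = W)//; apply/funext => q; rewrite /preimage /= rotateK.
  by have := reaches_rotate YY rw; rewrite !rotateK.
Unshelve. all: by end_near. Qed.
End Rotation.

Section Sectors.
Variable R : realType.

Lemma poly_between_horner_N lo hi (c : nat -> R) x :
  (poly_between lo hi (fun i => (-1) ^+ i * c i)).[x] = (poly_between lo hi c).[- x].
Proof.
rewrite !poly_between_horner; apply: eq_bigr => i _.
by rewrite [(- x) ^+ i]exprNn; ring.
Qed.

Section Top.
Variables (m n r s : nat) (a b : nat -> R).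
Let g := poly_between r m a.
Let f := poly_between s n b.
Let G := primitive_between r m a.
Let F := primitive_between s n b.
Hypotheses (hrm : (r <= m)%N) (n0 : (0 < n)%N) (nm : (2 * n + 1 <= m)%N).
Hypotheses (mo : odd m) (am : 0 < a m).
Hypotheses (rd : right_data G F) (rdl : right_data (refl G) (refl F)).
Hypothesis sym : forall x1 x2 : R, 0 < x1 -> 0 < x2 -> G.[x1] = (refl G).[x2] -> F.[x1] = (refl F).[x2].
Hypothesis xg : forall x : R, x != 0 -> 0 < x * g.[x].

Lemma one_hyperbolic_sector_top :
  one_hyperbolic_sector (poincare_field (lienard_system g f)) (@poincare_disc R) (y_axis_top R).
Proof.
have am0 : a m != 0 by rewrite gt_eqF.
have [A [L0 [A0 L00 turn]]] := turning_bound hrm nm am0 rd rdl sym xg.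
have [C [C0 hC]] := xcoord_height hrm n0 nm am0 rd rdl sym.
have [L L1 large] := ycoord_large rd rdl sym (1 + A * (2 * C + 1)).
pose e := (1 + L0 + L)^-1.
have e0 : 0 < e by rewrite invr_gt0; lra.
have e1 : e <= 1 by rewrite invf_le1; lra.
apply: (sector_top hrm n0 nm mo am rd rdl sym A0 C0 e0 e1) => //.
- by move=> p y0; rewrite invrK => h; apply: turn => //; lra.
- by move=> p y0 xy; rewrite invrK => h; apply: large => //; lra.
Qed.
End Top.

Section Bottom.
Variables (m n r s : nat) (a b : nat -> R).
Let g := poly_between r m a.
Let f := poly_between s n b.
Let G := primitive_between r m a.
Let F := primitive_between s n b.
Hypotheses (hrm : (r <= m)%N) (n0 : (0 < n)%N) (nm : (2 * n + 1 <= m)%N).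
Hypotheses (mo : odd m) (am : 0 < a m).
Hypotheses (rd : right_data G F) (rdl : right_data (refl G) (refl F)).
Hypothesis sym : forall x1 x2 : R, 0 < x1 -> 0 < x2 -> G.[x1] = (refl G).[x2] -> F.[x1] = (refl F).[x2].
Hypothesis xg : forall x : R, x != 0 -> 0 < x * g.[x].
(** Coefficients of the system conjugated by (x, y) -> (- x, - y): g becomes - g (- x) and f becomes
    f (- x), so their primitives become [refl G] and [- refl F]. *)
Let a' i := (-1) ^+ i.+1 * a i.
Let b' i := (-1) ^+ i * b i.
Let S := lienard_system g f.
Let S' := lienard_system (poly_between r m a') (poly_between s n b').

Let am' : a' m = a m. Proof. by rewrite /a' exprS -signr_odd mo expr1 mulN1r opprK mul1r. Qed.
Let am0 : a m != 0. Proof. by rewrite gt_eqF. Qed.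
Let am0' : a' m != 0. Proof. by rewrite am'. Qed.

Let g'E x : (poly_between r m a').[x] = - g.[- x].
Proof.
rewrite -poly_between_horner_N !poly_between_horner -sumrN; apply: eq_bigr => i _.
by rewrite /a' exprS; ring.
Qed.

Let G'E : primitive_between r m a' = refl G. Proof. by rewrite refl_primitive_between. Qed.

Let F'E : primitive_between s n b' = - refl F.
Proof.
rewrite refl_primitive_between /primitive_between /poly_between -sumrN.
by apply: eq_bigr => i _; rewrite -scaleNr /b' exprS !mulN1r !mulNr opprK.
Qed.

Lemma poincare_field_rotate q : poincare_field S' (rotate q) = rotate (poincare_field S q).
Proof.
rewrite (poincare_field_coords s b' hrm n0 nm am0') (poincare_field_coords s b hrm n0 nm am0).
rewrite /rotate xcoord3 ycoord3 zcoord3 xcoord3 ycoord3 zcoord3.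
have [z0|z0] := eqVneq (zcoord q) 0.
  rewrite z0 !(homogenization_first_at0 r s _ _ n0 nm).
  rewrite (homogenization_second_at0 s b' hrm n0 nm am0') (homogenization_second_at0 s b hrm n0 nm am0).
  rewrite am' (_ : (- xcoord q) ^+ m = - xcoord q ^+ m); last first.
    by rewrite exprNn -signr_odd mo expr1 mulN1r.
  by congr row3; ring.
rewrite !(homogenization_first_neq0 r s _ _ n0 nm)//.
rewrite (homogenization_second_neq0 s b' hrm n0 nm am0')// (homogenization_second_neq0 s b hrm n0 nm am0)//.
rewrite g'E poly_between_horner_N !mulNr !opprK -/g -/f.
by congr row3; ring.
Qed.

Lemma one_hyperbolic_sector_bottom :
  one_hyperbolic_sector (poincare_field S) (@poincare_disc R) (y_axis_bottom R).
Proof.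
apply: (one_hyperbolic_sector_rotate poincare_field_rotate).
have -> : rotate (y_axis_bottom R) = y_axis_top R.
  by rewrite /rotate /y_axis_bottom xcoord3 ycoord3 zcoord3 oppr0 opprK.
apply: one_hyperbolic_sector_top => //; rewrite ?am' ?G'E ?F'E//.
- exact: right_data_opp.
- have -> : refl (- refl F) = - F by rewrite -[F in RHS]refl_refl {1}/refl raddfN.
  by rewrite refl_refl; exact: right_data_opp.
- move=> x1 x2 p1 p2; rewrite refl_refl => /esym/(sym p2 p1) e.
  have -> : refl (- refl F) = - F by rewrite -[F in RHS]refl_refl {1}/refl raddfN.
  by rewrite !hornerN e.
- move=> x x0; rewrite g'E mulrN -mulNr; apply: xg; by rewrite oppr_eq0.
Qed.
End Bottom.
End Sectors.

(** * The equivalence and the phase portrait *)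

Section Integrals.
Variable R : realType.

Lemma integral_from0_poly_between lo hi (c : nat -> R) :
  integral_from0 (fun x => (poly_between lo hi c).[x]) = (fun x => (primitive_between lo hi c).[x]).
Proof.
apply: integral_from0E; [exact: continuous_horner|exact: primitive_between0|].
by move=> t; rewrite -primitive_between_deriv; apply: (isd_eq (isd_horner _ (isd_id t))); rewrite mulr1.
Qed.

Lemma nilpotent_global_center_closed_orbits (G F : {poly R}) : F.[0] = 0 ->
  nilpotent_global_center (lienard_system G^`() F^`()) 0 -> closed_orbits G F.
Proof.
move=> F0 [[_ [[per _ _] _]] _]; apply: periodic_orbits_closed_orbits => // q q0.
by have [|O [pO _ Oq _]] := per q; [exact: q0|exists O].
Qed.

Lemma poly_between_at0 lo hi (c : nat -> R) : (lo <= hi)%N ->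
  (poly_between lo hi c).[0] = if lo == 0%N then c 0%N else 0.
Proof.
move=> h; rewrite poly_between_horner big_ltn ?ltnS// big1_seq ?addr0.
  by case: eqP => [->|/eqP]; rewrite ?expr0 ?mulr1// -lt0n => ?; rewrite expr0n gtn_eqF// mulr0.
move=> i /andP[_]; rewrite mem_index_iota => /andP[h1 _].
by rewrite expr0n gtn_eqF ?mulr0//; apply: leq_ltn_trans h1.
Qed.

Lemma poly_between_deriv_at0 lo hi (c : nat -> R) : (0 < lo <= hi)%N ->
  (poly_between lo hi c)^`().[0] = if lo == 1%N then c 1%N else 0.
Proof.
move=> /andP[l0 h]; rewrite horner_coef0 coef_deriv mulr1n coef_sum big_ltn ?ltnS// big1_seq ?addr0.
  by rewrite coefZ coefXn eq_sym; case: eqP => [->|]; rewrite ?mulr1 ?mulr0.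
move=> i /andP[_]; rewrite mem_index_iota => /andP[h1 _].
by rewrite coefZ coefXn [1 == i]eq_sym gtn_eqF ?mulr0//; apply: leq_ltn_trans h1.
Qed.

Section Main.
Variables (m n r s : nat) (a b : nat -> R).
Hypotheses (hrm : (r <= m)%N) (hsn : (s <= n)%N).
Hypotheses (ar : a r != 0) (am : a m != 0) (bs : b s != 0) (bn : b n != 0).
Let g := poly_between r m a.
Let f := poly_between s n b.
Let G := primitive_between r m a.
Let F := primitive_between s n b.
Let S := lienard_system g f.
Notation X := (vector_field S).

Let SE : S = lienard_system G^`() F^`(). Proof. by rewrite !primitive_between_deriv. Qed.
Let F0 : F.[0] = 0. Proof. exact: primitive_between0. Qed.

Definition global_center_conditions :=
    [/\ forall x : R, x != 0 -> 0 < x * g.[x],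
        [/\ odd r, (2 < r < 2 * s + 1)%N & 0 < a r] \/
        [/\ r = (2 * s + 1)%N, (3 <= r)%N &
            b s ^+ 2 - 2 * (r%:R + 1) * a r < 0],
        [/\ odd m, (2 * n + 1 < m)%N & 0 < a m] \/
        (m = (2 * n + 1)%N /\ 1 < 4 * (n%:R + 1) * a m * b n ^- 2) &
        forall x1 x2 : R, x1 < 0 -> 0 < x2 -> G.[x1] = G.[x2] -> F.[x1] = F.[x2]].

Lemma conditions_data : global_center_conditions ->
  [/\ [/\ (1 < r)%N, (0 < s)%N & (2 * n + 1 <= m)%N], odd m /\ 0 < a m,
      right_data G F /\ right_data (refl G) (refl F),
      forall x1 x2 : R, 0 < x1 -> 0 < x2 -> G.[x1] = (refl G).[x2] -> F.[x1] = (refl F).[x2] &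
      forall x : R, x != 0 -> 0 < x * G^`().[x]].
Proof.
move=> [xg c0 coo sy].
have [_ ar0 om am0] := odd_signs hrm ar am xg.
have r1 : (1 < r)%N by case: c0 => -[_ h _]; move: h; clear; lia.
have s0 : (0 < s)%N by case: c0 => -[h h' _]; move: h h'; clear; lia.
split => //; first by split => //; case: coo => -[h h']; move: h h'; clear; lia.
- apply: right_data_both => //; first exact: ltnW.
    case: c0 => [[_ /andP[_ ?] _]|[rE _ h]]; [by left|right; split => //]; lra.
  case: coo => [[_ ? _]|[mE h]]; [by left|right; split => //].
  by move: h; rewrite ltr_pdivlMr ?mul1r// exprn_even_gt0.
- move=> x1 x2 p1 p2; rewrite !refl_horner => e; apply/esym/sy => //; rewrite ?oppr_lt0//.
- by move=> x x0; rewrite primitive_between_deriv; exact: xg.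
Qed.

(** The center property alone gives a regular statement for odd r, including r = 1 and s = 0;
    nilpotency, that is g'(0) = f(0) = 0, excludes these two values, and r > 2 follows by parity. *)
Lemma nilpotent_global_centerP : nilpotent_global_center S 0 <-> global_center_conditions.
Proof.
split => [ngc|/conditions_data[[r1 s0 nm] _ [rd rdl] sym xg]]; last first.
  rewrite /nilpotent_global_center SE; split; first exact: global_center_origin.
  apply/nilpotent_linear_partP; rewrite !primitive_between_deriv.
  rewrite poly_between_deriv_at0; last by rewrite hrm ltnW.
  by rewrite poly_between_at0// !gtn_eqF.
have co : closed_orbits G F.
  by move: ngc; rewrite SE; exact: nilpotent_global_center_closed_orbits.
have g0 : g.[0] = 0.
  have [[[eq0 _] _] _] := ngc; have := congr1 (@ycoord R 0) eq0.
  rewrite vector_field_lienard ycoord2 /xcoord /ycoord !mxE mulr0 subr0.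
  by move/eqP; rewrite oppr_eq0 => /eqP.
have r0 : (0 < r)%N.
  rewrite lt0n; apply/eqP => rE; move: g0; rewrite /g poly_between_at0// rE /= -[in a 0%N]rE.
  by move/eqP; rewrite (negbTE ar).
have [g1 f0] : g^`().[0] = 0 /\ f.[0] = 0.
  by have [_] := ngc; rewrite SE => /nilpotent_linear_partP; rewrite !primitive_between_deriv.
have r1 : (1 < r)%N.
  rewrite ltn_neqAle r0 andbT; apply/eqP => rE.
  move: g1; rewrite /g poly_between_deriv_at0 ?r0// -rE /= [in a 1%N]rE.
  by move/eqP; rewrite (negbTE ar).
have s0 : (0 < s)%N.
  rewrite lt0n; apply/eqP => sE; move: f0; rewrite /f poly_between_at0// sE /= -[in b 0%N]sE.
  by move/eqP; rewrite (negbTE bs).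
have [xg c0 coo] := closed_orbits_conditions hrm hsn ar am bs bn r0 co.
have [or ar0 om am0] := odd_signs hrm ar am xg.
have [rd rdl] := right_data_both hrm hsn ar am r0 xg c0 coo.
have sym := closed_orbits_sym rd rdl co.
split => //.
- have r2 : (2 < r)%N by move: or r1; case: (r) => [|[|[|]]].
  by case: c0 => [c0|[rE c0]]; [left; split; rewrite // r2|right; split => //; rewrite subr_lt0].
- case: coo => [?|[mE coo]]; [by left|right; split => //].
  by rewrite ltr_pdivlMr ?mul1r// exprn_even_gt0.
- move=> x1 x2 p1 p2 e; rewrite -[x1]opprK -refl_horner; apply/esym/sym; rewrite ?oppr_gt0//.
  by rewrite refl_horner opprK.
Qed.

Lemma global_center_phase_portrait : global_center_conditions ->
  phase_portrait_one_hyperbolic_sector_at_ends_of_y_axis S.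
Proof.
move=> /conditions_data[[r1 s0 nm] [om am0] [rd rdl] sym xg].
have n0 : (0 < n)%N by exact: leq_trans hsn.
have xg' : forall x : R, x != 0 -> 0 < x * g.[x] by move: xg; rewrite primitive_between_deriv.
have am' : a m != 0 by rewrite gt_eqF.
split.
- by rewrite SE; exact: equilibrium_origin.
- by move=> p p0; rewrite SE (orbit_level rd rdl sym p0); exact: periodic_orbit_through.
- exact: equilibria_at_infinity.
- exact: one_hyperbolic_sector_top.
- exact: one_hyperbolic_sector_bottom.
Qed.
End Main.
End Integrals.

Theorem theorem2 (R : realType) (m n r s : nat) (a b : nat -> R)
    (hrm : (r <= m)%N) (hsn : (s <= n)%N)
    (hab : a r * a m * b s * b n != 0) :
  let g := poly_between r m a in
  let f := poly_between s n b in
  let F := integral_from0 (fun x : R => f.[x]) in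
  let G := integral_from0 (fun x : R => g.[x]) in
  let S := lienard_system g f in
  (nilpotent_global_center S 0 <->
    [/\ (* (i) *)
        forall x : R, x != 0 -> 0 < x * g.[x],
        (* (ii) *)
        [/\ odd r, (2 < r < 2 * s + 1)%N & 0 < a r] \/
        [/\ r = (2 * s + 1)%N, (3 <= r)%N &
            b s ^+ 2 - 2 * (r%:R + 1) * a r < 0],
        (* (iii) *)
        [/\ odd m, (2 * n + 1 < m)%N & 0 < a m] \/
        (m = (2 * n + 1)%N /\ 1 < 4 * (n%:R + 1) * a m * b n ^- 2) &
        (* (iv) *)
        forall x1 x2 : R, x1 < 0 -> 0 < x2 -> G x1 = G x2 -> F x1 = F x2])
  /\ (nilpotent_global_center S 0 ->
        phase_portrait_one_hyperbolic_sector_at_ends_of_y_axis S).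
Proof.
move=> g f F G S.
have [[ar am] [bs bn]] : (a r != 0 /\ a m != 0) /\ (b s != 0 /\ b n != 0).
  by move: hab; rewrite !mulf_eq0 !negb_or -!andbA => /and4P[].
rewrite /F /G !integral_from0_poly_between.
have gcP := nilpotent_global_centerP hrm hsn ar am bs bn.
by split => // /gcP; exact: global_center_phase_portrait.
Qed.
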